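(* Let $A$ be a twisted differential operator (of any order $m$) with source $\tilde A$. If $\ker\tilde A=0$ and $\ker(\tilde A)'\subset\mathcal S(\mathbb R)$, then $A$ is globally regular.
   Context: $D=-\mathrm i\,d/dx$, $M$ = multiplication by $x$ on $\mathcal S'(\mathbb R)$; $D_x,D_y=-\mathrm i\partial_x,-\mathrm i\partial_y$ and $M_x,M_y$ multiplication by $x,y$ on $\mathcal S'(\mathbb R^2)$. A linear operator $P$ on $\mathcal S'(\mathbb R^n)$ is globally regular if $u\in\mathcal S'$ and $Pu\in\mathcal S$ imply $u\in\mathcal S$. A twisted differential operator of order $m$ is $A=\sum_{j+k\le m}(-1)^{j+k}a_{kj}(\alpha D_y-\beta M_x)^j(\gamma D_x-\delta M_y)^k$ with $\alpha,\beta,\gamma,\delta\in\mathbb R$, $\alpha\delta-\beta\gamma=1$, $\beta\delta\ne0$, $a_{kj}\in\mathbb C$, $\sum_{j+k=m}|a_{kj}|\ne0$; its source is $\tilde A=\sum_{j+k\le m}a_{kj}M^jD^k$ and $(\tilde A)'=\sum_{j+k\le m}(-1)^ka_{kj}D^kM^j$ is its transpose, both acting on $\mathcal S'(\mathbb R)$. Kernels are taken in $\mathcal S'(\mathbb R)$. *)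

(* Defs.v *)
From Stdlib Require Import Reals.
Open Scope R_scope.

Definition Cx : Type := (R * R)%type.
Definition C0 : Cx := (0, 0).
Definition C1 : Cx := (1, 0).
Definition Ci : Cx := (0, 1).
Definition RtoC (r : R) : Cx := (r, 0).
Definition Cadd (z w : Cx) : Cx := (fst z + fst w, snd z + snd w).
Definition Copp (z : Cx) : Cx := (- fst z, - snd z).
Definition Csub (z w : Cx) : Cx := Cadd z (Copp w).
Definition Cmul (z w : Cx) : Cx :=
  (fst z * fst w - snd z * snd w, fst z * snd w + snd z * fst w).
Definition Cscal (r : R) (z : Cx) : Cx := (r * fst z, r * snd z).
Definition Cmod (z : Cx) : R := sqrt (fst z ^ 2 + snd z ^ 2).

Fixpoint Csum (n : nat) (f : nat -> Cx) : Cx :=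
  match n with
  | O => C0
  | S n' => Cadd (Csum n' f) (f n')
  end.

Definition RInt_on (f : R -> R) (a b l : R) : Prop :=
  exists pr : Riemann_integrable f a b, RiemannInt pr = l.

Definition RImproper (f : R -> R) (l : R) : Prop :=
  forall eps : R, 0 < eps -> exists N : R, forall a b : R, a <= - N -> N <= b ->
    exists I : R, RInt_on f a b I /\ Rabs (I - l) < eps.

Definition CImproper (f : R -> Cx) (l : Cx) : Prop :=
  RImproper (fun x => fst (f x)) (fst l) /\ RImproper (fun x => snd (f x)) (snd l).

Definition CImproper2 (F : R -> R -> Cx) (l : Cx) : Prop :=
  exists G : R -> Cx, (forall y, CImproper (fun x => F x y) (G y)) /\ CImproper G l.

(* A function on R is represented together with the family of its derivatives:
   g k = k-th derivative of g 0. *)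
Definition Fam1 : Type := nat -> R -> Cx.

Definition Schwartz1 (g : Fam1) : Prop :=
  (forall k x, derivable_pt_lim (fun t => fst (g k t)) x (fst (g (S k) x)) /\
               derivable_pt_lim (fun t => snd (g k t)) x (snd (g (S k) x))) /\
  (forall j k : nat, exists M : R, forall x, Rabs x ^ j * Cmod (g k x) <= M).

Definition fadd1 (g h : Fam1) : Fam1 := fun k x => Cadd (g k x) (h k x).
Definition fscal1 (c : Cx) (g : Fam1) : Fam1 := fun k x => Cmul c (g k x).
Definition fopp1 (g : Fam1) : Fam1 := fun k x => Copp (g k x).
Definition fD1 (g : Fam1) : Fam1 := fun k x => Cmul (Copp Ci) (g (S k) x).
(* M = multiplication by x; (x g)^(k) = x g^(k) + k g^(k-1) *)
Definition fM1 (g : Fam1) : Fam1 :=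
  fun k x => Cadd (Cscal x (g k x)) (Cscal (INR k) (g (pred k) x)).

(* u is a functional on test functions; only its values on Schwartz functions matter *)
Definition Dist1 : Type := Fam1 -> Cx.

Definition Tempered1 (u : Dist1) : Prop :=
  (forall f g, Schwartz1 f -> Schwartz1 g -> u (fadd1 f g) = Cadd (u f) (u g)) /\
  (forall c f, Schwartz1 f -> u (fscal1 c f) = Cmul c (u f)) /\
  (exists (N : nat) (K : R), forall f B, Schwartz1 f ->
      (forall j k : nat, (j <= N)%nat -> (k <= N)%nat ->
          forall x, Rabs x ^ j * Cmod (f k x) <= B) ->
      Cmod (u f) <= K * B).

Definition dD1 (u : Dist1) : Dist1 := fun f => u (fopp1 (fD1 f)).
Definition dM1 (u : Dist1) : Dist1 := fun f => u (fM1 f).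

Definition Dist1_zero (u : Dist1) : Prop := forall f, Schwartz1 f -> u f = C0.

Definition InS1 (u : Dist1) : Prop :=
  exists g : Fam1, Schwartz1 g /\
    forall f, Schwartz1 f -> CImproper (fun x => Cmul (g O x) (f O x)) (u f).

Definition source_op (m : nat) (a : nat -> nat -> Cx) (u : Dist1) : Dist1 :=
  fun f => Csum (S m) (fun k => Csum (S m - k) (fun j =>
     Cmul (a k j) (Nat.iter j dM1 (Nat.iter k dD1 u) f))).

Definition source_transpose_op (m : nat) (a : nat -> nat -> Cx) (u : Dist1) : Dist1 :=
  fun f => Csum (S m) (fun k => Csum (S m - k) (fun j =>
     Cmul (Cmul (RtoC ((-1) ^ k)) (a k j)) (Nat.iter k dD1 (Nat.iter j dM1 u) f))).

(* g a b = d_x^a d_y^b (g 0 0) *)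
Definition Fam2 : Type := nat -> nat -> R -> R -> Cx.

Definition Schwartz2 (g : Fam2) : Prop :=
  (forall a b x y,
     derivable_pt_lim (fun t => fst (g a b t y)) x (fst (g (S a) b x y)) /\
     derivable_pt_lim (fun t => snd (g a b t y)) x (snd (g (S a) b x y)) /\
     derivable_pt_lim (fun t => fst (g a b x t)) y (fst (g a (S b) x y)) /\
     derivable_pt_lim (fun t => snd (g a b x t)) y (snd (g a (S b) x y))) /\
  (forall i j a b : nat, exists M : R, forall x y,
     Rabs x ^ i * Rabs y ^ j * Cmod (g a b x y) <= M).

Definition fadd2 (g h : Fam2) : Fam2 := fun a b x y => Cadd (g a b x y) (h a b x y).
Definition fscal2 (c : Cx) (g : Fam2) : Fam2 := fun a b x y => Cmul c (g a b x y).
Definition fopp2 (g : Fam2) : Fam2 := fun a b x y => Copp (g a b x y).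
Definition fDx (g : Fam2) : Fam2 := fun a b x y => Cmul (Copp Ci) (g (S a) b x y).
Definition fDy (g : Fam2) : Fam2 := fun a b x y => Cmul (Copp Ci) (g a (S b) x y).
Definition fMx (g : Fam2) : Fam2 :=
  fun a b x y => Cadd (Cscal x (g a b x y)) (Cscal (INR a) (g (pred a) b x y)).
Definition fMy (g : Fam2) : Fam2 :=
  fun a b x y => Cadd (Cscal y (g a b x y)) (Cscal (INR b) (g a (pred b) x y)).

Definition Dist2 : Type := Fam2 -> Cx.

Definition Tempered2 (u : Dist2) : Prop :=
  (forall f g, Schwartz2 f -> Schwartz2 g -> u (fadd2 f g) = Cadd (u f) (u g)) /\
  (forall c f, Schwartz2 f -> u (fscal2 c f) = Cmul c (u f)) /\
  (exists (N : nat) (K : R), forall f B, Schwartz2 f ->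
      (forall i j a b : nat, (i <= N)%nat -> (j <= N)%nat -> (a <= N)%nat -> (b <= N)%nat ->
          forall x y, Rabs x ^ i * Rabs y ^ j * Cmod (f a b x y) <= B) ->
      Cmod (u f) <= K * B).

Definition dDx (u : Dist2) : Dist2 := fun f => u (fopp2 (fDx f)).
Definition dDy (u : Dist2) : Dist2 := fun f => u (fopp2 (fDy f)).
Definition dMx (u : Dist2) : Dist2 := fun f => u (fMx f).
Definition dMy (u : Dist2) : Dist2 := fun f => u (fMy f).

Definition InS2 (u : Dist2) : Prop :=
  exists g : Fam2, Schwartz2 g /\
    forall f, Schwartz2 f ->
      CImproper2 (fun x y => Cmul (g O O x y) (f O O x y)) (u f).

Definition dL1 (al be : R) (u : Dist2) : Dist2 :=
  fun f => Csub (Cscal al (dDy u f)) (Cscal be (dMx u f)).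
Definition dL2 (ga de : R) (u : Dist2) : Dist2 :=
  fun f => Csub (Cscal ga (dDx u f)) (Cscal de (dMy u f)).

Definition twisted_op (m : nat) (a : nat -> nat -> Cx) (al be ga de : R)
  (u : Dist2) : Dist2 :=
  fun f => Csum (S m) (fun k => Csum (S m - k) (fun j =>
     Cmul (Cmul (RtoC ((-1) ^ (j + k))) (a k j))
          (Nat.iter j (dL1 al be) (Nat.iter k (dL2 ga de) u) f))).

Definition globally_regular2 (P : Dist2 -> Dist2) : Prop :=
  forall u, Tempered2 u -> InS2 (P u) -> InS2 u.

(* Main.v *)
(* Let [At] be the transpose of the source, acting on test functions, and [Aa] the source itself.
   Metaplectic conjugation: there is an invertible, transposable operator [T] on S(R^2) (a linear
   substitution followed by an inverse Fourier transform in [y]) such that the transpose of the twisted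
   operator composed with [T] is [T] composed with [At] acting in the variable [x] alone.

   In one variable, conjugating by a chirp and a Fourier transform makes the leading coefficient constant.
   Put x = e^s near infinity: the coefficients become polynomials in e^s and e^(-s), and an induction
   along the Newton polygon (shifts by roots of the characteristic polynomials, ramifications
   s -> q s, and a maximum principle for first order operators) bounds every Schwartz seminorm of [f] by
   seminorms of [Q f] and finitely many continuous functionals of [f].  Hence [At] and [Aa] have closed
   range and a bounded inverse from their range to a complement of their kernel.  By Hahn-Banach the
   hypothesis on the kernel of the source says that [At] is onto, and the hypothesis on the
   kernel of the transpose says that the range of [Aa] is the orthogonal of Schwartz functions killed by [At].

   If A v = w is Schwartz, then <v, T At H> = <w', H> with w' the transpose of [T] applied to [w].  The slices
   of w' are orthogonal to the kernel of [At], so w' = Aa g' with g' Schwartz; solving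
   At H = T^-1 Phi slicewise gives <v, Phi> = <g', T^-1 Phi>, and [v] is the Schwartz function obtained by
   transposing T^-1. *)
From Coquelicot Require Import Rcomplements Rbar Hierarchy Derive Continuity Lim_seq RInt RInt_analysis AutoDerive.
From Coquelicot Require Complex.
From mathcomp Require all_boot all_algebra.
From mathcomp Require Rstruct complex boolp classical_sets.
From Stdlib Require Import Reals Lra Lia Psatz Classical FunctionalExtensionality ClassicalEpsilon ZArith List.
(* last, because [C1] is also a name of the Stdlib reals *)
Require Import Defs.
Open Scope R_scope.

(** * Complex-valued calculus on the line *)

(** Distributions enter only as functionals, so every operator is replaced by its transpose on test
    functions. What has to be proved is then solvability in S(R) with continuous dependence on the
    data, because the equation is solved on all slices of a Schwartz function of two variables at
    once. There are two obstacles: the leading coefficient of the source may have zeros, and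
    infinity may be an irregular singular point. The first is removed by the conjugation. For the
    second no asymptotic solutions are constructed: on rapidly decaying functions a first order
    operator [d/ds - h] obeys a maximum principle for either sign of [Re h], provided that the
    exponential weight is large, and the only loss is the value at one end point. Higher order
    operators reduce to this case as soon as their zeroth coefficient decays, and the Newton polygon
    induction arranges exactly that. The end point values become the finitely many functionals in
    [coercive]. *)

Lemma Cx_ring_theory : ring_theory C0 C1 Cadd Cmul Csub Copp eq.
Proof.
  split; intros; unfold Csub, Cadd, Cmul, Copp, C0, C1;
    try (apply injective_projections; simpl; ring); reflexivity.
Qed.
Add Ring Cx_ring : Cx_ring_theory.

Definition Cinv (z : Cx) : Cx :=
  (fst z / (fst z ^ 2 + snd z ^ 2), - snd z / (fst z ^ 2 + snd z ^ 2)).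

(** [Cx] and its operations are convertible to the complex numbers of Coquelicot, so this fact and
    the modulus facts below transfer by [exact]. *)
Lemma Cinv_l (z : Cx) : z <> C0 -> Cmul (Cinv z) z = C1.
Proof. exact (Complex.Cinv_l z). Qed.

Lemma Cx_field_theory :
  field_theory C0 C1 Cadd Cmul Csub Copp (fun a b => Cmul a (Cinv b)) Cinv eq.
Proof.
  split.
  - exact Cx_ring_theory.
  - intros H; injection H; lra.
  - reflexivity.
  - exact Cinv_l.
Qed.
Add Field Cx_field : Cx_field_theory.

Lemma Cscal_mul (r : R) (z : Cx) : Cscal r z = Cmul (RtoC r) z.
Proof. unfold Cscal, Cmul, RtoC; apply injective_projections; simpl; ring. Qed.

Lemma RtoC_mul (r s : R) : RtoC (r * s) = Cmul (RtoC r) (RtoC s).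
Proof. unfold Cmul, RtoC; apply injective_projections; simpl; ring. Qed.

Lemma RtoC_add (r s : R) : RtoC (r + s) = Cadd (RtoC r) (RtoC s).
Proof. unfold Cadd, RtoC; apply injective_projections; simpl; ring. Qed.

Lemma RtoC_opp (r : R) : RtoC (- r) = Copp (RtoC r).
Proof. unfold Copp, RtoC; apply injective_projections; simpl; ring. Qed.

Lemma RtoC_sub (r s : R) : RtoC (r - s) = Csub (RtoC r) (RtoC s).
Proof. unfold Csub, Cadd, Copp, RtoC; apply injective_projections; simpl; ring. Qed.

Lemma RtoC_0 : RtoC 0 = C0.
Proof. reflexivity. Qed.

Lemma RtoC_1 : RtoC 1 = C1.
Proof. reflexivity. Qed.

Lemma Ci2 : Cmul Ci Ci = Copp C1.
Proof. unfold Cmul, Ci, Copp, C1; apply injective_projections; simpl; ring. Qed.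

Ltac cring :=
  unfold Rminus;
  repeat first [rewrite Cscal_mul | rewrite RtoC_mul | rewrite RtoC_add | rewrite RtoC_opp];
  try rewrite RtoC_0; try rewrite RtoC_1; ring.

Lemma Cmod_pos (z : Cx) : 0 <= Cmod z.
Proof. exact (Complex.Cmod_ge_0 z). Qed.

Lemma Cmod_add (z w : Cx) : Cmod (Cadd z w) <= Cmod z + Cmod w.
Proof. exact (Complex.Cmod_triangle z w). Qed.

Lemma Cmod_mul (z w : Cx) : Cmod (Cmul z w) = Cmod z * Cmod w.
Proof. exact (Complex.Cmod_mult z w). Qed.

Lemma Cmod_opp (z : Cx) : Cmod (Copp z) = Cmod z.
Proof. exact (Complex.Cmod_opp z). Qed.

Lemma Cmod_RtoC (r : R) : Cmod (RtoC r) = Rabs r.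
Proof. exact (Complex.Cmod_R r). Qed.

Lemma Cmod_scal (r : R) (z : Cx) : Cmod (Cscal r z) = Rabs r * Cmod z.
Proof. now rewrite Cscal_mul, Cmod_mul, Cmod_RtoC. Qed.

Lemma Cmod_C0 : Cmod C0 = 0.
Proof. exact Complex.Cmod_0. Qed.

Lemma Cmod_C1 : Cmod C1 = 1.
Proof. exact Complex.Cmod_1. Qed.

Lemma Cmod_Ci : Cmod Ci = 1.
Proof. exact Complex.Cmod_Ci. Qed.

Lemma Cmod_eq0 (z : Cx) : Cmod z = 0 -> z = C0.
Proof. exact (Complex.Cmod_eq_0 z). Qed.

Lemma Cmod_gt0 (z : Cx) : z <> C0 -> 0 < Cmod z.
Proof. exact (proj1 (Complex.Cmod_gt_0 z)). Qed.

Lemma Cmod_sub (z w : Cx) : Cmod (Csub z w) <= Cmod z + Cmod w.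
Proof. unfold Csub; rewrite <- (Cmod_opp w); apply Cmod_add. Qed.

Lemma fst_le_Cmod (z : Cx) : Rabs (fst z) <= Cmod z.
Proof. eapply Rle_trans; [apply Rmax_l | apply (Complex.Rmax_Cmod z)]. Qed.

Lemma snd_le_Cmod (z : Cx) : Rabs (snd z) <= Cmod z.
Proof. eapply Rle_trans; [apply Rmax_r | apply (Complex.Rmax_Cmod z)]. Qed.

Lemma Cmod_le_sum (z : Cx) : Cmod z <= Rabs (fst z) + Rabs (snd z).
Proof.
  assert (E : z = Cadd (RtoC (fst z)) (Cmul Ci (RtoC (snd z)))).
  { unfold Cadd, RtoC, Ci, Cmul; apply injective_projections; simpl; ring. }
  rewrite E at 1; eapply Rle_trans; [apply Cmod_add |].
  rewrite Cmod_mul, Cmod_Ci, !Cmod_RtoC; lra.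
Qed.

Lemma Cmod2 (z : Cx) : Cmod z * Cmod z = fst z * fst z + snd z * snd z.
Proof.
  unfold Cmod; rewrite sqrt_sqrt; [ring |].
  generalize (pow2_ge_0 (fst z)) (pow2_ge_0 (snd z)); lra.
Qed.

Definition dCat (f : R -> Cx) (x : R) (l : Cx) : Prop :=
  derivable_pt_lim (fun t => fst (f t)) x (fst l) /\
  derivable_pt_lim (fun t => snd (f t)) x (snd l).

Lemma dCat_is (f : R -> Cx) x l : dCat f x l <->
  is_derive (fun t => fst (f t)) x (fst l) /\ is_derive (fun t => snd (f t)) x (snd l).
Proof. unfold dCat; now rewrite <- !is_derive_Reals. Qed.

Lemma dCat_ext (f g : R -> Cx) x l : (forall t, f t = g t) -> dCat f x l -> dCat g x l.
Proof. intros H; replace g with f; auto; now apply functional_extensionality. Qed.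

Lemma dCat_const (c : Cx) x : dCat (fun _ => c) x C0.
Proof. split; apply derivable_pt_lim_const. Qed.

Lemma dCat_add (f g : R -> Cx) x l m :
  dCat f x l -> dCat g x m -> dCat (fun t => Cadd (f t) (g t)) x (Cadd l m).
Proof.
  intros [A B] [A' B']; split; simpl;
    [apply (derivable_pt_lim_plus _ _ _ _ _ A A') | apply (derivable_pt_lim_plus _ _ _ _ _ B B')].
Qed.

Lemma dCat_mul (f g : R -> Cx) x l m :
  dCat f x l -> dCat g x m ->
  dCat (fun t => Cmul (f t) (g t)) x (Cadd (Cmul l (g x)) (Cmul (f x) m)).
Proof.
  rewrite !dCat_is; intros [A B] [A' B']; split; simpl.
  - apply (is_derive_ext_loc (fun t => fst (f t) * fst (g t) - snd (f t) * snd (g t))).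
    { now apply filter_forall. }
    evar_last. { apply @is_derive_minus; apply @is_derive_mult; eauto; intros; apply Rmult_comm. }
    unfold minus, plus, opp, mult; simpl; ring.
  - apply (is_derive_ext_loc (fun t => fst (f t) * snd (g t) + snd (f t) * fst (g t))).
    { now apply filter_forall. }
    evar_last. { apply @is_derive_plus; apply @is_derive_mult; eauto; intros; apply Rmult_comm. }
    unfold plus, mult; simpl; ring.
Qed.

Lemma dCat_RtoC (f : R -> R) x l : is_derive f x l -> dCat (fun t => RtoC (f t)) x (RtoC l).
Proof. intros H; apply dCat_is; split; simpl; auto. apply @is_derive_const. Qed.

Lemma dCat_cmul (c : Cx) (f : R -> Cx) x l :
  dCat f x l -> dCat (fun t => Cmul c (f t)) x (Cmul c l).
Proof.
  intros H; replace (Cmul c l) with (Cadd (Cmul C0 (f x)) (Cmul c l)) by ring.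
  apply (dCat_mul (fun _ => c)); auto; apply dCat_const.
Qed.

Lemma dCat_opp (f : R -> Cx) x l : dCat f x l -> dCat (fun t => Copp (f t)) x (Copp l).
Proof.
  intros [A B]; split; simpl;
    [apply (derivable_pt_lim_opp _ _ _ A) | apply (derivable_pt_lim_opp _ _ _ B)].
Qed.

Lemma dCat_sub (f g : R -> Cx) x l m :
  dCat f x l -> dCat g x m -> dCat (fun t => Csub (f t) (g t)) x (Csub l m).
Proof. intros A B; apply (dCat_add _ (fun t => Copp (g t))); auto; now apply dCat_opp. Qed.

Lemma dCat_comp (f : R -> Cx) (h : R -> R) x l m :
  dCat f (h x) l -> is_derive h x m -> dCat (fun t => f (h t)) x (Cscal m l).
Proof.
  rewrite !dCat_is; intros [A B] H; split; simpl;
    [apply (is_derive_comp _ _ _ _ _ A H) | apply (is_derive_comp _ _ _ _ _ B H)].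
Qed.

Lemma dCat_unique (f : R -> Cx) x l m : dCat f x l -> dCat f x m -> l = m.
Proof.
  intros [A B] [A' B']; apply injective_projections; eapply uniqueness_limite; eauto.
Qed.

(** A quadratic remainder bound survives limits, integration and continuous linear maps. Derivatives
    of limits, of parameter integrals and of slicewise images are all obtained in this form, which
    replaces theorems on exchanging limits. *)
Lemma lim_quad (f : R -> R) x l M :
  (forall y, Rabs (y - x) <= 1 -> Rabs (f y - f x - (y - x) * l) <= M * (y - x) ^ 2) ->
  derivable_pt_lim f x l.
Proof.
  intros H eps He.
  assert (HM : 0 < Rabs M + 1) by (generalize (Rabs_pos M); lra).
  assert (Hd : 0 < Rmin 1 (eps / (Rabs M + 1))).
  { apply Rmin_pos; [lra | now apply Rdiv_lt_0_compat]. }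
  exists (mkposreal _ Hd); simpl; intros h Hh0 Hh.
  specialize (H (x + h)); replace (x + h - x) with h in H by ring.
  assert (h1 : Rabs h <= 1) by (left; eapply Rlt_le_trans; [apply Hh | apply Rmin_l]).
  assert (h2 : Rabs h < eps / (Rabs M + 1)) by (eapply Rlt_le_trans; [apply Hh | apply Rmin_r]).
  specialize (H h1).
  replace ((f (x + h) - f x) / h - l) with ((f (x + h) - f x - h * l) / h) by (field; auto).
  rewrite Rabs_div by auto.
  assert (Hp : 0 < Rabs h) by now apply Rabs_pos_lt.
  apply Rlt_div_l; auto.
  apply Rle_lt_trans with ((Rabs M + 1) * Rabs h * Rabs h).
  - eapply Rle_trans; [apply H |]. rewrite <- (pow2_abs h).
    generalize (Rle_abs M) (pow2_ge_0 (Rabs h)); intros; nra.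
  - apply Rmult_lt_compat_r; auto.
    replace eps with ((Rabs M + 1) * (eps / (Rabs M + 1))) by (field; lra).
    now apply Rmult_lt_compat_l.
Qed.

Lemma dCat_quad (f : R -> Cx) x l M :
  (forall y, Rabs (y - x) <= 1 ->
     Cmod (Csub (Csub (f y) (f x)) (Cscal (y - x) l)) <= M * (y - x) ^ 2) ->
  dCat f x l.
Proof.
  intros H; split; apply lim_quad with M; intros y Hy; eapply Rle_trans; try apply (H y Hy).
  - refine (Rle_trans _ _ _ _ (fst_le_Cmod _)); simpl; apply Req_le; f_equal; ring.
  - refine (Rle_trans _ _ _ _ (snd_le_Cmod _)); simpl; apply Req_le; f_equal; ring.
Qed.

Lemma mean_real (f f' : R -> R) (a b M : R) :
  (forall t, Rmin a b <= t <= Rmax a b -> derivable_pt_lim f t (f' t)) ->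
  (forall t, Rmin a b <= t <= Rmax a b -> Rabs (f' t) <= M) ->
  Rabs (f b - f a) <= M * Rabs (b - a).
Proof.
  intros Hd HM.
  destruct (MVT_gen f a b f') as [c [Hc E]].
  - intros x Hx; apply is_derive_Reals, Hd; lra.
  - intros x Hx; apply derivable_continuous_pt; exists (f' x); apply Hd; lra.
  - rewrite E, Rabs_mult; apply Rmult_le_compat_r; [apply Rabs_pos | now apply HM].
Qed.

Lemma taylor_real (f f' f'' : R -> R) (a b M : R) :
  (forall t, Rmin a b <= t <= Rmax a b -> derivable_pt_lim f t (f' t)) ->
  (forall t, Rmin a b <= t <= Rmax a b -> derivable_pt_lim f' t (f'' t)) ->
  (forall t, Rmin a b <= t <= Rmax a b -> Rabs (f'' t) <= M) ->
  Rabs (f b - f a - (b - a) * f' a) <= M * (b - a) ^ 2.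
Proof.
  intros Hd Hd' HM.
  assert (HM0 : 0 <= M).
  { eapply Rle_trans; [apply Rabs_pos | apply (HM a)]. split; [apply Rmin_l | apply Rmax_l]. }
  replace (f b - f a - (b - a) * f' a) with
    ((fun t => f t - (t - a) * f' a) b - (fun t => f t - (t - a) * f' a) a) by ring.
  replace (M * (b - a) ^ 2) with (M * Rabs (b - a) * Rabs (b - a)).
  2:{ rewrite <- (pow2_abs (b - a)); ring. }
  apply (mean_real (fun t => f t - (t - a) * f' a) (fun t => f' t - f' a)).
  - intros t Ht; apply is_derive_Reals.
    specialize (Hd t Ht); apply is_derive_Reals in Hd.
    assert (H1 : is_derive (fun t => (t - a) * f' a) t (f' a)) by (auto_derive; [trivial | ring]).
    exact (is_derive_minus _ _ _ _ _ Hd H1).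
  - intros t Ht; eapply Rle_trans.
    + apply (mean_real f' f'' a t M); intros s Hs.
      * apply Hd'; revert Hs Ht; unfold Rmin, Rmax; repeat destruct Rle_dec; lra.
      * apply HM; revert Hs Ht; unfold Rmin, Rmax; repeat destruct Rle_dec; lra.
    + apply Rmult_le_compat_l; auto.
      revert Ht; unfold Rmin, Rmax, Rabs; repeat destruct Rle_dec; repeat destruct Rcase_abs; lra.
Qed.

(** There is no mean value equality for complex values; the factor 2 comes from treating real and
    imaginary part separately. *)
Lemma mean_C (f f' : R -> Cx) (a b M : R) :
  (forall t, Rmin a b <= t <= Rmax a b -> dCat f t (f' t)) ->
  (forall t, Rmin a b <= t <= Rmax a b -> Cmod (f' t) <= M) ->
  Cmod (Csub (f b) (f a)) <= 2 * M * Rabs (b - a).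
Proof.
  intros Hd HM; eapply Rle_trans; [apply Cmod_le_sum |].
  replace (2 * M * Rabs (b - a)) with (M * Rabs (b - a) + M * Rabs (b - a)) by ring.
  apply Rplus_le_compat.
  - replace (fst (Csub (f b) (f a))) with (fst (f b) - fst (f a)) by (simpl; ring).
    apply (mean_real (fun t => fst (f t)) (fun t => fst (f' t))); intros t Ht; [apply (Hd t Ht) |].
    eapply Rle_trans; [apply fst_le_Cmod | now apply HM].
  - replace (snd (Csub (f b) (f a))) with (snd (f b) - snd (f a)) by (simpl; ring).
    apply (mean_real (fun t => snd (f t)) (fun t => snd (f' t))); intros t Ht; [apply (Hd t Ht) |].
    eapply Rle_trans; [apply snd_le_Cmod | now apply HM].
Qed.

Lemma taylor_C (f f' f'' : R -> Cx) (a b M : R) :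
  (forall t, Rmin a b <= t <= Rmax a b -> dCat f t (f' t)) ->
  (forall t, Rmin a b <= t <= Rmax a b -> dCat f' t (f'' t)) ->
  (forall t, Rmin a b <= t <= Rmax a b -> Cmod (f'' t) <= M) ->
  Cmod (Csub (Csub (f b) (f a)) (Cscal (b - a) (f' a))) <= 2 * M * (b - a) ^ 2.
Proof.
  intros Hd Hd' HM; eapply Rle_trans; [apply Cmod_le_sum |].
  replace (2 * M * (b - a) ^ 2) with (M * (b - a) ^ 2 + M * (b - a) ^ 2) by ring.
  apply Rplus_le_compat.
  - replace (fst _) with (fst (f b) - fst (f a) - (b - a) * fst (f' a)) by (simpl; ring).
    apply (taylor_real (fun t => fst (f t)) (fun t => fst (f' t)) (fun t => fst (f'' t)));
      intros t Ht; [apply (Hd t Ht) | apply (Hd' t Ht) |].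
    eapply Rle_trans; [apply fst_le_Cmod | now apply HM].
  - replace (snd _) with (snd (f b) - snd (f a) - (b - a) * snd (f' a)) by (simpl; ring).
    apply (taylor_real (fun t => snd (f t)) (fun t => snd (f' t)) (fun t => snd (f'' t)));
      intros t Ht; [apply (Hd t Ht) | apply (Hd' t Ht) |].
    eapply Rle_trans; [apply snd_le_Cmod | now apply HM].
Qed.

(** * Finite sums, polynomials and exponential polynomials *)

Lemma Csum_ext n f g : (forall k, (k < n)%nat -> f k = g k) -> Csum n f = Csum n g.
Proof.
  induction n as [|n IH]; simpl; intros H; auto.
  rewrite IH, (H n); auto.
Qed.

Lemma Csum_add n f g : Csum n (fun k => Cadd (f k) (g k)) = Cadd (Csum n f) (Csum n g).
Proof. induction n as [|n IH]; simpl; [ring | rewrite IH; ring]. Qed.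

Lemma Csum_mul n c f : Cmul c (Csum n f) = Csum n (fun k => Cmul c (f k)).
Proof. induction n as [|n IH]; simpl; [ring | rewrite <- IH; ring]. Qed.

Lemma Csum_0 n f : (forall k, (k < n)%nat -> f k = C0) -> Csum n f = C0.
Proof. induction n as [|n IH]; simpl; intros H; auto. rewrite IH, (H n); auto; ring. Qed.

Lemma Csum_swap n m (f : nat -> nat -> Cx) :
  Csum n (fun i => Csum m (f i)) = Csum m (fun j => Csum n (fun i => f i j)).
Proof.
  induction n as [|n IH]; simpl.
  - symmetry; now apply Csum_0.
  - now rewrite IH, Csum_add.
Qed.

Lemma Csum_first n f : Csum (S n) f = Cadd (f O) (Csum n (fun k => f (S k))).
Proof. induction n as [|n IH]; [simpl; ring | change (Csum (S (S n)) f) with (Cadd (Csum (S n) f) (f (S n))); rewrite IH; simpl; ring]. Qed.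

Lemma Csum_widen n m f : (n <= m)%nat -> (forall k, (n <= k < m)%nat -> f k = C0) -> Csum m f = Csum n f.
Proof.
  induction m as [|m IH]; intros H H0.
  - now replace n with O by lia.
  - destruct (Nat.eq_dec n (S m)) as [->|]; auto. simpl.
    rewrite IH, H0; [ring | lia | lia | intros; apply H0; lia].
Qed.

Lemma Csum_single n k0 f : (k0 < n)%nat ->
  (forall k, (k < n)%nat -> k <> k0 -> f k = C0) -> Csum n f = f k0.
Proof.
  induction n as [|n IH]; intros H H0; [lia |]; simpl.
  destruct (Nat.eq_dec k0 n) as [->|].
  - rewrite Csum_0; [ring | intros; apply H0; lia].
  - rewrite IH, (H0 n); [ring | lia | lia | lia | intros; apply H0; lia].
Qed.

Lemma Cmod_Csum_le n f M : 0 <= M -> (forall k, (k < n)%nat -> Cmod (f k) <= M) ->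
  Cmod (Csum n f) <= INR n * M.
Proof.
  intros HM; induction n as [|n IH]; intros H.
  - simpl; rewrite Cmod_C0; lra.
  - simpl Csum; rewrite S_INR; eapply Rle_trans; [apply Cmod_add |].
    generalize (H n (Nat.lt_succ_diag_r n)); specialize (IH (fun k Hk => H k (Nat.lt_lt_succ_r _ _ Hk))); lra.
Qed.

Lemma dCat_Csum n (f : nat -> R -> Cx) x l :
  (forall k, (k < n)%nat -> dCat (f k) x (l k)) ->
  dCat (fun t => Csum n (fun k => f k t)) x (Csum n l).
Proof.
  induction n as [|n IH]; intros H; simpl; [apply dCat_const |].
  apply (dCat_add (fun t => Csum n (fun k => f k t))); auto.
Qed.

(** [Derive] is total, so [dd] can be iterated without carrying differentiability proofs; its value
    is meaningful only where [dd_eq] applies. *)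
Definition dd (f : R -> Cx) (s : R) : Cx :=
  (Derive (fun t => fst (f t)) s, Derive (fun t => snd (f t)) s).

Lemma dd_eq f x l : dCat f x l -> dd f x = l.
Proof.
  rewrite dCat_is; intros [A B]; unfold dd; apply injective_projections; simpl; now apply is_derive_unique.
Qed.

Fixpoint peval (l : list Cx) (t : R) : Cx :=
  match l with
  | nil => C0
  | a :: l' => Cadd a (Cmul (RtoC t) (peval l' t))
  end.

Definition ispoly (f : R -> Cx) : Prop := exists l, forall t, f t = peval l t.

Lemma ispoly_cons a f : ispoly f -> ispoly (fun t => Cadd a (Cmul (RtoC t) (f t))).
Proof. intros [l H]; exists (a :: l); intros t; simpl; now rewrite H. Qed.

Lemma ispoly_ext f g : (forall t, f t = g t) -> ispoly f -> ispoly g.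
Proof. intros H [l Hl]; exists l; intros t; now rewrite <- H. Qed.

Lemma ispoly_const c : ispoly (fun _ => c).
Proof. exists (c :: nil); intros t; simpl; ring. Qed.

Lemma ispoly_tmul f : ispoly f -> ispoly (fun t => Cmul (RtoC t) (f t)).
Proof. intros H; eapply ispoly_ext; [| apply (ispoly_cons C0 _ H)]; intros; simpl; ring. Qed.

Lemma ispoly_add f g : ispoly f -> ispoly g -> ispoly (fun t => Cadd (f t) (g t)).
Proof.
  intros [l Hl] [m Hm]; revert m f g Hl Hm; induction l as [|a l IH]; intros m f g Hl Hm.
  - exists m; intros t; rewrite Hl, Hm; simpl; ring.
  - destruct m as [|b m].
    + exists (a :: l); intros t; rewrite Hl, Hm; simpl; ring.
    + destruct (IH m (peval l) (peval m)) as [q Hq]; auto.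
      exists (Cadd a b :: q); intros t; rewrite Hl, Hm; simpl; rewrite <- Hq; ring.
Qed.

Lemma ispoly_scal c f : ispoly f -> ispoly (fun t => Cmul c (f t)).
Proof.
  intros [l Hl]; exists (map (Cmul c) l); intros t; rewrite Hl; clear Hl.
  induction l as [|a l IH]; simpl; [ring | rewrite <- IH; ring].
Qed.

Lemma ispoly_mul f g : ispoly f -> ispoly g -> ispoly (fun t => Cmul (f t) (g t)).
Proof.
  intros [l Hl] Hg; revert f Hl; induction l as [|a l IH]; intros f Hl.
  - apply (ispoly_ext (fun _ => C0)); [intros t; rewrite Hl; simpl; ring | apply ispoly_const].
  - apply (ispoly_ext (fun t => Cadd (Cmul a (g t)) (Cmul (RtoC t) (Cmul (peval l t) (g t))))).
    + intros t; rewrite Hl; simpl; ring.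
    + apply ispoly_add; [now apply ispoly_scal | apply ispoly_tmul, IH; auto].
Qed.

Lemma ispoly_pow q f : ispoly f -> ispoly (fun t => Cmul (RtoC (t ^ q)) (f t)).
Proof.
  intros H; induction q as [|q IH].
  - eapply ispoly_ext; [| apply H]; intros; simpl; rewrite RtoC_1; ring.
  - eapply ispoly_ext; [| apply (ispoly_tmul _ IH)]; intros; simpl; rewrite RtoC_mul; ring.
Qed.

Lemma ispoly_comp_pow q f : ispoly f -> ispoly (fun t => f (t ^ q)).
Proof.
  intros [l Hl]; revert f Hl; induction l as [|a l IH]; intros f Hl.
  - apply (ispoly_ext (fun _ => C0)); [intros t; now rewrite Hl | apply ispoly_const].
  - apply (ispoly_ext (fun t => Cadd a (Cmul (RtoC (t ^ q)) (peval l (t ^ q))))).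
    + intros t; now rewrite Hl.
    + apply ispoly_add; [apply ispoly_const | apply ispoly_pow, IH; auto].
Qed.

Lemma peval_deriv l : exists f', ispoly f' /\ forall t, dCat (peval l) t (f' t).
Proof.
  induction l as [|a l [f' [Hf Hd]]].
  - exists (fun _ => C0); split; [apply ispoly_const | intros; apply dCat_const].
  - exists (fun t => Cadd (peval l t) (Cmul (RtoC t) (f' t))); split.
    + apply ispoly_add; [now exists l | now apply ispoly_tmul].
    + intros t; simpl.
      replace (Cadd (peval l t) (Cmul (RtoC t) (f' t)))
        with (Cadd C0 (Cadd (Cmul (RtoC 1) (peval l t)) (Cmul (RtoC t) (f' t)))) by (rewrite RtoC_1; ring).
      apply (dCat_add (fun _ => a)); [apply dCat_const |].
      apply (dCat_mul RtoC); auto. apply (dCat_RtoC (fun t => t)); apply @is_derive_id.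
Qed.

Lemma peval_bound l : exists M, 0 <= M /\ forall t, 0 <= t <= 1 -> Cmod (peval l t) <= M.
Proof.
  induction l as [|a l [M [HM H]]]; simpl.
  - exists 0; split; [lra |]; intros; rewrite Cmod_C0; lra.
  - exists (Cmod a + M); split; [generalize (Cmod_pos a); lra |]; intros t Ht.
    eapply Rle_trans; [apply Cmod_add |]; rewrite Cmod_mul, Cmod_RtoC, Rabs_pos_eq by lra.
    generalize (H t Ht) (Cmod_pos (peval l t)); nra.
Qed.

(* [lead d f c]: [f s] is [e^(d s)] times a polynomial in [e^(-s)] with constant term [c],
   i.e. a Laurent polynomial in [x = e^s] of degree at most [d] with [x^d]-coefficient [c]. *)
Definition lead (d : Z) (f : R -> Cx) (c : Cx) : Prop :=
  exists p, ispoly p /\ forall s,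
    f s = Cmul (RtoC (exp (IZR d * s))) (Cadd c (Cmul (RtoC (exp (- s))) (p (exp (- s))))).

Definition exp_poly (f : R -> Cx) : Prop := exists d c, lead d f c.

Lemma lead_exp_poly d f c : lead d f c -> exp_poly f.
Proof. now exists d, c. Qed.

Lemma lead_ext d f g c : (forall s, f s = g s) -> lead d f c -> lead d g c.
Proof. intros H; replace g with f; auto; now apply functional_extensionality. Qed.

Lemma lead_add d f g c c' :
  lead d f c -> lead d g c' -> lead d (fun s => Cadd (f s) (g s)) (Cadd c c').
Proof.
  intros [p [Hp E]] [q [Hq E']]; exists (fun t => Cadd (p t) (q t)); split;
    [now apply ispoly_add | intros s; rewrite E, E'; ring].
Qed.

Lemma lead_mul d e f g c c' :
  lead d f c -> lead e g c' -> lead (d + e) (fun s => Cmul (f s) (g s)) (Cmul c c').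
Proof.
  intros [p [Hp E]] [q [Hq E']].
  exists (fun t => Cadd (Cadd (Cmul c (q t)) (Cmul c' (p t))) (Cmul (RtoC t) (Cmul (p t) (q t)))); split.
  - repeat apply ispoly_add; try apply ispoly_scal; auto. apply ispoly_tmul, ispoly_mul; auto.
  - intros s; rewrite E, E', plus_IZR, Rmult_plus_distr_r, exp_plus, RtoC_mul; ring.
Qed.

Lemma lead_exp d c : lead d (fun s => Cmul c (RtoC (exp (IZR d * s)))) c.
Proof. exists (fun _ => C0); split; [apply ispoly_const | intros s; ring]. Qed.

Lemma lead_const c : lead 0 (fun _ => c) c.
Proof.
  exists (fun _ => C0); split; [apply ispoly_const |].
  intros s; rewrite Rmult_0_l, exp_0, RtoC_1; ring.
Qed.

Lemma lead_zero d : lead d (fun _ => C0) C0.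
Proof. exists (fun _ => C0); split; [apply ispoly_const | intros; ring]. Qed.

Lemma lead_scal d f c k : lead d f c -> lead d (fun s => Cmul k (f s)) (Cmul k c).
Proof. intros H; apply (lead_mul 0 d (fun _ => k)); auto; apply lead_const. Qed.

(** Since [lead] only bounds the degree, [c] can be moved into the polynomial tail. This lets
    coefficients of different degrees be compared with one line of the Newton polygon. *)
Lemma lead_up1 d f c : lead d f c -> lead (d + 1) f C0.
Proof.
  intros [p [Hp E]]; exists (fun t => Cadd c (Cmul (RtoC t) (p t))); split; [now apply ispoly_cons |].
  intros s; rewrite E, plus_IZR, Rmult_plus_distr_r, exp_plus, RtoC_mul, Rmult_1_l.
  assert (K : Cmul (RtoC (exp s)) (RtoC (exp (- s))) = C1).
  { now rewrite <- RtoC_mul, <- exp_plus, Rplus_opp_r, exp_0. }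
  set (X := RtoC (exp (IZR d * s))); set (T := RtoC (exp (- s))) in *; set (Y := RtoC (exp s)) in *.
  transitivity (Cmul (Cmul X C1) (Cadd c (Cmul T (p (exp (- s)))))); [ring | rewrite <- K; ring].
Qed.

Lemma lead_up d e f c : (d < e)%Z -> lead d f c -> lead e f C0.
Proof.
  intros H Hf. replace e with (d + 1 + Z.of_nat (Z.to_nat (e - d - 1)))%Z by lia.
  generalize (Z.to_nat (e - d - 1)); intros n; induction n as [|n IH].
  - rewrite Z.add_0_r; now apply lead_up1 with c.
  - replace (d + 1 + Z.of_nat (S n))%Z with (d + 1 + Z.of_nat n + 1)%Z by lia. now apply lead_up1 with C0.
Qed.

Lemma lead_le d e f c : (d <= e)%Z -> lead d f c -> exists c', lead e f c'.
Proof.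
  intros H Hf; destruct (Z.eq_dec d e) as [->|]; [now exists c |].
  exists C0; apply lead_up with d c; auto; lia.
Qed.

Lemma lead_down d f : lead d f C0 -> exists c, lead (d - 1) f c.
Proof.
  intros [p [[l Hl] E]]; destruct l as [|c l].
  - exists C0; apply (lead_ext _ (fun _ => C0)); [| apply lead_zero].
    intros s; rewrite E, Hl; simpl; ring.
  - exists c, (peval l); split; [now exists l |].
    intros s; rewrite E, Hl; simpl.
    rewrite minus_IZR; replace ((IZR d - 1) * s) with (IZR d * s + - s) by ring.
    rewrite exp_plus, RtoC_mul; ring.
Qed.

(** Stripping zero coefficients from the head of the list lowers the degree one at a time; either
    the list runs out or an exact leading term appears. *)
Lemma lead_cases d f c : lead d f c ->
  (forall s, f s = C0) \/ exists e c', (e <= d)%Z /\ c' <> C0 /\ lead e f c'.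
Proof.
  intros [p [[l Hl] E]].
  assert (E' : forall s, f s = Cmul (RtoC (exp (IZR d * s))) (peval (c :: l) (exp (- s)))).
  { intros s; rewrite E, Hl; reflexivity. }
  clear E Hl p. generalize (c :: l) E'; clear E' c l; intros l; revert d.
  induction l as [|a l IH]; intros d E.
  - left; intros s; rewrite E; simpl; ring.
  - destruct (classic (a = C0)) as [->|Ha].
    + destruct (IH (d - 1)%Z) as [H|[e [c' [H1 H2]]]]; auto.
      * intros s; rewrite E; simpl; rewrite minus_IZR; replace ((IZR d - 1) * s) with (IZR d * s + - s) by ring.
        rewrite exp_plus, RtoC_mul; ring.
      * right; exists e, c'; split; auto; lia.
    + right; exists d, a; split; [lia | split; auto]. exists (peval l); split; [now exists l | auto].
Qed.

(** [d/ds] is the Euler operator [x d/dx]: it keeps the degree and multiplies the coefficient of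
    [x^k] by [k]. With [t = e^(-s)] the tail [p] becomes [(d - 1) p - t p']. *)
Lemma lead_deriv d f c : lead d f c ->
  (forall s, dCat f s (dd f s)) /\ lead d (dd f) (Cmul (RtoC (IZR d)) c).
Proof.
  intros [p [[l Hl] E]].
  destruct (peval_deriv l) as [p' [Hp' Hd]].
  assert (D : forall s, dCat f s (Cmul (RtoC (exp (IZR d * s)))
     (Cadd (Cmul (RtoC (IZR d)) c) (Cmul (RtoC (exp (- s)))
       ((fun t => Cadd (Cmul (RtoC (IZR d - 1)) (peval l t)) (Copp (Cmul (RtoC t) (p' t)))) (exp (- s))))))).
  { intros s.
    apply (dCat_ext (fun s => Cmul (RtoC (exp (IZR d * s))) (Cadd c (Cmul (RtoC (exp (- s))) (peval l (exp (- s))))))).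
    { intros t; now rewrite E, Hl. }
    assert (D1 : is_derive (fun s => exp (- s)) s (- exp (- s))) by (auto_derive; [trivial | ring]).
    assert (D2 : is_derive (fun s => exp (IZR d * s)) s (IZR d * exp (IZR d * s))) by (auto_derive; [trivial | ring]).
    generalize (dCat_comp (peval l) (fun s => exp (- s)) s _ _ (Hd (exp (- s))) D1); intros D3.
    generalize (dCat_mul _ _ _ _ _ (dCat_RtoC (fun s => exp (- s)) _ _ D1) D3); intros D4.
    generalize (dCat_mul _ _ _ _ _ (dCat_RtoC (fun s => exp (IZR d * s)) _ _ D2)
       (dCat_add (fun _ => c) _ _ _ _ (dCat_const c s) D4)).
    intros D5; eapply eq_ind; [exact D5 |].
    rewrite RtoC_sub, RtoC_1. cring. }
  split.
  - intros s; now rewrite (dd_eq _ _ _ (D s)).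
  - exists (fun t => Cadd (Cmul (RtoC (IZR d - 1)) (peval l t)) (Copp (Cmul (RtoC t) (p' t)))); split.
    + apply ispoly_add; [apply ispoly_scal; now exists l |].
      eapply ispoly_ext; [| apply ispoly_scal with (c := Copp C1), ispoly_tmul, Hp']; intros; simpl; ring.
    + intros s; now rewrite (dd_eq _ _ _ (D s)).
Qed.

(** With [t = e^(-s)] the new tail [t^q p(t^q)] is split as [t] times [t^(q - 1) p(t^q)], which is
    where [1 <= q] enters. *)
Lemma lead_ramify d f c (q : nat) : (1 <= q)%nat -> lead d f c ->
  lead (Z.of_nat q * d) (fun s => f (INR q * s)) c.
Proof.
  intros Hq [p [Hp E]].
  exists (fun t => Cmul (RtoC (t ^ (q - 1))) (p (t ^ q))); split.
  - now apply ispoly_pow, ispoly_comp_pow.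
  - intros s; rewrite E, mult_IZR, <- INR_IZR_INZ.
    replace (IZR d * (INR q * s)) with (INR q * IZR d * s) by ring.
    assert (P : exp (- (INR q * s)) = exp (- s) ^ q).
    { rewrite <- Rpower_pow by apply exp_pos; unfold Rpower; rewrite ln_exp; f_equal; ring. }
    rewrite P; f_equal; f_equal.
    destruct q as [|q]; [lia |]. replace (S q - 1)%nat with q by lia.
    simpl; rewrite RtoC_mul; ring.
Qed.

Lemma lead_bound d f c : lead d f c ->
  exists M, 0 <= M /\ forall s, 0 <= s -> Cmod (f s) <= M * exp (IZR d * s).
Proof.
  intros [p [[l Hl] E]]; destruct (peval_bound (c :: l)) as [M [HM H]].
  exists M; split; auto; intros s Hs; rewrite E, Hl.
  rewrite Cmod_mul, Cmod_RtoC, Rabs_pos_eq by (left; apply exp_pos).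
  rewrite Rmult_comm; apply Rmult_le_compat_r; [left; apply exp_pos |].
  apply (H (exp (- s))); split; [left; apply exp_pos |].
  rewrite <- exp_0; destruct Hs as [Hs| <-]; [left; apply exp_increasing; lra | rewrite Ropp_0; lra].
Qed.

Lemma exp_poly_add f g : exp_poly f -> exp_poly g -> exp_poly (fun s => Cadd (f s) (g s)).
Proof.
  intros [d [c H]] [e [c' H']].
  destruct (lead_le d (Z.max d e) f c) as [c1 H1]; auto; [lia |].
  destruct (lead_le e (Z.max d e) g c') as [c2 H2]; auto; [lia |].
  eexists; eexists; apply (lead_add _ _ _ _ _ H1 H2).
Qed.

Lemma exp_poly_mul f g : exp_poly f -> exp_poly g -> exp_poly (fun s => Cmul (f s) (g s)).
Proof. intros [d [c H]] [e [c' H']]; eexists; eexists; apply (lead_mul _ _ _ _ _ _ H H'). Qed.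

Lemma exp_poly_const c : exp_poly (fun _ => c).
Proof. exists 0%Z, c; apply lead_const. Qed.

Lemma exp_poly_opp f : exp_poly f -> exp_poly (fun s => Copp (f s)).
Proof.
  intros H; replace (fun s => Copp (f s)) with (fun s => Cmul (Copp C1) (f s))
    by (apply functional_extensionality; intros; ring).
  apply exp_poly_mul; auto; apply exp_poly_const.
Qed.

Lemma exp_poly_dd f : exp_poly f -> exp_poly (dd f).
Proof. intros [d [c H]]; eexists; eexists; apply (lead_deriv _ _ _ H). Qed.

Lemma exp_poly_dCat f : exp_poly f -> forall s, dCat f s (dd f s).
Proof. intros [d [c H]]; apply (lead_deriv _ _ _ H). Qed.

Lemma exp_poly_bound f : exp_poly f -> exists (n : nat) M, 0 <= M /\ forall s, 0 <= s -> Cmod (f s) <= M * exp (INR n * s).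
Proof.
  intros [d [c H]]; destruct (lead_le d (Z.of_nat (Z.to_nat d)) f c) as [c' H']; [lia | auto |].
  destruct (lead_bound _ _ _ H') as [M [HM HB]]; exists (Z.to_nat d), M; split; auto.
  intros s Hs; rewrite INR_IZR_INZ; auto.
Qed.

Lemma exp_poly_Csum n (f : nat -> R -> Cx) : (forall k, (k < n)%nat -> exp_poly (f k)) -> exp_poly (fun s => Csum n (fun k => f k s)).
Proof.
  induction n as [|n IH]; intros H; simpl; [apply exp_poly_const |].
  apply exp_poly_add; auto.
Qed.

Lemma lead_Csum d n (f : nat -> R -> Cx) c :
  (forall k, (k < n)%nat -> lead d (f k) (c k)) -> lead d (fun s => Csum n (fun k => f k s)) (Csum n c).
Proof.
  induction n as [|n IH]; intros H; simpl; [apply lead_zero |].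
  apply lead_add; auto.
Qed.

(** * A priori estimates for operators with exponential polynomial coefficients *)

(** For [x = e^s] the weights [e^(n s)] on [s >= 0] are the powers of [x] on [x >= 1]: this is
    Schwartz decay at plus infinity. For negative [s] only smoothness is required. *)
Definition rapid (v : R -> Cx) : Prop := forall k,
  (forall s, dCat (Nat.iter k dd v) s (Nat.iter (S k) dd v s)) /\
  (forall n : nat, exists M, forall s, 0 <= s -> exp (INR n * s) * Cmod (Nat.iter k dd v s) <= M).

Lemma iter_comm {A} k (f : A -> A) x : Nat.iter k f (f x) = f (Nat.iter k f x).
Proof. induction k as [|k IH]; simpl; auto; now rewrite IH. Qed.

Lemma rapid_dd v : rapid v -> rapid (dd v).
Proof.
  intros H k; specialize (H (S k)); destruct H as [A B]; split.
  - intros s; rewrite iter_comm; simpl; rewrite iter_comm. apply A.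
  - intros n; destruct (B n) as [M HM]; exists M; intros s Hs; rewrite iter_comm; now apply HM.
Qed.

Lemma rapid_iter k v : rapid v -> rapid (Nat.iter k dd v).
Proof. intros H; induction k as [|k IH]; simpl; auto; now apply rapid_dd. Qed.

Lemma rapid_dCat v s : rapid v -> dCat v s (dd v s).
Proof. intros H; apply (H O). Qed.

(** Finite sums of such products are closed under [dd], so the rapid decay of all derivatives of a
    product follows by iterating one step rather than from a Leibniz formula. *)
Inductive SmQ : (R -> Cx) -> Prop :=
| SmQ_mul f v : exp_poly f -> rapid v -> SmQ (fun s => Cmul (f s) (v s))
| SmQ_add u v : SmQ u -> SmQ v -> SmQ (fun s => Cadd (u s) (v s)).

Lemma SmQ_step w : SmQ w -> (forall s, dCat w s (dd w s)) /\ SmQ (dd w) /\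
  (forall n : nat, exists M, forall s, 0 <= s -> exp (INR n * s) * Cmod (w s) <= M).
Proof.
  induction 1 as [f v Hf Hv | u v Hu [A [B D]] Hv [A' [B' D']]].
  - assert (D : forall s, dCat (fun s => Cmul (f s) (v s)) s (Cadd (Cmul (dd f s) (v s)) (Cmul (f s) (dd v s)))).
    { intros s; apply dCat_mul; [now apply exp_poly_dCat | now apply rapid_dCat]. }
    split; [| split].
    + intros s; rewrite (dd_eq _ _ _ (D s)); apply D.
    + replace (dd (fun s => Cmul (f s) (v s))) with (fun s => Cadd (Cmul (dd f s) (v s)) (Cmul (f s) (dd v s))).
      * apply SmQ_add; apply SmQ_mul; auto using exp_poly_dd, rapid_dd.
      * apply functional_extensionality; intros s; now rewrite (dd_eq _ _ _ (D s)).
    + intros n; destruct (exp_poly_bound f Hf) as [k [M [HM HB]]].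
      destruct (proj2 (Hv O) (n + k)%nat) as [M' HM']; simpl in HM'.
      exists (M * M'); intros s Hs; rewrite Cmod_mul.
      specialize (HB s Hs); specialize (HM' s Hs); rewrite plus_INR, Rmult_plus_distr_r, exp_plus in HM'.
      generalize (exp_pos (INR n * s)) (exp_pos (INR k * s)) (Cmod_pos (v s)) (Cmod_pos (f s)); intros.
      apply Rle_trans with (exp (INR n * s) * (M * exp (INR k * s) * Cmod (v s))).
      * apply Rmult_le_compat_l; [lra |]; apply Rmult_le_compat_r; auto.
      * replace (exp (INR n * s) * (M * exp (INR k * s) * Cmod (v s)))
          with (M * (exp (INR n * s) * exp (INR k * s) * Cmod (v s))) by ring.
        apply Rmult_le_compat_l; auto.
  - assert (E : dd (fun s => Cadd (u s) (v s)) = fun s => Cadd (dd u s) (dd v s)).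
    { apply functional_extensionality; intros s; apply dd_eq, dCat_add; auto. }
    split; [| split].
    + rewrite E; intros s; apply dCat_add; auto.
    + rewrite E; now apply SmQ_add.
    + intros n; destruct (D n) as [M HM]; destruct (D' n) as [M' HM']; exists (M + M'); intros s Hs.
      specialize (HM s Hs); specialize (HM' s Hs).
      generalize (exp_pos (INR n * s)) (Cmod_add (u s) (v s)); intros; nra.
Qed.

Lemma SmQ_rapid w : SmQ w -> rapid w.
Proof.
  intros H k; assert (Q : SmQ (Nat.iter k dd w)).
  { induction k as [|k IH]; simpl; auto; now apply SmQ_step. }
  apply SmQ_step in Q; destruct Q as [A [_ B]]; split; auto.
Qed.

Lemma rapid_mul f v : exp_poly f -> rapid v -> rapid (fun s => Cmul (f s) (v s)).
Proof. intros; now apply SmQ_rapid, SmQ_mul. Qed.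

Lemma rapid_SmQ v : rapid v -> SmQ v.
Proof.
  intros H; replace v with (fun s => Cmul ((fun _ => C1) s) (v s))
    by (apply functional_extensionality; intros; ring).
  apply SmQ_mul; auto; apply exp_poly_const.
Qed.

Lemma rapid_add u v : rapid u -> rapid v -> rapid (fun s => Cadd (u s) (v s)).
Proof. intros; apply SmQ_rapid, SmQ_add; now apply rapid_SmQ. Qed.

(** This is [d/ds] conjugated by the exponential of a primitive of [h]. Carrying [h] along stands
    for factoring such an exponential out of [v], which could destroy rapid decay. *)
Definition Op (h v : R -> Cx) (s : R) : Cx := Csub (dd v s) (Cmul (h s) (v s)).

Lemma rapid_Op h v : exp_poly h -> rapid v -> rapid (Op h v).
Proof.
  intros Hh Hv; replace (Op h v) with (fun s => Cadd (dd v s) (Cmul (Copp (h s)) (v s))).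
  - apply rapid_add; [now apply rapid_dd | apply (rapid_mul (fun s => Copp (h s))); auto; now apply exp_poly_opp].
  - apply functional_extensionality; intros s; unfold Op; ring.
Qed.

Lemma rapid_Opk h v k : exp_poly h -> rapid v -> rapid (Nat.iter k (Op h) v).
Proof. intros Hh Hv; induction k as [|k IH]; simpl; auto; now apply rapid_Op. Qed.

Definition PS (m : nat) (a : nat -> R -> Cx) (h v : R -> Cx) (s : R) : Cx :=
  Csum (S m) (fun k => Cmul (a k s) (Nat.iter k (Op h) v s)).

Lemma exp_ge (x : R) : 1 + x <= exp x.
Proof. destruct (Req_dec x 0) as [->|H]; [rewrite exp_0; lra | left; now apply exp_ineq1]. Qed.

Lemma exp_le (x y : R) : x <= y -> exp x <= exp y.
Proof. intros [H| ->]; [left; now apply exp_increasing | lra]. Qed.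

Lemma dCat_scale v (q : R) s l : dCat v (q * s) l -> dCat (fun t => v (q * t)) s (Cscal q l).
Proof.
  intros H; apply (dCat_comp v (fun t => q * t)); auto. auto_derive; [trivial | ring].
Qed.

Lemma rapid_scale v (q : nat) : (1 <= q)%nat -> rapid v ->
  rapid (fun s => v (INR q * s)) /\
  forall k, Nat.iter k dd (fun s => v (INR q * s)) = fun s => Cscal (INR q ^ k) (Nat.iter k dd v (INR q * s)).
Proof.
  intros Hq Hv.
  assert (E : forall k, Nat.iter k dd (fun s => v (INR q * s)) = fun s => Cscal (INR q ^ k) (Nat.iter k dd v (INR q * s))).
  { induction k as [|k IH]; simpl.
    - apply functional_extensionality; intros; cring.
    - rewrite IH; apply functional_extensionality; intros s; apply dd_eq.
      generalize (dCat_cmul (RtoC (INR q ^ k)) _ _ _ (dCat_scale _ (INR q) s _ (rapid_dCat _ (INR q * s) (rapid_iter k v Hv)))).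
      intros H; apply (dCat_ext _ (fun s => Cscal (INR q ^ k) (Nat.iter k dd v (INR q * s)))) in H;
        [| intros; now rewrite Cscal_mul].
      eapply eq_ind; [exact H |]; cring. }
  assert (Hq1 : 1 <= INR q) by (now apply (le_INR 1)).
  split; auto; intros k; split.
  - change (Nat.iter (S k) dd (fun s => v (INR q * s))) with (dd (Nat.iter k dd (fun s => v (INR q * s)))).
    rewrite E; intros s.
    generalize (dCat_cmul (RtoC (INR q ^ k)) _ _ _ (dCat_scale _ (INR q) s _ (rapid_dCat _ (INR q * s) (rapid_iter k v Hv)))).
    intros H; apply (dCat_ext _ (fun s => Cscal (INR q ^ k) (Nat.iter k dd v (INR q * s)))) in H;
      [| intros; now rewrite Cscal_mul].
    now rewrite (dd_eq _ _ _ H).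
  - intros n; rewrite E; destruct (proj2 (Hv k) n) as [M HM].
    exists (INR q ^ k * M); intros s Hs; rewrite Cmod_scal, Rabs_pos_eq by (apply pow_le; lra).
    assert (P : 0 <= INR q ^ k) by (apply pow_le; lra).
    specialize (HM (INR q * s)). assert (0 <= INR q * s) by nra. specialize (HM H).
    assert (exp (INR n * s) <= exp (INR n * (INR q * s))).
    { apply exp_le, Rmult_le_compat_l; [apply pos_INR | nra]. }
    generalize (Cmod_pos (Nat.iter k dd v (INR q * s))); intros.
    apply Rle_trans with (INR q ^ k * (exp (INR n * (INR q * s)) * Cmod (Nat.iter k dd v (INR q * s)))).
    + replace (exp (INR n * s) * (INR q ^ k * Cmod (Nat.iter k dd v (INR q * s)))) with
        (INR q ^ k * (exp (INR n * s) * Cmod (Nat.iter k dd v (INR q * s)))) by ring.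
      apply Rmult_le_compat_l; auto; apply Rmult_le_compat_r; auto.
    + apply Rmult_le_compat_l; auto.
Qed.

(** The supremum [K] of [E] satisfies [K <= A + K / 2]. This needs a finite [K], which the rapid
    decay of the functions in question provides beforehand. *)
Lemma absorb (P : R -> Prop) (E : R -> R) (A : R) :
  (exists M, forall s, P s -> E s <= M) ->
  (forall K, (forall s, P s -> E s <= K) -> forall s, P s -> E s <= A + K / 2) ->
  forall s, P s -> E s <= 2 * A.
Proof.
  intros [M HM] H s Hs.
  destruct (completeness (fun y => exists t, P t /\ y = E t)) as [K [K1 K2]].
  - exists M; intros y [t [Ht ->]]; auto.
  - now exists (E s), s.
  - assert (HK : forall t, P t -> E t <= K) by (intros t Ht; apply K1; now exists t).
    specialize (H K HK).
    assert (K <= A + K / 2) by (apply K2; intros y [t [Ht ->]]; auto).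
    specialize (HK s Hs); lra.
Qed.

(** Only the real part matters, so leading coefficients with zero real part are discarded one after
    the other. Then either [Re h] is bounded on [s >= 0] and a large [n] dominates it, or its
    leading term grows at least like [e^s] and far out dominates any given [n]. *)
Lemma exp_poly_re_large h : exp_poly h ->
  exists n0 : nat, forall n : nat, (n0 <= n)%nat ->
  exists R0, 0 <= R0 /\ forall s, R0 <= s -> 1 <= Rabs (INR n + fst (h s)).
Proof.
  intros [d [c [p [[l Hl] E]]]].
  assert (E' : forall s, fst (h s) = fst (Cmul (RtoC (exp (IZR d * s))) (peval (c :: l) (exp (- s))))).
  { intros s; rewrite E, Hl; reflexivity. }
  clear E Hl p. generalize (c :: l) E'; clear E' c l; intros l; revert l d.
  assert (Bd : forall d l, (d <= 0)%Z ->
    (forall s, fst (h s) = fst (Cmul (RtoC (exp (IZR d * s))) (peval l (exp (- s))))) ->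
    exists n0 : nat, forall n : nat, (n0 <= n)%nat ->
    exists R0, 0 <= R0 /\ forall s, R0 <= s -> 1 <= Rabs (INR n + fst (h s))).
  { intros d l Hd E. destruct (peval_bound l) as [M [HM HB]].
    destruct (nfloor_ex (M + 1)) as [n0 Hn0]; [lra |].
    exists (S n0); intros n Hn; exists 0; split; [lra |]; intros s Hs.
    assert (Rabs (fst (h s)) <= M).
    { rewrite E; eapply Rle_trans; [apply fst_le_Cmod |].
      rewrite Cmod_mul, Cmod_RtoC, Rabs_pos_eq by (left; apply exp_pos).
      assert (exp (IZR d * s) <= 1).
      { rewrite <- exp_0; apply exp_le. apply IZR_le in Hd; nra. }
      assert (0 <= exp (- s) <= 1).
      { split; [left; apply exp_pos | rewrite <- exp_0; apply exp_le; lra]. }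
      generalize (HB _ H0) (Cmod_pos (peval l (exp (- s)))) (exp_pos (IZR d * s)); nra. }
    apply le_INR in Hn; rewrite S_INR in Hn.
    revert H; unfold Rabs; repeat destruct Rcase_abs; lra. }
  intros l; induction l as [|c l IH]; intros d E.
  - apply (Bd 0%Z nil); [lia |]; intros s; rewrite E; simpl; ring.
  - destruct (Z_le_gt_dec d 0) as [Hd|Hd]; [now apply (Bd d (c :: l)) |].
    destruct (Req_dec (fst c) 0) as [Hc|Hc].
    + apply (IH (d - 1)%Z); intros s; rewrite E; simpl.
      rewrite minus_IZR, Hc; replace ((IZR d - 1) * s) with (IZR d * s + - s) by ring.
      rewrite exp_plus; ring.
    + destruct (peval_bound l) as [M [HM HB]].
      exists O; intros n _.
      assert (Pc : 0 < Rabs (fst c)) by now apply Rabs_pos_lt.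
      (* Beyond [X] the leading term, at least [(1 + s) |Re c|], exceeds the rate [n], the margin 1
         and the tail, whose share is at most [M]. *)
      set (X := (1 + INR n + M) / Rabs (fst c)).
      exists (Rabs X); split; [apply Rabs_pos |]; intros s Hs.
      assert (Hs0 : 0 <= s) by (generalize (Rabs_pos X); lra).
      assert (T : 0 < exp (- s) <= 1).
      { split; [apply exp_pos | rewrite <- exp_0; apply exp_le; lra]. }
      rewrite E; simpl peval.
      set (y := peval l (exp (- s))). specialize (HB (exp (- s))); fold y in HB.
      assert (Hy : Rabs (fst y) <= M).
      { eapply Rle_trans; [apply fst_le_Cmod | apply HB; lra]. }
      simpl; rewrite !Rmult_0_l, !Rminus_0_r.
      set (e := exp (IZR d * s)).
      assert (He : 1 + s <= e /\ e * exp (- s) >= 1).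
      { split.
        - eapply Rle_trans; [apply exp_ge |]; apply exp_le. assert (1 <= IZR d) by (apply IZR_le; lia); nra.
        - unfold e; rewrite <- exp_plus; rewrite <- exp_0 at 1; apply Rle_ge, exp_le.
          assert (1 <= IZR d) by (apply IZR_le; lia); nra. }
      assert (Hb : 1 + INR n <= e * (Rabs (fst c) - exp (- s) * M)).
      { assert (HX : X <= s) by (generalize (Rle_abs X); lra).
        assert (HXc : 1 + INR n + M <= s * Rabs (fst c)).
        { unfold X in HX; apply Rle_div_l in HX; auto. }
        assert (t1 : exp (- s) * (1 + s) <= 1).
        { apply Rle_trans with (exp (- s) * exp s).
          - apply Rmult_le_compat_l; [lra | apply exp_ge].
          - rewrite <- exp_plus, Rplus_opp_l, exp_0; lra. }
        generalize (pos_INR n); intros Hn.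
        assert (exp (- s) * M * (1 + s) <= M) by nra.
        assert (0 <= (Rabs (fst c) - exp (- s) * M)) by nra.
        apply Rle_trans with ((1 + s) * (Rabs (fst c) - exp (- s) * M)); [nra |].
        apply Rmult_le_compat_r; lra. }
      assert (Rabs (e * (fst c + exp (- s) * fst y)) >= e * (Rabs (fst c) - exp (- s) * M)).
      { rewrite Rabs_mult, (Rabs_pos_eq e) by lra. apply Rle_ge, Rmult_le_compat_l; [lra |].
        assert (Rabs (exp (- s) * fst y) <= exp (- s) * M).
        { rewrite Rabs_mult, (Rabs_pos_eq (exp (- s))) by lra; apply Rmult_le_compat_l; lra. }
        revert H; unfold Rabs; repeat destruct Rcase_abs; lra. }
      assert (Q : forall N Y, 0 <= N -> 1 + N <= Rabs Y -> 1 <= Rabs (N + Y)).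
      { intros N Y; unfold Rabs; repeat destruct Rcase_abs; lra. }
      apply Q; [apply pos_INR | lra].
Qed.

(** Maximum principle for [phi = |e^(n s) v|^2], which attains its maximum by rapid decay. At an
    interior maximum [phi' = 0] reads [(n + Re h) |v|^2 = - Re (conj v g)] with [g = Op h v], hence
    [|v| <= |g|] there because [|n + Re h| >= 1], whatever the sign. A maximum at the end point
    gives the boundary term. *)
Lemma first_order h : exp_poly h ->
  exists n0 : nat, forall n : nat, (n0 <= n)%nat ->
  exists R0, 0 <= R0 /\ forall Rr v B, R0 <= Rr -> rapid v ->
    (forall s, Rr <= s -> exp (INR n * s) * Cmod (Op h v s) <= B) ->
    forall s, Rr <= s -> exp (INR n * s) * Cmod (v s) <= B + exp (INR n * Rr) * Cmod (v Rr).
Proof.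
  intros Hh; destruct (exp_poly_re_large h Hh) as [n0 H0]; exists n0; intros n Hn.
  destruct (H0 n Hn) as [R0 [HR0 Hre]]; exists R0; split; auto.
  intros Rr v B HRr Hv HB s1 Hs1.
  set (phi := fun s => exp (2 * INR n * s) * (fst (v s) * fst (v s) + snd (v s) * snd (v s))).
  assert (Ephi : forall s, phi s = (exp (INR n * s) * Cmod (v s)) ^ 2).
  { intros s; unfold phi; rewrite <- Cmod2; replace (2 * INR n * s) with (INR n * s + INR n * s) by ring.
    rewrite exp_plus; ring. }
  assert (P : forall s, 0 <= exp (INR n * s) * Cmod (v s)).
  { intros s; apply Rmult_le_pos; [left; apply exp_pos | apply Cmod_pos]. }
  assert (HB0 : 0 <= B).
  { eapply Rle_trans; [| apply (HB Rr); lra]; apply Rmult_le_pos; [left; apply exp_pos | apply Cmod_pos]. }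
  apply Rnot_lt_le; intros Hc.
  set (E1 := exp (INR n * s1) * Cmod (v s1)) in *.
  generalize (P Rr); intros PR.
  assert (HE1 : 0 < E1) by lra.
  destruct (proj2 (Hv O) (S n)) as [M HM]; simpl Nat.iter in HM.
  (* Decay at rate [n + 1] makes the weighted [v] smaller beyond [S0] than its value [E1] at [s1],
     so the maximum over [[Rr, S0]] is not at the right end. *)
  set (S0 := s1 + 1 + Rabs (M / E1)).
  assert (Hfar : forall s, S0 <= s -> exp (INR n * s) * Cmod (v s) < E1).
  { intros s Hs. generalize (Rabs_pos (M / E1)) (Rle_abs (M / E1)); intros ? ?.
    assert (s0 : 0 <= s) by (unfold S0 in Hs; lra).
    specialize (HM s s0); rewrite S_INR, Rmult_plus_distr_r, exp_plus, Rmult_1_l in HM.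
    assert (L : M / E1 < exp s) by (generalize (exp_ge s); unfold S0 in Hs; lra).
    apply Rlt_div_l in L; auto. specialize (P s).
    generalize (exp_pos s); intros.
    apply Rmult_lt_reg_r with (exp s); auto. lra. }
  assert (Dphi : forall s, is_derive phi s
    (2 * INR n * phi s + exp (2 * INR n * s) * (2 * (fst (v s) * fst (dd v s) + snd (v s) * snd (dd v s))))).
  { intros s; destruct (proj1 (dCat_is _ _ _) (rapid_dCat v s Hv)) as [D1 D2]; unfold phi.
    assert (D0 : is_derive (fun s => exp (2 * INR n * s)) s (2 * INR n * exp (2 * INR n * s)))
      by (auto_derive; [trivial | ring]).
    generalize (is_derive_mult _ _ s _ _ D0 (is_derive_plus _ _ s _ _
      (is_derive_mult _ _ s _ _ D1 D1) (is_derive_mult _ _ s _ _ D2 D2))).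
    intros D3; eapply eq_ind; [exact D3 |].
    unfold plus, mult; simpl; ring. }
  assert (HS : Rr < S0) by (unfold S0; generalize (Rabs_pos (M / E1)); lra).
  destruct (continuity_ab_maj phi Rr S0) as [sx [Hmax Hsx]]; [lra | |].
  { intros s _; apply derivable_continuous_pt; eexists; apply is_derive_Reals, Dphi. }
  assert (Hs1S : s1 <= S0) by (unfold S0; generalize (Rabs_pos (M / E1)); lra).
  assert (Hge : E1 <= exp (INR n * sx) * Cmod (v sx)).
  { generalize (Hmax s1 (conj Hs1 Hs1S)); rewrite !Ephi; fold E1; intros.
    apply Rnot_lt_le; intros K; specialize (P sx). nra. }
  assert (N1 : sx <> Rr) by (intros ->; lra).
  assert (N2 : sx <> S0) by (intros ->; specialize (Hfar S0); lra).
  assert (pr : derivable_pt phi sx) by (eexists; apply is_derive_Reals, Dphi).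
  assert (Z : derive_pt phi sx pr = 0).
  { apply (deriv_maximum phi Rr S0 sx pr); try lra; intros; apply Hmax; lra. }
  rewrite (Derive_Reals phi sx pr), (is_derive_unique phi sx _ (Dphi sx)) in Z.
  assert (HRsx : Rr <= sx) by lra. assert (HR0sx : R0 <= sx) by lra.
  specialize (HB sx HRsx); specialize (Hre sx HR0sx).
  set (X := exp (INR n * sx)) in *.
  assert (HX : 0 < X) by apply exp_pos.
  assert (EX : exp (2 * INR n * sx) = X * X).
  { unfold X; rewrite <- exp_plus; f_equal; ring. }
  set (g := Op h v sx) in *.
  assert (Eg : dd v sx = Cadd g (Cmul (h sx) (v sx))) by (unfold g, Op; ring).
  clearbody g; rewrite Eg, EX in Z; unfold phi in Z; rewrite EX, <- Cmod2 in Z.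
  set (c := Cmod (v sx)) in *.
  assert (Hc0 : 0 <= c) by apply Cmod_pos.
  assert (Hin : Rabs (fst (v sx) * fst g + snd (v sx) * snd g) <= c * Cmod g).
  { eapply Rle_trans; [| right; apply (Cmod_mul (v sx) g)].
    assert (K : Cmod (Cmul (v sx) g) = Cmod (Cmul (fst (v sx), - snd (v sx)) g)).
    { rewrite !Cmod_mul; f_equal; unfold Cmod; simpl; f_equal; ring. }
    rewrite K; eapply Rle_trans; [| apply fst_le_Cmod]; simpl; apply Req_le; f_equal; ring. }
  assert (Z2 : (INR n + fst (h sx)) * (X * X * (c * c)) + X * X * (fst (v sx) * fst g + snd (v sx) * snd g) = 0).
  { generalize (Cmod2 (v sx)); fold c; intros K. simpl in Z. rewrite K in Z |- *.
    apply Rmult_eq_reg_l with 2; [| lra]. rewrite Rmult_0_r, <- Z; ring. }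
  set (G := Cmod g) in *. set (ip := fst (v sx) * fst g + snd (v sx) * snd g) in *.
  assert (HG : 0 <= G) by apply Cmod_pos.
  assert (Z3 : X * X * (c * c) <= X * X * (c * G)).
  { assert (q1 : Rabs ((INR n + fst (h sx)) * (X * X * (c * c))) = Rabs (X * X * ip)).
    { replace ((INR n + fst (h sx)) * (X * X * (c * c))) with (- (X * X * ip)) by lra; apply Rabs_Ropp. }
    rewrite !Rabs_mult in q1. rewrite (Rabs_pos_eq X), (Rabs_pos_eq c) in q1 by lra.
    assert (0 <= X * X * (c * c)) by (apply Rmult_le_pos; apply Rmult_le_pos; lra).
    assert (X * X * Rabs ip <= X * X * (c * G)) by (apply Rmult_le_compat_l; [apply Rmult_le_pos; lra | exact Hin]).
    nra. }
  assert (0 < X * c) by lra.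
  assert (X * c <= X * G).
  { apply Rmult_le_reg_l with (X * c); auto; lra. }
  lra.
Qed.

(* A weighted estimate on half-lines for [sum a_k (d/ds - h)^k]; the rate [n] must be large, while the
   lower derivatives may lose a fixed rate [l]. *)
Definition a_priori (m : nat) (a : nat -> R -> Cx) : Prop :=
  forall h, exp_poly h -> exists l n0 : nat, forall n, (n0 <= n)%nat ->
  exists C R0, 0 <= C /\ 0 <= R0 /\ forall Rr, R0 <= Rr ->
  exists Cb, 0 <= Cb /\ forall v B b, rapid v -> 0 <= b ->
    (forall s, Rr <= s -> exp (INR n * s) * Cmod (PS m a h v s) <= B) ->
    (forall k, (k < m)%nat -> Cmod (Nat.iter k dd v Rr) <= b) ->
    (forall s, Rr <= s -> exp (INR n * s) * Cmod (v s) <= C * B + Cb * b) /\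
    (forall k, (k < m)%nat -> forall s, Rr <= s ->
       exp ((INR n - INR l) * s) * Cmod (Nat.iter k dd v s) <= Cb * (B + b)).

Lemma le_mul_ge1 x y z w : 0 <= x -> 0 <= z -> 0 <= y -> 1 <= w -> x * y <= (z + x) * (w * y).
Proof.
  intros; apply Rle_trans with (x * (w * y)).
  - apply Rmult_le_compat_l; nra.
  - apply Rmult_le_compat_r; nra.
Qed.

Lemma leibniz_exp_poly h k : exp_poly h -> exists f : nat -> R -> Cx, (forall i, exp_poly (f i)) /\
  forall v, rapid v -> Nat.iter k dd (fun s => Cmul (h s) (v s)) =
    fun s => Csum (S k) (fun i => Cmul (f i s) (Nat.iter i dd v s)).
Proof.
  intros Hh; induction k as [|k [f [Hf IH]]].
  - exists (fun _ => h); split; auto; intros v Hv; apply functional_extensionality; intros s; simpl; ring.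
  - exists (fun i s => Cadd (if le_dec i k then dd (f i) s else C0)
       (match i with O => C0 | S i' => f i' s end)); split.
    + intros i; apply exp_poly_add; [destruct (le_dec i k); [now apply exp_poly_dd | apply exp_poly_const] |].
      destruct i; [apply exp_poly_const | apply Hf].
    + intros v Hv; simpl Nat.iter; rewrite IH by auto.
      apply functional_extensionality; intros s.
      transitivity (Csum (S k) (fun i => Cadd (Cmul (dd (f i) s) (Nat.iter i dd v s))
                                         (Cmul (f i s) (Nat.iter (S i) dd v s)))).
      * apply dd_eq. apply (dCat_Csum (S k) (fun i t => Cmul (f i t) (Nat.iter i dd v t))).
        intros i _; apply dCat_mul; [now apply exp_poly_dCat | apply (Hv i)].
      * rewrite Csum_add.
        rewrite (Csum_ext (S (S k)) _ (fun i => Cadd (Cmul (if le_dec i k then dd (f i) s else C0) (Nat.iter i dd v s))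
            (Cmul (match i with O => C0 | S i' => f i' s end) (Nat.iter i dd v s)))) by (intros; ring).
        rewrite Csum_add; f_equal.
        -- rewrite (Csum_widen (S k) (S (S k))); [| lia |].
           ++ apply Csum_ext; intros i Hi; destruct (le_dec i k); [auto | lia].
           ++ intros i Hi; destruct (le_dec i k); [lia | ring].
        -- rewrite (Csum_first (S k)); ring_simplify; auto.
Qed.

(** Apply [k] derivatives to [v' = Op h v + h v]. This trades derivatives of [v] for those of
    [Op h v], in either direction, up to lower derivatives of [v]. *)
Lemma Op_deriv h k : exp_poly h -> exists f : nat -> R -> Cx, (forall i, exp_poly (f i)) /\
  forall v s, rapid v -> Nat.iter (S k) dd v s =
    Cadd (Nat.iter k dd (Op h v) s) (Csum (S k) (fun i => Cmul (f i s) (Nat.iter i dd v s))).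
Proof.
  intros Hh; destruct (leibniz_exp_poly h k Hh) as [f [Hf E]]; exists f; split; auto; intros v s Hv.
  specialize (E v Hv). apply (f_equal (fun F => F s)) in E; rewrite <- E; clear E.
  assert (G : forall u w, rapid u -> rapid w -> Nat.iter k dd (fun s => Cadd (u s) (w s)) =
     fun s => Cadd (Nat.iter k dd u s) (Nat.iter k dd w s)).
  { clear; intros u w Hu Hw; induction k as [|k IH]; simpl; auto; rewrite IH.
    apply functional_extensionality; intros s; apply dd_eq, dCat_add; [apply (Hu k) | apply (Hw k)]. }
  generalize (G (Op h v) (fun s => Cmul (h s) (v s)) (rapid_Op h v Hh Hv) (rapid_mul h v Hh Hv)); intros G1.
  apply (f_equal (fun F => F s)) in G1; simpl in G1; rewrite <- G1; clear G1.
  change (Nat.iter (S k) dd v s) with (dd (Nat.iter k dd v) s); rewrite <- iter_comm; f_equal; f_equal.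
  apply functional_extensionality; intros t; unfold Op; ring.
Qed.

Lemma PS_tail m a h v s : PS (S m) a h v s =
  Cadd (Cmul (a O s) (v s)) (PS m (fun k => a (S k)) h (Op h v) s).
Proof.
  unfold PS; rewrite Csum_first; f_equal; apply Csum_ext; intros k _; now rewrite iter_comm.
Qed.

Lemma Op_data h m (Rr : R) : exp_poly h -> exists D, 0 <= D /\ forall v b, rapid v -> 0 <= b ->
  (forall k, (k < S m)%nat -> Cmod (Nat.iter k dd v Rr) <= b) ->
  forall k, (k < m)%nat -> Cmod (Nat.iter k dd (Op h v) Rr) <= D * b.
Proof.
  intros Hh; induction m as [|m [D [HD IH]]].
  - exists 0; split; [lra |]; intros; lia.
  - destruct (Op_deriv h m Hh) as [f [_ E]].
    set (F := sum_f_R0 (fun i => Cmod (f i Rr)) m).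
    assert (HF : 0 <= F) by (apply cond_pos_sum; intros; apply Cmod_pos).
    assert (HF' : forall i, (i < S m)%nat -> Cmod (f i Rr) <= F).
    { intros i Hi; unfold F; clear -Hi; induction m as [|m IH]; simpl.
      - replace i with O by lia; lra.
      - destruct (Nat.eq_dec i (S m)) as [->|].
        + assert (0 <= sum_f_R0 (fun i => Cmod (f i Rr)) m) by (apply cond_pos_sum; intros; apply Cmod_pos); lra.
        + generalize (Cmod_pos (f (S m) Rr)) (IH ltac:(lia)); lra. }
    exists (D + (1 + INR (S m) * F)); split.
    { generalize (pos_INR (S m)); intros; nra. }
    intros v b Hv Hb H k Hk.
    assert (P : 0 <= INR (S m) * F) by (generalize (pos_INR (S m)); intros; nra).
    destruct (Nat.eq_dec k m) as [->|].
    + replace (Nat.iter m dd (Op h v) Rr) with (Csub (Nat.iter (S m) dd v Rr)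
        (Csum (S m) (fun i => Cmul (f i Rr) (Nat.iter i dd v Rr)))) by (rewrite (E v Rr Hv); ring).
      eapply Rle_trans; [apply Cmod_sub |].
      assert (Cmod (Csum (S m) (fun i => Cmul (f i Rr) (Nat.iter i dd v Rr))) <= INR (S m) * (F * b)).
      { apply Cmod_Csum_le; [nra |]; intros i Hi; rewrite Cmod_mul; apply Rmult_le_compat; auto using Cmod_pos. }
      generalize (H (S m) ltac:(lia)); intros; nra.
    + eapply Rle_trans; [apply (IH v b Hv Hb); [intros; apply H; lia | lia] |]. nra.
Qed.

(** Each derivative recovered through [Op_deriv] costs the growth [e^(lam s)] of the coefficients
    there; this is the origin of the loss [l] in [a_priori]. *)
Lemma Op_growth h m : exp_poly h -> exists (lam : nat) F, 0 <= F /\ forall v, rapid v -> forall k, (k < m)%nat ->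
  forall s, 0 <= s -> Cmod (Nat.iter (S k) dd v s) <= Cmod (Nat.iter k dd (Op h v) s) +
    F * exp (INR lam * s) * sum_f_R0 (fun i => Cmod (Nat.iter i dd v s)) k.
Proof.
  intros Hh; induction m as [|m [lam [F [HF IH]]]].
  - exists O, 0; split; [lra |]; intros; lia.
  - destruct (Op_deriv h m Hh) as [f [Hf E]].
    assert (G : forall j, exists (n : nat) M, 0 <= M /\ forall i, (i <= j)%nat -> forall s, 0 <= s ->
       Cmod (f i s) <= M * exp (INR n * s)).
    { induction j as [|j [n [M [HM H]]]].
      - destruct (exp_poly_bound (f O) (Hf O)) as [n [M [HM H]]]; exists n, M; split; auto.
        intros i Hi; replace i with O by lia; auto.
      - destruct (exp_poly_bound (f (S j)) (Hf (S j))) as [n' [M' [HM' H']]].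
        exists (n + n')%nat, (M + M'); split; [lra |]; intros i Hi s Hs.
        rewrite plus_INR, (Rmult_plus_distr_r (INR n)), exp_plus.
        assert (1 <= exp (INR n * s) /\ 1 <= exp (INR n' * s)).
        { rewrite <- exp_0; split; apply exp_le, Rmult_le_pos; auto using pos_INR. }
        destruct (Nat.eq_dec i (S j)) as [->|].
        + eapply Rle_trans; [now apply H' |]. 
          apply le_mul_ge1; lra.
        + eapply Rle_trans; [apply (H i); auto; lia |].
          rewrite (Rplus_comm M), (Rmult_comm (exp (INR n * s))); apply le_mul_ge1; lra. }
    destruct (G m) as [n [M [HM H]]].
    exists (lam + n)%nat, (F + M); split; [lra |]; intros v Hv k Hk s Hs.
    set (Sg := sum_f_R0 (fun i => Cmod (Nat.iter i dd v s)) k).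
    assert (HSg : 0 <= Sg) by (apply cond_pos_sum; intros; apply Cmod_pos).
    rewrite plus_INR, (Rmult_plus_distr_r (INR lam)), exp_plus.
    assert (1 <= exp (INR lam * s) /\ 1 <= exp (INR n * s)) as [e1 e2].
    { rewrite <- exp_0; split; apply exp_le, Rmult_le_pos; auto using pos_INR. }
    destruct (Nat.eq_dec k m) as [->|].
    + rewrite (E v s Hv); eapply Rle_trans; [apply Cmod_add |]; apply Rplus_le_compat_l.
      apply Rle_trans with (M * exp (INR n * s) * Sg).
      * unfold Sg. assert (HS : forall j, (j <= m)%nat -> Cmod (Csum (S j) (fun i => Cmul (f i s) (Nat.iter i dd v s))) <=
           M * exp (INR n * s) * sum_f_R0 (fun i => Cmod (Nat.iter i dd v s)) j).
        { induction j as [|j IHj]; intros Hj.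
          - simpl; replace (Cadd C0 (Cmul (f O s) (v s))) with (Cmul (f O s) (v s)) by ring.
            rewrite Cmod_mul; apply Rmult_le_compat_r; [apply Cmod_pos | apply H; auto].
          - change (Csum (S (S j)) (fun i => Cmul (f i s) (Nat.iter i dd v s))) with
             (Cadd (Csum (S j) (fun i => Cmul (f i s) (Nat.iter i dd v s))) (Cmul (f (S j) s) (Nat.iter (S j) dd v s))).
            eapply Rle_trans; [apply Cmod_add |]; simpl sum_f_R0; rewrite Rmult_plus_distr_l.
            apply Rplus_le_compat; [apply IHj; lia |].
            rewrite Cmod_mul; apply Rmult_le_compat_r; [apply Cmod_pos | apply H; auto]. }
        now apply HS.
      * apply Rmult_le_compat_r; auto.
        apply le_mul_ge1; lra.
    + eapply Rle_trans; [apply (IH v Hv k); auto; lia |]; apply Rplus_le_compat_l.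
      apply Rmult_le_compat_r; auto.
      rewrite (Rplus_comm F), (Rmult_comm (exp (INR lam * s))); apply le_mul_ge1; lra.
Qed.

Lemma a_priori_base a c : c <> C0 -> (forall s, a O s = c) -> a_priori 0 a.
Proof.
  intros Hc Ha h Hh; exists O, O; intros n _; exists (/ Cmod c), 0.
  assert (P : 0 < Cmod c) by now apply Cmod_gt0.
  split; [left; now apply Rinv_0_lt_compat | split; [lra |]].
  intros Rr HR; exists 0; split; [lra |]; intros v B b Hv Hb HB _; split; [| intros; lia].
  intros s Hs; specialize (HB s Hs); unfold PS in HB; simpl in HB; rewrite Ha in HB.
  replace (Cadd C0 (Cmul c (v s))) with (Cmul c (v s)) in HB by ring.
  rewrite Cmod_mul in HB. rewrite Rmult_0_l, Rplus_0_r.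
  apply Rmult_le_reg_l with (Cmod c); auto. replace (Cmod c * (/ Cmod c * B)) with B by (field; lra). lra.
Qed.

(** Put [w = Op h v] and treat [a_0 v], which is small because [a_0 = O(e^(-s))], as part of the
    right-hand side of an equation of order [m] for [w]. Then [w] is controlled by [B] and
    [eps |v|], and [v] by [w] through [first_order]; for large [Rr] the term with [eps] is
    absorbed. *)
Lemma a_priori_tail m a c : lead (-1) (a O) c -> a_priori m (fun k => a (S k)) -> a_priori (S m) a.
Proof.
  intros Ha IH h Hh.
  destruct (lead_bound _ _ _ Ha) as [M [HM HaM]].
  destruct (IH h Hh) as [l1 [n1 IH1]].
  destruct (first_order h Hh) as [n2 FO].
  destruct (Op_growth h m Hh) as [lam [F [HF HG]]].
  (* One loss [lam] for each derivative of [v] reconstructed from those of [w]. *)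
  exists (l1 + S m * lam)%nat, (max n1 n2); intros n Hn.
  destruct (IH1 n) as [C1 [R1 [HC1 [HR1 IH2]]]]; [lia |].
  destruct (FO n) as [R2 [HR2 FO2]]; [lia |].
  (* [Rr] must be large in terms of [C1]: this is why [a_priori] fixes [C] before [Rr] and lets only
     [Cb] depend on [Rr]. The entry [2 * C1 * M] yields [C1 * eps <= / 2]. *)
  exists (2 * C1), (Rmax R1 (Rmax R2 (2 * C1 * M))); split; [lra |]; split.
  { eapply Rle_trans; [apply HR1 | apply Rmax_l]. }
  intros Rr HR.
  assert (HRR1 : R1 <= Rr) by (eapply Rle_trans; [apply Rmax_l | apply HR]).
  assert (HRR2 : R2 <= Rr) by (eapply Rle_trans; [| apply HR]; eapply Rle_trans; [| apply Rmax_r]; apply Rmax_l).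
  assert (HRR3 : 2 * C1 * M <= Rr) by (eapply Rle_trans; [| apply HR]; eapply Rle_trans; [| apply Rmax_r]; apply Rmax_r).
  destruct (IH2 Rr HRR1) as [Cb1 [HCb1 IH3]].
  destruct (Op_data h m Rr Hh) as [D [HD HDat]].
  set (eps := M * exp (- Rr)).
  assert (Heps0 : 0 <= eps) by (apply Rmult_le_pos; auto; left; apply exp_pos).
  assert (Heps : C1 * eps <= / 2).
  { assert (exp (- Rr) * (1 + Rr) <= 1).
    { apply Rle_trans with (exp (- Rr) * exp Rr).
      - apply Rmult_le_compat_l; [left; apply exp_pos | apply exp_ge].
      - rewrite <- exp_plus, Rplus_opp_l, exp_0; lra. }
    generalize (exp_pos (- Rr)); intros.
    assert (0 <= C1 * M) by nra. unfold eps; nra. }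
  set (e0 := exp (INR n * Rr)). assert (He0 : 0 < e0) by apply exp_pos.
  (* [Q0] bounds the weighted [v], [Q1] the derivatives of [w], and [T] is the factor by which the
     bound grows with each further derivative of [v]. *)
  set (Q0 := 2 * C1 + 2 * (Cb1 * D + e0)).
  set (Q1 := Cb1 * (1 + eps * Q0 + D)).
  set (T := 1 + F * INR (S m)).
  assert (HQ0 : 0 <= Q0) by (unfold Q0; nra).
  assert (HQ1 : 0 <= Q1) by (unfold Q1; apply Rmult_le_pos; nra).
  assert (HT : 1 <= T) by (unfold T; generalize (pos_INR (S m)); intros; nra).
  exists ((Q0 + Q1) * T ^ S m + Q0).
  assert (HTm : 1 <= T ^ S m) by now apply pow_R1_Rle.
  split; [apply Rplus_le_le_0_compat; auto; apply Rmult_le_pos; lra |].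
  intros v B b Hv Hb HB Hdat.
  assert (HB0 : 0 <= B).
  { eapply Rle_trans; [| apply (HB Rr); lra]; apply Rmult_le_pos; [left; apply exp_pos | apply Cmod_pos]. }
  set (w := Op h v). assert (Hw : rapid w) by now apply rapid_Op.
  assert (HwB : forall K, (forall s, Rr <= s -> exp (INR n * s) * Cmod (v s) <= K) ->
     forall s, Rr <= s -> exp (INR n * s) * Cmod (PS m (fun k => a (S k)) h w s) <= B + eps * K).
  { intros K HK s Hs.
    replace (PS m (fun k => a (S k)) h w s) with (Csub (PS (S m) a h v s) (Cmul (a O s) (v s)))
      by (rewrite PS_tail; fold w; ring).
    generalize (Cmod_sub (PS (S m) a h v s) (Cmul (a O s) (v s))) (exp_pos (INR n * s)) (HB s Hs) (HK s Hs).
    rewrite Cmod_mul; intros A1 A2 A3 A4.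
    assert (A5 : Cmod (a O s) <= eps).
    { eapply Rle_trans; [apply HaM; lra |]; apply Rmult_le_compat_l; auto; apply exp_le; lra. }
    generalize (Cmod_pos (a O s)) (Cmod_pos (v s)); intros.
    assert (Cmod (a O s) * (exp (INR n * s) * Cmod (v s)) <= eps * K).
    { apply Rmult_le_compat; auto; nra. }
    nra. }
  assert (HDb : forall k, (k < m)%nat -> Cmod (Nat.iter k dd w Rr) <= D * b) by now apply HDat.
  assert (HDb0 : 0 <= D * b) by nra.
  assert (Hv0 : forall s, Rr <= s -> exp (INR n * s) * Cmod (v s) <= 2 * (C1 * B + Cb1 * (D * b) + e0 * b)).
  { apply (absorb (fun s => Rr <= s)).
    - destruct (proj2 (Hv O) n) as [M' HM']; exists M'; intros s Hs; apply HM'; lra.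
    - intros K HK s Hs.
      destruct (IH3 w _ (D * b) Hw HDb0 (HwB K HK) HDb) as [W1 _].
      assert (W2 := FO2 Rr v _ HRR2 Hv W1 s Hs).
      assert (Cmod (v Rr) <= b) by (apply (Hdat O); lia).
      assert (0 <= K).
      { eapply Rle_trans; [| apply (HK s Hs)]; apply Rmult_le_pos; [left; apply exp_pos | apply Cmod_pos]. }
      fold e0 in W2; nra. }
  assert (Hpos : forall s, Rr <= s -> 0 <= exp (INR n * s) * Cmod (v s)).
  { intros s Hs; apply Rmult_le_pos; [left; apply exp_pos | apply Cmod_pos]. }
  split.
  - intros s Hs; eapply Rle_trans; [now apply Hv0 |].
    assert (0 <= (Q0 + Q1) * T ^ S m * b) by (apply Rmult_le_pos; auto; apply Rmult_le_pos; lra).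
    assert (2 * (Cb1 * (D * b) + e0 * b) <= Q0 * b) by (unfold Q0; nra). nra.
  - assert (HvQ : forall s, Rr <= s -> exp (INR n * s) * Cmod (v s) <= Q0 * (B + b)).
    { intros s Hs; eapply Rle_trans; [now apply Hv0 |]. 
      assert (0 <= C1 * b) by nra. assert (0 <= Cb1 * D * B) by (apply Rmult_le_pos; nra).
      assert (0 <= e0 * B) by nra. unfold Q0; nra. }
    destruct (IH3 w _ (D * b) Hw HDb0 (HwB _ HvQ) HDb) as [_ W2].
    assert (W3 : forall k, (k < m)%nat -> forall s, Rr <= s ->
       exp ((INR n - INR l1) * s) * Cmod (Nat.iter k dd w s) <= Q1 * (B + b)).
    { intros k Hk s Hs; eapply Rle_trans; [now apply W2 |].
      unfold Q1; rewrite Rmult_assoc; apply Rmult_le_compat_l; auto. nra. }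
    assert (V : forall k, (k < S m)%nat -> forall s, Rr <= s -> forall i, (i <= k)%nat ->
       exp ((INR n - INR l1 - INR k * INR lam) * s) * Cmod (Nat.iter i dd v s) <= (Q0 + Q1) * T ^ k * (B + b)).
    { induction k as [|k IHk]; intros Hk s Hs i Hi.
      - replace i with O by lia; simpl.
        apply Rle_trans with (Q0 * (B + b)); [| nra].
        eapply Rle_trans; [| apply (HvQ s Hs)]; apply Rmult_le_compat_r; [apply Cmod_pos |].
        apply exp_le, Rmult_le_compat_r; [lra |]. generalize (pos_INR l1); lra.
      - specialize (IHk ltac:(lia) s Hs).
        assert (Hs0 : 0 <= s) by lra.
        assert (Emon : exp ((INR n - INR l1 - INR (S k) * INR lam) * s) <= exp ((INR n - INR l1 - INR k * INR lam) * s)).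
        { apply exp_le, Rmult_le_compat_r; auto. rewrite S_INR; generalize (pos_INR lam); nra. }
        assert (HTk : 0 <= (Q0 + Q1) * T ^ k * (B + b)).
        { apply Rmult_le_pos; [apply Rmult_le_pos; [lra | apply pow_le; lra] | lra]. }
        assert (Tstep : (Q0 + Q1) * T ^ S k * (B + b) = T * ((Q0 + Q1) * T ^ k * (B + b))) by (simpl; ring).
        destruct (Nat.eq_dec i (S k)) as [->|].
        + specialize (HG v Hv k ltac:(lia) s Hs0).
          apply Rle_trans with (exp ((INR n - INR l1 - INR (S k) * INR lam) * s) * Cmod (Nat.iter k dd w s) +
            F * sum_f_R0 (fun i => exp ((INR n - INR l1 - INR k * INR lam) * s) * Cmod (Nat.iter i dd v s)) k).
          * set (Sg := sum_f_R0 (fun i => Cmod (Nat.iter i dd v s)) k).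
            replace (sum_f_R0 _ k) with (exp ((INR n - INR l1 - INR k * INR lam) * s) * Sg)
              by (unfold Sg; rewrite scal_sum; apply sum_eq; intros; ring).
            fold w in HG; fold Sg in HG.
            replace (exp ((INR n - INR l1 - INR k * INR lam) * s)) with
              (exp ((INR n - INR l1 - INR (S k) * INR lam) * s) * exp (INR lam * s))
              by (rewrite <- exp_plus; f_equal; rewrite S_INR; ring).
            generalize (exp_pos ((INR n - INR l1 - INR (S k) * INR lam) * s)); intros.
            eapply Rle_trans; [apply Rmult_le_compat_l; [lra | apply HG] |]. right; ring.
          * apply Rle_trans with (Q1 * (B + b) + F * (INR (S k) * ((Q0 + Q1) * T ^ k * (B + b)))).
            -- apply Rplus_le_compat.
               ++ eapply Rle_trans; [| apply (W3 k ltac:(lia) s Hs)]; apply Rmult_le_compat_r; [apply Cmod_pos |].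
                  apply exp_le, Rmult_le_compat_r; auto. generalize (pos_INR (S k)) (pos_INR lam); nra.
               ++ apply Rmult_le_compat_l; auto.
                  rewrite <- (Rmult_comm _ (INR (S k))), <- (sum_cte _ k).
                  apply sum_Rle; intros j Hj; auto.
            -- rewrite Tstep.
               assert (Q1 * (B + b) <= (Q0 + Q1) * T ^ k * (B + b)).
               { apply Rmult_le_compat_r; [lra |]. assert (1 <= T ^ k) by (apply pow_R1_Rle; lra). nra. }
               assert (INR (S k) <= INR (S m)) by (apply le_INR; lia).
               assert (F * (INR (S k) * ((Q0 + Q1) * T ^ k * (B + b))) <= F * (INR (S m) * ((Q0 + Q1) * T ^ k * (B + b)))).
               { apply Rmult_le_compat_l; auto; apply Rmult_le_compat_r; auto. }
               set (X := (Q0 + Q1) * T ^ k * (B + b)) in *. clearbody X. unfold T; lra.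
        + apply Rle_trans with ((Q0 + Q1) * T ^ k * (B + b)).
          * eapply Rle_trans; [| apply (IHk i); lia]. apply Rmult_le_compat_r; [apply Cmod_pos | auto].
          * rewrite Tstep, <- (Rmult_1_l ((Q0 + Q1) * T ^ k * (B + b))) at 1; apply Rmult_le_compat_r; lra. }
    intros k Hk s Hs.
    apply Rle_trans with ((Q0 + Q1) * T ^ S m * (B + b)).
    + eapply Rle_trans; [| eapply Rle_trans; [apply (V k Hk s Hs k); lia |]].
      * apply Rmult_le_compat_r; [apply Cmod_pos |]; apply exp_le, Rmult_le_compat_r; [lra |].
        rewrite plus_INR, mult_INR. assert (INR k <= INR (S m)) by (apply le_INR; lia).
        generalize (pos_INR lam); nra.
      * apply Rmult_le_compat_r; [lra |]; apply Rmult_le_compat_l; [lra |].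
        apply Rle_pow; [lra | lia].
    + apply Rmult_le_compat_r; lra.
Qed.

(** * Roots of complex polynomials *)

Fixpoint Cpow (z : Cx) (n : nat) : Cx :=
  match n with O => C1 | S n' => Cmul z (Cpow z n') end.

(** The algebraic closedness of [R[i]] is taken from mathcomp; the module keeps its notations and
    coercions away from the rest. *)
Module FTA.
Import all_boot all_algebra Rstruct complex.
Import GRing.Theory.
Local Open Scope ring_scope.

Definition toRi (z : Cx) : R[i] := Complex (fst z) (snd z).

Lemma toRi_add z w : toRi (Cadd z w) = toRi z + toRi w.
Proof. by []. Qed.

Lemma toRi_mul z w : toRi (Cmul z w) = toRi z * toRi w.
Proof. by []. Qed.

Lemma toRi_pow z n : toRi (Cpow z n) = toRi z ^+ n.
Proof. by elim: n => [|n IH] //; rewrite exprS -IH -toRi_mul. Qed.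

Lemma toRi_Csum n f : toRi (Csum n f) = \sum_(i < n) toRi (f i).
Proof. by elim: n => [|n IH]; rewrite ?big_ord0 // big_ord_recr /= -IH -toRi_add. Qed.

Lemma toRi_inj z w : toRi z = toRi w -> z = w.
Proof. by case: z w => [a b] [c d] [-> ->]. Qed.

Lemma poly_root (m : nat) (al : nat -> Cx) (k : nat) : (1 <= k)%coq_nat -> (k <= m)%coq_nat ->
  al k <> C0 -> exists r, Csum (S m) (fun k => Cmul (al k) (Cpow r k)) = C0.
Proof.
move=> /leP k1 /leP km ak.
pose p : {poly R[i]} := \poly_(i < m.+1) toRi (al i).
have pk : p`_k != 0.
  rewrite coef_poly ltnS km; apply/eqP => H; apply: ak; exact: (@toRi_inj _ C0).
have sp : size p != 1%N.
  apply/eqP => sp; move: pk; rewrite nth_default ?eqxx // sp //.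
have [x rx] := closed_rootP _ sp.
exists (Re x, Im x); apply: (@toRi_inj _ C0); rewrite toRi_Csum.
have -> : toRi C0 = 0 by [].
rewrite -[RHS](eqP rx) horner_poly; apply: eq_bigr => i _.
rewrite toRi_mul toRi_pow; congr (_ * _ ^+ _); by case: (x).
Qed.
End FTA.
Definition poly_root := FTA.poly_root.

Lemma Cpow_mod z n : Cmod (Cpow z n) = Cmod z ^ n.
Proof. induction n as [|n IH]; simpl; [apply Cmod_C1 | now rewrite Cmod_mul, IH]. Qed.

(** The Cauchy bound: for [|r| > 1] the top term is balanced by lower terms of total size at most
    [S0 |r|^mu]. *)
Lemma root_bound (mu : nat) (al : nat -> Cx) : al mu <> C0 ->
  exists Bd, forall r, Csum (S mu) (fun k => Cmul (al k) (Cpow r k)) = C0 -> Cmod r <= Bd.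
Proof.
  intros Ha; destruct mu as [|mu].
  - exists 0; intros r H; exfalso; apply Ha; simpl in H.
    replace (al O) with (Cadd C0 (Cmul (al O) C1)) by ring; exact H.
  - set (S0 := sum_f_R0 (fun k => Cmod (al k)) mu).
    assert (P : 0 < Cmod (al (S mu))) by now apply Cmod_gt0.
    exists (Rmax 1 (S0 / Cmod (al (S mu)))); intros r H.
    destruct (Rle_dec (Cmod r) 1) as [h|h]; [eapply Rle_trans; [exact h | apply Rmax_l] |].
    eapply Rle_trans; [| apply Rmax_r]. apply Rnot_le_lt in h.
    apply Rle_div_r; auto.
    change (Cadd (Csum (S mu) (fun k => Cmul (al k) (Cpow r k))) (Cmul (al (S mu)) (Cpow r (S mu))) = C0) in H.
    assert (H1 : Cmod (Cmul (al (S mu)) (Cpow r (S mu))) = Cmod (Csum (S mu) (fun k => Cmul (al k) (Cpow r k)))).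
    { rewrite <- (Cmod_opp (Csum _ _)); f_equal.
      set (A := Csum _ _) in *; set (B := Cmul _ _) in *.
      transitivity (Csub (Cadd A B) A); [ring | rewrite H; ring]. }
    assert (H2 : forall j, (j <= mu)%nat -> Cmod (Csum (S j) (fun k => Cmul (al k) (Cpow r k))) <=
       sum_f_R0 (fun k => Cmod (al k)) j * Cmod r ^ mu).
    { induction j as [|j IH]; intros Hj.
      - simpl. replace (Cadd C0 (Cmul (al O) C1)) with (al O) by ring.
        generalize (pow_R1_Rle (Cmod r) mu ltac:(lra)) (Cmod_pos (al O)); nra.
      - change (Csum (S (S j)) (fun k => Cmul (al k) (Cpow r k))) with
          (Cadd (Csum (S j) (fun k => Cmul (al k) (Cpow r k))) (Cmul (al (S j)) (Cpow r (S j)))).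
        eapply Rle_trans; [apply Cmod_add |]; simpl sum_f_R0; rewrite Rmult_plus_distr_r.
        apply Rplus_le_compat; [apply IH; lia |].
        rewrite Cmod_mul, Cpow_mod; apply Rmult_le_compat_l; [apply Cmod_pos | apply Rle_pow; [lra | lia]]. }
    specialize (H2 mu (le_n _)); fold S0 in H2.
    rewrite <- H1, Cmod_mul, Cpow_mod in H2; simpl in H2.
    apply Rmult_le_reg_r with (Cmod r ^ mu); [apply pow_lt; lra |]. lra.
Qed.

(** If every root [r] had a further root [r - n], the real parts would descend without end, against
    [root_bound]. A root without such resonances is what the successive corrections in
    [a_priori_kill] require. *)
Lemma good_root (mu : nat) (al : nat -> Cx) : (1 <= mu)%nat -> al mu <> C0 ->
  exists r, Csum (S mu) (fun k => Cmul (al k) (Cpow r k)) = C0 /\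
    forall n, (1 <= n)%nat -> Csum (S mu) (fun k => Cmul (al k) (Cpow (Csub r (RtoC (INR n))) k)) <> C0.
Proof.
  intros Hmu Ha; destruct (root_bound mu al Ha) as [Bd HBd].
  destruct (poly_root mu al mu Hmu (le_n _) Ha) as [r0 Hr0].
  apply NNPP; intros Hc.
  assert (D : forall N : nat, exists r, Csum (S mu) (fun k => Cmul (al k) (Cpow r k)) = C0 /\ fst r <= fst r0 - INR N).
  { induction N as [|N [r [Hr Hre]]]; [exists r0; split; auto; simpl; lra |].
    apply NNPP; intros Hn; apply Hc; exists r; split; auto; intros n Hn1 E; apply Hn.
    exists (Csub r (RtoC (INR n))); split; auto; rewrite S_INR; simpl.
    apply le_INR in Hn1; simpl in Hn1; lra. }
  destruct (nfloor_ex (fst r0 + Bd + 1 + Rabs (fst r0 + Bd + 1))) as [N HN].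
  { unfold Rabs; destruct Rcase_abs; lra. }
  destruct (D (S N)) as [r [Hr Hre]]; specialize (HBd r Hr).
  generalize (fst_le_Cmod r); rewrite S_INR in Hre.
  revert HN; unfold Rabs; repeat destruct Rcase_abs; lra.
Qed.

(** * Shifts and ramifications *)

Lemma choose_fun {A B} (P : A -> B -> Prop) : (forall x, exists y, P x y) -> exists f, forall x, P x (f x).
Proof.
  intros H; exists (fun x => proj1_sig (constructive_indefinite_description _ (H x))).
  intros x; apply (proj2_sig (constructive_indefinite_description _ (H x))).
Qed.

(** Coefficients of [(D + c)^k = sum_j Bc c k j D^j] for the first order operator
    [D = d/ds - h - c]; the derivative term appears because [D] does not commute with functions. *)
Fixpoint Bc (c : R -> Cx) (k j : nat) : R -> Cx :=
  match k with
  | O => fun _ => match j with O => C1 | _ => C0 end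
  | S k' => fun s => Cadd (Cadd (match j with O => C0 | S j' => Bc c k' j' s end)
                                (dd (Bc c k' j) s)) (Cmul (c s) (Bc c k' j s))
  end.

Lemma Bc_exp_poly c k j : exp_poly c -> exp_poly (Bc c k j).
Proof.
  intros Hc; revert j; induction k as [|k IH]; intros j; simpl.
  - destruct j; apply exp_poly_const.
  - apply exp_poly_add; [apply exp_poly_add | apply exp_poly_mul; auto]; [| now apply exp_poly_dd].
    destruct j; [apply exp_poly_const | apply IH].
Qed.

Lemma dd_const z s : dd (fun _ => z) s = C0.
Proof. apply dd_eq, dCat_const. Qed.

Lemma Bc_zero c k j : (k < j)%nat -> Bc c k j = fun _ => C0.
Proof.
  revert j; induction k as [|k IH]; intros j H; apply functional_extensionality; intros s; simpl.
  - destruct j; [lia | auto].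
  - rewrite (IH j) by lia; rewrite dd_const. destruct j; [lia |]. rewrite IH by lia; ring.
Qed.

Lemma Bc_diag c k : Bc c k k = fun _ => C1.
Proof.
  induction k as [|k IH]; apply functional_extensionality; intros s; simpl; auto.
  rewrite (Bc_zero c k (S k)), IH, dd_const by lia; ring.
Qed.

Lemma Bc_shift c h v k N s : exp_poly c -> exp_poly h -> rapid v -> (k <= N)%nat ->
  Nat.iter k (Op h) v s =
  Csum (S N) (fun j => Cmul (Bc c k j s) (Nat.iter j (Op (fun t => Cadd (h t) (c t))) v s)).
Proof.
  intros Hc Hh Hv; revert s; induction k as [|k IH]; intros s Hk.
  - rewrite Csum_first, Csum_0; [simpl; ring |]. intros j Hj; simpl; ring.
  - set (h' := fun t => Cadd (h t) (c t)) in *.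
    assert (Hh' : exp_poly h') by now apply exp_poly_add.
    set (w := fun j => Nat.iter j (Op h') v) in *.
    assert (Hw : forall j t, dCat (w j) t (dd (w j) t)).
    { intros j t; apply rapid_dCat; now apply rapid_Opk. }
    assert (Ew : forall j, dd (w j) s = Cadd (w (S j) s) (Cmul (Cadd (h s) (c s)) (w j s))).
    { intros j; change (w (S j) s) with (Csub (dd (w j) s) (Cmul (Cadd (h s) (c s)) (w j s))); ring. }
    change (Op h (Nat.iter k (Op h) v) s = Csum (S N) (fun j => Cmul (Bc c (S k) j s) (w j s))).
    unfold Op at 1.
    assert (IH' : Nat.iter k (Op h) v s = Csum (S N) (fun j => Cmul (Bc c k j s) (w j s))) by (apply IH; lia).
    assert (E : dd (Nat.iter k (Op h) v) s = Csum (S N) (fun j =>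
       Cadd (Cmul (dd (Bc c k j) s) (w j s)) (Cmul (Bc c k j s) (dd (w j) s)))).
    { apply dd_eq.
      apply (dCat_ext (fun t => Csum (S N) (fun j => Cmul (Bc c k j t) (w j t)))).
      - intros t; symmetry; apply (IH t); lia.
      - apply (dCat_Csum (S N) (fun j t => Cmul (Bc c k j t) (w j t))); intros j _.
        apply dCat_mul; auto. now apply exp_poly_dCat, Bc_exp_poly. }
    rewrite E, IH'.
    unfold Csub; rewrite <- (Csum_ext (S N) (fun j => Cadd (Cadd
       (Cmul (Cadd (dd (Bc c k j) s) (Cmul (c s) (Bc c k j s))) (w j s))
       (Cmul (Bc c k j s) (w (S j) s))) (Cmul (h s) (Cmul (Bc c k j s) (w j s))))).
    2:{ intros j _; rewrite Ew; ring. }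
    rewrite Csum_add, <- Csum_mul.
    match goal with |- Cadd (Cadd ?A ?B) (Copp ?B') = _ =>
      replace (Cadd (Cadd A B) (Copp B')) with A by ring end.
    rewrite Csum_add.
    rewrite (Csum_ext (S N) (fun j => Cmul (Bc c (S k) j s) (w j s)) (fun j => Cadd
       (Cmul (Cadd (dd (Bc c k j) s) (Cmul (c s) (Bc c k j s))) (w j s))
       (Cmul (match j with O => C0 | S j' => Bc c k j' s end) (w j s)))) by (intros; simpl; ring).
    rewrite Csum_add; f_equal.
    rewrite (Csum_first N (fun j => Cmul (match j with O => C0 | S j' => Bc c k j' s end) (w j s))).
    change (Cadd (Csum N (fun j => Cmul (Bc c k j s) (w (S j) s))) (Cmul (Bc c k N s) (w (S N) s)) =
      Cadd (Cmul C0 (w O s)) (Csum N (fun j => Cmul (Bc c k j s) (w (S j) s)))).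
    rewrite (Bc_zero c k N) by lia. ring.
Qed.

Definition shifted (m : nat) (a : nat -> R -> Cx) (c : R -> Cx) (j : nat) (s : R) : Cx :=
  Csum (S m) (fun k => Cmul (a k s) (Bc c k j s)).

Lemma PS_shift m a c h v s : exp_poly c -> exp_poly h -> rapid v ->
  PS m a h v s = PS m (shifted m a c) (fun t => Cadd (h t) (c t)) v s.
Proof.
  intros Hc Hh Hv; unfold PS, shifted.
  rewrite (Csum_ext (S m) _ (fun k => Csum (S m) (fun j =>
    Cmul (Cmul (a k s) (Bc c k j s)) (Nat.iter j (Op (fun t => Cadd (h t) (c t))) v s)))).
  - rewrite Csum_swap; apply Csum_ext; intros j _.
    set (W := Nat.iter _ _ _ _).
    replace (Cmul (Csum (S m) (fun k => Cmul (a k s) (Bc c k j s))) W) with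
      (Cmul W (Csum (S m) (fun k => Cmul (a k s) (Bc c k j s)))) by ring.
    rewrite Csum_mul; apply Csum_ext; intros; ring.
  - intros k Hk; rewrite (Bc_shift c h v k m s), Csum_mul by (auto; lia).
    apply Csum_ext; intros; ring.
Qed.

(** A shift moves [c] from the coefficients into [h], and [a_priori] quantifies over all [h] to
    allow this. *)
Lemma a_priori_shift m a c : exp_poly c -> a_priori m (shifted m a c) -> a_priori m a.
Proof.
  intros Hc H h Hh.
  destruct (H (fun t => Cadd (h t) (c t)) (exp_poly_add _ _ Hh Hc)) as [l [n0 H1]].
  exists l, n0; intros n Hn; destruct (H1 n Hn) as [C [R0 [HC [HR H2]]]].
  exists C, R0; split; [auto | split; auto]; intros Rr HRr.
  destruct (H2 Rr HRr) as [Cb [HCb H3]]; exists Cb; split; auto.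
  intros v B b Hv Hb HB Hd; apply H3; auto.
  intros s Hs; rewrite <- PS_shift by auto; now apply HB.
Qed.

Definition ramified (q : nat) (a : nat -> R -> Cx) (k : nat) (s : R) : Cx :=
  Cmul (RtoC (/ INR q ^ k)) (a k (INR q * s)).

(** For [s = q t] each [d/ds] becomes [(1/q) d/dt], whence the factor in [ramified]; rates are
    multiplied by [q] and the end point [Rr] is divided by it. *)
Lemma a_priori_ramify m a q : (1 <= q)%nat -> a_priori m (ramified q a) -> a_priori m a.
Proof.
  intros Hq H h Hh.
  assert (Hq1 : 1 <= INR q) by now apply (le_INR 1).
  assert (Hh' : exp_poly (fun s => Cmul (RtoC (INR q)) (h (INR q * s)))).
  { apply exp_poly_mul; [apply exp_poly_const |]. destruct Hh as [d [c Hd]]; exists (Z.of_nat q * d)%Z, c.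
    now apply lead_ramify. }
  destruct (H _ Hh') as [l [n0 H1]].
  exists l, n0; intros n Hn.
  destruct (H1 (n * q)%nat) as [C [R0 [HC [HR H2]]]]; [nia |].
  exists C, (INR q * R0); split; [auto | split; [nra |]]; intros Rr HRr.
  destruct (H2 (Rr / INR q)) as [Cb [HCb H3]].
  { apply Rle_div_r; lra. }
  assert (Pq : forall k, 1 <= INR q ^ k) by (intros; now apply pow_R1_Rle).
  (* The derivatives of [v (q s)] at the new end point exceed those of [v] by a factor of at most
     [q^m]. *)
  exists (Cb * INR q ^ m); split; [apply Rmult_le_pos; auto; specialize (Pq m); lra |].
  intros v B b Hv Hb HB Hd.
  destruct (rapid_scale v q Hq Hv) as [HV EV].
  assert (Escale : forall s, INR q * (s / INR q) = s) by (intros; field; lra).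
  assert (EO : forall k s, Nat.iter k (Op (fun s => Cmul (RtoC (INR q)) (h (INR q * s)))) (fun s => v (INR q * s)) s =
     Cscal (INR q ^ k) (Nat.iter k (Op h) v (INR q * s))).
  { induction k as [|k IH]; intros s; simpl; [cring |].
    unfold Op at 1. rewrite IH.
    assert (D : dCat (Nat.iter k (Op (fun s => Cmul (RtoC (INR q)) (h (INR q * s)))) (fun s => v (INR q * s))) s
      (Cscal (INR q ^ k) (Cscal (INR q) (dd (Nat.iter k (Op h) v) (INR q * s))))).
    { apply (dCat_ext (fun t => Cmul (RtoC (INR q ^ k)) (Nat.iter k (Op h) v (INR q * t)))).
      - intros t; rewrite IH; apply eq_sym, Cscal_mul.
      - rewrite Cscal_mul; apply dCat_cmul, dCat_scale, rapid_dCat; now apply rapid_Opk. }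
    rewrite (dd_eq _ _ _ D). unfold Op at 3. cring. }
  assert (EP' : forall s, PS m (ramified q a) (fun s => Cmul (RtoC (INR q)) (h (INR q * s))) (fun s => v (INR q * s)) s =
     PS m a h v (INR q * s)).
  { intros s; unfold PS; apply Csum_ext; intros k _; rewrite EO; unfold ramified; rewrite Cscal_mul.
    assert (K : Cmul (RtoC (/ INR q ^ k)) (RtoC (INR q ^ k)) = C1).
    { rewrite <- RtoC_mul, Rinv_l, RtoC_1; auto. specialize (Pq k); lra. }
    set (A := RtoC (/ INR q ^ k)) in *; set (A' := RtoC (INR q ^ k)) in *.
    transitivity (Cmul (Cmul A A') (Cmul (a k (INR q * s)) (Nat.iter k (Op h) v (INR q * s)))); [ring | rewrite K; ring]. }
  destruct (H3 (fun s => v (INR q * s)) B (INR q ^ m * b) HV) as [H4 H5].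
  - specialize (Pq m); nra.
  - intros s Hs; rewrite EP', mult_INR.
    replace (INR n * INR q * s) with (INR n * (INR q * s)) by ring; apply HB.
    apply Rle_div_l in Hs; lra.
  - intros k Hk; rewrite EV, Cmod_scal, Escale, Rabs_pos_eq by (specialize (Pq k); lra).
    apply Rmult_le_compat; auto; [specialize (Pq k); lra | apply Cmod_pos | apply Rle_pow; [lra | lia]].
  - assert (HRs : forall s, Rr <= s -> Rr / INR q <= s / INR q).
    { intros s Hs; apply Rmult_le_compat_r; auto; left; apply Rinv_0_lt_compat; lra. }
    split.
    + intros s Hs; specialize (H4 _ (HRs s Hs)); simpl in H4; rewrite Escale, mult_INR in H4.
      replace (INR n * INR q * (s / INR q)) with (INR n * s) in H4 by (field; lra). lra.
    + intros k Hk s Hs; specialize (H5 k Hk _ (HRs s Hs)).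
      rewrite EV, Escale, Cmod_scal, mult_INR, Rabs_pos_eq in H5 by (specialize (Pq k); lra).
      assert (Hs0 : 0 <= s) by nra.
      replace ((INR n * INR q - INR l) * (s / INR q)) with ((INR n - INR l / INR q) * s) in H5 by (field; lra).
      assert (exp ((INR n - INR l) * s) <= exp ((INR n - INR l / INR q) * s)).
      { apply exp_le, Rmult_le_compat_r; auto.
        assert (INR l / INR q <= INR l) by (apply Rle_div_l; [lra | generalize (pos_INR l); nra]). lra. }
      assert (HB0 : 0 <= B).
      { eapply Rle_trans; [| apply (HB Rr); lra]; apply Rmult_le_pos; [left; apply exp_pos | apply Cmod_pos]. }
      generalize (Cmod_pos (Nat.iter k dd v s)) (exp_pos ((INR n - INR l / INR q) * s)); intros.
      apply Rle_trans with (Cb * (B + INR q ^ m * b)).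
      * eapply Rle_trans; [| apply H5]. specialize (Pq k).
        apply Rmult_le_compat; auto; [left; apply exp_pos | nra].
      * rewrite Rmult_assoc; apply Rmult_le_compat_l; auto. specialize (Pq m); nra.
Qed.

(** [binomial(k, j) c^(k - j)], the coefficients of [(z + c)^k]: the analogue of [Bc] for commuting
    symbols. *)
Fixpoint bet (c : Cx) (k j : nat) : Cx :=
  match k with
  | O => match j with O => C1 | _ => C0 end
  | S k' => Cadd (match j with O => C0 | S j' => bet c k' j' end) (Cmul c (bet c k' j))
  end.

Lemma bet_zero c k j : (k < j)%nat -> bet c k j = C0.
Proof.
  revert j; induction k as [|k IH]; intros j H; simpl; destruct j; try lia; auto.
  rewrite !IH by lia; ring.
Qed.

Lemma bet_diag c k : bet c k k = C1.
Proof. induction k as [|k IH]; simpl; auto; rewrite IH, bet_zero by lia; ring. Qed.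

Lemma bet_subdiag c k : bet c (S k) k = Cmul (RtoC (INR (S k))) c.
Proof.
  induction k as [|k IH]; [simpl; rewrite RtoC_1; ring |].
  change (bet c (S (S k)) (S k)) with (Cadd (bet c (S k) k) (Cmul c (bet c (S k) (S k)))).
  rewrite IH, bet_diag, (S_INR (S k)), RtoC_add, RtoC_1; ring.
Qed.

Lemma bet_0 k j : bet C0 k j = if Nat.eq_dec k j then C1 else C0.
Proof.
  revert j; induction k as [|k IH]; intros j; simpl.
  - destruct j; auto.
  - destruct j; simpl; [ring |]. rewrite IH.
    destruct (Nat.eq_dec k j); destruct (Nat.eq_dec (S k) (S j)); try lia; ring.
Qed.

Lemma bet_binom c k N z : (k <= N)%nat ->
  Csum (S N) (fun j => Cmul (bet c k j) (Cpow z j)) = Cpow (Cadd z c) k.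
Proof.
  induction k as [|k IH]; intros H.
  - rewrite Csum_first, Csum_0; [simpl; ring |]. intros; simpl; ring.
  - simpl Cpow; rewrite <- IH by lia.
    rewrite (Csum_ext _ _ (fun j => Cadd (Cmul (match j with O => C0 | S j' => bet c k j' end) (Cpow z j))
        (Cmul c (Cmul (bet c k j) (Cpow z j))))) by (intros; simpl; ring).
    rewrite Csum_add, <- Csum_mul.
    rewrite (Csum_first N (fun j => Cmul (match j with O => C0 | S j' => bet c k j' end) (Cpow z j))).
    rewrite (Csum_ext N _ (fun j => Cmul z (Cmul (bet c k j) (Cpow z j)))) by (intros; simpl; ring).
    rewrite <- Csum_mul. simpl Csum. rewrite (bet_zero c k N) by lia. ring.
Qed.

(** Coefficients of the characteristic polynomial after the translation [z -> z + c], see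
    [shc_eval]. *)
Definition shc (m : nat) (al : nat -> Cx) (c : Cx) (j : nat) : Cx :=
  Csum (S m) (fun k => Cmul (al k) (bet c k j)).

Lemma shc_eval m al c z :
  Csum (S m) (fun j => Cmul (shc m al c j) (Cpow z j)) = Csum (S m) (fun k => Cmul (al k) (Cpow (Cadd z c) k)).
Proof.
  unfold shc.
  rewrite (Csum_ext _ _ (fun j => Csum (S m) (fun k => Cmul (Cmul (al k) (bet c k j)) (Cpow z j)))).
  - rewrite Csum_swap; apply Csum_ext; intros k Hk.
    rewrite <- (bet_binom c k m) by lia. rewrite Csum_mul; apply Csum_ext; intros; ring.
  - intros j _. replace (Cmul (Csum (S m) (fun k => Cmul (al k) (bet c k j))) (Cpow z j)) with
      (Cmul (Cpow z j) (Csum (S m) (fun k => Cmul (al k) (bet c k j)))) by ring.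
    rewrite Csum_mul; apply Csum_ext; intros; ring.
Qed.

Lemma shc_0 m al c : shc m al c O = Csum (S m) (fun k => Cmul (al k) (Cpow c k)).
Proof.
  generalize (shc_eval m al c C0). rewrite Csum_first, Csum_0.
  - simpl Cpow at 1. intros H.
    replace (shc m al c O) with (Cadd (Cmul (shc m al c O) C1) C0) by ring. rewrite H.
    apply Csum_ext; intros; do 2 f_equal; ring.
  - intros; simpl; ring.
Qed.

(** In the recursion for [Bc] the derivative term has degree [kap (k - j)] against the expected
    [kap (k + 1 - j)]. For [kap > 0] it does not reach the leading coefficient, and for [kap = 0]
    differentiation multiplies that coefficient by 0. *)
Lemma Bc_lead kap c k j : (0 <= kap)%Z ->
  lead (kap * (Z.of_nat k - Z.of_nat j)) (Bc (fun s => Cmul c (RtoC (exp (IZR kap * s)))) k j) (bet c k j).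
Proof.
  intros Hk; set (f := fun s => Cmul c (RtoC (exp (IZR kap * s)))).
  assert (Hf : lead kap f c) by apply lead_exp.
  revert j; induction k as [|k IH]; intros j.
  - destruct j; simpl; [rewrite Z.mul_0_r; apply lead_const | apply lead_zero].
  - simpl bet; simpl Bc.
    replace (Cadd (match j with O => C0 | S j' => bet c k j' end) (Cmul c (bet c k j))) with
      (Cadd (Cadd (match j with O => C0 | S j' => bet c k j' end) C0) (Cmul c (bet c k j))) by ring.
    apply lead_add; [apply lead_add |].
    + destruct j; [apply lead_zero |].
      replace (Z.of_nat (S k) - Z.of_nat (S j))%Z with (Z.of_nat k - Z.of_nat j)%Z by lia; apply IH.
    + destruct (lead_deriv _ _ _ (IH j)) as [_ D].
      destruct (Z.eq_dec kap 0) as [->|].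
      * rewrite Z.mul_0_l in *; rewrite RtoC_0 in D; replace C0 with (Cmul C0 (bet c k j)) by ring; exact D.
      * eapply lead_up; [| apply D]. nia.
    + replace (kap * (Z.of_nat (S k) - Z.of_nat j))%Z with (kap + kap * (Z.of_nat k - Z.of_nat j))%Z by lia.
      apply lead_mul; auto.
Qed.

Lemma shifted_lead m a al W kap c : (0 <= kap)%Z ->
  (forall k, (k <= m)%nat -> lead (W - kap * Z.of_nat k) (a k) (al k)) ->
  forall j, lead (W - kap * Z.of_nat j) (shifted m a (fun s => Cmul c (RtoC (exp (IZR kap * s)))) j) (shc m al c j).
Proof.
  intros Hk H j; apply lead_Csum; intros k Hkm.
  replace (W - kap * Z.of_nat j)%Z with (W - kap * Z.of_nat k + kap * (Z.of_nat k - Z.of_nat j))%Z by lia.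
  apply lead_mul; [apply H; lia | now apply Bc_lead].
Qed.

Lemma shifted_top m a c s : shifted m a c m s = a m s.
Proof.
  unfold shifted; rewrite (Csum_single _ m) by (try lia; intros; rewrite Bc_zero by lia; ring).
  rewrite Bc_diag; ring.
Qed.

Lemma shifted_exp_poly m a c : exp_poly c -> (forall k, (k <= m)%nat -> exp_poly (a k)) -> forall j, exp_poly (shifted m a c j).
Proof.
  intros Hc H j; apply exp_poly_Csum; intros k Hk; apply exp_poly_mul; [apply H; lia | now apply Bc_exp_poly].
Qed.

(** For a decaying shift [f = c e^(-n s)] products of [f] with itself are of higher order, so to
    leading order [Bc f (k + 1) 0] is the [k]-th derivative of [f]. This linear effect corrects the
    zeroth coefficient in [a_priori_kill]. *)
Lemma Bc_lead_neg n c : (1 <= n)%nat ->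
  let f := fun s => Cmul c (RtoC (exp (IZR (- Z.of_nat n) * s))) in
  (forall k j, lead 0 (Bc f k j) (if Nat.eq_dec k j then C1 else C0)) /\
  (forall k, lead (- Z.of_nat n) (Bc f (S k) O) (Cmul c (Cpow (RtoC (- INR n)) k))).
Proof.
  intros Hn f.
  assert (Hf : lead (- Z.of_nat n) f c) by apply lead_exp.
  assert (A : forall k j, lead 0 (Bc f k j) (if Nat.eq_dec k j then C1 else C0)).
  { induction k as [|k IH]; intros j.
    - destruct j; simpl; [apply lead_const | apply lead_zero].
    - replace (if Nat.eq_dec (S k) j then C1 else C0) with
        (Cadd (Cadd (match j with O => C0 | S j' => if Nat.eq_dec k j' then C1 else C0 end) C0) C0).
      2:{ destruct j; [destruct (Nat.eq_dec (S k) O); [lia | ring] |].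
          destruct (Nat.eq_dec k j); destruct (Nat.eq_dec (S k) (S j)); try lia; ring. }
      simpl Bc; apply lead_add; [apply lead_add |].
      + destruct j; [apply lead_zero | apply IH].
      + destruct (lead_deriv _ _ _ (IH j)) as [_ D]. rewrite RtoC_0 in D.
        replace C0 with (Cmul C0 (if Nat.eq_dec k j then C1 else C0)) by ring; exact D.
      + eapply lead_up; [| apply (lead_mul _ _ _ _ _ _ Hf (IH j))]; lia. }
  split; auto.
  induction k as [|k IH].
  - simpl. replace (Cmul c C1) with (Cadd (Cadd C0 C0) (Cmul c C1)) by ring.
    apply lead_add; [apply lead_add; [apply lead_zero |] |].
    + apply (lead_ext _ (fun _ => C0)); [intros; now rewrite dd_const | apply lead_zero].
    + rewrite <- (Z.add_0_r (- Z.of_nat n)); apply lead_mul; auto. apply lead_const.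
  - change (Bc f (S (S k)) O) with (fun s => Cadd (Cadd C0 (dd (Bc f (S k) O) s)) (Cmul (f s) (Bc f (S k) O s))).
    replace (Cmul c (Cpow (RtoC (- INR n)) (S k))) with
      (Cadd (Cadd C0 (Cmul (RtoC (IZR (- Z.of_nat n))) (Cmul c (Cpow (RtoC (- INR n)) k)))) C0).
    2:{ rewrite opp_IZR, <- INR_IZR_INZ; simpl; ring. }
    apply lead_add; [apply lead_add; [apply lead_zero |] |].
    + apply lead_deriv; auto.
    + eapply lead_up; [| apply (lead_mul _ _ _ _ _ _ Hf IH)]; lia.
Qed.

(** * Newton polygon induction *)

Definition regular_op (m : nat) (a : nat -> R -> Cx) : Prop :=
  (forall k, (k <= m)%nat -> exp_poly (a k)) /\ exists c, c <> C0 /\ forall s, a m s = c.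

Lemma regular_shifted m a c : exp_poly c -> regular_op m a -> regular_op m (shifted m a c).
Proof.
  intros Hc [H1 [z [Hz H2]]]; split; [intros; now apply shifted_exp_poly |].
  exists z; split; auto; intros s; now rewrite shifted_top.
Qed.

Lemma regular_ramified m a q : (1 <= q)%nat -> regular_op m a -> regular_op m (ramified q a).
Proof.
  intros Hq [H1 [z [Hz H2]]].
  assert (Pq : forall k, 0 < INR q ^ k) by (intros; apply pow_lt; apply (lt_INR 0); lia).
  split.
  - intros k Hk; apply exp_poly_mul; [apply exp_poly_const |]. destruct (H1 k Hk) as [d [c Hd]].
    exists (Z.of_nat q * d)%Z, c; now apply lead_ramify.
  - exists (Cmul (RtoC (/ INR q ^ m)) z); split.
    + intros E; apply (f_equal Cmod) in E; rewrite Cmod_mul, Cmod_RtoC, Cmod_C0 in E.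
      assert (0 < Cmod z) by now apply Cmod_gt0.
      assert (0 < Rabs (/ INR q ^ m)) by (apply Rabs_pos_lt; apply Rinv_neq_0_compat; specialize (Pq m); lra).
      nra.
    + intros s; unfold ramified; now rewrite H2.
Qed.

(** A shift by [eps e^(-N s)] changes the coefficient of degree [d - N] in [a_0] by [eps S0] and
    leaves the leading coefficients [al] alone, so that coefficient can be cancelled whenever [S0]
    is nonzero. After finitely many shifts, counted by [j], the degree of [a_0] is at most -1 and
    [a_priori_tail] lowers the order. *)
Lemma a_priori_kill m d al : (1 <= m)%nat ->
  (forall b, regular_op (m - 1) b -> a_priori (m - 1) b) -> 
  (forall n, (1 <= n)%nat -> Csum m (fun k => Cmul (al (S k)) (Cpow (RtoC (- INR n)) k)) <> C0) ->
  forall j a N c0, (Z.to_nat (d - Z.of_nat N + 1) <= j)%nat -> (1 <= N)%nat -> regular_op m a ->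
    (forall k, (k <= m)%nat -> lead d (a k) (al k)) -> lead (d - Z.of_nat N) (a O) c0 -> a_priori m a.
Proof.
  intros Hm IH Hal; induction j as [|j IHj]; intros a N c0 Hj HN Hreg Hlead H0.
  - destruct (lead_le (d - Z.of_nat N) (-1) (a O) c0) as [c1 H1]; auto; [lia |].
    destruct m as [|m]; [lia |]. simpl in IH; rewrite Nat.sub_0_r in IH.
    apply (a_priori_tail m a c1 H1), IH; destruct Hreg as [A B]; split; auto.
    intros k Hk; apply A; lia.
  - set (S0 := Csum m (fun k => Cmul (al (S k)) (Cpow (RtoC (- INR N)) k))).
    assert (HS0 : S0 <> C0) by now apply Hal.
    set (eps := Copp (Cmul c0 (Cinv S0))).
    set (f := fun s => Cmul eps (RtoC (exp (IZR (- Z.of_nat N) * s)))).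
    assert (Hf : exp_poly f) by (eapply lead_exp_poly; apply lead_exp).
    destruct (Bc_lead_neg N eps HN) as [B1 B2]; fold f in B1, B2.
    apply (a_priori_shift m a f Hf).
    assert (K : lead (d - Z.of_nat N) (shifted m a f O) C0).
    { unfold shifted.
      apply (lead_ext _ (fun s => Cadd (a O s) (Csum m (fun k => Cmul (a (S k) s) (Bc f (S k) O s))))).
      { intros s; rewrite Csum_first; f_equal. change (Bc f O O s) with C1; ring. }
      replace C0 with (Cadd c0 (Csum m (fun k => Cmul (al (S k)) (Cmul eps (Cpow (RtoC (- INR N)) k))))).
      2:{ rewrite (Csum_ext m _ (fun k => Cmul eps (Cmul (al (S k)) (Cpow (RtoC (- INR N)) k)))) by (intros; ring).
          rewrite <- Csum_mul; fold S0; unfold eps. field; auto. }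
      apply lead_add; auto. apply lead_Csum; intros k Hk.
      apply (lead_mul d (- Z.of_nat N)); [apply Hlead; lia | apply B2]. }
    destruct (lead_down _ _ K) as [c1 Hc1].
    apply (IHj _ (S N) c1); [lia | lia | now apply regular_shifted | |].
    + intros k Hk.
      replace (al k) with (Csum (S m) (fun i => Cmul (al i) (if Nat.eq_dec i k then C1 else C0))).
      * apply lead_Csum; intros i Hi. rewrite <- (Z.add_0_r d); apply lead_mul; [apply Hlead; lia | apply B1].
      * rewrite (Csum_single _ k); [| lia | intros i Hi Hik; destruct (Nat.eq_dec i k); [lia | ring]].
        destruct (Nat.eq_dec k k); [ring | lia].
    + replace (d - Z.of_nat (S N))%Z with (d - Z.of_nat N - 1)%Z by lia; auto.
Qed.

(* the vertex [mu] of the Newton polygon separates the slopes [< s0] from the slopes [>= s0] *)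
Definition newton_vertex (m : nat) (a : nat -> R -> Cx) (mu : nat) (s0 d : Z) : Prop :=
  (1 <= mu <= m)%nat /\ (1 <= s0)%Z /\ (exists c, c <> C0 /\ lead d (a mu) c) /\
  (forall k, (k < mu)%nat -> exists c, lead (d + s0 * (Z.of_nat mu - Z.of_nat k) - 1) (a k) c) /\
  (forall k, (mu < k <= m)%nat -> exists c, lead (d - s0 * (Z.of_nat k - Z.of_nat mu)) (a k) c).

Lemma shc_deg m al mu c : (mu <= m)%nat -> (forall k, (mu < k <= m)%nat -> al k = C0) -> shc m al c mu = al mu.
Proof.
  intros Hm H; unfold shc; rewrite (Csum_single _ mu); [rewrite bet_diag; ring | lia |].
  intros k Hk Hk'. destruct (lt_dec k mu); [rewrite bet_zero by lia; ring | rewrite H by lia; ring].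
Qed.

(** All points of the polygon lie on or below the line [W - kap k]. A shift by [r e^(kap s)], with
    [r] a root of the characteristic polynomial of this line, translates the root to 0. The new
    vertex [mu'] is its multiplicity, and the points to the left of [mu'] drop strictly below the
    line. *)
Lemma slope_step m a W kap al mu : (1 <= mu <= m)%nat -> (1 <= kap)%Z -> al mu <> C0 ->
  (forall k, (mu < k <= m)%nat -> al k = C0) ->
  (forall k, (k <= m)%nat -> lead (W - kap * Z.of_nat k) (a k) (al k)) ->
  exists f mu' r, exp_poly f /\ newton_vertex m (shifted m a f) mu' kap (W - kap * Z.of_nat mu') /\ (mu' <= mu)%nat /\
    (forall j, (j < mu')%nat -> shc m al r j = C0).
Proof.
  intros Hmu Hkap Ha Hz Hl.
  destruct (poly_root m al mu) as [r Hr]; [lia | lia | auto |].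
  set (f := fun s => Cmul r (RtoC (exp (IZR kap * s)))).
  assert (Hf : exp_poly f) by (eapply lead_exp_poly; apply lead_exp).
  assert (Hl' : forall j, lead (W - kap * Z.of_nat j) (shifted m a f j) (shc m al r j)).
  { apply shifted_lead; auto; lia. }
  assert (Hmin : exists mu', shc m al r mu' <> C0 /\ (mu' <= mu)%nat /\ forall j, (j < mu')%nat -> shc m al r j = C0).
  { assert (Hne : shc m al r mu <> C0) by (rewrite shc_deg; auto; lia).
    clear -Hne. revert Hne; induction mu as [mu IH] using lt_wf_ind; intros Hne.
    destruct (classic (exists j, (j < mu)%nat /\ shc m al r j <> C0)) as [[j [Hj Hj']]|Hn].
    - destruct (IH j Hj Hj') as [mu' [A [B C]]]; exists mu'; repeat split; auto; lia.
    - exists mu; repeat split; auto. intros j Hj; apply NNPP; intros K; apply Hn; now exists j. }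
  destruct Hmin as [mu' [Hne [Hle Hlt]]].
  assert (mu' <> O) by (intros ->; apply Hne; rewrite shc_0; auto).
  exists f, mu', r; split; auto; split; [| split; auto].
  repeat split; try lia.
  - now exists (shc m al r mu').
  - intros k Hk. generalize (Hl' k); rewrite Hlt by auto; intros K; apply lead_down in K.
    destruct K as [c K]; exists c.
    replace (W - kap * Z.of_nat mu' + kap * (Z.of_nat mu' - Z.of_nat k) - 1)%Z with (W - kap * Z.of_nat k - 1)%Z by lia; auto.
  - intros k Hk; exists (shc m al r k).
    replace (W - kap * Z.of_nat mu' - kap * (Z.of_nat k - Z.of_nat mu'))%Z with (W - kap * Z.of_nat k)%Z by lia; auto.
Qed.

(** A constant shift by a root [r] makes the leading coefficient of [a_0] vanish, and the sums that
    [a_priori_kill] divides by are nonzero because no [r - n] is a root. *)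
Lemma a_priori_regular_singular m a d al mu : (1 <= mu <= m)%nat ->
  (forall b, regular_op (m - 1) b -> a_priori (m - 1) b) -> regular_op m a -> al mu <> C0 ->
  (forall k, (mu < k <= m)%nat -> al k = C0) ->
  (forall k, (k <= m)%nat -> lead d (a k) (al k)) -> a_priori m a.
Proof.
  intros Hmu IH Hreg Ha Hz Hl.
  destruct (good_root mu al) as [r [Hr Hr']]; [lia | auto |].
  set (f := fun s => Cmul r (RtoC (exp (IZR 0 * s)))).
  assert (Hf : exp_poly f) by (eapply lead_exp_poly; apply lead_exp).
  apply (a_priori_shift m a f Hf).
  assert (Hl' : forall j, lead d (shifted m a f j) (shc m al r j)).
  { intros j; generalize (shifted_lead m a al d 0 r ltac:(lia)); intros K.
    replace d with (d - 0 * Z.of_nat j)%Z by lia; apply K.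
    intros k Hk; replace (d - 0 * Z.of_nat k)%Z with d by lia; auto. }
  assert (Hw : forall z, Csum (S m) (fun k => Cmul (al k) (Cpow z k)) = Csum (S mu) (fun k => Cmul (al k) (Cpow z k))).
  { intros z; apply Csum_widen; [lia |]; intros k Hk; rewrite Hz by lia; ring. }
  assert (H0 : shc m al r O = C0) by (rewrite shc_0, Hw; auto).
  generalize (Hl' O); rewrite H0; intros K; apply lead_down in K; destruct K as [c K].
  apply (a_priori_kill m d (shc m al r)) with (j := Z.to_nat (d - Z.of_nat 1 + 1)) (N := 1%nat) (c0 := c); auto; try lia.
  (* The value of the characteristic polynomial at [r - n] is [- n] times the sum in question, since
     the constant term of the translated polynomial is 0. *)
  - intros n Hn E. apply (Hr' n Hn). rewrite <- Hw.
    replace (Csub r (RtoC (INR n))) with (Cadd (RtoC (- INR n)) r) by (rewrite RtoC_opp; ring).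
    rewrite <- shc_eval, Csum_first, H0.
    rewrite (Csum_ext m _ (fun k => Cmul (RtoC (- INR n)) (Cmul (shc m al r (S k)) (Cpow (RtoC (- INR n)) k))))
      by (intros; simpl; ring).
    rewrite <- Csum_mul, E; ring.
  - now apply regular_shifted.
Qed.

(** Outer induction on the vertex [mu], inner induction on a bound [s] for the slopes to its left.
    If all slopes are at most the integer [s0 - 1], then [slope_step] either moves the vertex to the
    left or keeps it and lowers the slope bound. Otherwise the largest slope is fractional.
    Ramification makes it integral, and now the vertex has to move: the characteristic polynomial
    has no term of index [mu - 1] but one of index [k0 < mu], so it is not a multiple of a power
    [(z - r)^mu]. *)
Lemma a_priori_vertex m : (1 <= m)%nat ->
  (forall b, regular_op (m - 1) b -> a_priori (m - 1) b) ->
  forall mu s (s0 d : Z) a, (s0 <= Z.of_nat s)%Z -> regular_op m a -> newton_vertex m a mu s0 d -> a_priori m a.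
Proof.
  intros Hm IH mu; induction mu as [mu IHmu] using lt_wf_ind.
  induction s as [|s IHs]; intros s0 d a Hs Hreg Hinv; pose proof Hinv as [Hmu [Hs0 [[cmu [Hcmu Hlmu]] [Hlow Hhigh]]]]; [lia |].
  destruct (classic (forall k, (k < mu)%nat -> exists c, lead (d + (s0 - 1) * (Z.of_nat mu - Z.of_nat k)) (a k) c)) as [Hval|Hinval].
  - (* all remaining slopes are at most [s0 - 1] *)
    set (kap := (s0 - 1)%Z) in *. set (W := (d + kap * Z.of_nat mu)%Z).
    destruct (choose_fun (fun k c => (k <= m)%nat -> lead (W - kap * Z.of_nat k) (a k) c /\
       (k = mu -> c <> C0) /\ ((mu < k)%nat -> c = C0))) as [al Hal].
    { intros k. destruct (lt_eq_lt_dec k mu) as [[Hk| ->]|Hk].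
      - destruct (Hval k Hk) as [c Hc]; exists c; intros _; split; [| split; intros; lia].
        replace (W - kap * Z.of_nat k)%Z with (d + kap * (Z.of_nat mu - Z.of_nat k))%Z by lia; auto.
      - exists cmu; intros _; split; [| split; [auto | intros; lia]].
        replace (W - kap * Z.of_nat mu)%Z with d by lia; auto.
      - exists C0; intros Hkm; split; [| split; intros; [lia | auto]].
        destruct (Hhigh k) as [c Hc]; [lia |]. eapply lead_up with (2 := Hc); nia. }
    destruct (Z.eq_dec kap 0) as [Hk0|Hk0].
    + apply (a_priori_regular_singular m a W al mu Hmu IH Hreg).
      * apply (Hal mu); lia.
      * intros k Hk; apply (Hal k); lia.
      * intros k Hk; destruct (Hal k Hk) as [K _]. rewrite Hk0 in K; rewrite Z.mul_0_l, Z.sub_0_r in K; auto.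
    + destruct (slope_step m a W kap al mu) as [f [mu' [r [Hf [Hv [Hle _]]]]]]; auto; try lia.
      * apply (Hal mu); lia.
      * intros k Hk; apply (Hal k); lia.
      * intros k Hk; now apply Hal.
      * apply (a_priori_shift m a f Hf).
        destruct (Nat.eq_dec mu' mu) as [->|Hne].
        -- apply (IHs kap (W - kap * Z.of_nat mu)%Z); auto; [lia | now apply regular_shifted].
        -- apply (IHmu mu' ltac:(lia) (Z.to_nat kap) kap (W - kap * Z.of_nat mu')%Z); auto; [lia | now apply regular_shifted].
  - (* the largest slope is not an integer: ramify *)
    destruct (choose_fun (fun k (p : bool * Z * Cx) => let '(b, e, c) := p in (k < mu)%nat ->
       if b then c <> C0 /\ lead e (a k) c /\ (e <= d + s0 * (Z.of_nat mu - Z.of_nat k) - 1)%Z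
       else forall s, a k s = C0)) as [E HE].
    { intros k; destruct (lt_dec k mu) as [Hk|Hk].
      - destruct (Hlow k Hk) as [c Hc]; destruct (lead_cases _ _ _ Hc) as [Hz|[e [c' [H1 [H2 H3]]]]].
        + exists (false, 0%Z, C0); auto.
        + exists (true, e, c'); auto.
      - exists (false, 0%Z, C0); intros; lia. }
    set (nz := fun k => fst (fst (E k))). set (e := fun k => snd (fst (E k))). set (c := fun k => snd (E k)).
    assert (HE' : forall k, (k < mu)%nat -> if nz k then c k <> C0 /\ lead (e k) (a k) (c k) /\
       (e k <= d + s0 * (Z.of_nat mu - Z.of_nat k) - 1)%Z else forall s, a k s = C0).
    { intros k Hk; generalize (HE k); unfold nz, e, c; destruct (E k) as [[b e'] c']; simpl; intros K; exact (K Hk). }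
    (* [k0] maximises the slope [(e k - d) / (mu - k)]; the inequality is cross-multiplied to stay
       in the integers. *)
    assert (Hmax : forall j, (j <= mu)%nat -> (exists k, (k < j)%nat /\ nz k = true) ->
      exists k0, (k0 < j)%nat /\ nz k0 = true /\ forall k, (k < j)%nat -> nz k = true ->
        ((e k - d) * (Z.of_nat mu - Z.of_nat k0) <= (e k0 - d) * (Z.of_nat mu - Z.of_nat k))%Z).
    { induction j as [|j IHj]; intros Hj [k [Hk Hnk]]; [lia |].
      destruct (classic (exists k, (k < j)%nat /\ nz k = true)) as [Hex|Hnex].
      - destruct (IHj ltac:(lia) Hex) as [k0 [A [B C]]].
        destruct (nz j) eqn:Ej.
        + destruct (Z_le_gt_dec ((e j - d) * (Z.of_nat mu - Z.of_nat k0)) ((e k0 - d) * (Z.of_nat mu - Z.of_nat j))) as [h|h].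
          * exists k0; repeat split; auto; intros i Hi Hni.
            destruct (Nat.eq_dec i j) as [->|]; [auto | apply C; auto; lia].
          * exists j; repeat split; auto; intros i Hi Hni.
            destruct (Nat.eq_dec i j) as [->|]; [lia |].
            specialize (C i ltac:(lia) Hni).
            assert (P1 : (0 < Z.of_nat mu - Z.of_nat k0)%Z) by lia.
            assert (P2 : (0 < Z.of_nat mu - Z.of_nat j)%Z) by lia.
            assert (P3 : (0 < Z.of_nat mu - Z.of_nat i)%Z) by lia.
            set (x := (Z.of_nat mu - Z.of_nat k0)%Z) in *. set (y := (Z.of_nat mu - Z.of_nat j)%Z) in *.
            set (z := (Z.of_nat mu - Z.of_nat i)%Z) in *.
            apply Z.mul_le_mono_pos_r with x; auto.
            replace ((e i - d) * y * x)%Z with ((e i - d) * x * y)%Z by ring.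
            replace ((e j - d) * z * x)%Z with ((e j - d) * x * z)%Z by ring.
            apply Z.le_trans with ((e k0 - d) * z * y)%Z; [apply Z.mul_le_mono_nonneg_r; lia |].
            replace ((e k0 - d) * z * y)%Z with ((e k0 - d) * y * z)%Z by ring.
            apply Z.mul_le_mono_nonneg_r; lia.
        + exists k0; repeat split; auto; intros i Hi Hni.
          destruct (Nat.eq_dec i j) as [->|]; [congruence | apply C; auto; lia].
      - assert (k = j) by (destruct (Nat.eq_dec k j); auto; exfalso; apply Hnex; exists k; split; auto; lia).
        subst k; exists j; repeat split; auto; intros i Hi Hni.
        destruct (Nat.eq_dec i j) as [->|]; [lia |]. exfalso; apply Hnex; exists i; split; auto; lia. }
    assert (Hk1 : exists k1, (k1 < mu)%nat /\ nz k1 = true /\ (d + (s0 - 1) * (Z.of_nat mu - Z.of_nat k1) < e k1)%Z).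
    { apply NNPP; intros Hn; apply Hinval; intros k Hk. specialize (HE' k Hk).
      destruct (nz k) eqn:Ek.
      - destruct HE' as [_ [H1 _]].
        destruct (Z_le_gt_dec (e k) (d + (s0 - 1) * (Z.of_nat mu - Z.of_nat k))) as [h|h].
        + apply (lead_le _ _ _ _ h H1).
        + exfalso; apply Hn; exists k; repeat split; auto; lia.
      - exists C0; apply (lead_ext _ (fun _ => C0)); [intros; now rewrite HE' | apply lead_zero]. }
    destruct Hk1 as [k1 [Hk1 [Hnz1 He1]]].
    destruct (Hmax mu (le_n _)) as [k0 [Hk0 [Hnz0 Hsl]]]; [now exists k1 |].
    pose proof (HE' k0 Hk0) as HEk0; rewrite Hnz0 in HEk0; destruct HEk0 as [Hc0 [Hl0 Hu0]].
    assert (Hlow0 : ((s0 - 1) * (Z.of_nat mu - Z.of_nat k0) < e k0 - d)%Z).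
    { specialize (Hsl k1 Hk1 Hnz1).
      assert (P1 : (0 < Z.of_nat mu - Z.of_nat k0)%Z) by lia.
      assert (P2 : (0 < Z.of_nat mu - Z.of_nat k1)%Z) by lia.
      apply Z.mul_lt_mono_pos_r with (Z.of_nat mu - Z.of_nat k1)%Z; auto.
      apply Z.lt_le_trans with ((e k1 - d) * (Z.of_nat mu - Z.of_nat k0))%Z; auto.
      replace ((s0 - 1) * (Z.of_nat mu - Z.of_nat k0) * (Z.of_nat mu - Z.of_nat k1))%Z with
        ((s0 - 1) * (Z.of_nat mu - Z.of_nat k1) * (Z.of_nat mu - Z.of_nat k0))%Z by ring.
      apply Z.mul_lt_mono_pos_r; auto; lia. }
    (* For [k0 = mu - 1] the largest slope would be an integer strictly between [s0 - 1] and
       [s0]. *)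
    assert (Hk0mu : (k0 < mu - 1)%nat).
    { destruct (Nat.eq_dec k0 (mu - 1)) as [->|]; [| lia]. exfalso; nia. }
    (* A denominator of the largest slope [(e k0 - d) / (mu - k0)], not necessarily reduced; after
       ramification by [q] the slope is the integer [kap]. *)
    set (q := (mu - k0)%nat). assert (Hq : (1 <= q)%nat) by (unfold q; lia).
    set (kap := (e k0 - d)%Z) in *. assert (Hkap : (1 <= kap)%Z) by nia.
    set (W := (Z.of_nat q * d + kap * Z.of_nat mu)%Z).
    assert (Pq : forall k z, z <> C0 -> Cmul (RtoC (/ INR q ^ k)) z <> C0).
    { intros k z Hz K; apply (f_equal Cmod) in K; rewrite Cmod_mul, Cmod_RtoC, Cmod_C0 in K.
      assert (0 < Cmod z) by now apply Cmod_gt0.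
      assert (0 < Rabs (/ INR q ^ k)).
      { apply Rabs_pos_lt, Rinv_neq_0_compat, pow_nonzero, not_0_INR; lia. }
      nra. }
    assert (Hram : forall k f z, lead f (a k) z -> lead (Z.of_nat q * f) (ramified q a k) (Cmul (RtoC (/ INR q ^ k)) z)).
    { intros k f z Hz; apply lead_scal; now apply (lead_ramify f (a k)). }
    destruct (choose_fun (fun k z => (k <= m)%nat -> lead (W - kap * Z.of_nat k) (ramified q a k) z /\
       (k = mu -> z <> C0) /\ ((mu < k)%nat -> z = C0) /\ (k = k0 -> z <> C0) /\ (k = (mu - 1)%nat -> z = C0))) as [al Hal].
    { intros k. destruct (Nat.eq_dec k k0) as [->|Hkk0].
      { exists (Cmul (RtoC (/ INR q ^ k0)) (c k0)); intros _; split; [| repeat split; intros; try lia; now apply Pq].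
        replace (W - kap * Z.of_nat k0)%Z with (Z.of_nat q * e k0)%Z; [now apply Hram |].
        unfold W, q, kap; nia. }
      destruct (Nat.eq_dec k (mu - 1)) as [->|Hkm1].
      { exists C0; intros _; split; [| repeat split; intros; try lia].
        destruct (Hlow (mu - 1)%nat ltac:(lia)) as [z Hz].
        eapply lead_up with (2 := Hram _ _ _ Hz). unfold W, q in *; nia. }
      destruct (lt_eq_lt_dec k mu) as [[Hk| ->]|Hk].
      - specialize (HE' k Hk); destruct (nz k) eqn:Ek.
        + destruct HE' as [H1 [H2 H3]].
          destruct (fun L => lead_le (Z.of_nat q * e k) (W - kap * Z.of_nat k) _ _ L (Hram _ _ _ H2)) as [z Hz].
          * specialize (Hsl k Hk Ek). unfold W, q in *; fold kap in Hsl. nia.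
          * exists z; intros _; split; auto; repeat split; intros; lia.
        + exists C0; intros _; split; [| repeat split; intros; try lia].
          apply (lead_ext _ (fun _ => C0)); [intros; unfold ramified; rewrite HE'; ring | apply lead_zero].
      - exists (Cmul (RtoC (/ INR q ^ mu)) cmu); intros _; split; [| repeat split; intros; try lia; now apply Pq].
        replace (W - kap * Z.of_nat mu)%Z with (Z.of_nat q * d)%Z by (unfold W; lia); now apply Hram.
      - exists C0; intros Hkm; split; [| repeat split; intros; try lia].
        destruct (Hhigh k) as [z Hz]; [lia |].
        eapply lead_up with (2 := Hram _ _ _ Hz). unfold W, q in *.
        assert (kap < s0 * Z.of_nat (mu - k0))%Z by (unfold kap; nia). nia. }
    assert (Hzero : forall k, (mu < k <= m)%nat -> al k = C0) by (intros k Hk; destruct (Hal k) as [_ [_ [K _]]]; [lia | apply K; lia]).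
    assert (Hamu : al mu <> C0) by (destruct (Hal mu) as [_ [K _]]; [lia | now apply K]).
    destruct (slope_step m (ramified q a) W kap al mu) as [f [mu' [r [Hf [Hv [Hle Hsh]]]]]]; auto; try lia.
    { intros k Hk; now apply Hal. }
    apply (a_priori_ramify m a q Hq), (a_priori_shift m _ f Hf).
    assert (Hregq := regular_ramified m a q Hq Hreg).
    (* [kap] may exceed the former slope bound; the outer induction permits this since the vertex
       moves to the left. *)
    apply (IHmu mu') with (s := Z.to_nat kap) (s0 := kap) (d := (W - kap * Z.of_nat mu')%Z); auto; [| lia | now apply regular_shifted].
    destruct (Nat.eq_dec mu' mu) as [->|]; [exfalso | lia].
    (* If [mu' = mu], the coefficient of index [mu - 1] of the translated polynomial is [mu r al_mu]
       and has to vanish, so [r = 0]. But then the coefficient of index [k0] is [al k0], which is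
       nonzero. *)
    assert (Hr : r = C0).
    { generalize (Hsh (mu - 1)%nat ltac:(lia)); unfold shc.
      rewrite (Csum_single _ mu); [| lia |].
      - replace mu with (S (mu - 1)) at 2 by lia. rewrite bet_subdiag. replace (S (mu - 1)) with mu by lia.
        intros K. apply NNPP; intros Hr.
        apply (f_equal Cmod) in K; rewrite !Cmod_mul, Cmod_RtoC, Cmod_C0 in K.
        assert (0 < Cmod (al mu)) by now apply Cmod_gt0. assert (0 < Cmod r) by now apply Cmod_gt0.
        assert (0 < Rabs (INR mu)) by (apply Rabs_pos_lt, not_0_INR; lia).
        assert (0 < Rabs (INR mu) * Cmod r) by now apply Rmult_lt_0_compat.
        assert (0 < Cmod (al mu) * (Rabs (INR mu) * Cmod r)) by now apply Rmult_lt_0_compat.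
        lra.
      - intros k Hk Hkm. destruct (lt_eq_lt_dec k (mu - 1)) as [[h|h]|h].
        + rewrite bet_zero by lia; ring.
        + rewrite (proj2 (proj2 (proj2 (proj2 (Hal k ltac:(lia)))))) by auto; ring.
        + rewrite Hzero by lia; ring. }
    generalize (Hsh k0 ltac:(lia)); rewrite Hr; unfold shc.
    rewrite (Csum_single _ k0); [| lia |].
    + rewrite bet_0; destruct (Nat.eq_dec k0 k0); [| lia].
      intros K. apply (proj1 (proj2 (proj2 (proj2 (Hal k0 ltac:(lia))))) eq_refl).
      transitivity (Cmul (al k0) C1); [ring | auto].
    + intros k Hk Hkk; rewrite bet_0; destruct (Nat.eq_dec k k0); [lia | ring].
Qed.

(** The constant top coefficient puts a vertex at index [m] and height 0; [s0] is chosen above all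
    degrees and hence above all slopes at that vertex. *)
Theorem a_priori_all m a : regular_op m a -> a_priori m a.
Proof.
  revert a; induction m as [|m IH]; intros a Hreg.
  - destruct Hreg as [_ [c [Hc Ha]]]; now apply (a_priori_base a c).
  - destruct (choose_fun (fun k (p : Z * Cx) => (k <= S m)%nat -> lead (fst p) (a k) (snd p))) as [E HE].
    { intros k; destruct (le_dec k (S m)) as [Hk|Hk].
      - destruct (proj1 Hreg k Hk) as [d [c Hd]]; now exists (d, c).
      - exists (0%Z, C0); intros; lia. }
    destruct Hreg as [H1 [c [Hc H2]]].
    assert (Hb : forall j, exists s : Z, (1 <= s)%Z /\ forall k, (k <= j)%nat -> (fst (E k) <= s - 1)%Z).
    { induction j as [|j [s [Hs Hj]]].
      - exists (Z.max 1 (fst (E O) + 1))%Z; split; [lia |]; intros k Hk; replace k with O by lia; lia.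
      - exists (Z.max s (fst (E (S j)) + 1))%Z; split; [lia |]; intros k Hk.
        destruct (Nat.eq_dec k (S j)) as [->|]; [lia | specialize (Hj k ltac:(lia)); lia]. }
    destruct (Hb m) as [s0 [Hs0 Hs]].
    apply (a_priori_vertex (S m)) with (mu := S m) (s := Z.to_nat s0) (s0 := s0) (d := 0%Z); try lia.
    + simpl; rewrite Nat.sub_0_r; auto.
    + split; [auto | exists c; auto].
    + repeat split; try lia.
      * exists c; split; auto. apply (lead_ext _ (fun _ => c)); [auto | apply lead_const].
      * intros k Hk. apply lead_le with (2 := HE k ltac:(lia)). specialize (Hs k ltac:(lia)); nia.
Qed.

(** * Schwartz functions on the line *)

Definition bd (N : nat) (f : Fam1) (B : R) : Prop :=
  forall j k : nat, (j <= N)%nat -> (k <= N)%nat -> forall x, Rabs x ^ j * Cmod (f k x) <= B.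

Lemma bd_pos N f B : bd N f B -> 0 <= B.
Proof.
  intros H; eapply Rle_trans; [| apply (H O O ltac:(lia) ltac:(lia) 0)].
  apply Rmult_le_pos; [apply pow_le, Rabs_pos | apply Cmod_pos].
Qed.

Lemma bd_mono N N' f B B' : (N <= N')%nat -> B <= B' -> bd N' f B -> bd N f B'.
Proof. intros H1 H2 H j k Hj Hk x; eapply Rle_trans; [apply H; lia | auto]. Qed.

Lemma Schwartz_dCat f k x : Schwartz1 f -> dCat (f k) x (f (S k) x).
Proof. intros [H _]; apply H. Qed.

Lemma Schwartz_intro f : (forall k x, dCat (f k) x (f (S k) x)) ->
  (forall N, exists B, bd N f B) -> Schwartz1 f.
Proof.
  intros H1 H2; split; [exact H1 |]. intros j k; destruct (H2 (max j k)) as [B HB]; exists B.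
  intros x; apply HB; lia.
Qed.

Lemma Schwartz_bd f N : Schwartz1 f -> exists B, bd N f B.
Proof.
  intros [_ H].
  assert (G : forall J K : nat, exists B, forall j k, (j < J)%nat -> (k < K)%nat -> forall x, Rabs x ^ j * Cmod (f k x) <= B).
  { induction J as [|J IHJ]; [intros K; exists 0; intros; lia |].
    induction K as [|K IHK]; [exists 0; intros; lia |].
    destruct IHK as [B1 H1]; destruct (IHJ (S K)) as [B2 H2]; destruct (H J K) as [B3 H3].
    exists (Rmax B1 (Rmax B2 B3)); intros j k Hj Hk x.
    destruct (Nat.eq_dec k K) as [->|].
    - destruct (Nat.eq_dec j J) as [->|].
      + eapply Rle_trans; [apply H3 |]; eapply Rle_trans; [| apply Rmax_r]; apply Rmax_r.
      + eapply Rle_trans; [apply H2; lia |]; eapply Rle_trans; [| apply Rmax_r]; apply Rmax_l.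
    - eapply Rle_trans; [apply H1; lia | apply Rmax_l]. }
  destruct (G (S N) (S N)) as [B HB]; exists B; intros j k Hj Hk x; apply HB; lia.
Qed.

Lemma fam_ext (f g : Fam1) : (forall k x, f k x = g k x) -> f = g.
Proof. intros H; apply functional_extensionality; intros k; apply functional_extensionality; auto. Qed.

Lemma deriv_fam_ext (f g : Fam1) : (forall k x, dCat (f k) x (f (S k) x)) -> (forall k x, dCat (g k) x (g (S k) x)) ->
  (forall x, f O x = g O x) -> f = g.
Proof.
  intros Hf Hg H; apply fam_ext; intros k; induction k as [|k IH]; auto; intros x.
  apply dCat_unique with (f k) x; auto. apply (dCat_ext (g k)); auto.
Qed.

(** Derivatives are unique, so a family is determined by its member of order 0; identities between
    operators are checked only there. *)
Lemma Schwartz_ext f g : Schwartz1 f -> Schwartz1 g -> (forall x, f O x = g O x) -> f = g.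
Proof. intros [Hf _] [Hg _]; apply deriv_fam_ext; [exact Hf | exact Hg]. Qed.

Definition f0 : Fam1 := fun _ _ => C0.
Definition fsub1 (f g : Fam1) : Fam1 := fadd1 f (fopp1 g).

Lemma bd_f0 N : bd N f0 0.
Proof. intros j k _ _ x; unfold f0; rewrite Cmod_C0; lra. Qed.

Lemma bd_add N f g B B' : bd N f B -> bd N g B' -> bd N (fadd1 f g) (B + B').
Proof.
  intros H H' j k Hj Hk x; specialize (H j k Hj Hk x); specialize (H' j k Hj Hk x).
  unfold fadd1; generalize (Cmod_add (f k x) (g k x)) (pow_le (Rabs x) j (Rabs_pos x)); intros; nra.
Qed.

Lemma bd_opp N f B : bd N f B -> bd N (fopp1 f) B.
Proof. intros H j k Hj Hk x; unfold fopp1; rewrite Cmod_opp; auto. Qed.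

Lemma bd_scal N c f B : bd N f B -> bd N (fscal1 c f) (Cmod c * B).
Proof.
  intros H j k Hj Hk x; unfold fscal1; rewrite Cmod_mul.
  replace (Rabs x ^ j * (Cmod c * Cmod (f k x))) with (Cmod c * (Rabs x ^ j * Cmod (f k x))) by ring.
  apply Rmult_le_compat_l; [apply Cmod_pos | auto].
Qed.

Lemma bd_zero N f : (forall eps, 0 < eps -> bd N f eps) -> forall k x, (k <= N)%nat -> f k x = C0.
Proof.
  intros H k x Hk; apply Cmod_eq0, Rle_antisym; [| apply Cmod_pos].
  apply le_epsilon; intros eps He; rewrite Rplus_0_l.
  generalize (H eps He O k ltac:(lia) Hk x); simpl; lra.
Qed.

Lemma Schwartz_f0 : Schwartz1 f0.
Proof. apply Schwartz_intro; [intros; apply dCat_const | intros N; exists 0; apply bd_f0]. Qed.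

Lemma Schwartz_add f g : Schwartz1 f -> Schwartz1 g -> Schwartz1 (fadd1 f g).
Proof.
  intros Hf Hg; apply Schwartz_intro.
  - intros k x; apply dCat_add; now apply Schwartz_dCat.
  - intros N; destruct (Schwartz_bd f N Hf) as [B H]; destruct (Schwartz_bd g N Hg) as [B' H'].
    exists (B + B'); now apply bd_add.
Qed.

Lemma Schwartz_scal c f : Schwartz1 f -> Schwartz1 (fscal1 c f).
Proof.
  intros Hf; apply Schwartz_intro.
  - intros k x; apply dCat_cmul; now apply Schwartz_dCat.
  - intros N; destruct (Schwartz_bd f N Hf) as [B H]; eexists; apply bd_scal, H.
Qed.

Lemma fopp1_scal f : fopp1 f = fscal1 (Copp C1) f.
Proof. apply fam_ext; intros; unfold fopp1, fscal1; ring. Qed.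

Lemma Schwartz_opp f : Schwartz1 f -> Schwartz1 (fopp1 f).
Proof. rewrite fopp1_scal; apply Schwartz_scal. Qed.

Lemma Schwartz_sub f g : Schwartz1 f -> Schwartz1 g -> Schwartz1 (fsub1 f g).
Proof. intros; apply Schwartz_add; auto; now apply Schwartz_opp. Qed.

Record SLin (T : Fam1 -> Fam1) : Prop := {
  SL_S : forall f, Schwartz1 f -> Schwartz1 (T f);
  SL_add : forall f g, Schwartz1 f -> Schwartz1 g -> T (fadd1 f g) = fadd1 (T f) (T g);
  SL_scal : forall c f, Schwartz1 f -> T (fscal1 c f) = fscal1 c (T f);
  SL_bd : forall N, exists (N' : nat) (C : R), 0 <= C /\
    forall f B, Schwartz1 f -> bd N' f B -> bd N (T f) (C * B) }.

Lemma SL_opp T f : SLin T -> Schwartz1 f -> T (fopp1 f) = fopp1 (T f).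
Proof. intros HT Hf; rewrite !fopp1_scal; now apply SL_scal. Qed.

Lemma SL_sub T f g : SLin T -> Schwartz1 f -> Schwartz1 g -> T (fsub1 f g) = fsub1 (T f) (T g).
Proof. intros HT Hf Hg; unfold fsub1; rewrite SL_add, SL_opp; auto using Schwartz_opp. Qed.

Lemma SL_0 T : SLin T -> T f0 = f0.
Proof.
  intros HT; replace f0 with (fscal1 C0 f0) by (apply fam_ext; intros; unfold fscal1, f0; ring).
  rewrite SL_scal; auto using Schwartz_f0. apply fam_ext; intros; unfold fscal1, f0; ring.
Qed.

Lemma SLin_id : SLin (fun f => f).
Proof.
  split; auto. intros N; exists N, 1; split; [lra |]; intros f B _ H; now rewrite Rmult_1_l.
Qed.

Lemma SLin_comp T U : SLin T -> SLin U -> SLin (fun f => T (U f)).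
Proof.
  intros HT HU; split.
  - intros; now apply SL_S, SL_S.
  - intros f g Hf Hg; rewrite (SL_add U HU), (SL_add T HT); auto; now apply SL_S.
  - intros c f Hf; rewrite (SL_scal U HU), (SL_scal T HT); auto; now apply SL_S.
  - intros N; destruct (SL_bd T HT N) as [N1 [C1 [H1 B1]]]; destruct (SL_bd U HU N1) as [N2 [C2 [H2 B2]]].
    exists N2, (C1 * C2); split; [now apply Rmult_le_pos |]; intros f B Hf HB.
    rewrite Rmult_assoc; apply B1; [now apply SL_S | auto].
Qed.

Lemma SLin_iter k T : SLin T -> SLin (Nat.iter k T).
Proof.
  intros H; induction k as [|k IH]; [apply SLin_id |]. exact (SLin_comp T (Nat.iter k T) H IH).
Qed.

Lemma SLin_zero : SLin (fun _ => f0).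
Proof.
  split.
  - intros; apply Schwartz_f0.
  - intros; apply fam_ext; intros; unfold fadd1, f0; ring.
  - intros; apply fam_ext; intros; unfold fscal1, f0; ring.
  - intros N; exists O, 0; split; [lra |]; intros f B _ _; rewrite Rmult_0_l; apply bd_f0.
Qed.

Lemma SLin_add T U : SLin T -> SLin U -> SLin (fun f => fadd1 (T f) (U f)).
Proof.
  intros HT HU; split.
  - intros; apply Schwartz_add; now apply SL_S.
  - intros f g Hf Hg; rewrite (SL_add U HU), (SL_add T HT); auto. apply fam_ext; intros; unfold fadd1; ring.
  - intros c f Hf; rewrite (SL_scal U HU), (SL_scal T HT); auto. apply fam_ext; intros; unfold fadd1, fscal1; ring.
  - intros N; destruct (SL_bd T HT N) as [N1 [C1 [H1 B1]]]; destruct (SL_bd U HU N) as [N2 [C2 [H2 B2]]].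
    exists (max N1 N2), (C1 + C2); split; [lra |]; intros f B Hf HB.
    rewrite Rmult_plus_distr_r; apply bd_add; [apply B1 | apply B2]; auto.
    + apply bd_mono with (max N1 N2) B; auto; [lia | lra].
    + apply bd_mono with (max N1 N2) B; auto; [lia | lra].
Qed.

Lemma SLin_scal c : SLin (fscal1 c).
Proof.
  split.
  - intros; now apply Schwartz_scal.
  - intros; apply fam_ext; intros; unfold fscal1, fadd1; ring.
  - intros; apply fam_ext; intros; unfold fscal1; ring.
  - intros N; exists N, (Cmod c); split; [apply Cmod_pos |]; intros f B _ H; now apply bd_scal.
Qed.

Lemma SLin_ext T U : (forall f, T f = U f) -> SLin T -> SLin U.
Proof. intros H; replace U with T; auto; now apply functional_extensionality. Qed.

Lemma SLin_D : SLin fD1.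
Proof.
  assert (HB : forall N f B, bd (S N) f B -> bd N (fD1 f) (1 * B)).
  { intros N f B H j k Hj Hk x; unfold fD1; rewrite Cmod_mul, Cmod_opp, Cmod_Ci, !Rmult_1_l. apply H; lia. }
  split.
  - intros f Hf; apply Schwartz_intro.
    + intros k x; apply dCat_cmul; now apply Schwartz_dCat.
    + intros N; destruct (Schwartz_bd f (S N) Hf) as [B H]; eexists; apply HB, H.
  - intros; apply fam_ext; intros; unfold fD1, fadd1; ring.
  - intros; apply fam_ext; intros; unfold fD1, fscal1; ring.
  - intros N; exists (S N), 1; split; [lra |]; intros f B _; apply HB.
Qed.

Lemma SLin_M : SLin fM1.
Proof.
  assert (HB : forall N f B, bd (S N) f B -> bd N (fM1 f) ((1 + INR N) * B)).
  { intros N f B H j k Hj Hk x; unfold fM1.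
    assert (A1 := H (S j) k ltac:(lia) ltac:(lia) x). assert (A2 := H j (pred k) ltac:(lia) ltac:(lia) x).
    assert (A3 : INR k <= INR N) by now apply le_INR.
    generalize (Cmod_add (Cscal x (f k x)) (Cscal (INR k) (f (pred k) x))) (pow_le (Rabs x) j (Rabs_pos x)) (pos_INR k)
      (bd_pos _ _ _ H).
    rewrite !Cmod_scal, (Rabs_pos_eq (INR k)) by apply pos_INR; simpl in A1; intros.
    apply Rle_trans with (Rabs x ^ j * (Rabs x * Cmod (f k x) + INR k * Cmod (f (pred k) x))).
    - now apply Rmult_le_compat_l.
    - assert (INR k * (Rabs x ^ j * Cmod (f (pred k) x)) <= INR N * B).
      { apply Rmult_le_compat; auto. apply Rmult_le_pos; auto using Cmod_pos. }
      lra. }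
  split.
  - intros f Hf; apply Schwartz_intro.
    + intros k x; unfold fM1.
      assert (D1 : dCat (fun t => Cscal t (f k t)) x (Cadd (f k x) (Cscal x (f (S k) x)))).
      { apply (dCat_ext (fun t => Cmul (RtoC t) (f k t))); [intros; now rewrite Cscal_mul |].
        replace (Cadd (f k x) (Cscal x (f (S k) x))) with (Cadd (Cmul (RtoC 1) (f k x)) (Cmul (RtoC x) (f (S k) x)))
          by (rewrite RtoC_1; cring).
        apply (dCat_mul RtoC); [apply (dCat_RtoC (fun t => t)), @is_derive_id | now apply Schwartz_dCat]. }
      destruct k as [|k].
      * apply (dCat_ext (fun t => Cadd (Cscal t (f O t)) C0)); [intros t; simpl; rewrite Cscal_mul, (Cscal_mul 0), RtoC_0; ring |].
        eapply eq_ind; [apply dCat_add; [apply D1 | apply dCat_const] |].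
        simpl; rewrite !Cscal_mul, RtoC_1; ring.
      * eapply eq_ind; [apply dCat_add; [apply D1 |] |].
        -- apply (dCat_ext (fun t => Cmul (RtoC (INR (S k))) (f k t))); [intros; simpl pred; now rewrite Cscal_mul |].
           apply dCat_cmul, Schwartz_dCat; auto.
        -- simpl pred; rewrite (S_INR (S k)); cring.
    + intros N; destruct (Schwartz_bd f (S N) Hf) as [B H]; eexists; apply HB, H.
  - intros; apply fam_ext; intros; unfold fM1, fadd1; cring.
  - intros; apply fam_ext; intros; unfold fM1, fscal1; cring.
  - intros N; exists (S N), (1 + INR N); split; [generalize (pos_INR N); lra |]; intros f B _; apply HB.
Qed.

(** [dD1 u f] is [u (oD f)]: this is [i d/dx], the transpose of [D]. *)
Definition oD (f : Fam1) : Fam1 := fopp1 (fD1 f).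

Lemma SLin_oD : SLin oD.
Proof.
  apply (SLin_ext (fun f => fscal1 (Copp C1) (fD1 f))).
  - intros f; unfold oD; now rewrite fopp1_scal.
  - apply (SLin_comp (fscal1 (Copp C1)) fD1); [apply SLin_scal | apply SLin_D].
Qed.

Definition fsum (n : nat) (F : nat -> Fam1) : Fam1 := fun k x => Csum n (fun i => F i k x).

Lemma SLin_sum n (T : nat -> Fam1 -> Fam1) : (forall i, (i < n)%nat -> SLin (T i)) -> SLin (fun f => fsum n (fun i => T i f)).
Proof.
  induction n as [|n IH]; intros H.
  - apply (SLin_ext (fun _ => f0)); [auto | apply SLin_zero].
  - apply (SLin_ext (fun f => fadd1 (fsum n (fun i => T i f)) (T n f))); [auto |].
    apply SLin_add; auto.
Qed.

(** The pointwise limits of all derivatives again form a family of derivatives, because the Taylor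
    remainder of [u i] is bounded uniformly in [i] and the bound passes to the limit. *)
Lemma Schwartz_complete (u : nat -> Fam1) : (forall n, Schwartz1 (u n)) ->
  (forall N eps, 0 < eps -> exists J, forall i j, (J <= i)%nat -> (J <= j)%nat -> bd N (fsub1 (u i) (u j)) eps) ->
  exists f, Schwartz1 f /\ forall N eps, 0 < eps -> exists J, forall j, (J <= j)%nat -> bd N (fsub1 f (u j)) eps.
Proof.
  intros HS HC.
  assert (L : forall k x, exists l, is_lim_seq (fun n => fst (u n k x)) (Finite (fst l)) /\
                                    is_lim_seq (fun n => snd (u n k x)) (Finite (snd l))).
  { intros k x.
    assert (Q : forall (pr : Cx -> R), (forall z w, Rabs (pr z - pr w) <= Cmod (Csub z w)) ->
       exists l : R, is_lim_seq (fun n => pr (u n k x)) (Finite l)).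
    { intros pr Hpr. destruct (proj2 (ex_lim_seq_cauchy_corr (fun n => pr (u n k x)))) as [l Hl]; [| now exists l].
      intros eps. destruct (HC k (eps / 2)) as [J HJ]; [destruct eps; simpl; lra |].
      exists J; intros i j Hi Hj. eapply Rle_lt_trans; [apply Hpr |].
      generalize (HJ i j Hi Hj O k ltac:(lia) ltac:(lia) x); unfold fsub1, fadd1, fopp1, Csub; simpl.
      destruct eps as [eps He]; simpl; lra. }
    destruct (Q fst) as [l1 H1].
    { intros z w; eapply Rle_trans; [| apply fst_le_Cmod]; simpl; apply Req_le; f_equal; ring. }
    destruct (Q snd) as [l2 H2].
    { intros z w; eapply Rle_trans; [| apply snd_le_Cmod]; simpl; apply Req_le; f_equal; ring. }
    exists (l1, l2); auto. }
  destruct (choose_fun (fun (p : nat * R) l => is_lim_seq (fun n => fst (u n (fst p) (snd p))) (Finite (fst l)) /\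
                                    is_lim_seq (fun n => snd (u n (fst p) (snd p))) (Finite (snd l)))) as [g Hg].
  { intros [k x]; apply L. }
  set (f := (fun k x => g (k, x)) : Fam1).
  assert (Hconv : forall k x eps, 0 < eps -> exists J, forall j, (J <= j)%nat -> Cmod (Csub (f k x) (u j k x)) <= eps).
  { intros k x eps He; destruct (Hg (k, x)) as [A B]; simpl in A, B.
    apply is_lim_seq_spec in A; apply is_lim_seq_spec in B.
    assert (He2 : 0 < eps / 2) by lra.
    destruct (A (mkposreal _ He2)) as [J1 H1]; destruct (B (mkposreal _ He2)) as [J2 H2]; simpl in H1, H2.
    exists (max J1 J2); intros j Hj; specialize (H1 j ltac:(lia)); specialize (H2 j ltac:(lia)).
    eapply Rle_trans; [apply Cmod_le_sum |]; unfold f; simpl.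
    rewrite <- Rabs_Ropp in H1; rewrite <- Rabs_Ropp in H2.
    replace (- (fst (u j k x) - fst (g (k, x)))) with (fst (g (k, x)) + - fst (u j k x)) in H1 by ring.
    replace (- (snd (u j k x) - snd (g (k, x)))) with (snd (g (k, x)) + - snd (u j k x)) in H2 by ring. lra. }
  assert (Hlim : forall N eps, 0 < eps -> exists J, forall j, (J <= j)%nat -> bd N (fsub1 f (u j)) eps).
  { intros N eps He; destruct (HC N (eps / 2)) as [J HJ]; [lra |].
    exists J; intros j Hj a k Ha Hk x.
    assert (P : 0 < Rabs x ^ a + 1) by (generalize (pow_le (Rabs x) a (Rabs_pos x)); lra).
    destruct (Hconv k x (eps / 2 / (Rabs x ^ a + 1))) as [J' HJ']; [apply Rdiv_lt_0_compat; lra |].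
    set (i := max J J'). specialize (HJ' i ltac:(lia)).
    specialize (HJ i j ltac:(lia) Hj a k Ha Hk x).
    unfold fsub1, fadd1, fopp1 in *; fold (Csub (f k x) (u j k x)); fold (Csub (u i k x) (u j k x)) in HJ.
    assert (T : Cmod (Csub (f k x) (u j k x)) <= Cmod (Csub (f k x) (u i k x)) + Cmod (Csub (u i k x) (u j k x))).
    { replace (Csub (f k x) (u j k x)) with (Cadd (Csub (f k x) (u i k x)) (Csub (u i k x) (u j k x))) by ring.
      apply Cmod_add. }
    apply Rle_div_r in HJ'; auto.
    generalize (pow_le (Rabs x) a (Rabs_pos x)) (Cmod_pos (Csub (f k x) (u i k x))); intros.
    apply Rle_trans with (Rabs x ^ a * (Cmod (Csub (f k x) (u i k x)) + Cmod (Csub (u i k x) (u j k x)))).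
    - apply Rmult_le_compat_l; auto.
    - nra. }
  assert (HB : forall N, exists B, (exists J, forall i, (J <= i)%nat -> bd N (u i) B) /\ bd N f B).
  { intros N; destruct (Hlim N 1) as [J HJ]; [lra |].
    destruct (Schwartz_bd (u J) N (HS J)) as [B HBJ].
    assert (K : bd N f (1 + B)).
    { replace f with (fadd1 (fsub1 f (u J)) (u J)) by (apply fam_ext; intros; unfold fsub1, fadd1, fopp1; ring).
      apply bd_add; auto. }
    exists (1 + (1 + B)); split; [| apply bd_mono with N (1 + B); auto; lra].
    exists J; intros i Hi.
    replace (u i) with (fadd1 (fopp1 (fsub1 f (u i))) f) by (apply fam_ext; intros; unfold fsub1, fadd1, fopp1; ring).
    apply bd_add; auto. now apply bd_opp, HJ. }
  exists f; split; auto.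
  apply Schwartz_intro; [| intros N; destruct (HB N) as [B [_ H]]; now exists B].
  intros k x.
  destruct (HB (S (S k))) as [B [HBu _]]; destruct HBu as [J HJ].
  apply dCat_quad with (2 * B); intros y Hy.
  apply le_epsilon; intros eps He.
  assert (He3 : 0 < eps / 3) by lra.
  destruct (Hconv k y _ He3) as [J1 H1]; destruct (Hconv k x _ He3) as [J2 H2]; destruct (Hconv (S k) x _ He3) as [J3 H3].
  set (i := max J (max J1 (max J2 J3))).
  specialize (H1 i ltac:(lia)); specialize (H2 i ltac:(lia)); specialize (H3 i ltac:(lia)); specialize (HJ i ltac:(lia)).
  assert (T : Cmod (Csub (Csub (u i k y) (u i k x)) (Cscal (y - x) (u i (S k) x))) <= 2 * B * (y - x) ^ 2).
  { apply taylor_C with (f' := u i (S k)) (f'' := u i (S (S k))); intros t _; try (now apply Schwartz_dCat).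
    generalize (HJ O (S (S k)) ltac:(lia) ltac:(lia) t); simpl; lra. }
  replace (Csub (Csub (f k y) (f k x)) (Cscal (y - x) (f (S k) x))) with
    (Cadd (Csub (Csub (u i k y) (u i k x)) (Cscal (y - x) (u i (S k) x)))
       (Csub (Csub (Csub (f k y) (u i k y)) (Csub (f k x) (u i k x))) (Cscal (y - x) (Csub (f (S k) x) (u i (S k) x)))))
    by cring.
  eapply Rle_trans; [apply Cmod_add |]; apply Rplus_le_compat; auto.
  eapply Rle_trans; [apply Cmod_sub |]; rewrite Cmod_scal.
  generalize (Cmod_sub (Csub (f k y) (u i k y)) (Csub (f k x) (u i k x))) (Cmod_pos (Csub (f (S k) x) (u i (S k) x)))
    (Rabs_pos (y - x)); nra.
Qed.

(** * From half-line estimates to differential operators *)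

Definition Lp (m : nat) (p : nat -> R -> Cx) (f : Fam1) (x : R) : Cx :=
  Csum (S m) (fun k => Cmul (p k x) (f k x)).

Lemma exp_INR (n : nat) s : exp (INR n * s) = exp s ^ n.
Proof. rewrite <- Rpower_pow by apply exp_pos; unfold Rpower; now rewrite ln_exp. Qed.

(** [x^j f^(j)(x)] at [x = e^s]; on these functions [d/ds] acts as multiplication by [j] plus a step
    from [j] to [j + 1]. *)
Definition logw (f : Fam1) (j : nat) (s : R) : Cx := Cscal (exp (INR j * s)) (f j (exp s)).

Lemma logw_deriv f j s : Schwartz1 f ->
  dCat (logw f j) s (Cadd (Cmul (RtoC (INR j)) (logw f j s)) (logw f (S j) s)).
Proof.
  intros Hf; unfold logw.
  assert (D1 : is_derive (fun s => exp (INR j * s)) s (INR j * exp (INR j * s))) by (auto_derive; [trivial | ring]).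
  assert (D2 : is_derive exp s (exp s)) by (auto_derive; [trivial | ring]).
  generalize (dCat_mul _ _ _ _ _ (dCat_RtoC _ _ _ D1) (dCat_comp (f j) exp s _ _ (Schwartz_dCat f j (exp s) Hf) D2)).
  intros H; apply (dCat_ext _ (fun t => Cscal (exp (INR j * t)) (f j (exp t)))) in H; [| intros; now rewrite Cscal_mul].
  eapply eq_ind; [exact H |].
  rewrite S_INR, Rmult_plus_distr_r, exp_plus, Rmult_1_l; cring.
Qed.

Lemma logw_decay f j (n : nat) : Schwartz1 f -> exists M, forall s, 0 <= s -> exp (INR n * s) * Cmod (logw f j s) <= M.
Proof.
  intros Hf; destruct (proj2 Hf (n + j)%nat j) as [M HM]; exists M; intros s Hs.
  specialize (HM (exp s)); rewrite Rabs_pos_eq in HM by (left; apply exp_pos).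
  unfold logw; rewrite Cmod_scal, !exp_INR, Rabs_pos_eq by (apply pow_le; left; apply exp_pos).
  rewrite pow_add in HM; lra.
Qed.

(** The coefficients are the Stirling numbers of the second kind, which expand [(x d/dx)^k] in the
    operators [x^j d^j/dx^j]. *)
Lemma logw_stirling k : exists c : nat -> Cx, forall f, Schwartz1 f -> forall s,
  Nat.iter k dd (logw f O) s = Csum (S k) (fun j => Cmul (c j) (logw f j s)).
Proof.
  induction k as [|k [c IH]].
  - exists (fun _ => C1); intros f Hf s; simpl; ring.
  - exists (fun j => Cadd (if le_dec j k then Cmul (RtoC (INR j)) (c j) else C0) (match j with O => C0 | S i => c i end)).
    intros f Hf s; simpl Nat.iter.
    transitivity (Csum (S k) (fun j => Cadd (Cmul (Cmul (RtoC (INR j)) (c j)) (logw f j s)) (Cmul (c j) (logw f (S j) s)))).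
    + apply dd_eq. apply (dCat_ext (fun t => Csum (S k) (fun j => Cmul (c j) (logw f j t)))); [intros; now rewrite IH |].
      rewrite (Csum_ext _ _ (fun j => Cmul (c j) (Cadd (Cmul (RtoC (INR j)) (logw f j s)) (logw f (S j) s)))) by (intros; ring).
      apply (dCat_Csum (S k) (fun j t => Cmul (c j) (logw f j t))); intros j _; apply dCat_cmul; now apply logw_deriv.
    + rewrite Csum_add.
      rewrite (Csum_ext (S (S k)) _ (fun i => Cadd (Cmul (if le_dec i k then Cmul (RtoC (INR i)) (c i) else C0) (logw f i s))
            (Cmul (match i with O => C0 | S i' => c i' end) (logw f i s)))) by (intros; ring).
      rewrite Csum_add; f_equal.
      * rewrite (Csum_widen (S k) (S (S k))); [| lia |].
        -- apply Csum_ext; intros i Hi; destruct (le_dec i k); [auto | lia].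
        -- intros i Hi; destruct (le_dec i k); [lia | ring].
      * rewrite (Csum_first (S k)); ring_simplify; auto.
Qed.

Lemma logw_rapid f : Schwartz1 f -> rapid (logw f O).
Proof.
  intros Hf k; destruct (logw_stirling k) as [c Hc]; specialize (Hc f Hf).
  assert (E : Nat.iter k dd (logw f O) = fun s => Csum (S k) (fun j => Cmul (c j) (logw f j s)))
    by (apply functional_extensionality; auto).
  split.
  - change (Nat.iter (S k) dd (logw f O)) with (dd (Nat.iter k dd (logw f O))); rewrite E; intros s.
    assert (D : dCat (fun s => Csum (S k) (fun j => Cmul (c j) (logw f j s))) s
      (Csum (S k) (fun j => Cmul (c j) (Cadd (Cmul (RtoC (INR j)) (logw f j s)) (logw f (S j) s))))).
    { apply (dCat_Csum (S k) (fun j t => Cmul (c j) (logw f j t))); intros j _; apply dCat_cmul; now apply logw_deriv. }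
    now rewrite (dd_eq _ _ _ D).
  - intros n; rewrite E; clear E Hc.
    assert (G : forall K, exists M, forall s, 0 <= s -> exp (INR n * s) * Cmod (Csum K (fun j => Cmul (c j) (logw f j s))) <= M).
    { induction K as [|K [M HM]]; [exists 0; intros; simpl; rewrite Cmod_C0; lra |].
      destruct (logw_decay f K n Hf) as [M' HM']; exists (M + Cmod (c K) * M'); intros s Hs.
      specialize (HM s Hs); specialize (HM' s Hs); simpl.
      generalize (Cmod_add (Csum K (fun j => Cmul (c j) (logw f j s))) (Cmul (c K) (logw f K s))).
      rewrite Cmod_mul; generalize (exp_pos (INR n * s)) (Cmod_pos (c K)); intros.
      assert (Cmod (c K) * (exp (INR n * s) * Cmod (logw f K s)) <= Cmod (c K) * M') by now apply Rmult_le_compat_l.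
      apply Rle_trans with (exp (INR n * s) * (Cmod (Csum K (fun j => Cmul (c j) (logw f j s))) + Cmod (c K) * Cmod (logw f K s))).
      - apply Rmult_le_compat_l; lra.
      - lra. }
    apply G.
Qed.

(** Signed Stirling numbers of the first kind: [x^j d^j/dx^j] is the product of the factors
    [theta - i] over [i < j], where [theta = x d/dx]. *)
Fixpoint tst (j k : nat) : Cx :=
  match j with
  | O => match k with O => C1 | _ => C0 end
  | S j' => Csub (match k with O => C0 | S k' => tst j' k' end) (Cmul (RtoC (INR j')) (tst j' k))
  end.

Lemma tst_zero j k : (j < k)%nat -> tst j k = C0.
Proof.
  revert k; induction j as [|j IH]; intros k H; destruct k; try lia; auto; simpl.
  rewrite !IH by lia; ring.
Qed.

Lemma tst_diag j : tst j j = C1.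
Proof. induction j as [|j IH]; simpl; auto; rewrite IH, tst_zero by lia; ring. Qed.

Lemma logw_tst f j N s : Schwartz1 f -> (j <= N)%nat ->
  logw f j s = Csum (S N) (fun k => Cmul (tst j k) (Nat.iter k dd (logw f O) s)).
Proof.
  intros Hf; revert s; induction j as [|j IH]; intros s Hj.
  - rewrite Csum_first, Csum_0; [simpl; ring | intros; simpl; ring].
  - assert (E : logw f (S j) s = Csub (dd (logw f j) s) (Cmul (RtoC (INR j)) (logw f j s))).
    { rewrite (dd_eq _ _ _ (logw_deriv f j s Hf)); ring. }
    assert (D : dd (logw f j) s = Csum (S N) (fun k => Cmul (tst j k) (Nat.iter (S k) dd (logw f O) s))).
    { apply dd_eq.
      apply (dCat_ext (fun t => Csum (S N) (fun k => Cmul (tst j k) (Nat.iter k dd (logw f O) t)))); [intros; rewrite <- IH; auto; lia |].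
      apply (dCat_Csum (S N) (fun k t => Cmul (tst j k) (Nat.iter k dd (logw f O) t))); intros k _.
      apply dCat_cmul, (logw_rapid f Hf k). }
    rewrite E, D, IH by lia.
    set (w := fun k => Nat.iter k dd (logw f O) s).
    change (Csub (Csum (S N) (fun k => Cmul (tst j k) (w (S k)))) (Cmul (RtoC (INR j)) (Csum (S N) (fun k => Cmul (tst j k) (w k))))
      = Csum (S N) (fun k => Cmul (tst (S j) k) (w k))).
    rewrite (Csum_ext (S N) (fun k => Cmul (tst (S j) k) (w k)) (fun k => Cadd (Cmul (match k with O => C0 | S k' => tst j k' end) (w k))
      (Cmul (Copp (RtoC (INR j))) (Cmul (tst j k) (w k))))) by (intros; simpl; ring).
    rewrite Csum_add, <- Csum_mul.
    rewrite (Csum_first N (fun k => Cmul (match k with O => C0 | S k' => tst j k' end) (w k))).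
    change (Csum (S N) (fun k => Cmul (tst j k) (w (S k)))) with
      (Cadd (Csum N (fun k => Cmul (tst j k) (w (S k)))) (Cmul (tst j N) (w (S N)))).
    rewrite (tst_zero j N) by lia. ring.
Qed.

Lemma peval_exp_exp_poly l : exp_poly (fun s => peval l (exp s)).
Proof.
  induction l as [|a l IH]; simpl; [apply exp_poly_const |].
  apply exp_poly_add; [apply exp_poly_const | apply exp_poly_mul; auto].
  apply (lead_exp_poly 1 _ C1). apply (lead_ext _ (fun s => Cmul C1 (RtoC (exp (IZR 1 * s))))); [| apply lead_exp].
  intros s; rewrite Rmult_1_l; ring.
Qed.

(** Multiplied by [x^m] and written in [theta = d/ds], the operator has coefficients polynomial in
    [e^s] and still the constant top coefficient [l], so [a_priori_all] applies with [h = 0]. *)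
Lemma half_line m p l : (forall k, (k <= m)%nat -> ispoly (p k)) -> l <> C0 -> (forall x, p m x = l) ->
  forall N, exists (N' : nat) X C, 1 <= X /\ 0 <= C /\ forall f B, Schwartz1 f ->
    (forall x, X <= x -> x ^ N' * Cmod (Lp m p f x) <= B) ->
    (forall j, (j < m)%nat -> Cmod (f j X) <= B) ->
    forall j, (j < m)%nat -> forall x, X <= x -> x ^ N * Cmod (f j x) <= C * B.
Proof.
  intros Hp Hl Hm N.
  set (a := fun k s => Csum (S m) (fun j => Cmul (Cmul (p j (exp s)) (RtoC (exp (IZR (Z.of_nat m - Z.of_nat j) * s)))) (tst j k))).
  assert (Hreg : regular_op m a).
  { split.
    - intros k _; apply exp_poly_Csum; intros j Hj; apply exp_poly_mul; [apply exp_poly_mul | apply exp_poly_const].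
      + destruct (Hp j ltac:(lia)) as [q Hq]; destruct (peval_exp_exp_poly q) as [d [c Hd]]; exists d, c.
        eapply lead_ext; [| apply Hd]; intros; now rewrite Hq.
      + eapply lead_exp_poly. apply (lead_ext _ (fun s => Cmul C1 (RtoC (exp (IZR (Z.of_nat m - Z.of_nat j) * s))))); [| apply lead_exp].
        intros; ring.
    - exists l; split; auto; intros s; unfold a.
      rewrite (Csum_single _ m); [| lia | intros; rewrite tst_zero by lia; ring].
      rewrite tst_diag, Hm, Z.sub_diag, Rmult_0_l, exp_0, RtoC_1; ring. }
  assert (EPS : forall f s, Schwartz1 f -> PS m a (fun _ => C0) (logw f O) s = Cmul (RtoC (exp (INR m * s))) (Lp m p f (exp s))).
  { intros f s Hf.
    assert (EO : forall k, Nat.iter k (Op (fun _ => C0)) (logw f O) = Nat.iter k dd (logw f O)).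
    { induction k as [|k IH]; simpl; auto; rewrite IH. apply functional_extensionality; intros t; unfold Op; ring. }
    unfold PS, Lp, a; rewrite Csum_mul.
    rewrite (Csum_ext (S m) _ (fun k => Csum (S m) (fun j => Cmul (Cmul (Cmul (p j (exp s)) (RtoC (exp (IZR (Z.of_nat m - Z.of_nat j) * s)))) (tst j k))
       (Nat.iter k dd (logw f O) s)))).
    - rewrite Csum_swap; apply Csum_ext; intros j Hj.
      rewrite (Csum_ext _ _ (fun k => Cmul (Cmul (p j (exp s)) (RtoC (exp (IZR (Z.of_nat m - Z.of_nat j) * s)))) (Cmul (tst j k)
       (Nat.iter k dd (logw f O) s)))) by (intros; ring).
      rewrite <- Csum_mul, <- logw_tst by (auto; lia).
      replace (exp (INR m * s)) with (exp (IZR (Z.of_nat m - Z.of_nat j) * s) * exp (INR j * s)).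
      + unfold logw; cring.
      + rewrite <- exp_plus; f_equal; rewrite minus_IZR, <- !INR_IZR_INZ; ring.
    - intros k _; rewrite EO. set (W := Nat.iter _ _ _ _).
      replace (Cmul (Csum (S m) (fun j => Cmul (Cmul (p j (exp s)) (RtoC (exp (IZR (Z.of_nat m - Z.of_nat j) * s)))) (tst j k))) W) with
       (Cmul W (Csum (S m) (fun j => Cmul (Cmul (p j (exp s)) (RtoC (exp (IZR (Z.of_nat m - Z.of_nat j) * s)))) (tst j k)))) by ring.
      rewrite Csum_mul; apply Csum_ext; intros; ring. }
  destruct (a_priori_all m a Hreg (fun _ => C0) (exp_poly_const C0)) as [lo [n0 H1]].
  (* The rate exceeds the wanted weight [N] by the loss [lo] of the derivatives. *)
  set (n := max n0 (N + lo)).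
  destruct (H1 n ltac:(lia)) as [C [R0 [HC [HR0 H2]]]].
  destruct (H2 R0 (Rle_refl _)) as [Cb [HCb H3]].
  assert (HD : forall M, exists D, 0 <= D /\ forall f B, Schwartz1 f -> 0 <= B -> (forall j, (j < M)%nat -> Cmod (f j (exp R0)) <= B) ->
     forall k, (k < M)%nat -> Cmod (Nat.iter k dd (logw f O) R0) <= D * B).
  { induction M as [|M [D [HD0 HD]]]; [exists 0; split; [lra | intros; lia] |].
    destruct (logw_stirling M) as [c Hc].
    assert (HG : exists G, 0 <= G /\ forall j, (j <= M)%nat -> Cmod (c j) * exp (INR j * R0) <= G).
    { clear; induction M as [|M [G [HG0 HG]]].
      - exists (Cmod (c O) * exp (INR 0 * R0)); split; [apply Rmult_le_pos; [apply Cmod_pos | left; apply exp_pos] |].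
        intros j Hj; replace j with O by lia; lra.
      - exists (G + Cmod (c (S M)) * exp (INR (S M) * R0)).
        assert (0 <= Cmod (c (S M)) * exp (INR (S M) * R0)) by (apply Rmult_le_pos; [apply Cmod_pos | left; apply exp_pos]).
        split; [lra |]; intros j Hj; destruct (Nat.eq_dec j (S M)) as [->|]; [lra | specialize (HG j ltac:(lia)); lra]. }
    destruct HG as [G [HG0 HG]].
    exists (D + INR (S M) * G); split; [generalize (pos_INR (S M)); nra |].
    intros f B Hf HB H k Hk.
    assert (0 <= INR (S M) * G) by (generalize (pos_INR (S M)); nra).
    destruct (Nat.eq_dec k M) as [->|].
    - rewrite Hc by auto. apply Rle_trans with (INR (S M) * (G * B)).
      + apply Cmod_Csum_le; [nra |]; intros j Hj; unfold logw.
        rewrite Cmod_mul, Cmod_scal, Rabs_pos_eq by (left; apply exp_pos).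
        rewrite <- Rmult_assoc; apply Rmult_le_compat; auto using Cmod_pos.
        * apply Rmult_le_pos; [apply Cmod_pos | left; apply exp_pos].
        * apply HG; lia.
      + nra.
    - eapply Rle_trans; [apply (HD f B Hf HB); [intros; apply H; lia | lia] | nra]. }
  destruct (HD m) as [D [HD0 HDm]].
  assert (HT : forall j, exists T, 0 <= T /\ forall i k, (i <= j)%nat -> Cmod (tst i k) <= T).
  { assert (HT1 : forall i K, exists T, 0 <= T /\ forall k, (k <= K)%nat -> Cmod (tst i k) <= T).
    { intros i; induction K as [|K [T [HT0 HT]]].
      - exists (Cmod (tst i O)); split; [apply Cmod_pos |]; intros k Hk; replace k with O by lia; lra.
      - exists (T + Cmod (tst i (S K))); generalize (Cmod_pos (tst i (S K))); intros; split; [lra |].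
        intros k Hk; destruct (Nat.eq_dec k (S K)) as [->|]; [lra | specialize (HT k ltac:(lia)); lra]. }
    induction j as [|j [T [HT0 HT]]].
    - destruct (HT1 O O) as [T [HT0 HT]]; exists T; split; auto; intros i k Hi; replace i with O by lia.
      destruct k; [apply HT; lia | rewrite tst_zero, Cmod_C0 by lia; auto].
    - destruct (HT1 (S j) (S j)) as [T' [HT0' HT']]; exists (T + T'); split; [lra |]; intros i k Hi.
      destruct (le_dec k i).
      + destruct (Nat.eq_dec i (S j)) as [->|]; [specialize (HT' k ltac:(lia)); lra | specialize (HT i k ltac:(lia)); lra].
      + rewrite tst_zero, Cmod_C0 by lia; lra. }
  destruct (HT m) as [T [HT0 HTm]].
  (* The additional [m] pays for the factor [x^m] in [EPS]. *)
  exists (n + m)%nat, (exp R0), (INR (S m) * (T * (Cb * (1 + D)))).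
  assert (HX : 1 <= exp R0) by (rewrite <- exp_0; now apply exp_le).
  split; auto; split.
  { apply Rmult_le_pos; [apply pos_INR |]. apply Rmult_le_pos; auto; nra. }
  intros f B Hf HB Hdat j Hj x Hx.
  assert (HB0 : 0 <= B).
  { eapply Rle_trans; [| apply (HB x Hx)]; apply Rmult_le_pos; [apply pow_le; lra | apply Cmod_pos]. }
  destruct (H3 (logw f O) B (D * B) (logw_rapid f Hf)) as [_ H4].
  - nra.
  - intros s Hs; rewrite EPS, Cmod_mul, Cmod_RtoC, Rabs_pos_eq, !exp_INR by (auto; left; apply exp_pos).
    rewrite <- Rmult_assoc, <- pow_add; apply HB; now apply exp_le.
  - now apply HDm.
  - set (s := ln x).
    assert (Ex : exp s = x) by (apply exp_ln; lra).
    assert (Hs : R0 <= s).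
    { rewrite <- (ln_exp R0); apply Rcomplements.ln_le; [apply exp_pos | auto]. }
    assert (W : x ^ N * Cmod (logw f j s) <= INR (S m) * (T * (Cb * (1 + D))) * B).
    { rewrite (logw_tst f j m s Hf) by lia.
      rewrite Csum_widen with (n := S j); [| lia | intros; rewrite tst_zero by lia; ring].
      apply Rle_trans with (x ^ N * sum_f_R0 (fun k => T * Cmod (Nat.iter k dd (logw f O) s)) j).
      - apply Rmult_le_compat_l; [apply pow_le; lra |].
        clear -HTm Hj HT0. assert (K : forall i, (i <= j)%nat -> Cmod (Csum (S i) (fun k => Cmul (tst j k) (Nat.iter k dd (logw f O) s))) <=
          sum_f_R0 (fun k => T * Cmod (Nat.iter k dd (logw f O) s)) i).
        { induction i as [|i IH]; intros Hi.
          - simpl. replace (Cadd C0 (Cmul (tst j O) (logw f O s))) with (Cmul (tst j O) (logw f O s)) by ring.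
            rewrite Cmod_mul; apply Rmult_le_compat_r; [apply Cmod_pos | apply HTm; lia].
          - change (Csum (S (S i)) (fun k => Cmul (tst j k) (Nat.iter k dd (logw f O) s))) with
              (Cadd (Csum (S i) (fun k => Cmul (tst j k) (Nat.iter k dd (logw f O) s))) (Cmul (tst j (S i)) (Nat.iter (S i) dd (logw f O) s))).
            simpl sum_f_R0; eapply Rle_trans; [apply Cmod_add |]; apply Rplus_le_compat; [apply IH; lia |].
            rewrite Cmod_mul; apply Rmult_le_compat_r; [apply Cmod_pos | apply HTm; lia]. }
        now apply K.
      - rewrite scal_sum.
        apply Rle_trans with (sum_f_R0 (fun _ => T * (Cb * (B + D * B))) j).
        + apply sum_Rle; intros k Hk.
          specialize (H4 k ltac:(lia) s Hs).
          assert (x ^ N <= exp ((INR n - INR lo) * s)).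
          { rewrite <- Ex, <- exp_INR; apply exp_le, Rmult_le_compat_r; [lra |].
            assert (INR (N + lo) <= INR n) by (apply le_INR; lia). rewrite plus_INR in H; lra. }
          replace (T * Cmod (Nat.iter k dd (logw f O) s) * x ^ N) with (T * (x ^ N * Cmod (Nat.iter k dd (logw f O) s))) by ring.
          apply Rmult_le_compat_l; auto. eapply Rle_trans; [| apply H4].
          apply Rmult_le_compat_r; [apply Cmod_pos | auto].
        + rewrite sum_cte. assert (INR (S j) <= INR (S m)) by (apply le_INR; lia).
          assert (0 <= T * (Cb * (B + D * B))) by (apply Rmult_le_pos; auto; apply Rmult_le_pos; nra).
          replace (INR (S m) * (T * (Cb * (1 + D))) * B) with (T * (Cb * (B + D * B)) * INR (S m)) by ring.
          now apply Rmult_le_compat_l. }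
    eapply Rle_trans; [| apply W]. apply Rmult_le_compat_l; [apply pow_le; lra |].
    unfold logw; rewrite Cmod_scal, exp_INR, Ex, Rabs_pos_eq by (apply pow_le; lra).
    assert (1 <= x ^ j) by (apply pow_R1_Rle; lra). generalize (Cmod_pos (f j x)); nra.
Qed.

(** * Compact intervals and the estimate on the whole line *)

Definition Ccj (z : Cx) : Cx := (fst z, - snd z).

Lemma dCat_conj f x l : dCat f x l -> dCat (fun t => Ccj (f t)) x (Ccj l).
Proof. intros [A B]; split; simpl; auto. apply (derivable_pt_lim_opp _ _ _ B). Qed.

Lemma Cmod_conj z : Cmod (Ccj z) = Cmod z.
Proof. unfold Cmod, Ccj; simpl; f_equal; ring. Qed.

Lemma Cmul_conj z : Cmul z (Ccj z) = RtoC (Cmod z * Cmod z).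
Proof. rewrite Cmod2; unfold Cmul, Ccj, RtoC; apply injective_projections; simpl; ring. Qed.

Lemma ispoly_bound f : ispoly f -> exists M (d : nat), 0 <= M /\ forall t, Cmod (f t) <= M * (1 + Rabs t) ^ d.
Proof.
  intros [l Hl]; revert f Hl; induction l as [|a l IH]; intros f Hl.
  - exists 0, O; split; [lra |]; intros t; rewrite Hl; simpl; rewrite Cmod_C0; lra.
  - destruct (IH (peval l)) as [M [d [HM H]]]; auto.
    exists (Cmod a + M), (S d); split; [generalize (Cmod_pos a); lra |]; intros t; rewrite Hl; simpl.
    eapply Rle_trans; [apply Cmod_add |]; rewrite Cmod_mul, Cmod_RtoC.
    specialize (H t). generalize (Rabs_pos t); intros.
    assert (1 <= (1 + Rabs t) ^ d) by (apply pow_R1_Rle; lra).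
    assert (Rabs t * Cmod (peval l t) <= Rabs t * (M * (1 + Rabs t) ^ d)) by (apply Rmult_le_compat_l; auto).
    set (P := (1 + Rabs t) ^ d) in *. generalize (Cmod_pos a); intros.
    assert (Cmod a * 1 <= Cmod a * ((1 + Rabs t) * P)) by (apply Rmult_le_compat_l; nra).
    assert (0 <= M * P) by nra. nra.
Qed.

Lemma ispoly_neg f : ispoly f -> ispoly (fun t => f (- t)).
Proof.
  intros [l Hl]; revert f Hl; induction l as [|a l IH]; intros f Hl.
  - exists nil; intros t; now rewrite Hl.
  - apply (ispoly_ext (fun t => Cadd a (Cmul (RtoC t) (Cmul (Copp C1) (peval l (- t)))))).
    + intros t; rewrite Hl; simpl; rewrite RtoC_opp; ring.
    + apply ispoly_cons, ispoly_scal, IH; auto.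
Qed.

(** Energy estimate for [E], the sum of [|f^(j)|^2] over [j < m]. The equation expresses [f^(m)] by
    lower derivatives because its top coefficient is a nonzero constant, and this gives
    [|E'| <= K (E + B^2)]. *)
Lemma gronwall m p l X : (forall k, (k <= m)%nat -> ispoly (p k)) -> l <> C0 -> (forall x, p m x = l) -> 0 <= X ->
  exists C, 1 <= C /\ forall f B, Schwartz1 f ->
    (forall x, Rabs x <= X -> Cmod (Lp m p f x) <= B) ->
    (forall j, (j < m)%nat -> Cmod (f j 0) <= B) ->
    forall j, (j < m)%nat -> forall x, Rabs x <= X -> Cmod (f j x) <= C * B.
Proof.
  intros Hp Hl Hm HX.
  assert (HP : exists P, 0 <= P /\ forall k, (k < m)%nat -> forall x, Rabs x <= X -> Cmod (p k x) <= P).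
  { assert (G : forall n, (n <= m)%nat -> exists P, 0 <= P /\ forall k, (k < n)%nat -> forall x, Rabs x <= X -> Cmod (p k x) <= P).
    { induction n as [|n IH]; intros Hn; [exists 0; split; [lra | intros; lia] |].
      destruct (IH ltac:(lia)) as [P [HP0 HP]]; destruct (ispoly_bound (p n) (Hp n ltac:(lia))) as [M [d [HM H]]].
      assert (0 <= M * (1 + X) ^ d) by (apply Rmult_le_pos; auto; apply pow_le; lra).
      exists (P + M * (1 + X) ^ d); split; [lra |]; intros k Hk x Hx.
      destruct (Nat.eq_dec k n) as [->|]; [| specialize (HP k ltac:(lia) x Hx); lra].
      assert (M * (1 + Rabs x) ^ d <= M * (1 + X) ^ d).
      { apply Rmult_le_compat_l; auto; apply pow_incr; generalize (Rabs_pos x); lra. }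
      specialize (H x); lra. }
    apply G; auto. }
  destruct HP as [P [HP0 HP]].
  assert (Hml : 0 < Cmod l) by now apply Cmod_gt0.
  set (L := / Cmod l). assert (HL : 0 < L) by now apply Rinv_0_lt_compat.
  (* Each of the [m] terms of [E'] is at most [2 e (e + L (B + m P e))] with [e = sqrt E]; the
     inequality [2 e B <= E + B^2] turns this into the bracket. *)
  set (K := INR m * (2 + L + 2 * L * (INR m * P))).
  assert (HmP : 0 <= INR m * P) by (apply Rmult_le_pos; auto; apply pos_INR).
  assert (HLP : 0 <= L * (INR m * P)) by nra.
  assert (HK : 0 <= K) by (unfold K; apply Rmult_le_pos; [apply pos_INR | lra]).
  set (C := (INR m + 1) * exp (K * X)).
  assert (HeX : 1 <= exp (K * X)) by (rewrite <- exp_0; apply exp_le; nra).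
  assert (HC : 1 <= C) by (unfold C; generalize (pos_INR m); nra).
  exists C; split; auto. intros f B Hf HB Hd.
  assert (HB0 : 0 <= B).
  { eapply Rle_trans; [apply Cmod_pos | apply (HB 0)]; rewrite Rabs_R0; auto. }
  set (F := fun x => Csum m (fun j => Cmul (f j x) (Ccj (f j x)))).
  set (E := fun x => fst (F x)).
  set (F' := fun x => Csum m (fun j => Cadd (Cmul (f (S j) x) (Ccj (f j x))) (Cmul (f j x) (Ccj (f (S j) x))))).
  assert (DE : forall x, is_derive E x (fst (F' x))).
  { intros x; apply (proj1 (dCat_is F x (F' x))). apply (dCat_Csum m (fun j t => Cmul (f j t) (Ccj (f j t)))); intros j _.
    apply dCat_mul; [| apply dCat_conj]; now apply Schwartz_dCat. }
  assert (EG : forall n, (n <= m)%nat -> forall x, 0 <= fst (Csum n (fun j => Cmul (f j x) (Ccj (f j x)))) /\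
     forall j, (j < n)%nat -> Cmod (f j x) * Cmod (f j x) <= fst (Csum n (fun j => Cmul (f j x) (Ccj (f j x))))).
  { induction n as [|n IH]; intros Hn x; [simpl; split; [lra | intros; lia] |].
    destruct (IH ltac:(lia) x) as [A D]; simpl Csum; rewrite Cmul_conj.
    assert (0 <= Cmod (f n x) * Cmod (f n x)) by (apply Rmult_le_pos; apply Cmod_pos).
    simpl; split; [lra |]; intros j Hj; destruct (Nat.eq_dec j n) as [->|]; [lra | specialize (D j ltac:(lia)); lra]. }
  assert (HE0 : E 0 <= INR m * (B * B)).
  { eapply Rle_trans; [apply Rle_abs |]; eapply Rle_trans; [apply fst_le_Cmod |].
    apply Cmod_Csum_le; [nra |]; intros j Hj; rewrite Cmod_mul, Cmod_conj.
    specialize (Hd j Hj); apply Rmult_le_compat; auto using Cmod_pos. }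
  assert (HE' : forall x, Rabs x <= X -> Rabs (fst (F' x)) <= K * (E x + B * B)).
  { intros x Hx. destruct (EG m (le_n _) x) as [A D]; fold (F x) in A, D; fold (E x) in A, D.
    set (e := sqrt (E x)). assert (He0 : 0 <= e) by apply sqrt_pos.
    assert (Hee : e * e = E x) by now apply sqrt_sqrt.
    assert (Hj : forall j, (j < m)%nat -> Cmod (f j x) <= e).
    { intros j Hj; specialize (D j Hj); rewrite <- Hee in D. generalize (Cmod_pos (f j x)); nra. }
    assert (Hfm : Cmod (f m x) <= L * (B + INR m * P * e)).
    { assert (Q : f m x = Cmul (Cinv l) (Csub (Lp m p f x) (Csum m (fun k => Cmul (p k x) (f k x))))).
      { unfold Lp; simpl Csum; rewrite Hm. field; auto. }
      rewrite Q, Cmod_mul. replace (Cmod (Cinv l)) with L.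
      - apply Rmult_le_compat_l; [lra |]; eapply Rle_trans; [apply Cmod_sub |].
        apply Rplus_le_compat; [now apply HB |]. rewrite Rmult_assoc.
        apply Cmod_Csum_le; [nra |]; intros k Hk; rewrite Cmod_mul; apply Rmult_le_compat; auto using Cmod_pos.
      - unfold L; apply Rmult_eq_reg_l with (Cmod l); [| lra].
        rewrite Rinv_r, <- Cmod_mul by lra. replace (Cmul l (Cinv l)) with C1 by (field; auto). now rewrite Cmod_C1. }
    assert (Hj1 : forall j, (j < m)%nat -> Cmod (f (S j) x) <= e + L * (B + INR m * P * e)).
    { intros j Hjm; assert (0 <= L * (B + INR m * P * e)) by (apply Rmult_le_pos; nra).
      destruct (Nat.eq_dec (S j) m) as [Ej|]; [rewrite Ej; lra | specialize (Hj (S j) ltac:(lia)); lra]. }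
    eapply Rle_trans; [apply fst_le_Cmod |]. unfold K, F'; rewrite Rmult_assoc.
    assert (HeB : 2 * (e * B) <= E x + B * B) by (rewrite <- Hee; generalize (Rle_0_sqr (e - B)); unfold Rsqr; lra).
    apply Cmod_Csum_le; [apply Rmult_le_pos; nra |]; intros j Hjm.
    eapply Rle_trans; [apply Cmod_add |]; rewrite !Cmod_mul, !Cmod_conj.
    specialize (Hj j Hjm); specialize (Hj1 j Hjm).
    assert (Q1 : Cmod (f j x) * Cmod (f (S j) x) <= e * (e + L * (B + INR m * P * e))).
    { apply Rmult_le_compat; auto using Cmod_pos. }
    assert (Q2 : L * (2 * (e * B)) <= L * (E x + B * B)) by (apply Rmult_le_compat_l; lra).
    assert (Q3 : 0 <= (2 + 2 * L * (INR m * P)) * (B * B)) by (apply Rmult_le_pos; nra).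
    set (Z := INR m * P) in *.
    replace (Cmod (f (S j) x) * Cmod (f j x) + Cmod (f j x) * Cmod (f (S j) x)) with (2 * (Cmod (f j x) * Cmod (f (S j) x))) by ring.
    apply Rle_trans with (2 * (e * (e + L * (B + Z * e)))); [lra |].
    rewrite <- Hee in *; lra. }
  assert (HG : forall x, Rabs x <= X -> E x + B * B <= exp (K * X) * (E 0 + B * B)).
  { intros x Hx.
    (* The sign [sg] reflects the negative half-line, so that one argument for [u] covers both sides
       of 0. *)
    assert (Hsgn : exists sg, (sg = 1 \/ sg = -1) /\ 0 <= sg * x).
    { destruct (Rle_dec 0 x); [exists 1 | exists (-1)]; split; auto; lra. }
    destruct Hsgn as [sg [Hsg Hsx]].
    set (y := sg * x). assert (Hy : 0 <= y <= X).
    { split; auto; unfold y; revert Hx; unfold Rabs; destruct Rcase_abs; destruct Hsg as [-> | ->]; lra. }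
    assert (Exy : x = sg * y) by (unfold y; destruct Hsg as [-> | ->]; lra).
    set (u := fun t => (E (sg * t) + B * B) * exp (- (K * t))).
    assert (Du : forall t, is_derive u t ((sg * fst (F' (sg * t)) - K * (E (sg * t) + B * B)) * exp (- (K * t)))).
    { intros t; unfold u.
      assert (D1 : is_derive (fun t => sg * t) t sg) by (auto_derive; [trivial | ring]).
      generalize (is_derive_comp E (fun t => sg * t) t _ _ (DE (sg * t)) D1); intros D2.
      assert (D3 : is_derive (fun t => exp (- (K * t))) t (- K * exp (- (K * t)))) by (auto_derive; [trivial | ring]).
      assert (D4 : is_derive (fun _ : R => B * B) t 0) by apply @is_derive_const.
      generalize (is_derive_mult _ _ t _ _ (is_derive_plus _ _ t _ _ D2 D4) D3); intros D5.
      eapply eq_ind; [exact D5 |]. unfold plus, scal; simpl; unfold mult; simpl; ring. }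
    assert (Hu : u y <= u 0).
    { destruct (Req_dec y 0) as [->|Hy0]; [lra |].
      destruct (MVT_gen u 0 y (fun t => (sg * fst (F' (sg * t)) - K * (E (sg * t) + B * B)) * exp (- (K * t)))) as [c [Hc Ec]].
      - intros; apply Du.
      - intros t _; apply derivable_continuous_pt; eexists; apply is_derive_Reals, Du.
      - rewrite Rmin_left, Rmax_right in Hc by lra.
        assert (Hcx : Rabs (sg * c) <= X).
        { rewrite Rabs_mult; replace (Rabs sg) with 1; [rewrite Rabs_pos_eq; lra |].
          destruct Hsg as [-> | ->]; unfold Rabs; destruct Rcase_abs; lra. }
        specialize (HE' _ Hcx).
        assert (sg * fst (F' (sg * c)) <= K * (E (sg * c) + B * B)).
        { eapply Rle_trans; [| apply HE']. revert HE'; unfold Rabs; destruct Rcase_abs; destruct Hsg as [-> | ->]; lra. }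
        generalize (exp_pos (- (K * c))); intros.
        set (ec := exp (- (K * c))) in *. set (A := sg * fst (F' (sg * c))) in *. set (A' := K * (E (sg * c) + B * B)) in *.
        assert ((A - A') * ec <= 0) by nra. rewrite Rminus_0_r in Ec. nra. }
    unfold u in Hu; rewrite <- Exy in Hu. replace (- (K * 0)) with 0 in Hu by ring. rewrite exp_0, !Rmult_0_r, Rmult_1_r in Hu.
    assert (He1 : exp (- (K * y)) * exp (K * y) = 1) by (rewrite <- exp_plus, Rplus_opp_l, exp_0; auto).
    assert (exp (K * y) <= exp (K * X)) by (apply exp_le, Rmult_le_compat_l; lra).
    assert (0 <= E 0 + B * B) by (destruct (EG m (le_n _) 0) as [A _]; fold (F 0) in A; fold (E 0) in A; nra).
    apply Rle_trans with ((E 0 + B * B) * exp (K * y)).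
    - replace (E x + B * B) with ((E x + B * B) * exp (- (K * y)) * exp (K * y)) by (rewrite Rmult_assoc, He1; ring).
      apply Rmult_le_compat_r; [left; apply exp_pos | auto].
    - rewrite Rmult_comm; apply Rmult_le_compat_r; auto. }
  intros j Hj x Hx. destruct (EG m (le_n _) x) as [_ D]; specialize (D j Hj); fold (F x) in D; fold (E x) in D.
  specialize (HG x Hx).
  assert (Q : Cmod (f j x) * Cmod (f j x) <= C * (B * B)).
  { unfold C; nra. }
  apply Rnot_lt_le; intros Hc.
  assert (0 <= C * B) by nra.
  assert (C * B * (C * B) < Cmod (f j x) * Cmod (f j x)) by (apply Rmult_le_0_lt_compat; auto).
  assert (C * (B * B) <= C * B * (C * B)) by (replace (C * B * (C * B)) with (C * (C * (B * B))) by ring; apply Rmult_le_compat_l; nra).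
  lra.
Qed.

Definition reflect (f : Fam1) : Fam1 := fun k x => Cscal ((-1) ^ k) (f k (- x)).

Lemma pow_m1_abs k : Rabs ((-1) ^ k) = 1.
Proof. exact (pow_1_abs k). Qed.

Lemma reflect_bd N f B : bd N f B -> bd N (reflect f) B.
Proof.
  intros H j k Hj Hk x; unfold reflect; rewrite Cmod_scal, pow_m1_abs, Rmult_1_l, <- (Rabs_Ropp x); auto.
Qed.

Lemma reflect_Schwartz f : Schwartz1 f -> Schwartz1 (reflect f).
Proof.
  intros Hf; apply Schwartz_intro.
  - intros k x; unfold reflect.
    apply (dCat_ext (fun t => Cmul (RtoC ((-1) ^ k)) (f k (- t)))); [intros; now rewrite Cscal_mul |].
    replace (Cscal ((-1) ^ S k) (f (S k) (- x))) with (Cmul (RtoC ((-1) ^ k)) (Cscal (- (1)) (f (S k) (- x))))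
      by (replace ((-1) ^ S k) with (- (-1) ^ k) by (simpl; ring); cring).
    apply dCat_cmul. apply (dCat_comp (f k) Ropp); [now apply Schwartz_dCat |].
    assert (D : is_derive (fun t : R => - t) x (- (1))) by (auto_derive; [trivial | ring]). exact D.
  - intros N; destruct (Schwartz_bd f N Hf) as [B H]; exists B; now apply reflect_bd.
Qed.

Lemma weight_le (x y : R) i N : 0 <= y -> (i <= N)%nat -> Rabs x ^ i * y <= y + Rabs x ^ N * y.
Proof.
  intros Hy Hi; assert (Rabs x ^ i <= 1 + Rabs x ^ N).
  { generalize (Rabs_pos x); intros H; destruct (Rle_dec (Rabs x) 1).
    - assert (Rabs x ^ i <= 1 ^ i) by (apply pow_incr; lra). rewrite pow1 in H0.
      generalize (pow_le (Rabs x) N H); lra.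
    - assert (Rabs x ^ i <= Rabs x ^ N) by (apply Rle_pow; [lra | auto]). lra. }
  nra.
Qed.

(** [half_line] serves for [x >= X] and, after reflection, for [x <= - X]; [gronwall] covers the
    middle and carries the data from 0 to the end points of the half-lines. *)
Lemma low_order m p l : (forall k, (k <= m)%nat -> ispoly (p k)) -> l <> C0 -> (forall x, p m x = l) ->
  forall N, exists (N' : nat) C, 0 <= C /\ forall f B, Schwartz1 f ->
    (forall i, (i <= N')%nat -> forall x, Rabs x ^ i * Cmod (Lp m p f x) <= B) ->
    (forall j, (j < m)%nat -> Cmod (f j 0) <= B) ->
    forall j, (j < m)%nat -> forall x, Rabs x ^ N * Cmod (f j x) <= C * B.
Proof.
  intros Hp Hl Hm N.
  destruct (half_line m p l Hp Hl Hm N) as [N1 [X1 [C1' [HX1 [HC1 H1]]]]].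
  set (p' := fun k x => Cscal ((-1) ^ k) (p k (- x))).
  destruct (half_line m p' (Cscal ((-1) ^ m) l)) with (N := N) as [N2 [X2 [C2 [HX2 [HC2 H2]]]]].
  { intros k Hk; unfold p'; apply (ispoly_ext (fun x => Cmul (RtoC ((-1) ^ k)) (p k (- x)))); [intros; now rewrite Cscal_mul |].
    apply ispoly_scal, (ispoly_neg (p k)); auto. }
  { intros E; apply (f_equal Cmod) in E; rewrite Cmod_scal, pow_m1_abs, Cmod_C0, Rmult_1_l in E.
    apply Hl; now apply Cmod_eq0. }
  { intros x; unfold p'; now rewrite Hm. }
  set (X := Rmax X1 X2). assert (HXa : X1 <= X /\ X2 <= X) by (split; [apply Rmax_l | apply Rmax_r]).
  destruct (gronwall m p l X Hp Hl Hm) as [C3 [HC3 H3]]; [lra |].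
  exists (max N1 N2), ((C1' + C2 + X ^ N) * C3).
  assert (HXN : 0 <= X ^ N) by (apply pow_le; lra).
  split; [apply Rmult_le_pos; lra |].
  intros f B Hf HB Hd j Hj x.
  assert (HB0 : 0 <= B).
  { eapply Rle_trans; [| apply (HB O ltac:(lia) 0)]; apply Rmult_le_pos; [apply pow_le, Rabs_pos | apply Cmod_pos]. }
  assert (HG : forall j, (j < m)%nat -> forall x, Rabs x <= X -> Cmod (f j x) <= C3 * B).
  { apply H3; auto. intros t _; generalize (HB O ltac:(lia) t); simpl; lra. }
  assert (HCB : B <= C3 * B) by nra.
  assert (Hfin : forall Q, 0 <= Q -> Q <= C1' + C2 + X ^ N -> Q * (C3 * B) <= (C1' + C2 + X ^ N) * C3 * B).
  { intros Q _ HQ; rewrite Rmult_assoc; apply Rmult_le_compat_r; [nra | auto]. }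
  destruct (Rle_dec (Rabs x) X) as [hx|hx].
  - eapply Rle_trans; [| apply (Hfin (X ^ N)); lra].
    apply Rmult_le_compat; auto using Cmod_pos, pow_le, Rabs_pos. apply pow_incr; split; auto using Rabs_pos.
  - apply Rnot_le_lt in hx. destruct (Rle_dec 0 x) as [h0|h0].
    + rewrite Rabs_pos_eq in * by auto. eapply Rle_trans; [| apply (Hfin C1'); lra].
      apply H1; auto; [| | lra].
      * intros t Ht; apply Rle_trans with B; auto. generalize (HB N1 ltac:(lia) t); rewrite Rabs_pos_eq by lra; auto.
      * intros i Hi; apply HG; auto; rewrite Rabs_pos_eq; lra.
    + rewrite Rabs_left in * by lra. eapply Rle_trans; [| apply (Hfin C2); lra].
      assert (ER : Cmod (f j x) = Cmod (reflect f j (- x))).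
      { unfold reflect; rewrite Cmod_scal, pow_m1_abs, Ropp_involutive; ring. }
      rewrite ER; apply H2; auto; [now apply reflect_Schwartz | | | lra].
      * intros t Ht; apply Rle_trans with B; auto.
        replace (Lp m p' (reflect f) t) with (Lp m p f (- t)).
        -- generalize (HB N2 ltac:(lia) (- t)); rewrite Rabs_Ropp, Rabs_pos_eq by lra; auto.
        -- unfold Lp; apply Csum_ext; intros k _; unfold p', reflect; rewrite !Cscal_mul.
           assert (K : Cmul (RtoC ((-1) ^ k)) (RtoC ((-1) ^ k)) = Defs.C1).
           { rewrite <- RtoC_mul, <- Rpow_mult_distr, <- RtoC_1; f_equal.
             replace (-1 * -1) with 1 by ring; apply pow1. }
           set (q := RtoC ((-1) ^ k)) in *.
           transitivity (Cmul (Cmul q q) (Cmul (p k (- t)) (f k (- t)))); [rewrite K; ring | ring].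
      * intros i Hi; unfold reflect; rewrite Cmod_scal, pow_m1_abs, Rmult_1_l; apply HG; auto.
        rewrite Rabs_Ropp, Rabs_pos_eq; lra.
Qed.

(** * Operators with constant leading coefficient *)

Definition const_lead (m : nat) (l : Cx) (Q : Fam1 -> Fam1) : Prop :=
  exists p, (forall k, (k <= m)%nat -> ispoly (p k)) /\ (forall x, p m x = l) /\
    forall f, Schwartz1 f -> forall x, Q f O x = Lp m p f x.

Lemma const_lead_derivs m l Q i : SLin Q -> const_lead m l Q -> exists q, (forall k, ispoly (q k)) /\
  forall f, Schwartz1 f -> forall x, Q f i x = Cadd (Cmul l (f (m + i)%nat x)) (Csum (m + i) (fun k => Cmul (q k x) (f k x))).
Proof.
  intros HQ [p [Hp [Hm HD]]]; induction i as [|i [q [Hq IH]]].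
  - exists (fun k => if le_dec k m then p k else fun _ => C0); split.
    + intros k; destruct (le_dec k m); auto. apply ispoly_const.
    + intros f Hf x; rewrite Nat.add_0_r, HD by auto; unfold Lp; simpl Csum; rewrite Hm.
      replace (Csum m (fun k => Cmul ((if le_dec k m then p k else fun _ => C0) x) (f k x))) with
        (Csum m (fun k => Cmul (p k x) (f k x))); [ring |].
      apply Csum_ext; intros k Hk; destruct (le_dec k m); [auto | lia].
  - destruct (choose_fun (fun k q' => ispoly q' /\ forall t, dCat (q k) t (q' t))) as [q' Hq'].
    { intros k; destruct (Hq k) as [c Hc]; destruct (peval_deriv c) as [g [Hg Hg']]; exists g; split; auto.
      intros t; apply (dCat_ext (peval c)); auto. }
    exists (fun k x => Cadd (if lt_dec k (m + i) then q' k x else C0) (match k with O => C0 | S j => q j x end)).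
    split.
    + intros k; apply ispoly_add.
      * destruct (lt_dec k (m + i)); [apply Hq' | apply ispoly_const].
      * destruct k; [apply ispoly_const | apply Hq].
    + intros f Hf x.
      transitivity (Cadd (Cmul l (f (S (m + i)) x)) (Csum (m + i) (fun k => Cadd (Cmul (q' k x) (f k x)) (Cmul (q k x) (f (S k) x))))).
      * apply dCat_unique with (Q f i) x; [apply Schwartz_dCat; now apply SL_S |].
        apply (dCat_ext (fun t => Cadd (Cmul l (f (m + i)%nat t)) (Csum (m + i) (fun k => Cmul (q k t) (f k t))))); [intros; now rewrite IH |].
        apply dCat_add; [apply dCat_cmul; now apply Schwartz_dCat |].
        apply (dCat_Csum (m + i) (fun k t => Cmul (q k t) (f k t))); intros k _; apply dCat_mul; [apply Hq' | now apply Schwartz_dCat].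
      * rewrite Nat.add_succ_r; f_equal. rewrite Csum_add.
        rewrite (Csum_ext (S (m + i)) _ (fun k => Cadd (Cmul (if lt_dec k (m + i) then q' k x else C0) (f k x))
            (Cmul (match k with O => C0 | S j => q j x end) (f k x)))) by (intros; ring).
        rewrite Csum_add; f_equal.
        -- rewrite (Csum_widen (m + i) (S (m + i))); [| lia |].
           ++ apply Csum_ext; intros k Hk; destruct (lt_dec k (m + i)); [auto | lia].
           ++ intros k Hk; destruct (lt_dec k (m + i)); [lia | ring].
        -- rewrite (Csum_first (m + i)); ring_simplify; auto.
Qed.

(** With arbitrary tempered functionals in place of values at a point, the estimate is stable under
    conjugation by isomorphisms of S(R), see [coercive_conj]. *)
Definition coercive (Q : Fam1 -> Fam1) : Prop := exists (r : nat) (xi : nat -> Dist1),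
  (forall i, (i < r)%nat -> Tempered1 (xi i)) /\
  forall N, exists (N' : nat) C, 0 <= C /\ forall f B, Schwartz1 f -> bd N' (Q f) B ->
    (forall i, (i < r)%nat -> Cmod (xi i f) <= B) -> bd N f (C * B).

(** Higher derivatives come by induction from the [K]-th derivative of the equation, solved for
    [f^(m + K)]: its coefficient is still the constant [l], while the polynomial coefficients of the
    lower terms are paid for with larger weights. *)
Theorem DO_coercive m l Q : SLin Q -> l <> C0 -> const_lead m l Q -> coercive Q.
Proof.
  intros HQ Hl HDO; pose proof HDO as [p [Hp [Hm HD]]].
  exists m, (fun i f => f i 0); split.
  { intros i _; split; [auto | split; [auto |]].
    exists i, 1; intros f B Hf H; generalize (H O i ltac:(lia) ltac:(lia) 0); simpl; lra. }
  assert (Hml : 0 < Cmod l) by now apply Cmod_gt0.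
  assert (HE : forall K N, exists (N' : nat) C, 0 <= C /\ forall f B, Schwartz1 f -> bd N' (Q f) B ->
    (forall i, (i < m)%nat -> Cmod (f i 0) <= B) -> forall j, (j < m + K)%nat -> forall x, Rabs x ^ N * Cmod (f j x) <= C * B).
  { induction K as [|K IH]; intros N.
    - destruct (low_order m p l Hp Hl Hm N) as [N' [C [HC H]]]; exists N', C; split; auto.
      intros f B Hf HB Hd j Hj x; apply H; auto; [| lia].
      intros i Hi y; rewrite <- HD by auto; apply HB; lia.
    - destruct (const_lead_derivs m l Q K HQ HDO) as [q [Hq Hqf]].
      assert (HS : forall n, (n <= m + K)%nat -> exists (N' : nat) C, 0 <= C /\ forall f B, Schwartz1 f -> bd N' (Q f) B ->
        (forall i, (i < m)%nat -> Cmod (f i 0) <= B) -> forall x, Rabs x ^ N * Cmod (Csum n (fun k => Cmul (q k x) (f k x))) <= C * B).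
      { induction n as [|n IHn]; intros Hn.
        - exists O, 0; split; [lra |]; intros f B _ _ _ x; simpl Csum; rewrite Cmod_C0; lra.
        - destruct (IHn ltac:(lia)) as [N1 [C1' [HC1 H1]]].
          destruct (ispoly_bound (q n) (Hq n)) as [M [d [HM HMd]]].
          destruct (IH N) as [N2 [C2 [HC2 H2]]]. destruct (IH (N + d)%nat) as [N3 [C3 [HC3 H3]]].
          exists (max N1 (max N2 N3)), (C1' + M * 2 ^ d * (C2 + C3)).
          assert (H2d : 0 <= 2 ^ d) by (apply pow_le; lra).
          split; [apply Rplus_le_le_0_compat; auto; apply Rmult_le_pos; [nra | lra] |].
          intros f B Hf HB Hd x; simpl Csum.
          specialize (H1 f B Hf ltac:(apply bd_mono with (2 := Rle_refl B) (3 := HB); lia) Hd x).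
          specialize (H2 f B Hf ltac:(apply bd_mono with (2 := Rle_refl B) (3 := HB); lia) Hd n ltac:(lia) x).
          specialize (H3 f B Hf ltac:(apply bd_mono with (2 := Rle_refl B) (3 := HB); lia) Hd n ltac:(lia) x).
          generalize (Cmod_add (Csum n (fun k => Cmul (q k x) (f k x))) (Cmul (q n x) (f n x))); rewrite Cmod_mul; intros T.
          set (y := Cmod (f n x)) in *. assert (Hy : 0 <= y) by apply Cmod_pos.
          assert (Hw : 0 <= Rabs x ^ N) by (apply pow_le, Rabs_pos).
          assert (Hpd : (1 + Rabs x) ^ d <= 2 ^ d * (1 + Rabs x ^ d)).
          { generalize (Rabs_pos x); intros. destruct (Rle_dec (Rabs x) 1).
            - apply Rle_trans with (2 ^ d); [apply pow_incr; lra |]. generalize (pow_le (Rabs x) d H); nra.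
            - apply Rle_trans with ((2 * Rabs x) ^ d); [apply pow_incr; lra |]. rewrite Rpow_mult_distr; nra. }
          assert (Z : Rabs x ^ N * (Cmod (q n x) * y) <= M * 2 ^ d * (C2 + C3) * B).
          { rewrite pow_add in H3.
            apply Rle_trans with (Rabs x ^ N * (M * (2 ^ d * (1 + Rabs x ^ d)) * y)).
            - apply Rmult_le_compat_l; auto; apply Rmult_le_compat_r; auto. eapply Rle_trans; [apply HMd |].
              now apply Rmult_le_compat_l.
            - replace (Rabs x ^ N * (M * (2 ^ d * (1 + Rabs x ^ d)) * y)) with
                (M * 2 ^ d * (Rabs x ^ N * y + Rabs x ^ N * Rabs x ^ d * y)) by ring.
              replace (M * 2 ^ d * (C2 + C3) * B) with (M * 2 ^ d * (C2 * B + C3 * B)) by ring.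
              apply Rmult_le_compat_l; [nra | lra]. }
          apply Rle_trans with (Rabs x ^ N * (Cmod (Csum n (fun k => Cmul (q k x) (f k x))) + Cmod (q n x) * y)).
          + now apply Rmult_le_compat_l.
          + lra. }
      destruct (HS (m + K)%nat (le_n _)) as [N1 [C1' [HC1 H1]]]. destruct (IH N) as [N2 [C2 [HC2 H2]]].
      exists (max (max N K) (max N1 N2)), (C2 + / Cmod l * (1 + C1')).
      assert (Hil : 0 < / Cmod l) by now apply Rinv_0_lt_compat.
      split; [apply Rplus_le_le_0_compat; auto; apply Rmult_le_pos; lra |].
      intros f B Hf HB Hd j Hj x.
      assert (HB0 := bd_pos _ _ _ HB).
      assert (Hz : 0 <= / Cmod l * (1 + C1') * B) by (apply Rmult_le_pos; auto; apply Rmult_le_pos; lra).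
      assert (Hz2 : 0 <= C2 * B) by nra.
      destruct (Nat.eq_dec j (m + K)) as [->|].
      + assert (Q1 : f (m + K)%nat x = Cmul (Cinv l) (Csub (Q f K x) (Csum (m + K) (fun k => Cmul (q k x) (f k x))))).
        { rewrite Hqf by auto; field; auto. }
        assert (Hinv : Cmod (Cinv l) = / Cmod l).
        { apply Rmult_eq_reg_l with (Cmod l); [| lra].
          rewrite Rinv_r, <- Cmod_mul by lra. replace (Cmul l (Cinv l)) with C1 by (field; auto). now rewrite Cmod_C1. }
        rewrite Q1, Cmod_mul, Hinv.
        specialize (H1 f B Hf ltac:(apply bd_mono with (2 := Rle_refl B) (3 := HB); lia) Hd x).
        assert (H5 := HB N K ltac:(lia) ltac:(lia) x).
        generalize (Cmod_sub (Q f K x) (Csum (m + K) (fun k => Cmul (q k x) (f k x)))) (pow_le (Rabs x) N (Rabs_pos x)); intros T1 T2.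
        set (U := Cmod (Csub _ _)) in *.
        assert (Rabs x ^ N * U <= (1 + C1') * B) by nra.
        replace (Rabs x ^ N * (/ Cmod l * U)) with (/ Cmod l * (Rabs x ^ N * U)) by ring.
        assert (/ Cmod l * (Rabs x ^ N * U) <= / Cmod l * ((1 + C1') * B)) by (apply Rmult_le_compat_l; lra). lra.
      + specialize (H2 f B Hf ltac:(apply bd_mono with (2 := Rle_refl B) (3 := HB); lia) Hd j ltac:(lia) x). lra. }
  intros N.
  destruct (HE (S N) O) as [N1 [C1' [HC1 H1]]]. destruct (HE (S N) N) as [N2 [C2 [HC2 H2]]].
  exists (max N1 N2), (C1' + C2); split; [lra |]; intros f B Hf HB Hd j k Hj Hk x.
  specialize (H1 f B Hf ltac:(apply bd_mono with (2 := Rle_refl B) (3 := HB); lia) Hd k ltac:(lia) x).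
  specialize (H2 f B Hf ltac:(apply bd_mono with (2 := Rle_refl B) (3 := HB); lia) Hd k ltac:(lia) x).
  eapply Rle_trans; [apply weight_le with (N := N); auto using Cmod_pos |]. simpl in H1; lra.
Qed.

(** * Hahn-Banach separation and closed range *)

Definition is_inf (E : R -> Prop) (m : R) : Prop :=
  (forall x, E x -> m <= x) /\ forall b, (forall x, E x -> b <= x) -> b <= m.

Lemma inf_exists E : (exists x, E x) -> (exists b, forall x, E x -> b <= x) -> exists m, is_inf E m.
Proof.
  intros [x Hx] [b Hb].
  destruct (completeness (fun y => E (- y))) as [M [H1 H2]].
  - exists (- b); intros y Hy; specialize (Hb _ Hy); lra.
  - exists (- x); now rewrite Ropp_involutive.
  - exists (- M); split.
    + intros y Hy; assert (- y <= M) by (apply H1; now rewrite Ropp_involutive); lra.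
    + intros c Hc; assert (M <= - c) by (apply H2; intros y Hy; specialize (Hc _ Hy); lra); lra.
Qed.

Lemma inf_plus E E' m m' b : is_inf E m -> is_inf E' m' -> (forall x y, E x -> E' y -> b <= x + y) -> b <= m + m'.
Proof.
  intros [_ H] [_ H'] Hb.
  assert (b - m' <= m); [| lra]. apply H; intros x Hx.
  assert (b - x <= m'); [| lra]. apply H'; intros y Hy. specialize (Hb x y Hx Hy); lra.
Qed.

Definition rs (t : R) (f : Fam1) : Fam1 := fscal1 (RtoC t) f.

Lemma rs_S t f : Schwartz1 f -> Schwartz1 (rs t f).
Proof. apply Schwartz_scal. Qed.

Ltac fext := apply fam_ext; intros; unfold rs, fsub1, fadd1, fopp1, fscal1, f0;
  unfold Rminus; repeat first [rewrite RtoC_mul | rewrite RtoC_add | rewrite RtoC_opp | rewrite RtoC_1 | rewrite RtoC_0]; try ring.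

Definition sublin (p : Fam1 -> R) : Prop :=
  (forall x y, Schwartz1 x -> Schwartz1 y -> p (fadd1 x y) <= p x + p y) /\
  (forall t x, 0 < t -> Schwartz1 x -> p (rs t x) <= t * p x).

Lemma sublin_hom p t x : sublin p -> 0 < t -> Schwartz1 x -> p (rs t x) = t * p x.
Proof.
  intros [_ H] Ht Hx; apply Rle_antisym; [now apply H |].
  generalize (H (/ t) (rs t x) (Rinv_0_lt_compat _ Ht) (rs_S t x Hx)).
  replace (rs (/ t) (rs t x)) with x.
  - intros K; apply Rmult_le_compat_l with (r := t) in K; [| lra].
    replace (t * (/ t * p (rs t x))) with (p (rs t x)) in K by (field; lra). lra.
  - apply fam_ext; intros; unfold rs, fscal1.
    replace (Cmul (RtoC (/ t)) (Cmul (RtoC t) (x k x0))) with (Cmul (RtoC (/ t * t)) (x k x0)) by (rewrite RtoC_mul; ring).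
    rewrite Rinv_l, RtoC_1 by lra; ring.
Qed.

Lemma sublin_0 p : sublin p -> p f0 = 0.
Proof.
  intros H; generalize (sublin_hom p 2 f0 H ltac:(lra) Schwartz_f0).
  replace (rs 2 f0) with f0 by (fext). lra.
Qed.

Lemma sublin_neg p x : sublin p -> Schwartz1 x -> - p (fopp1 x) <= p x.
Proof.
  intros H Hx; generalize (proj1 H x (fopp1 x) Hx (Schwartz_opp _ Hx)).
  replace (fadd1 x (fopp1 x)) with f0 by (fext). rewrite (sublin_0 p H); lra.
Qed.

(** [p' y] is the infimum of [p (y + t x0) - t p x0] over [t >= 0]. If [p] is minimal then
    [p <= p'], and the last property becomes [p y + p x0 <= p (y + x0)], the missing half of
    additivity. *)
Lemma sublin_step p x0 : sublin p -> Schwartz1 x0 -> exists p', sublin p' /\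
  (forall y, Schwartz1 y -> p' y <= p y) /\
  (forall y, Schwartz1 y -> p' y <= p (fadd1 y x0) - p x0).
Proof.
  intros Hp Hx.
  set (E := fun y r => exists t, 0 <= t /\ r = p (fadd1 y (rs t x0)) - t * p x0).
  destruct (choose_fun (fun y m => Schwartz1 y -> is_inf (E y) m)) as [p' Hp'].
  { intros y; destruct (classic (Schwartz1 y)) as [Hy|Hy]; [| exists 0; tauto].
    destruct (inf_exists (E y)) as [m Hm]; [| | now exists m].
    - exists (p (fadd1 y (rs 0 x0)) - 0 * p x0), 0; split; [lra | auto].
    - exists (- p (fopp1 y)); intros r [t [Ht ->]].
      generalize (proj1 Hp (fadd1 y (rs t x0)) (fopp1 y) (Schwartz_add _ _ Hy (rs_S _ _ Hx)) (Schwartz_opp _ Hy)).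
      replace (fadd1 (fadd1 y (rs t x0)) (fopp1 y)) with (rs t x0) by (fext).
      destruct (Rle_lt_or_eq_dec 0 t Ht) as [Ht'| <-]; [rewrite (sublin_hom p t x0); auto; lra |].
      replace (rs 0 x0) with f0 by (fext). rewrite (sublin_0 p Hp).
      replace (fadd1 y f0) with y by (fext). lra. }
  exists p'; split; [split |split].
  - intros y z Hy Hz. apply (inf_plus (E y) (E z)); auto.
    intros a b [t [Ht ->]] [s [Hs ->]].
    apply Rle_trans with (p (fadd1 (fadd1 y z) (rs (t + s) x0)) - (t + s) * p x0).
    + apply (Hp' (fadd1 y z)); [now apply Schwartz_add |]. exists (t + s); split; [lra | auto].
    + generalize (proj1 Hp (fadd1 y (rs t x0)) (fadd1 z (rs s x0)) ltac:(auto using Schwartz_add, rs_S) ltac:(auto using Schwartz_add, rs_S)).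
      replace (fadd1 (fadd1 y (rs t x0)) (fadd1 z (rs s x0))) with (fadd1 (fadd1 y z) (rs (t + s) x0)) by (fext). lra.
  - intros s y Hs Hy.
    assert (K : / s * p' (rs s y) <= p' y).
    { apply (Hp' y Hy); intros r [t [Ht ->]].
      apply Rmult_le_reg_l with s; auto. rewrite <- Rmult_assoc, Rinv_r, Rmult_1_l by lra.
      apply (Hp' (rs s y) (rs_S _ _ Hy)). exists (s * t); split; [nra |].
      replace (fadd1 (rs s y) (rs (s * t) x0)) with (rs s (fadd1 y (rs t x0))) by (fext).
      rewrite (sublin_hom p s) by auto using Schwartz_add, rs_S. ring. }
    apply Rmult_le_compat_l with (r := s) in K; [| lra].
    rewrite <- Rmult_assoc, Rinv_r, Rmult_1_l in K by lra. auto.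
  - intros y Hy; apply Rle_trans with (p (fadd1 y (rs 0 x0)) - 0 * p x0).
    + apply (Hp' y Hy). exists 0; split; [lra | auto].
    + replace (fadd1 y (rs 0 x0)) with y by (fext). lra.
  - intros y Hy; apply Rle_trans with (p (fadd1 y (rs 1 x0)) - 1 * p x0).
    + apply (Hp' y Hy). exists 1; split; [lra | auto].
    + replace (rs 1 x0) with x0 by (fext). lra.
Qed.

(* A minimal sublinear functional is linear, by [sublin_step]. *)
Lemma hahn_banach q f : sublin q -> Schwartz1 f -> exists F : Fam1 -> R,
  (forall x y, Schwartz1 x -> Schwartz1 y -> F (fadd1 x y) = F x + F y) /\
  (forall t x, Schwartz1 x -> F (rs t x) = t * F x) /\
  (forall x, Schwartz1 x -> F x <= q x) /\ q f <= F f.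
Proof.
  intros Hq Hf.
  (* Lowering [q] once in the direction [f] gives [q1 (- f) <= - q f], so a linear functional below
     [q1] is at least [q f] at [f]. *)
  destruct (sublin_step q f Hq Hf) as [q1 [Hq1 [Hle Hstep]]].
  set (P := fun p => sublin p /\ forall y, Schwartz1 y -> p y <= q1 y).
  set (T := {p : Fam1 -> R | P p}).
  assert (H0 : P q1) by (split; [auto | intros; lra]).
  (* The order is reversed: an element maximal for [Rel] is a minimal sublinear functional, and
     chains are bounded by their pointwise infimum. *)
  set (Rel := fun a b : T => boolp.asbool (forall y, Schwartz1 y -> proj1_sig b y <= proj1_sig a y)).
  assert (RelP : forall a b, is_true (Rel a b) <-> forall y, Schwartz1 y -> proj1_sig b y <= proj1_sig a y).
  { intros a b; split; [intros K; exact (boolp.asboolW K) | intros K; exact (boolp.asboolT K)]. }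
  destruct (@classical_sets.ZL_preorder T (exist _ q1 H0) Rel) as [[F [HF HFq]] Hmax].
  - intros t; apply RelP; intros; lra.
  - intros r s t Hrs Hst; apply RelP; intros y Hy.
    apply Rle_trans with (proj1_sig s y); [now apply (proj1 (RelP s t)) | now apply (proj1 (RelP r s))].
  - intros A Htot.
    destruct (classic (exists a, A a)) as [[a0 Ha0]|Hne]; [| exists (exist _ q1 H0); intros s Hs; exfalso; apply Hne; now exists s].
    set (E := fun y r => exists a, A a /\ r = proj1_sig a y).
    destruct (choose_fun (fun y m => Schwartz1 y -> is_inf (E y) m)) as [p Hp].
    { intros y; destruct (classic (Schwartz1 y)) as [Hy|Hy]; [| exists 0; tauto].
      destruct (inf_exists (E y)) as [m Hm]; [| | now exists m].
      - exists (proj1_sig a0 y), a0; auto.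
      - exists (- q1 (fopp1 y)); intros r [a [Ha ->]]. destruct a as [p [Hp Hpq]]; simpl.
        generalize (sublin_neg p y Hp Hy) (Hpq (fopp1 y) (Schwartz_opp _ Hy)); lra. }
    assert (HP : P p).
    { split; [split |].
      - intros y z Hy Hz; apply (inf_plus (E y) (E z)); auto.
        intros r r' [a [Ha ->]] [b [Hb ->]].
        (* In a chain two members can be replaced by the smaller one, which makes the infimum
           subadditive. *)
        assert (Hc : exists c, A c /\ proj1_sig c y <= proj1_sig a y /\ proj1_sig c z <= proj1_sig b z).
        { destruct (Htot a b Ha Hb) as [H|H]; apply (proj1 (RelP _ _)) with (y := y) in H as H1; auto;
            apply (proj1 (RelP _ _)) with (y := z) in H as H2; auto; [exists b | exists a]; repeat split; auto; lra. }
        destruct Hc as [c [Hc [H1 H2]]].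
        apply Rle_trans with (proj1_sig c (fadd1 y z)).
        + apply (Hp (fadd1 y z)); [now apply Schwartz_add |]. now exists c.
        + destruct c as [pc [Hpc Hpcq]]; simpl in *. generalize (proj1 Hpc y z Hy Hz); lra.
      - intros t y Ht Hy.
        assert (K : / t * p (rs t y) <= p y).
        { apply (Hp y Hy); intros r [a [Ha ->]].
          apply Rmult_le_reg_l with t; auto. rewrite <- Rmult_assoc, Rinv_r, Rmult_1_l by lra.
          apply Rle_trans with (proj1_sig a (rs t y)).
          - apply (Hp (rs t y) (rs_S _ _ Hy)). now exists a.
          - destruct a as [pa [Hpa Hpaq]]; simpl. now apply Hpa. }
        apply Rmult_le_compat_l with (r := t) in K; [| lra].
        rewrite <- Rmult_assoc, Rinv_r, Rmult_1_l in K by lra. auto.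
      - intros y Hy; apply Rle_trans with (proj1_sig a0 y).
        + apply (Hp y Hy). now exists a0.
        + destruct a0 as [pa [Hpa Hpaq]]; simpl. now apply Hpaq. }
    exists (exist _ p HP); intros s Hs; apply RelP; intros y Hy; simpl.
    apply (Hp y Hy). now exists s.
  - assert (Hmin : forall p', sublin p' -> (forall y, Schwartz1 y -> p' y <= F y) -> forall y, Schwartz1 y -> F y <= p' y).
    { intros p' Hp' Hle' y Hy.
      assert (HP' : P p') by (split; [auto | intros z Hz; apply Rle_trans with (F z); auto]).
      assert (K : is_true (Rel (exist _ F (conj HF HFq)) (exist _ p' HP'))) by (apply RelP; auto).
      apply Hmax in K. apply (proj1 (RelP _ _) K y Hy). }
    assert (Hadd : forall x y, Schwartz1 x -> Schwartz1 y -> F (fadd1 x y) = F x + F y).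
    { intros x y Hx Hy; apply Rle_antisym; [now apply HF |].
      destruct (sublin_step F y HF Hy) as [p' [Hp' [H1 H2]]].
      generalize (Hmin p' Hp' H1 x Hx) (H2 x Hx); lra. }
    assert (Hneg : forall x, Schwartz1 x -> F (fopp1 x) = - F x).
    { intros x Hx; generalize (Hadd x (fopp1 x) Hx (Schwartz_opp _ Hx)).
      replace (fadd1 x (fopp1 x)) with f0 by (fext). rewrite (sublin_0 F HF); lra. }
    exists F; split; auto; split; [| split].
    + intros t x Hx; destruct (Rtotal_order t 0) as [Ht|[->|Ht]].
      * replace (rs t x) with (fopp1 (rs (- t) x)) by (fext).
        rewrite Hneg, (sublin_hom F) by (auto using rs_S; lra). ring.
      * replace (rs 0 x) with f0 by (fext). rewrite (sublin_0 F HF); ring.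
      * now apply sublin_hom.
    + intros x Hx; apply Rle_trans with (q1 x); auto.
    + assert (K : F (fopp1 f) <= - q f).
      { apply Rle_trans with (q1 (fopp1 f)); [apply HFq; now apply Schwartz_opp |].
        eapply Rle_trans; [apply Hstep; now apply Schwartz_opp |].
        replace (fadd1 (fopp1 f) f) with f0 by (fext). rewrite (sublin_0 q Hq); lra. }
      rewrite Hneg in K by auto. lra.
Qed.

(** The sublinear functional is the distance to the range of [Q] in the seminorm behind [bd N]: it
    is at most 0 on the range and at least [eps] at [f]. *)
Lemma hahn_banach_separation Q f N eps : SLin Q -> Schwartz1 f -> 0 < eps ->
  (forall u, Schwartz1 u -> ~ bd N (fsub1 f (Q u)) eps) ->
  exists U, Tempered1 U /\ (forall u, Schwartz1 u -> U (Q u) = C0) /\ U f <> C0.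
Proof.
  intros HQ Hf Heps Hsep.
  set (E := fun g B => exists u, Schwartz1 u /\ bd N (fsub1 g (Q u)) B).
  destruct (choose_fun (fun g m => Schwartz1 g -> is_inf (E g) m)) as [q Hq].
  { intros g; destruct (classic (Schwartz1 g)) as [Hg|Hg]; [| exists 0; tauto].
    destruct (inf_exists (E g)) as [m Hm]; [| | now exists m].
    - destruct (Schwartz_bd (fsub1 g (Q f0)) N) as [B HB]; [apply Schwartz_sub; auto; apply SL_S; auto using Schwartz_f0 |].
      exists B, f0; split; auto using Schwartz_f0.
    - exists 0; intros B [u [_ HB]]; now apply bd_pos in HB. }
  assert (Hsub : sublin q).
  { split.
    - intros x y Hx Hy; apply (inf_plus (E x) (E y)); auto. intros a b [u [Hu Ha]] [v [Hv Hb]].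
      apply (Hq (fadd1 x y)); [now apply Schwartz_add |]. exists (fadd1 u v); split; [now apply Schwartz_add |].
      rewrite (SL_add Q HQ) by auto.
      replace (fsub1 (fadd1 x y) (fadd1 (Q u) (Q v))) with (fadd1 (fsub1 x (Q u)) (fsub1 y (Q v))) by (fext).
      now apply bd_add.
    - intros t x Ht Hx.
      assert (K : / t * q (rs t x) <= q x).
      { apply (Hq x Hx); intros B [u [Hu HB]].
        apply Rmult_le_reg_l with t; auto. rewrite <- Rmult_assoc, Rinv_r, Rmult_1_l by lra.
        apply (Hq (rs t x) (rs_S _ _ Hx)). exists (rs t u); split; [now apply rs_S |].
        unfold rs at 2; rewrite (SL_scal Q HQ) by auto.
        replace (fsub1 (rs t x) (fscal1 (RtoC t) (Q u))) with (fscal1 (RtoC t) (fsub1 x (Q u))) by (fext).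
        replace t with (Cmod (RtoC t)) at 2 by (rewrite Cmod_RtoC, Rabs_pos_eq; lra). now apply bd_scal. }
      apply Rmult_le_compat_l with (r := t) in K; [| lra].
      rewrite <- Rmult_assoc, Rinv_r, Rmult_1_l in K by lra. auto. }
  assert (Hqf : eps <= q f).
  { apply (Hq f Hf); intros B [u [Hu HB]]; apply Rnot_lt_le; intros Hlt.
    apply (Hsep u Hu). apply bd_mono with N B; auto; lra. }
  assert (HqB : forall g B, Schwartz1 g -> bd N g B -> q g <= B).
  { intros g B Hg HB; apply (Hq g Hg). exists f0; split; [apply Schwartz_f0 |].
    rewrite (SL_0 Q HQ). replace (fsub1 g f0) with g by (fext). auto. }
  assert (HqQ : forall v, Schwartz1 v -> q (Q v) <= 0).
  { intros v Hv; apply (Hq (Q v)); [now apply SL_S |]. exists v; split; auto.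
    replace (fsub1 (Q v) (Q v)) with f0 by (fext). apply bd_f0. }
  destruct (hahn_banach q f Hsub Hf) as [F [FA [FS [Fq Ff]]]].
  assert (HFn : forall g, Schwartz1 g -> F (fopp1 g) = - F g).
  { intros g Hg; replace (fopp1 g) with (rs (- (1)) g) by (fext). rewrite FS by auto; ring. }
  assert (HFb : forall g B, Schwartz1 g -> bd N g B -> Rabs (F g) <= B).
  { intros g B Hg HB. generalize (Fq g Hg) (HqB g B Hg HB) (Fq (fopp1 g) (Schwartz_opp _ Hg))
     (HqB (fopp1 g) B (Schwartz_opp _ Hg) (bd_opp _ _ _ HB)). rewrite HFn by auto.
    unfold Rabs; destruct Rcase_abs; lra. }
  assert (HFQ : forall v, Schwartz1 v -> F (Q v) = 0).
  { intros v Hv. generalize (Fq (Q v) (SL_S Q HQ v Hv)) (HqQ v Hv) (Fq (Q (fopp1 v)) (SL_S Q HQ _ (Schwartz_opp _ Hv)))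
      (HqQ (fopp1 v) (Schwartz_opp _ Hv)).
    rewrite (SL_opp Q) by auto. rewrite HFn by (now apply SL_S). lra. }
  assert (HFc : forall z g, Schwartz1 g -> F (fscal1 z g) = fst z * F g + snd z * F (fscal1 Ci g)).
  { intros z g Hg. replace (fscal1 z g) with (fadd1 (rs (fst z) g) (rs (snd z) (fscal1 Ci g))).
    - rewrite FA, !FS; auto using rs_S, Schwartz_scal.
    - apply fam_ext; intros; unfold rs, fadd1, fscal1.
      replace z with (Cadd (RtoC (fst z)) (Cmul (RtoC (snd z)) Ci)) at 3; [ring |].
      destruct z; unfold Cadd, Cmul, RtoC, Ci; apply injective_projections; simpl; ring. }
  (* The complex linear functional with real part [F]. *)
  exists (fun g => (F g, - F (fscal1 Ci g))); split; [split; [| split] | split].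
  - intros g h Hg Hh. replace (fscal1 Ci (fadd1 g h)) with (fadd1 (fscal1 Ci g) (fscal1 Ci h)) by (fext).
    rewrite !FA by auto using Schwartz_scal. unfold Cadd; simpl; f_equal; ring.
  - intros z g Hg. replace (fscal1 Ci (fscal1 z g)) with (fscal1 (Cmul Ci z) g) by (fext).
    rewrite (HFc z g), (HFc (Cmul Ci z) g) by auto. unfold Cmul; simpl; f_equal; ring.
  - exists N, 2; intros g B Hg HB. change (bd N g B) in HB.
    eapply Rle_trans; [apply Cmod_le_sum |]; simpl; rewrite Rabs_Ropp.
    generalize (HFb g B Hg HB) (HFb _ _ (Schwartz_scal Ci g Hg) (bd_scal _ Ci _ _ HB)); rewrite Cmod_Ci; lra.
  - intros v Hv. rewrite HFQ by auto. rewrite <- (SL_scal Q HQ) by auto.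
    rewrite HFQ by (now apply Schwartz_scal). unfold C0; f_equal; ring.
  - intros K; apply (f_equal fst) in K; simpl in K; lra.
Qed.

Definition conv (u : nat -> Fam1) (f : Fam1) : Prop :=
  forall N eps, 0 < eps -> exists J, forall j, (J <= j)%nat -> bd N (fsub1 f (u j)) eps.

Lemma SLin_conv Q u f : SLin Q -> Schwartz1 f -> (forall n, Schwartz1 (u n)) -> conv u f -> conv (fun n => Q (u n)) (Q f).
Proof.
  intros HQ Hf Hu H N eps He; destruct (SL_bd Q HQ N) as [N' [C [HC HB]]].
  destruct (H N' (eps / (C + 1))) as [J HJ]; [apply Rdiv_lt_0_compat; lra |].
  exists J; intros j Hj; rewrite <- (SL_sub Q) by auto.
  apply bd_mono with N (C * (eps / (C + 1))); auto.
  - replace eps with ((C + 1) * (eps / (C + 1))) at 2 by (field; lra).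
    apply Rmult_le_compat_r; [left; apply Rdiv_lt_0_compat |]; lra.
  - apply HB; auto using Schwartz_sub.
Qed.

Lemma conv_unique u f g : conv u f -> conv u g -> f = g.
Proof.
  intros Hf Hg; apply fam_ext; intros k x.
  assert (K : fsub1 f g k x = C0).
  { apply (bd_zero k); auto. intros eps He.
    destruct (Hf k (eps / 2)) as [J1 H1]; [lra |]; destruct (Hg k (eps / 2)) as [J2 H2]; [lra |].
    replace (fsub1 f g) with (fadd1 (fsub1 f (u (max J1 J2))) (fopp1 (fsub1 g (u (max J1 J2))))) by (fext).
    replace eps with (eps / 2 + eps / 2) by field.
    apply bd_add; [apply H1; lia | apply bd_opp, H2; lia]. }
  replace (f k x) with (Cadd (fsub1 f g k x) (g k x)) by (unfold fsub1, fadd1, fopp1; ring). rewrite K; ring.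
Qed.

Lemma Tempered_conv eta u f : Tempered1 eta -> Schwartz1 f -> (forall n, Schwartz1 (u n)) -> conv u f ->
  forall eps, 0 < eps -> exists J, forall j, (J <= j)%nat -> Cmod (Csub (eta f) (eta (u j))) <= eps.
Proof.
  intros [HA [HS [N [K HK]]]] Hf Hu H eps He.
  assert (HP : 0 < Rabs K + 1) by (generalize (Rabs_pos K); lra).
  destruct (H N (eps / (Rabs K + 1))) as [J HJ]; [apply Rdiv_lt_0_compat; lra |].
  exists J; intros j Hj; specialize (HJ j Hj).
  replace (Csub (eta f) (eta (u j))) with (eta (fsub1 f (u j))).
  - eapply Rle_trans; [apply (HK _ _ (Schwartz_sub _ _ Hf (Hu j)) HJ) |].
    replace eps with ((Rabs K + 1) * (eps / (Rabs K + 1))) at 2 by (field; lra).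
    apply Rmult_le_compat_r; [left; apply Rdiv_lt_0_compat; lra |]. generalize (Rle_abs K); lra.
  - unfold fsub1; rewrite HA, fopp1_scal, HS by auto using Schwartz_opp. ring.
Qed.

(** That [L] meets the kernel of [Q] only in 0 is the case [B = 0] of [cp_est]. *)
Record complement (Q : Fam1 -> Fam1) (L : Fam1 -> Prop) : Prop := {
  cp_S : forall u, L u -> Schwartz1 u;
  cp_add : forall u v, L u -> L v -> L (fadd1 u v);
  cp_scal : forall c u, L u -> L (fscal1 c u);
  cp_closed : forall u f, (forall n, L (u n)) -> Schwartz1 f -> conv u f -> L f;
  cp_cover : forall u, Schwartz1 u -> exists k, Schwartz1 k /\ Q k = f0 /\ L (fsub1 u k);
  cp_est : forall N, exists (N' : nat) C, 0 <= C /\ forall f B, L f -> bd N' (Q f) B -> bd N f (C * B) }.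

(* If the last functional does not vanish on [ker Q] in [L], pass to its kernel; otherwise it is
   controlled by [Q], for a sequence violating this would converge to an element of [ker Q]. *)
Lemma drop_functionals Q r : SLin Q -> forall (xi : nat -> Dist1) (L : Fam1 -> Prop),
  (forall i, (i < r)%nat -> Tempered1 (xi i)) ->
  (forall u, L u -> Schwartz1 u) -> (forall u v, L u -> L v -> L (fadd1 u v)) ->
  (forall c u, L u -> L (fscal1 c u)) ->
  (forall u f, (forall n, L (u n)) -> Schwartz1 f -> conv u f -> L f) ->
  (forall u, Schwartz1 u -> exists k, Schwartz1 k /\ Q k = f0 /\ L (fsub1 u k)) ->
  (forall N, exists (N' : nat) C, 0 <= C /\ forall f B, L f -> bd N' (Q f) B ->
    (forall i, (i < r)%nat -> Cmod (xi i f) <= B) -> bd N f (C * B)) ->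
  exists L', complement Q L'.
Proof.
  intros HQ; induction r as [|r IH]; intros xi L Hxi HS HA HM HC HK HE.
  - exists L; split; auto. intros N; destruct (HE N) as [N' [C [H0 H1]]]; exists N', C; split; auto.
    intros f B Hf HB; apply H1; auto; intros; lia.
  - pose proof (Hxi r ltac:(lia)) as Heta; set (eta := xi r) in *.
    pose proof Heta as [EA [EM EB]].
    destruct (classic (exists k, L k /\ Q k = f0 /\ eta k <> C0)) as [[k0 [Lk0 [Qk0 Ek0]]]|Hno].
    + apply (IH xi (fun u => L u /\ eta u = C0)).
      * intros; apply Hxi; lia.
      * intros u [Hu _]; auto.
      * intros u v [Hu Eu] [Hv Ev]; split; auto. rewrite EA, Eu, Ev by auto; ring.
      * intros c u [Hu Eu]; split; auto. rewrite EM, Eu by auto; ring.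
      * intros u f Hu Hf Hc; split; [apply (HC u); auto; intros n; apply Hu |].
        apply Cmod_eq0, Rle_antisym; [| apply Cmod_pos]. apply le_epsilon; intros eps He; rewrite Rplus_0_l.
        destruct (Tempered_conv eta u f Heta Hf) with (eps := eps) as [J HJ]; auto; [intros n; apply HS, Hu |].
        specialize (HJ J (le_n _)); rewrite (proj2 (Hu J)) in HJ. replace (Csub (eta f) C0) with (eta f) in HJ by ring; auto.
      * intros u Hu; destruct (HK u Hu) as [k [Hk [Qk Lk]]].
        set (c := Cmul (eta (fsub1 u k)) (Cinv (eta k0))).
        exists (fadd1 k (fscal1 c k0)).
        assert (Hck : Schwartz1 (fscal1 c k0)) by (apply Schwartz_scal; auto).
        split; [now apply Schwartz_add | split].
        -- rewrite (SL_add Q HQ), (SL_scal Q HQ), Qk, Qk0 by auto. fext.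
        -- replace (fsub1 u (fadd1 k (fscal1 c k0))) with (fadd1 (fsub1 u k) (fscal1 (Copp c) k0)) by (fext).
           split; [apply HA; auto |]. rewrite EA, EM by auto. unfold c; field; auto.
      * intros N; destruct (HE N) as [N' [C [H0 H1]]]; exists N', C; split; auto.
        intros f B [Hf Ef] HB Hx; apply H1; auto. intros i Hi.
        destruct (Nat.eq_dec i r) as [->|]; [| apply Hx; lia].
        fold eta; rewrite Ef, Cmod_C0; apply (bd_pos _ _ _ HB).
    + apply (IH xi L); auto.
      assert (Hclaim : exists N1 C1', 0 <= C1' /\ forall f B, L f -> bd N1 (Q f) B ->
        (forall i, (i < r)%nat -> Cmod (xi i f) <= B) -> Cmod (eta f) <= C1' * B).
      { apply NNPP; intros Hn.
        (* For every [n] the claim fails with the constant [n + 1]; the counterexample is rescaled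
           so that [eta w = 1]. *)
        assert (Hseq : forall n : nat, exists w, L w /\ eta w = C1 /\ bd n (Q w) (/ (INR n + 1)) /\
           forall i, (i < r)%nat -> Cmod (xi i w) <= / (INR n + 1)).
        { intros n; apply NNPP; intros Hw; apply Hn; exists n, (INR n + 1).
          assert (Pn : 0 < INR n + 1) by (generalize (pos_INR n); lra).
          split; [lra |]; intros f B Lf HB Hx; apply Rnot_lt_le; intros Hlt; apply Hw.
          assert (HB0 := bd_pos _ _ _ HB).
          assert (Pe : 0 < Cmod (eta f)) by nra.
          assert (Ne : eta f <> C0) by (intros E; rewrite E, Cmod_C0 in Pe; lra).
          assert (Minv : Cmod (Cinv (eta f)) = / Cmod (eta f)).
          { apply Rmult_eq_reg_l with (Cmod (eta f)); [| lra].
            rewrite Rinv_r, <- Cmod_mul by lra. replace (Cmul (eta f) (Cinv (eta f))) with C1 by (field; auto). now rewrite Cmod_C1. }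
          assert (Hsm : / Cmod (eta f) * B <= / (INR n + 1)).
          { apply Rmult_le_reg_l with (Cmod (eta f)); auto. rewrite <- Rmult_assoc, Rinv_r, Rmult_1_l by lra.
            apply Rmult_le_reg_r with (INR n + 1); auto. rewrite Rmult_assoc, Rinv_l, Rmult_1_r by lra. lra. }
          exists (fscal1 (Cinv (eta f)) f); split; [auto | split; [| split]].
          - rewrite EM by auto. field; auto.
          - rewrite (SL_scal Q HQ) by auto. apply bd_mono with n (Cmod (Cinv (eta f)) * B); auto; [rewrite Minv; auto |].
            now apply bd_scal.
          - intros i Hi. rewrite (proj1 (proj2 (Hxi i ltac:(lia)))), Cmod_mul, Minv by auto.
            eapply Rle_trans; [| apply Hsm]. apply Rmult_le_compat_l; auto. left; now apply Rinv_0_lt_compat. }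
        destruct (choose_fun _ Hseq) as [w Hw].
        assert (Hinv : forall eps, 0 < eps -> exists J : nat, forall n, (J <= n)%nat -> / (INR n + 1) <= eps).
        { intros eps He; destruct (nfloor_ex (/ eps)) as [J HJ]; [left; now apply Rinv_0_lt_compat |].
          exists J; intros n Hn'. apply le_INR in Hn'. rewrite <- (Rinv_inv eps). apply Rinv_le_contravar; [now apply Rinv_0_lt_compat | lra]. }
        destruct (Schwartz_complete w) as [f [Sf Cf]].
        - intros n; apply HS, Hw.
        - intros N eps He; destruct (HE N) as [N' [C [H0 H1]]].
          destruct (Hinv (eps / (2 * (C + 1)))) as [J HJ]; [apply Rdiv_lt_0_compat; lra |].
          exists (max J N'); intros i j Hi Hj.
          apply bd_mono with N (C * (/ (INR i + 1) + / (INR j + 1))); auto.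
          + assert (/ (INR i + 1) + / (INR j + 1) <= 2 * (eps / (2 * (C + 1)))).
            { generalize (HJ i ltac:(lia)) (HJ j ltac:(lia)); lra. }
            replace (2 * (eps / (2 * (C + 1)))) with (eps / (C + 1)) in H by (field; lra).
            assert (0 <= / (INR i + 1) + / (INR j + 1)).
            { apply Rplus_le_le_0_compat; left; apply Rinv_0_lt_compat; [generalize (pos_INR i) | generalize (pos_INR j)]; lra. }
            apply Rle_trans with ((C + 1) * (eps / (C + 1))); [apply Rmult_le_compat; lra |]. right; field; lra.
          + destruct (Hw i) as [L1 [E1 [B1 X1]]]; destruct (Hw j) as [L2 [E2 [B2 X2]]].
            assert (Ld : L (fsub1 (w i) (w j))).
            { unfold fsub1; rewrite fopp1_scal; auto. }
            apply H1; auto.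
            * rewrite (SL_sub Q) by auto. apply bd_add; [apply bd_mono with i (/ (INR i + 1)); auto; [lia | lra] |].
              apply bd_opp, bd_mono with j (/ (INR j + 1)); auto; [lia | lra].
            * intros q Hq'. pose proof (Hxi q Hq') as [XA [XM _]].
              unfold fsub1; rewrite XA, fopp1_scal, XM by (rewrite <- ?fopp1_scal; auto using Schwartz_opp).
              replace (Cadd (xi q (w i)) (Cmul (Copp C1) (xi q (w j)))) with (Csub (xi q (w i)) (xi q (w j))) by ring.
              destruct (Nat.eq_dec q r) as [->|].
              -- fold eta; rewrite E1, E2. replace (Csub C1 C1) with C0 by ring. rewrite Cmod_C0.
                 apply Rplus_le_le_0_compat; left; apply Rinv_0_lt_compat; [generalize (pos_INR i) | generalize (pos_INR j)]; lra.
              -- eapply Rle_trans; [apply Cmod_sub |]. apply Rplus_le_compat; [apply X1 | apply X2]; lia.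
        - assert (Hws : forall n, Schwartz1 (w n)) by (intros n; apply HS, Hw).
          (* The limit of the sequence lies in [L], is killed by [Q] and satisfies [eta f = 1],
             against [Hno]. *)
          apply Hno; exists f; split; [apply (HC w); auto; intros n; apply Hw | split].
          + apply (conv_unique (fun n => Q (w n))); [now apply SLin_conv |].
            intros N eps He; destruct (Hinv eps He) as [J HJ]. exists (max J N); intros j Hj.
            replace (fsub1 f0 (Q (w j))) with (fopp1 (Q (w j))) by (fext).
            apply bd_opp, bd_mono with j (/ (INR j + 1)); [lia | apply HJ; lia | apply Hw].
          + intros E0. destruct (Tempered_conv eta w f Heta Sf Hws Cf (/ 2)) as [J HJ]; [lra |].
            specialize (HJ J (le_n _)). rewrite E0, (proj1 (proj2 (Hw J))) in HJ.
            replace (Csub C0 C1) with (Copp C1) in HJ by ring. rewrite Cmod_opp, Cmod_C1 in HJ. lra. }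
      destruct Hclaim as [N1 [C1' [HC1 H1]]].
      intros N; destruct (HE N) as [N' [C [H0 H2]]].
      exists (max N1 N'), (C * (1 + C1')); split; [nra |].
      intros f B Lf HB Hx. assert (HB0 := bd_pos _ _ _ HB). rewrite Rmult_assoc; apply H2; auto.
      * apply bd_mono with (max N1 N') B; auto; [lia | nra].
      * intros i Hi. destruct (Nat.eq_dec i r) as [->|].
        -- fold eta. apply Rle_trans with (C1' * B); [| nra]. apply H1; auto.
           apply bd_mono with (max N1 N') B; auto; [lia | lra].
        -- apply Rle_trans with B; [apply Hx; lia | nra].
Qed.

Lemma coercive_complement Q : SLin Q -> coercive Q -> exists L, complement Q L.
Proof.
  intros HQ [r [xi [Hxi HE]]]. apply (drop_functionals Q r HQ xi Schwartz1); auto.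
  - intros; now apply Schwartz_add.
  - intros; now apply Schwartz_scal.
  - intros u Hu; exists f0; split; [apply Schwartz_f0 | split; [now apply SL_0 |]].
    replace (fsub1 u f0) with u by (fext). auto.
Qed.

(** By Hahn-Banach [f] is a limit of elements [Q u]. Moved into [L] along the kernel, the
    approximate solutions form a Cauchy sequence by [cp_est]. *)
Lemma closed_range Q L f : SLin Q -> complement Q L -> Schwartz1 f ->
  (forall U, Tempered1 U -> (forall u, Schwartz1 u -> U (Q u) = C0) -> U f = C0) ->
  exists u, L u /\ Q u = f.
Proof.
  intros HQ HL Hf Hann.
  assert (Happ : forall n : nat, exists u, L u /\ bd n (fsub1 f (Q u)) (/ (INR n + 1))).
  { intros n; apply NNPP; intros Hn.
    destruct (hahn_banach_separation Q f n (/ (INR n + 1)) HQ Hf) as [U [HU [HU0 HUf]]].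
    - apply Rinv_0_lt_compat; generalize (pos_INR n); lra.
    - intros u Hu HB; apply Hn. destruct (cp_cover Q L HL u Hu) as [k [Hk [Qk Lk]]].
      exists (fsub1 u k); split; auto. rewrite (SL_sub Q), Qk by auto.
      replace (fsub1 (Q u) f0) with (Q u) by (fext). auto.
    - apply HUf, Hann; auto. }
  destruct (choose_fun _ Happ) as [w Hw].
  assert (Hinv : forall eps, 0 < eps -> exists J : nat, forall n, (J <= n)%nat -> / (INR n + 1) <= eps).
  { intros eps He; destruct (nfloor_ex (/ eps)) as [J HJ]; [left; now apply Rinv_0_lt_compat |].
    exists J; intros n Hn'. apply le_INR in Hn'. rewrite <- (Rinv_inv eps). apply Rinv_le_contravar; [now apply Rinv_0_lt_compat | lra]. }
  assert (Hws : forall n, Schwartz1 (w n)) by (intros n; apply (cp_S Q L HL), Hw).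
  destruct (Schwartz_complete w) as [u [Su Cu]]; auto.
  - intros N eps He; destruct (cp_est Q L HL N) as [N' [C [H0 H1]]].
    destruct (Hinv (eps / (2 * (C + 1)))) as [J HJ]; [apply Rdiv_lt_0_compat; lra |].
    exists (max J N'); intros i j Hi Hj.
    apply bd_mono with N (C * (/ (INR i + 1) + / (INR j + 1))); auto.
    + assert (/ (INR i + 1) + / (INR j + 1) <= 2 * (eps / (2 * (C + 1)))).
      { generalize (HJ i ltac:(lia)) (HJ j ltac:(lia)); lra. }
      replace (2 * (eps / (2 * (C + 1)))) with (eps / (C + 1)) in H by (field; lra).
      assert (0 <= / (INR i + 1) + / (INR j + 1)).
      { apply Rplus_le_le_0_compat; left; apply Rinv_0_lt_compat; [generalize (pos_INR i) | generalize (pos_INR j)]; lra. }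
      apply Rle_trans with ((C + 1) * (eps / (C + 1))); [apply Rmult_le_compat; lra |]. right; field; lra.
    + apply H1; [unfold fsub1; rewrite fopp1_scal; apply (cp_add Q L HL); [| apply (cp_scal Q L HL)]; apply Hw |].
      rewrite (SL_sub Q) by auto.
      replace (fsub1 (Q (w i)) (Q (w j))) with (fadd1 (fopp1 (fsub1 f (Q (w i)))) (fsub1 f (Q (w j)))) by (fext).
      apply bd_add.
      * apply bd_opp, bd_mono with i (/ (INR i + 1)); [lia | lra | apply Hw].
      * apply bd_mono with j (/ (INR j + 1)); [lia | lra | apply Hw].
  - exists u; split; [apply (cp_closed Q L HL w); auto; intros n; apply Hw |].
    apply (conv_unique (fun n => Q (w n))); [now apply SLin_conv |].
    intros N eps He; destruct (Hinv eps He) as [J HJ]; exists (max J N); intros j Hj.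
    apply bd_mono with j (/ (INR j + 1)); [lia | apply HJ; lia | apply Hw].
Qed.

(** * Improper integrals *)

Definition ccont (f : R -> Cx) : Prop :=
  forall x, continuous (fun t => fst (f t)) x /\ continuous (fun t => snd (f t)) x.

Lemma ccont_dCat f f' : (forall x, dCat f x (f' x)) -> ccont f.
Proof.
  intros H x; specialize (H x); rewrite dCat_is in H; destruct H as [A B].
  split; apply @ex_derive_continuous; eexists; eauto.
Qed.

Lemma ccont_lip f K : (forall x y, Cmod (Csub (f x) (f y)) <= K * Rabs (x - y)) -> ccont f.
Proof.
  intros H x.
  assert (G : forall g : R -> R, (forall x y, Rabs (g x - g y) <= K * Rabs (x - y)) -> continuous g x).
  { intros g Hg; apply continuity_pt_filterlim. intros eps He.
    exists (eps / (Rabs K + 1)); split.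
    - apply Rdiv_lt_0_compat; auto. generalize (Rabs_pos K); lra.
    - intros y [_ Hy]. unfold dist in *; simpl in *; unfold R_dist in *.
      eapply Rle_lt_trans; [apply Hg |].
      apply Rle_lt_trans with ((Rabs K + 1) * Rabs (y - x)).
      + apply Rmult_le_compat_r; [apply Rabs_pos |]. generalize (Rle_abs K); lra.
      + rewrite Rmult_comm. apply Rlt_div_r; auto. generalize (Rabs_pos K); lra. }
  split; apply G; intros a b; eapply Rle_trans; try apply H.
  - eapply Rle_trans; [| apply fst_le_Cmod]; simpl; apply Req_le; f_equal; ring.
  - eapply Rle_trans; [| apply snd_le_Cmod]; simpl; apply Req_le; f_equal; ring.
Qed.

Lemma ccont_add f g : ccont f -> ccont g -> ccont (fun x => Cadd (f x) (g x)).
Proof.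
  intros Hf Hg x; destruct (Hf x) as [A B]; destruct (Hg x) as [A' B']; split; simpl.
  - apply (continuous_plus _ _ _ A A').
  - apply (continuous_plus _ _ _ B B').
Qed.

Lemma ccont_cmul c f : ccont f -> ccont (fun x => Cmul c (f x)).
Proof.
  intros Hf x; destruct (Hf x) as [A B]; split; simpl.
  - apply (continuous_minus (fun t => fst c * fst (f t)) (fun t => snd c * snd (f t))).
    + apply (continuous_mult (K := R_AbsRing) (fun _ => fst c) (fun t => fst (f t))); auto; apply continuous_const.
    + apply (continuous_mult (K := R_AbsRing) (fun _ => snd c) (fun t => snd (f t))); auto; apply continuous_const.
  - apply (continuous_plus (fun t => fst c * snd (f t)) (fun t => snd c * fst (f t))).
    + apply (continuous_mult (K := R_AbsRing) (fun _ => fst c) (fun t => snd (f t))); auto; apply continuous_const.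
    + apply (continuous_mult (K := R_AbsRing) (fun _ => snd c) (fun t => fst (f t))); auto; apply continuous_const.
Qed.

Lemma anti_exists f : ccont f -> exists F, (forall x, dCat F x (f x)) /\ F 0 = C0.
Proof.
  intros Hf.
  assert (G : forall g : R -> R, (forall x, continuous g x) -> exists F, (forall x, is_derive F x (g x)) /\ F 0 = 0).
  { intros g Hg; exists (fun x => RInt g 0 x); split.
    - intros x; apply (is_derive_RInt g (fun x => RInt g 0 x) 0 x).
      + exists (mkposreal 1 Rlt_0_1); intros y _. apply @RInt_correct, @ex_RInt_continuous; auto.
      + apply Hg.
    - rewrite RInt_point; reflexivity. }
  destruct (G (fun t => fst (f t))) as [F1 [H1 Z1]]; [apply Hf |].
  destruct (G (fun t => snd (f t))) as [F2 [H2 Z2]]; [apply Hf |].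
  exists (fun x => (F1 x, F2 x)); split; [| now rewrite Z1, Z2].
  intros x; apply dCat_is; split; simpl; auto.
Qed.

Lemma RInt_on_anti (f F : R -> R) a b : (forall x, continuous f x) -> (forall x, is_derive F x (f x)) -> RInt_on f a b (F b - F a).
Proof.
  intros Hf HF.
  assert (H : is_RInt f a b (minus (F b) (F a))) by (apply (is_RInt_derive F f); intros; auto).
  assert (E : ex_RInt f a b) by (eexists; apply H).
  exists (ex_RInt_Reals_0 f a b E).
  rewrite <- RInt_Reals. rewrite (is_RInt_unique (V := R_CompleteNormedModule) f a b _ H). unfold minus, plus, opp; simpl; ring.
Qed.

Lemma RInt_on_unique f a b l l' : RInt_on f a b l -> RInt_on f a b l' -> l = l'.
Proof. intros [p <-] [q <-]; apply RiemannInt_P5. Qed.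

Lemma RImproper_unique f l l' : RImproper f l -> RImproper f l' -> l = l'.
Proof.
  intros H H'; apply cond_eq; intros eps He.
  destruct (H (eps / 2)) as [N HN]; [lra |]; destruct (H' (eps / 2)) as [N' HN']; [lra |].
  set (X := Rmax N N').
  assert (N <= X /\ N' <= X) as [A B] by (split; [apply Rmax_l | apply Rmax_r]).
  destruct (HN (- X) X) as [I [HI1 HI2]]; [lra | lra |].
  destruct (HN' (- X) X) as [I' [HI1' HI2']]; [lra | lra |].
  rewrite (RInt_on_unique _ _ _ _ _ HI1' HI1) in HI2'.
  replace (l - l') with (- (I - l) + (I - l')) by ring.
  eapply Rle_lt_trans; [apply Rabs_triang |]; rewrite Rabs_Ropp; lra.
Qed.

Lemma CImproper_unique f l l' : CImproper f l -> CImproper f l' -> l = l'.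
Proof. intros [A B] [A' B']; apply injective_projections; eapply RImproper_unique; eauto. Qed.

Lemma CImproper_anti f F l : ccont f -> (forall x, dCat F x (f x)) ->
  (forall eps, 0 < eps -> exists N, forall a b, a <= - N -> N <= b -> Cmod (Csub (Csub (F b) (F a)) l) <= eps) ->
  CImproper f l.
Proof.
  intros Hf HF H; split; intros eps He; destruct (H (eps / 2)) as [N HN]; try lra; exists N; intros a b Ha Hb;
    specialize (HN a b Ha Hb).
  - exists (fst (F b) - fst (F a)); split.
    + apply (RInt_on_anti (fun t => fst (f t)) (fun t => fst (F t))); [apply Hf | intros; apply dCat_is, HF].
    + eapply Rle_lt_trans; [| apply Rle_lt_trans with (1 := HN); lra].
      eapply Rle_trans; [| apply fst_le_Cmod]; simpl; apply Req_le; f_equal; ring.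
  - exists (snd (F b) - snd (F a)); split.
    + apply (RInt_on_anti (fun t => snd (f t)) (fun t => snd (F t))); [apply Hf | intros; apply dCat_is, HF].
    + eapply Rle_lt_trans; [| apply Rle_lt_trans with (1 := HN); lra].
      eapply Rle_trans; [| apply snd_le_Cmod]; simpl; apply Req_le; f_equal; ring.
Qed.

Lemma CImproper_anti_inv f F l : ccont f -> (forall x, dCat F x (f x)) -> CImproper f l ->
  forall eps, 0 < eps -> exists N, forall a b, a <= - N -> N <= b -> Cmod (Csub (Csub (F b) (F a)) l) <= eps.
Proof.
  intros Hf HF [H1 H2] eps He.
  destruct (H1 (eps / 2)) as [N HN]; [lra |]; destruct (H2 (eps / 2)) as [N' HN']; [lra |].
  exists (Rmax N N'); intros a b Ha Hb.
  assert (N <= Rmax N N' /\ N' <= Rmax N N') as [A B] by (split; [apply Rmax_l | apply Rmax_r]).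
  destruct (HN a b) as [I [HI1 HI2]]; [lra | lra |]. destruct (HN' a b) as [I' [HI1' HI2']]; [lra | lra |].
  assert (E1 : I = fst (F b) - fst (F a)).
  { eapply RInt_on_unique; [apply HI1 |].
    apply (RInt_on_anti (fun t => fst (f t)) (fun t => fst (F t))); [apply Hf | intros; apply dCat_is, HF]. }
  assert (E2 : I' = snd (F b) - snd (F a)).
  { eapply RInt_on_unique; [apply HI1' |].
    apply (RInt_on_anti (fun t => snd (f t)) (fun t => snd (F t))); [apply Hf | intros; apply dCat_is, HF]. }
  eapply Rle_trans; [apply Cmod_le_sum |]; simpl.
  rewrite E1 in HI2; rewrite E2 in HI2'.
  replace (fst (F b) + - fst (F a) + - fst l) with (fst (F b) - fst (F a) - fst l) by ring.
  replace (snd (F b) + - snd (F a) + - snd l) with (snd (F b) - snd (F a) - snd l) by ring. lra.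
Qed.

(** For both signs [s] the function [s F + M / x] does not increase, which bounds [s (F c - F b)] by
    [M / b]. *)
Lemma tail_real (F f : R -> R) M b c : (forall x, is_derive F x (f x)) -> (forall x, (1 + x ^ 2) * Rabs (f x) <= M) ->
  1 <= b -> b <= c -> Rabs (F c - F b) <= M / b.
Proof.
  intros HF HM Hb Hc.
  assert (HM0 : 0 <= M).
  { eapply Rle_trans; [| apply (HM 0)]. apply Rmult_le_pos; [nra | apply Rabs_pos]. }
  destruct (Req_dec b c) as [->|Hne].
  { replace (F c - F c) with 0 by ring; rewrite Rabs_R0. apply Rmult_le_pos; auto. left; apply Rinv_0_lt_compat; lra. }
  assert (K : forall s, (s = 1 \/ s = -1) -> s * (F c - F b) <= M / b).
  { intros s Hs.
    assert (D : forall x, b <= x <= c -> is_derive (fun x => s * F x + M / x) x (s * f x - M / x ^ 2)).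
    { intros x Hx.
      assert (D1 : is_derive (fun x => M / x) x (- (M / x ^ 2))) by (auto_derive; [lra | field; lra]).
      assert (D2 : is_derive (fun x => s * F x) x (s * f x)) by (apply is_derive_scal, HF).
      exact (is_derive_plus _ _ _ _ _ D2 D1). }
    destruct (MVT_gen (fun x => s * F x + M / x) b c (fun x => s * f x - M / x ^ 2)) as [x [Hx E]].
    - rewrite Rmin_left, Rmax_right by lra; intros; apply D; lra.
    - rewrite Rmin_left, Rmax_right by lra; intros y Hy; apply derivable_continuous_pt; eexists; apply is_derive_Reals, D; lra.
    - rewrite Rmin_left, Rmax_right in Hx by lra.
      assert (P : 0 < x ^ 2) by nra.
      assert (s * f x - M / x ^ 2 <= 0).
      { assert (s * f x <= Rabs (f x)) by (destruct Hs as [-> | ->]; unfold Rabs; destruct Rcase_abs; lra).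
        assert (Rabs (f x) <= M / x ^ 2) by (apply Rle_div_r; auto; specialize (HM x); generalize (Rabs_pos (f x)); nra). lra. }
      assert (0 <= M / c) by (apply Rmult_le_pos; auto; left; apply Rinv_0_lt_compat; lra).
      assert ((s * f x - M / x ^ 2) * (c - b) <= 0) by nra. lra. }
  generalize (K 1 (or_introl eq_refl)) (K (-1) (or_intror eq_refl)). unfold Rabs; destruct Rcase_abs; lra.
Qed.

Lemma tail_C (F f : R -> Cx) M b c : (forall x, dCat F x (f x)) -> (forall x, (1 + x ^ 2) * Cmod (f x) <= M) ->
  1 <= b -> b <= c -> Cmod (Csub (F c) (F b)) <= 2 * M / b.
Proof.
  intros HF HM Hb Hc; eapply Rle_trans; [apply Cmod_le_sum |].
  replace (2 * M / b) with (M / b + M / b) by (field; lra).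
  apply Rplus_le_compat; simpl.
  - apply (tail_real (fun t => fst (F t)) (fun t => fst (f t)) M b c); auto; [intros; apply dCat_is, HF |].
    intros x; eapply Rle_trans; [| apply HM]. apply Rmult_le_compat_l; [nra | apply fst_le_Cmod].
  - apply (tail_real (fun t => snd (F t)) (fun t => snd (f t)) M b c); auto; [intros; apply dCat_is, HF |].
    intros x; eapply Rle_trans; [| apply HM]. apply Rmult_le_compat_l; [nra | apply snd_le_Cmod].
Qed.

Lemma tail_C_neg (F f : R -> Cx) M b c : (forall x, dCat F x (f x)) -> (forall x, (1 + x ^ 2) * Cmod (f x) <= M) ->
  1 <= b -> b <= c -> Cmod (Csub (F (- c)) (F (- b))) <= 2 * M / b.
Proof.
  intros HF HM; apply (tail_C (fun x => F (- x)) (fun x => Cscal (- (1)) (f (- x)))).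
  - intros x; apply (dCat_comp F Ropp); [apply HF |].
    assert (D : is_derive (fun t : R => - t) x (- (1))) by (auto_derive; [trivial | ring]). exact D.
  - intros x; rewrite Cmod_scal, Rabs_Ropp, Rabs_R1, Rmult_1_l. specialize (HM (- x)).
    replace ((- x) ^ 2) with (x ^ 2) in HM by ring; auto.
Qed.

(** Domination by [M / (1 + x^2)] gives the existence of the integral, explicit tails and the bound
    [8 * M], without any theory of Lebesgue integration. *)
Definition Cdom (f : R -> Cx) (M : R) : Prop := ccont f /\ forall x, (1 + x ^ 2) * Cmod (f x) <= M.

Lemma Cdom_pos f M : Cdom f M -> 0 <= M.
Proof. intros [_ H]; eapply Rle_trans; [| apply (H 0)]; apply Rmult_le_pos; [nra | apply Cmod_pos]. Qed.

Lemma Cdom_improper f M F : Cdom f M -> (forall x, dCat F x (f x)) ->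
  exists l, CImproper f l /\ forall X a b, 1 <= X -> a <= - X -> X <= b -> Cmod (Csub (Csub (F b) (F a)) l) <= 4 * M / X.
Proof.
  intros Hd HF; pose proof Hd as [Hf HM]; assert (HM0 := Cdom_pos _ _ Hd).
  assert (Lim : forall G : R -> Cx, (forall b c, 1 <= b -> b <= c -> Cmod (Csub (G c) (G b)) <= 2 * M / b) ->
     exists l, forall b, 1 <= b -> Cmod (Csub (G b) l) <= 2 * M / b).
  { intros G HG.
    assert (Q : forall (pr : Cx -> R), (forall z w, Rabs (pr z - pr w) <= Cmod (Csub z w)) ->
       exists l : R, is_lim_seq (fun n => pr (G (INR n))) (Finite l)).
    { intros pr Hpr. destruct (proj2 (ex_lim_seq_cauchy_corr (fun n => pr (G (INR n))))) as [l Hl]; [| now exists l].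
      intros eps. destruct (nfloor_ex (2 * M / eps + 1)) as [J HJ].
      { apply Rplus_le_le_0_compat; [| lra]. apply Rmult_le_pos; [lra |]. left; apply Rinv_0_lt_compat, eps. }
      assert (HJ1 : 2 * M / eps < INR (S J)) by (rewrite S_INR; lra).
      assert (HJ2 : 1 <= INR (S J)) by (apply (le_INR 1); lia).
      exists (S J).
      assert (K : forall i j, (S J <= i)%nat -> (i <= j)%nat -> Rabs (pr (G (INR j)) - pr (G (INR i))) < eps).
      { intros i j Hi Hj; apply le_INR in Hi; apply le_INR in Hj.
        eapply Rle_lt_trans; [apply Hpr |]. eapply Rle_lt_trans; [apply HG; lra |].
        apply Rlt_div_l; [lra |]. destruct eps as [eps He]; simpl in *.
        apply Rlt_div_l in HJ1; auto. nra. }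
      intros i j Hi Hj; destruct (Nat.le_ge_cases i j).
      - rewrite Rabs_minus_sym; now apply K.
      - now apply K. }
    destruct (Q fst) as [l1 H1].
    { intros z w; eapply Rle_trans; [| apply fst_le_Cmod]; simpl; apply Req_le; f_equal; ring. }
    destruct (Q snd) as [l2 H2].
    { intros z w; eapply Rle_trans; [| apply snd_le_Cmod]; simpl; apply Req_le; f_equal; ring. }
    exists (l1, l2); intros b Hb. apply le_epsilon; intros eps He.
    apply is_lim_seq_spec in H1; apply is_lim_seq_spec in H2.
    assert (He2 : 0 < eps / 2) by lra.
    destruct (H1 (mkposreal _ He2)) as [J1 K1]; destruct (H2 (mkposreal _ He2)) as [J2 K2]; simpl in K1, K2.
    destruct (nfloor_ex b) as [J3 K3]; [lra |].
    set (n := max (S J3) (max J1 J2)).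
    specialize (K1 n ltac:(lia)); specialize (K2 n ltac:(lia)).
    assert (Hbn : b <= INR n) by (assert (INR (S J3) <= INR n) by (apply le_INR; lia); rewrite S_INR in H; lra).
    replace (Csub (G b) (l1, l2)) with (Cadd (Copp (Csub (G (INR n)) (G b))) (Csub (G (INR n)) (l1, l2))) by ring.
    eapply Rle_trans; [apply Cmod_add |]; rewrite Cmod_opp; apply Rplus_le_compat; [now apply HG |].
    eapply Rle_trans; [apply Cmod_le_sum |]; simpl.
    replace (fst (G (INR n)) + - l1) with (fst (G (INR n)) - l1) by ring.
    replace (snd (G (INR n)) + - l2) with (snd (G (INR n)) - l2) by ring. lra. }
  destruct (Lim F) as [lp Hlp]; [intros; now apply (tail_C F f) |].
  destruct (Lim (fun x => F (- x))) as [lm Hlm]; [intros; now apply (tail_C_neg F f) |].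
  assert (HT : forall X a b, 1 <= X -> a <= - X -> X <= b -> Cmod (Csub (Csub (F b) (F a)) (Csub lp lm)) <= 4 * M / X).
  { intros X a b HX Ha Hb.
    replace (Csub (Csub (F b) (F a)) (Csub lp lm)) with (Csub (Csub (F b) lp) (Csub (F a) lm)) by ring.
    eapply Rle_trans; [apply Cmod_sub |].
    generalize (Hlp b ltac:(lra)) (Hlm (- a) ltac:(lra)); rewrite Ropp_involutive; intros A B.
    assert (2 * M / b <= 2 * M / X) by (apply Rmult_le_compat_l; [lra | apply Rinv_le_contravar; lra]).
    assert (2 * M / (- a) <= 2 * M / X) by (apply Rmult_le_compat_l; [lra | apply Rinv_le_contravar; lra]).
    replace (4 * M / X) with (2 * M / X + 2 * M / X) by (field; lra). lra. }
  exists (Csub lp lm); split; auto.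
  apply (CImproper_anti f F); auto. intros eps He.
  exists (Rmax 1 (4 * M / eps)); intros a b Ha Hb.
  assert (1 <= Rmax 1 (4 * M / eps) /\ 4 * M / eps <= Rmax 1 (4 * M / eps)) as [A B] by (split; [apply Rmax_l | apply Rmax_r]).
  eapply Rle_trans; [apply (HT _ a b A Ha Hb) |].
  apply Rle_div_l; [lra |]. apply Rle_div_l in B; auto; lra.
Qed.

(** Defined by choice; its value means something only when the improper integral exists, which
    [CI_spec] derives from [Cdom]. *)
Definition CI (f : R -> Cx) : Cx := epsilon (inhabits C0) (CImproper f).

Lemma CI_val f l : CImproper f l -> CI f = l.
Proof.
  intros H; apply CImproper_unique with f; auto.
  apply (epsilon_spec (inhabits C0) (CImproper f)); now exists l.
Qed.

Lemma CI_spec f M : Cdom f M -> CImproper f (CI f).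
Proof.
  intros H; destruct (anti_exists f (proj1 H)) as [F [HF _]].
  destruct (Cdom_improper f M F H HF) as [l [Hl _]]. now rewrite (CI_val f l Hl).
Qed.

Lemma CI_tail f M F X a b : Cdom f M -> (forall x, dCat F x (f x)) -> 1 <= X -> a <= - X -> X <= b ->
  Cmod (Csub (Csub (F b) (F a)) (CI f)) <= 4 * M / X.
Proof.
  intros H HF; destruct (Cdom_improper f M F H HF) as [l [Hl HT]]. rewrite (CI_val f l Hl); apply HT.
Qed.

Lemma CI_bound f M : Cdom f M -> Cmod (CI f) <= 8 * M.
Proof.
  intros H; destruct (anti_exists f (proj1 H)) as [F [HF _]]. assert (HM := Cdom_pos _ _ H).
  (* The constant 8 is 4 for the tails beyond 1 and 4 for the interval from -1 to 1. *)
  assert (A := CI_tail f M F 1 (-1) 1 H HF ltac:(lra) ltac:(lra) ltac:(lra)).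
  assert (B : Cmod (Csub (F 1) (F (-1))) <= 2 * M * Rabs (1 - -1)).
  { apply mean_C with f; auto. intros t _; destruct H as [_ H]; specialize (H t).
    generalize (Cmod_pos (f t)) (pow2_ge_0 t); nra. }
  replace (1 - -1) with 2 in B by ring; rewrite Rabs_pos_eq in B by lra.
  replace (CI f) with (Csub (Csub (F 1) (F (-1))) (Csub (Csub (F 1) (F (-1))) (CI f))) by ring.
  eapply Rle_trans; [apply Cmod_sub |]; lra.
Qed.

Lemma Cdom_add f g M M' : Cdom f M -> Cdom g M' -> Cdom (fun x => Cadd (f x) (g x)) (M + M').
Proof.
  intros [A B] [A' B']; split; [now apply ccont_add |]; intros x.
  specialize (B x); specialize (B' x). generalize (Cmod_add (f x) (g x)) (pow2_ge_0 x); nra.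
Qed.

Lemma Cdom_cmul c f M : Cdom f M -> Cdom (fun x => Cmul c (f x)) (Cmod c * M).
Proof.
  intros [A B]; split; [now apply ccont_cmul |]; intros x; rewrite Cmod_mul.
  replace ((1 + x ^ 2) * (Cmod c * Cmod (f x))) with (Cmod c * ((1 + x ^ 2) * Cmod (f x))) by ring.
  apply Rmult_le_compat_l; auto using Cmod_pos.
Qed.

Lemma CI_add f g M M' : Cdom f M -> Cdom g M' -> CI (fun x => Cadd (f x) (g x)) = Cadd (CI f) (CI g).
Proof.
  intros Hf Hg; apply CI_val.
  destruct (anti_exists f (proj1 Hf)) as [F [HF _]]; destruct (anti_exists g (proj1 Hg)) as [G [HG _]].
  apply (CImproper_anti _ (fun x => Cadd (F x) (G x))).
  - apply ccont_add; [apply Hf | apply Hg].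
  - intros x; apply dCat_add; auto.
  - intros eps He.
    destruct (CImproper_anti_inv f F _ (proj1 Hf) HF (CI_spec _ _ Hf) (eps / 2)) as [N HN]; [lra |].
    destruct (CImproper_anti_inv g G _ (proj1 Hg) HG (CI_spec _ _ Hg) (eps / 2)) as [N' HN']; [lra |].
    exists (Rmax N N'); intros a b Ha Hb.
    assert (N <= Rmax N N' /\ N' <= Rmax N N') as [A B] by (split; [apply Rmax_l | apply Rmax_r]).
    specialize (HN a b ltac:(lra) ltac:(lra)); specialize (HN' a b ltac:(lra) ltac:(lra)).
    replace (Csub (Csub (Cadd (F b) (G b)) (Cadd (F a) (G a))) (Cadd (CI f) (CI g))) with
      (Cadd (Csub (Csub (F b) (F a)) (CI f)) (Csub (Csub (G b) (G a)) (CI g))) by ring.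
    eapply Rle_trans; [apply Cmod_add |]; lra.
Qed.

Lemma CImproper_cmul c f l : ccont f -> CImproper f l -> CImproper (fun x => Cmul c (f x)) (Cmul c l).
Proof.
  intros Hf Hl; destruct (anti_exists f Hf) as [F [HF _]].
  apply (CImproper_anti _ (fun x => Cmul c (F x))).
  - now apply ccont_cmul.
  - intros x; now apply dCat_cmul.
  - intros eps He.
    assert (Hc : 0 < Cmod c + 1) by (generalize (Cmod_pos c); lra).
    destruct (CImproper_anti_inv f F _ Hf HF Hl (eps / (Cmod c + 1))) as [N HN]; [now apply Rdiv_lt_0_compat |].
    exists N; intros a b Ha Hb; specialize (HN a b Ha Hb).
    replace (Csub (Csub (Cmul c (F b)) (Cmul c (F a))) (Cmul c l)) with (Cmul c (Csub (Csub (F b) (F a)) l)) by ring.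
    rewrite Cmod_mul. apply Rle_div_r in HN; auto.
    generalize (Cmod_pos (Csub (Csub (F b) (F a)) l)); nra.
Qed.

Lemma CI_cmul c f M : Cdom f M -> CI (fun x => Cmul c (f x)) = Cmul c (CI f).
Proof. intros Hf; apply CI_val, CImproper_cmul; [apply Hf | now apply CI_spec with M]. Qed.

Lemma CI_opp f M : Cdom f M -> CI (fun x => Copp (f x)) = Copp (CI f).
Proof.
  intros H; replace (fun x => Copp (f x)) with (fun x => Cmul (Copp C1) (f x))
    by (apply functional_extensionality; intros; ring).
  rewrite (CI_cmul _ _ M) by auto; ring.
Qed.

Lemma Cdom_opp f M : Cdom f M -> Cdom (fun x => Copp (f x)) M.
Proof.
  intros H; replace (fun x => Copp (f x)) with (fun x => Cmul (Copp C1) (f x))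
    by (apply functional_extensionality; intros; ring).
  generalize (Cdom_cmul (Copp C1) f M H); now rewrite Cmod_opp, Cmod_C1, Rmult_1_l.
Qed.

Lemma CI_sub f g M M' : Cdom f M -> Cdom g M' -> CI (fun x => Csub (f x) (g x)) = Csub (CI f) (CI g).
Proof.
  intros Hf Hg; unfold Csub; rewrite <- (CI_opp g M' Hg).
  apply (CI_add f (fun x => Copp (g x)) M M'); auto; now apply Cdom_opp.
Qed.

Lemma Cdom_sub f g M M' : Cdom f M -> Cdom g M' -> Cdom (fun x => Csub (f x) (g x)) (M + M').
Proof. intros Hf Hg; apply (Cdom_add f (fun x => Copp (g x))); auto; now apply Cdom_opp. Qed.

Lemma CI_deriv F f K : ccont f -> (forall x, dCat F x (f x)) -> (forall x, Rabs x * Cmod (F x) <= K) -> CI f = C0.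
Proof.
  intros Hf HF HK; apply CI_val, (CImproper_anti f F); auto. intros eps He.
  assert (HK0 : 0 <= K) by (eapply Rle_trans; [| apply (HK 0)]; apply Rmult_le_pos; [apply Rabs_pos | apply Cmod_pos]).
  exists (2 * K / eps + 1); intros a b Ha Hb.
  assert (P : 0 <= 2 * K / eps) by (apply Rmult_le_pos; [lra | left; now apply Rinv_0_lt_compat]).
  assert (Q : forall x, 2 * K / eps + 1 <= Rabs x -> Cmod (F x) <= eps / 2).
  { intros x Hx; specialize (HK x).
    assert (2 * K / eps <= Rabs x) by lra. apply Rle_div_l in H; auto.
    apply Rmult_le_reg_l with (Rabs x); [lra |]. lra. }
  replace (Csub (Csub (F b) (F a)) C0) with (Csub (F b) (F a)) by ring.
  eapply Rle_trans; [apply Cmod_sub |].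
  assert (Cmod (F b) <= eps / 2) by (apply Q; rewrite Rabs_pos_eq; lra).
  assert (Cmod (F a) <= eps / 2) by (apply Q; rewrite Rabs_left; lra). lra.
Qed.

Lemma CI_affine f l c t : ccont f -> CImproper f l -> c <> 0 ->
  CImproper (fun x => f (c * x + t)) (Cscal (/ Rabs c) l).
Proof.
  intros Hf Hl Hc; destruct (anti_exists f Hf) as [F [HF _]].
  assert (Hac : 0 < Rabs c) by now apply Rabs_pos_lt.
  apply (CImproper_anti _ (fun x => Cscal (/ c) (F (c * x + t)))).
  - intros x; split; [apply (continuous_comp (fun x => c * x + t) (fun y => fst (f y))) |
      apply (continuous_comp (fun x => c * x + t) (fun y => snd (f y)))]; try apply Hf;
      apply @ex_derive_continuous; auto_derive; trivial.
  - intros x.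
    assert (D : is_derive (fun x : R => c * x + t) x c) by (auto_derive; [trivial | ring]).
    generalize (dCat_cmul (RtoC (/ c)) _ _ _ (dCat_comp F _ _ _ _ (HF (c * x + t)) D)); intros H.
    apply (dCat_ext _ (fun x => Cscal (/ c) (F (c * x + t)))) in H; [| intros; now rewrite Cscal_mul].
    eapply eq_ind; [exact H |].
    rewrite Cscal_mul. replace (Cmul (RtoC (/ c)) (Cmul (RtoC c) (f (c * x + t)))) with (Cmul (RtoC (/ c * c)) (f (c * x + t))) by cring.
    rewrite Rinv_l, RtoC_1 by auto; ring.
  - intros eps He.
    destruct (CImproper_anti_inv f F _ Hf HF Hl (eps * Rabs c)) as [N HN]; [nra |].
    exists ((Rabs N + Rabs t) / Rabs c); intros a b Ha Hb.
    assert (Hb' : Rabs N + Rabs t <= Rabs c * b) by (apply Rle_div_l in Hb; auto; lra).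
    assert (Ha' : Rabs c * a <= - (Rabs N + Rabs t)).
    { apply Rmult_le_compat_l with (r := Rabs c) in Ha; [| lra].
      replace (Rabs c * - ((Rabs N + Rabs t) / Rabs c)) with (- (Rabs N + Rabs t)) in Ha by (field; lra). auto. }
    assert (HNN := Rle_abs N). assert (Ht := Rle_abs t). assert (Ht' := Rle_abs (- t)); rewrite Rabs_Ropp in Ht'.
    replace (Csub (Csub (Cscal (/ c) (F (c * b + t))) (Cscal (/ c) (F (c * a + t)))) (Cscal (/ Rabs c) l)) with
      (Cscal (/ c) (Csub (Csub (F (c * b + t)) (F (c * a + t))) (Cscal (c * / Rabs c) l))).
    2:{ replace (/ Rabs c) with (/ c * (c * / Rabs c)) at 2 by (field; lra). cring. }
    rewrite Cmod_scal, Rabs_inv. apply Rmult_le_reg_l with (Rabs c); auto. rewrite <- Rmult_assoc, Rinv_r, Rmult_1_l by lra.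
    rewrite (Rmult_comm (Rabs c)).
    (* For negative [c] the end points are exchanged, and the sign [c / |c|] compensates for
       this. *)
    destruct (Rlt_dec c 0) as [hc|hc].
    + rewrite (Rabs_left c) in * by auto.
      replace (c * / - c) with (-1) by (field; auto).
      replace (Csub (Csub (F (c * b + t)) (F (c * a + t))) (Cscal (-1) l)) with
        (Copp (Csub (Csub (F (c * a + t)) (F (c * b + t))) l)).
      * rewrite Cmod_opp; apply HN; lra.
      * rewrite Cscal_mul; replace (RtoC (-1)) with (Copp C1); [ring | rewrite <- RtoC_1, <- RtoC_opp; reflexivity].
    + rewrite (Rabs_pos_eq c) in * by lra. rewrite Rinv_r by auto.
      rewrite Cscal_mul, RtoC_1. replace (Cmul C1 l) with l by ring. apply HN; lra.
Qed.

Lemma CI_param (f f' : R -> R -> Cx) y M M0 M1 :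
  (forall y', Rabs (y' - y) <= 1 -> Cdom (fun x => f x y') M0) -> Cdom (fun x => f' x y) M1 ->
  (forall y' x, Rabs (y' - y) <= 1 ->
     (1 + x ^ 2) * Cmod (Csub (Csub (f x y') (f x y)) (Cscal (y' - y) (f' x y))) <= M * (y' - y) ^ 2) ->
  dCat (fun y => CI (fun x => f x y)) y (CI (fun x => f' x y)).
Proof.
  intros Hf Hf' HQ; apply dCat_quad with (8 * M); intros y' Hy'.
  assert (H0 : Rabs (y - y) <= 1) by (rewrite Rminus_diag, Rabs_R0; lra).
  assert (D1 := Hf y' Hy'). assert (D2 := Hf y H0).
  assert (D3 := Cdom_cmul (RtoC (y' - y)) _ _ Hf').
  rewrite Cscal_mul, <- (CI_cmul _ _ _ Hf').
  rewrite <- (CI_sub _ _ _ _ D1 D2), <- (CI_sub _ _ _ _ (Cdom_sub _ _ _ _ D1 D2) D3).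
  rewrite Rmult_assoc; apply CI_bound; split.
  - apply (Cdom_sub _ _ _ _ (Cdom_sub _ _ _ _ D1 D2) D3).
  - intros x; rewrite <- Cscal_mul; now apply HQ.
Qed.

(** No double integral is formed. If [A y x] is the integral of [H] in the first variable from 0 to
    [x], then [B x = CI (fun y => A y x)] is an antiderivative of [Phi], and [B b - B a] tends to
    the integral of [Psi] because the tails of [A y] are bounded by a small multiple of
    [1 / (1 + y^2)]. The derivatives of [H] serve to differentiate under the integral sign and to
    make [Psi] Lipschitz. *)
Lemma fubini (H Hx Hxx Hy : R -> R -> Cx) M :
  (forall x y, dCat (fun t => H t y) x (Hx x y)) -> (forall x y, dCat (fun t => Hx t y) x (Hxx x y)) ->
  (forall x y, dCat (fun t => H x t) y (Hy x y)) -> (forall x, ccont (fun y => Hx x y)) ->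
  (forall x y, (1 + x ^ 2) * (1 + y ^ 2) * Cmod (H x y) <= M) ->
  (forall x y, (1 + x ^ 2) * (1 + y ^ 2) * Cmod (Hx x y) <= M) ->
  (forall x y, (1 + x ^ 2) * (1 + y ^ 2) * Cmod (Hxx x y) <= M) ->
  (forall x y, (1 + x ^ 2) * (1 + y ^ 2) * Cmod (Hy x y) <= M) ->
  CI (fun y => CI (fun x => H x y)) = CI (fun x => CI (fun y => H x y)) /\
  CImproper (fun y => CI (fun x => H x y)) (CI (fun x => CI (fun y => H x y))) /\
  ccont (fun y => CI (fun x => H x y)).
Proof.
  intros dx dxx dy cx b0 bx bxx by'.
  assert (HM : 0 <= M) by (eapply Rle_trans; [| apply (b0 0 0)]; apply Rmult_le_pos; [nra | apply Cmod_pos]).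
  assert (W : forall x, 1 <= 1 + x ^ 2) by (intros x; generalize (pow2_ge_0 x); lra).
  assert (S1 : forall (G : R -> R -> Cx), (forall x y, (1 + x ^ 2) * (1 + y ^ 2) * Cmod (G x y) <= M) ->
    (forall x y, (1 + x ^ 2) * Cmod (G x y) <= M) /\ (forall x y, (1 + y ^ 2) * Cmod (G x y) <= M) /\ (forall x y, Cmod (G x y) <= M)).
  { intros G HG.
    assert (A : forall x y, (1 + x ^ 2) * Cmod (G x y) <= M).
    { intros x y; specialize (HG x y). generalize (W y) (W x) (Cmod_pos (G x y)); intros.
      assert (0 <= (1 + x ^ 2) * Cmod (G x y)) by (apply Rmult_le_pos; lra). nra. }
    split; auto; split; intros x y.
    - specialize (HG x y). generalize (W y) (W x) (Cmod_pos (G x y)); intros.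
      assert (0 <= (1 + y ^ 2) * Cmod (G x y)) by (apply Rmult_le_pos; lra). nra.
    - specialize (A x y). generalize (W x) (Cmod_pos (G x y)); nra. }
  destruct (S1 H b0) as [H1 [H2 H3]]. destruct (S1 Hx bx) as [Hx1 [Hx2 Hx3]]. destruct (S1 Hxx bxx) as [Hxx1 [Hxx2 Hxx3]].
  destruct (S1 Hy by') as [Hy1 [Hy2 Hy3]].
  assert (DX : forall y, Cdom (fun x => H x y) M) by (intros y; split; [apply ccont_dCat with (fun x => Hx x y); auto | auto]).
  assert (DY : forall x, Cdom (fun y => H x y) M) by (intros x; split; [apply ccont_dCat with (fun y => Hy x y); auto | auto]).
  set (Phi := fun x => CI (fun y => H x y)).
  assert (dPhi : forall x, dCat Phi x (CI (fun y => Hx x y))).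
  { intros x; apply (CI_param (fun y x => H x y) (fun y x => Hx x y) x (2 * M) M M); auto.
    - split; auto.
    - intros x' y Hx'.
      apply Rle_trans with ((1 + y ^ 2) * (2 * (M / (1 + y ^ 2)) * (x' - x) ^ 2)).
      + apply Rmult_le_compat_l; [generalize (W y); lra |].
        apply (taylor_C (fun x => H x y) (fun x => Hx x y) (fun x => Hxx x y)); auto.
        intros t _; apply Rle_div_r; [generalize (W y); lra |]. rewrite Rmult_comm; auto.
      + right; field. generalize (W y); lra. }
  assert (DPhi : Cdom Phi (8 * M)).
  { split; [eapply ccont_dCat, dPhi |]. intros x.
    assert (D : Cdom (fun y => H x y) (M / (1 + x ^ 2))).
    { split; [apply DY |]. intros y; refine (proj1 (Rle_div_r _ _ _ _) _); [generalize (W x); lra |]. specialize (b0 x y); cbv beta in *; lra. }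
    apply CI_bound in D; fold (Phi x) in D. generalize (W x); intros.
    apply Rle_trans with ((1 + x ^ 2) * (8 * (M / (1 + x ^ 2)))); [apply Rmult_le_compat_l; lra |].
    right; field; lra. }
  set (Psi := fun y => CI (fun x => H x y)).
  assert (CPsi : ccont Psi).
  { apply ccont_lip with (8 * (2 * M)); intros y y'. unfold Psi.
    rewrite <- (CI_sub _ _ _ _ (DX y) (DX y')).
    rewrite Rmult_assoc. apply CI_bound; split; [apply (Cdom_sub _ _ _ _ (DX y) (DX y')) |].
    intros x. apply Rle_trans with ((1 + x ^ 2) * (2 * (M / (1 + x ^ 2)) * Rabs (y - y'))).
    - apply Rmult_le_compat_l; [generalize (W x); lra |].
      apply (mean_C (fun y => H x y) (fun y => Hy x y)); auto.
      intros t _; apply Rle_div_r; [generalize (W x); lra |]. rewrite Rmult_comm; auto.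
    - right; field. generalize (W x); lra. }
  assert (DPsi : Cdom Psi (8 * M)).
  { split; auto. intros y.
    assert (D : Cdom (fun x => H x y) (M / (1 + y ^ 2))).
    { split; [apply DX |]. intros x; refine (proj1 (Rle_div_r _ _ _ _) _); [generalize (W y); lra |]. specialize (b0 x y); cbv beta in *; lra. }
    apply CI_bound in D; fold (Psi y) in D. generalize (W y); intros.
    apply Rle_trans with ((1 + y ^ 2) * (8 * (M / (1 + y ^ 2)))); [apply Rmult_le_compat_l; lra |].
    right; field; lra. }
  destruct (choose_fun (fun y A => (forall x, dCat A x (H x y)) /\ A 0 = C0)) as [A HA].
  { intros y; apply anti_exists, DX. }
  assert (HAb : forall y x, Cmod (A y x) <= 2 * (M / (1 + y ^ 2)) * Rabs x).
  { intros y x; destruct (HA y) as [D E0].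
    replace (A y x) with (Csub (A y x) (A y 0)) by (rewrite E0; ring).
    replace (Rabs x) with (Rabs (x - 0)) by (f_equal; ring).
    apply (mean_C (A y) (fun x => H x y)); auto.
    intros t _; apply Rle_div_r; [generalize (W y); lra |]. rewrite Rmult_comm; auto. }
  assert (DA : forall x, Cdom (fun y => A y x) (2 * M * Rabs x)).
  { intros x; split.
    - apply ccont_lip with (2 * (2 * M) * Rabs x); intros y y'.
      replace (Csub (A y x) (A y' x)) with (Csub (Csub (A y x) (A y' x)) (Csub (A y 0) (A y' 0)))
        by (rewrite (proj2 (HA y)), (proj2 (HA y')); ring).
      replace (2 * (2 * M) * Rabs x * Rabs (y - y')) with (2 * (2 * M * Rabs (y - y')) * Rabs (x - 0)).
      2:{ replace (x - 0) with x by ring; ring. }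
      apply (mean_C (fun x => Csub (A y x) (A y' x)) (fun x => Csub (H x y) (H x y'))).
      + intros t _; apply dCat_sub; [apply (HA y) | apply (HA y')].
      + intros t _; apply (mean_C (fun y => H t y) (fun y => Hy t y)); auto.
    - intros y; apply Rle_trans with ((1 + y ^ 2) * (2 * (M / (1 + y ^ 2)) * Rabs x)).
      + apply Rmult_le_compat_l; [generalize (W y); lra | apply HAb].
      + right; field. generalize (W y); lra. }
  set (B := fun x => CI (fun y => A y x)).
  assert (dB : forall x, dCat B x (Phi x)).
  { intros x; apply (CI_param (fun y x => A y x) (fun y x => H x y) x (2 * M) (2 * M * (Rabs x + 1)) M); auto.
    - intros x' Hx'; destruct (DA x') as [E1 E2]; split; auto. intros y; eapply Rle_trans; [apply E2 |].
      apply Rmult_le_compat_l; [lra |]. revert Hx'; unfold Rabs; repeat destruct Rcase_abs; lra.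
    - intros x' y Hx'.
      apply Rle_trans with ((1 + y ^ 2) * (2 * (M / (1 + y ^ 2)) * (x' - x) ^ 2)).
      + apply Rmult_le_compat_l; [generalize (W y); lra |].
        apply (taylor_C (A y) (fun x => H x y) (fun x => Hx x y)); auto.
        * intros t _; apply (HA y).
        * intros t _; apply Rle_div_r; [generalize (W y); lra |]. rewrite Rmult_comm; auto.
      + right; field. generalize (W y); lra. }
  assert (E : CImproper Phi (CI Psi)).
  { apply (CImproper_anti Phi B); [apply DPhi | auto |]. intros eps He.
    exists (Rmax 1 (8 * (4 * M) / eps)); intros a b Ha Hb.
    set (X := Rmax 1 (8 * (4 * M) / eps)) in *.
    assert (1 <= X /\ 8 * (4 * M) / eps <= X) as [X1 X2] by (split; [apply Rmax_l | apply Rmax_r]).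
    unfold B; rewrite <- (CI_sub _ _ _ _ (DA b) (DA a)).
    rewrite <- (CI_sub _ _ _ _ (Cdom_sub _ _ _ _ (DA b) (DA a)) DPsi).
    apply Rle_trans with (8 * (4 * M / X)).
    - apply CI_bound; split; [apply (Cdom_sub _ _ _ _ (Cdom_sub _ _ _ _ (DA b) (DA a)) DPsi) |].
      intros y. assert (D : Cdom (fun x => H x y) (M / (1 + y ^ 2))).
      { split; [apply DX |]. intros x; refine (proj1 (Rle_div_r _ _ _ _) _); [generalize (W y); lra |]. specialize (b0 x y); cbv beta in *; lra. }
      apply Rle_trans with ((1 + y ^ 2) * (4 * (M / (1 + y ^ 2)) / X)).
      + apply Rmult_le_compat_l; [generalize (W y); lra |]. apply (CI_tail _ _ (A y) X a b D); auto. apply (HA y).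
      + right; field. generalize (W y); lra.
    - apply Rle_div_l in X2; auto. replace (8 * (4 * M / X)) with (8 * (4 * M) / X) by (field; lra).
      apply Rle_div_l; lra. }
  apply CI_val in E. split; [now rewrite E | split; auto].
  rewrite E; now apply CI_spec with (8 * M).
Qed.

(** * Fourier transform *)

Definition cis (t : R) : Cx := (cos t, sin t).

Lemma Cmod_cis t : Cmod (cis t) = 1.
Proof.
  unfold Cmod, cis; simpl. replace (cos t * (cos t * 1) + sin t * (sin t * 1)) with (Rsqr (sin t) + Rsqr (cos t)) by (unfold Rsqr; ring).
  rewrite sin2_cos2; apply sqrt_1.
Qed.

Lemma cis_0 : cis 0 = C1.
Proof. unfold cis; now rewrite cos_0, sin_0. Qed.

Lemma cis_add s t : cis (s + t) = Cmul (cis s) (cis t).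
Proof. unfold cis, Cmul; simpl; rewrite cos_plus, sin_plus; f_equal; ring. Qed.

Lemma dCat_cis c t : dCat (fun t => cis (c * t)) t (Cmul (Cmul Ci (RtoC c)) (cis (c * t))).
Proof.
  apply dCat_is; split; unfold cis; simpl.
  - auto_derive; [trivial | ring].
  - auto_derive; [trivial | ring].
Qed.

Lemma Schwartz_ccont f k : Schwartz1 f -> ccont (f k).
Proof. intros H; apply ccont_dCat with (f (S k)); intros; now apply Schwartz_dCat. Qed.

Lemma bd_weight N f B i k x : bd N f B -> (i + 2 <= N)%nat -> (k <= N)%nat ->
  (1 + x ^ 2) * (Rabs x ^ i * Cmod (f k x)) <= 2 * B.
Proof.
  intros H Hi Hk. assert (A := H i k ltac:(lia) Hk x). assert (A' := H (i + 2)%nat k ltac:(lia) Hk x).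
  rewrite pow_add, pow2_abs in A'. lra.
Qed.

Lemma bd_Cdom N f B k : Schwartz1 f -> bd N f B -> (2 <= N)%nat -> (k <= N)%nat -> Cdom (f k) (2 * B).
Proof.
  intros Hf H HN Hk; split; [now apply Schwartz_ccont |]; intros x.
  generalize (bd_weight N f B O k x H HN Hk); simpl; lra.
Qed.

Lemma Cdom_mod1 f g M : Cdom f M -> ccont g -> (forall x, Cmod (g x) = Cmod (f x)) -> Cdom g M.
Proof. intros [_ H] Hg E; split; auto; intros x; rewrite E; auto. Qed.

Lemma Schwartz_cis_ccont f k c : Schwartz1 f -> ccont (fun x => Cmul (f k x) (cis (c * x))).
Proof.
  intros Hf; eapply ccont_dCat; intros x; apply dCat_mul; [now apply Schwartz_dCat | apply dCat_cis].
Qed.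

Definition F0 (f : Fam1) (xi : R) : Cx := CI (fun x => Cmul (f O x) (cis (- xi * x))).

Lemma F0_dom N f B k xi : Schwartz1 f -> bd N f B -> (2 <= N)%nat -> (k <= N)%nat ->
  Cdom (fun x => Cmul (f k x) (cis (xi * x))) (2 * B).
Proof.
  intros Hf H HN Hk; apply Cdom_mod1 with (f k).
  - now apply bd_Cdom with N.
  - now apply Schwartz_cis_ccont.
  - intros x; rewrite Cmod_mul, Cmod_cis; ring.
Qed.

Lemma F0_bound f B xi : Schwartz1 f -> bd 2 f B -> Cmod (F0 f xi) <= 16 * B.
Proof.
  intros Hf H; generalize (CI_bound _ _ (F0_dom 2 f B O (- xi) Hf H ltac:(lia) ltac:(lia))). unfold F0; lra.
Qed.

Lemma F0_add f g xi : Schwartz1 f -> Schwartz1 g -> F0 (fadd1 f g) xi = Cadd (F0 f xi) (F0 g xi).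
Proof.
  intros Hf Hg; destruct (Schwartz_bd f 2 Hf) as [B HB]; destruct (Schwartz_bd g 2 Hg) as [B' HB'].
  unfold F0; rewrite <- (CI_add _ _ _ _ (F0_dom 2 f B O (- xi) Hf HB ltac:(lia) ltac:(lia)) (F0_dom 2 g B' O (- xi) Hg HB' ltac:(lia) ltac:(lia))).
  f_equal; apply functional_extensionality; intros; unfold fadd1; ring.
Qed.

Lemma F0_scal c f xi : Schwartz1 f -> F0 (fscal1 c f) xi = Cmul c (F0 f xi).
Proof.
  intros Hf; destruct (Schwartz_bd f 2 Hf) as [B HB].
  unfold F0; rewrite <- (CI_cmul c _ _ (F0_dom 2 f B O (- xi) Hf HB ltac:(lia) ltac:(lia))).
  f_equal; apply functional_extensionality; intros; unfold fscal1; ring.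
Qed.

Definition nM (f : Fam1) : Fam1 := fscal1 (Copp Ci) (fM1 f).

Lemma SLin_nM : SLin nM.
Proof. exact (SLin_comp (fscal1 (Copp Ci)) fM1 (SLin_scal _) SLin_M). Qed.

Lemma fM1_0 f x : fM1 f O x = Cmul (RtoC x) (f O x).
Proof. unfold fM1; simpl; rewrite !Cscal_mul, RtoC_0; ring. Qed.

Lemma oD_0 f k x : oD f k x = Cmul Ci (f (S k) x).
Proof. unfold oD, fopp1, fD1; ring. Qed.

Lemma F0_deriv f xi : Schwartz1 f -> dCat (F0 f) xi (F0 (nM f) xi).
Proof.
  intros Hf; destruct (Schwartz_bd f 4 Hf) as [B HB].
  assert (Hn : Schwartz1 (nM f)) by (apply SL_S; auto; apply SLin_nM).
  destruct (Schwartz_bd (nM f) 2 Hn) as [B' HB'].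
  apply (CI_param (fun x xi => Cmul (f O x) (cis (- xi * x))) (fun x xi => Cmul (nM f O x) (cis (- xi * x))) xi (2 * (2 * B)) (2 * B) (2 * B')).
  - intros y _. now apply F0_dom with 4%nat; auto; try lia.
  - now apply F0_dom with 2%nat; auto; try lia.
  - intros y x _.
    assert (E : forall c, cis (- c * x) = cis (- x * c)) by (intros; f_equal; ring).
    replace (Csub (Csub (Cmul (f O x) (cis (- y * x))) (Cmul (f O x) (cis (- xi * x)))) (Cscal (y - xi) (Cmul (nM f O x) (cis (- xi * x)))))
      with (Cmul (f O x) (Csub (Csub (cis (- x * y)) (cis (- x * xi))) (Cscal (y - xi) (Cmul (Cmul Ci (RtoC (- x))) (cis (- x * xi)))))).
    2:{ rewrite !E; unfold nM, fscal1; rewrite fM1_0, !Cscal_mul, RtoC_opp; ring. }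
    rewrite Cmod_mul.
    assert (T : Cmod (Csub (Csub (cis (- x * y)) (cis (- x * xi))) (Cscal (y - xi) (Cmul (Cmul Ci (RtoC (- x))) (cis (- x * xi))))) <= 2 * x ^ 2 * (y - xi) ^ 2).
    { apply (taylor_C (fun t => cis (- x * t)) (fun t => Cmul (Cmul Ci (RtoC (- x))) (cis (- x * t)))
        (fun t => Cmul (Cmul Ci (RtoC (- x))) (Cmul (Cmul Ci (RtoC (- x))) (cis (- x * t))))).
      - intros t _; apply dCat_cis.
      - intros t _; apply dCat_cmul, dCat_cis.
      - intros t _; rewrite !Cmod_mul, Cmod_cis, Cmod_Ci, Cmod_RtoC, Rabs_Ropp. rewrite <- (pow2_abs x); right; ring. }
    generalize (bd_weight 4 f B 2 O x HB ltac:(lia) ltac:(lia)); rewrite pow2_abs; intros W.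
    generalize (Cmod_pos (f O x)) (pow2_ge_0 x) (pow2_ge_0 (y - xi)); intros.
    apply Rle_trans with ((1 + x ^ 2) * (Cmod (f O x) * (2 * x ^ 2 * (y - xi) ^ 2))).
    + apply Rmult_le_compat_l; [lra |]; now apply Rmult_le_compat_l.
    + replace ((1 + x ^ 2) * (Cmod (f O x) * (2 * x ^ 2 * (y - xi) ^ 2))) with
        (2 * (y - xi) ^ 2 * ((1 + x ^ 2) * (x ^ 2 * Cmod (f O x)))) by ring.
      replace (2 * (2 * B) * (y - xi) ^ 2) with (2 * (y - xi) ^ 2 * (2 * B)) by ring.
      apply Rmult_le_compat_l; [lra | auto].
Qed.

Lemma F0_oD f xi : Schwartz1 f -> F0 (oD f) xi = Cmul (RtoC (- xi)) (F0 f xi).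
Proof.
  intros Hf; destruct (Schwartz_bd f 2 Hf) as [B HB].
  assert (D0 := F0_dom 2 f B O (- xi) Hf HB ltac:(lia) ltac:(lia)).
  assert (D1 := F0_dom 2 f B 1 (- xi) Hf HB ltac:(lia) ltac:(lia)).
  assert (E : CI (fun x => Cadd (Cmul (f 1%nat x) (cis (- xi * x))) (Cmul (Cmul Ci (RtoC (- xi))) (Cmul (f O x) (cis (- xi * x))))) = C0).
  { apply (CI_deriv (fun x => Cmul (f O x) (cis (- xi * x))) _ B).
    - apply (Cdom_add _ _ _ _ D1 (Cdom_cmul (Cmul Ci (RtoC (- xi))) _ _ D0)).
    - intros x; eapply eq_ind; [apply dCat_mul; [apply (Schwartz_dCat f O x Hf) | apply dCat_cis] |]. cbv beta; ring.
    - intros x; rewrite Cmod_mul, Cmod_cis, Rmult_1_r. generalize (HB 1%nat O ltac:(lia) ltac:(lia) x); simpl; lra. }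
  rewrite (CI_add _ _ _ _ D1 (Cdom_cmul (Cmul Ci (RtoC (- xi))) _ _ D0)), (CI_cmul _ _ _ D0) in E.
  fold (F0 f xi) in E.
  assert (K : F0 (oD f) xi = Cmul Ci (CI (fun x => Cmul (f 1%nat x) (cis (- xi * x))))).
  { unfold F0; rewrite <- (CI_cmul _ _ _ D1). f_equal; apply functional_extensionality; intros x; rewrite oD_0; ring. }
  rewrite K. set (A := CI _) in *.
  replace A with (Csub (Cadd A (Cmul (Cmul Ci (RtoC (- xi))) (F0 f xi))) (Cmul (Cmul Ci (RtoC (- xi))) (F0 f xi))) by ring.
  rewrite E. transitivity (Copp (Cmul (Cmul Ci Ci) (Cmul (RtoC (- xi)) (F0 f xi)))); [ring | rewrite Ci2; ring].
Qed.

(** The [k]-th derivative of the transform is the transform of [(- i x)^k f]. There is no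
    normalising factor. *)
Definition FT (f : Fam1) : Fam1 := fun k xi => F0 (Nat.iter k nM f) xi.

Lemma nM_iter_S k f : Schwartz1 f -> Schwartz1 (Nat.iter k nM f).
Proof. intros; apply (SL_S _ (SLin_iter k nM SLin_nM)); auto. Qed.

Lemma SL_unif (T : nat -> Fam1 -> Fam1) n N : (forall i, SLin (T i)) -> exists (N' : nat) C, 0 <= C /\
  forall i, (i < n)%nat -> forall f B, Schwartz1 f -> bd N' f B -> bd N (T i f) (C * B).
Proof.
  intros HT; induction n as [|n [N1 [C1' [H1 K1]]]]; [exists O, 0; split; [lra | intros; lia] |].
  destruct (SL_bd _ (HT n) N) as [N2 [C2 [H2 K2]]].
  exists (max N1 N2), (C1' + C2); split; [lra |]; intros i Hi f B Hf HB. assert (HB0 := bd_pos _ _ _ HB).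
  destruct (Nat.eq_dec i n) as [->|].
  - apply bd_mono with N (C2 * B); auto; [nra |]. apply K2; auto. apply bd_mono with (max N1 N2) B; auto; [lia | lra].
  - apply bd_mono with N (C1' * B); auto; [nra |]. apply K1; auto; [lia |]. apply bd_mono with (max N1 N2) B; auto; [lia | lra].
Qed.

Lemma F0_oD_iter j f xi : Schwartz1 f -> F0 (Nat.iter j oD f) xi = Cmul (RtoC ((- xi) ^ j)) (F0 f xi).
Proof.
  intros Hf; induction j as [|j IH]; [simpl; rewrite RtoC_1; ring |].
  simpl Nat.iter; rewrite F0_oD, IH by (apply (SL_S _ (SLin_iter j oD SLin_oD)); auto). simpl; rewrite RtoC_mul; ring.
Qed.

Lemma FT_bd N : exists (N' : nat) C, 0 <= C /\ forall f B, Schwartz1 f -> bd N' f B -> bd N (FT f) (C * B).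
Proof.
  destruct (SL_unif (fun j => Nat.iter j oD) (S N) 2 (fun j => SLin_iter j oD SLin_oD)) as [N1 [C1' [H1 K1]]].
  destruct (SL_unif (fun k => Nat.iter k nM) (S N) N1 (fun k => SLin_iter k nM SLin_nM)) as [N2 [C2 [H2 K2]]].
  exists N2, (16 * (C1' * C2)); split; [nra |]; intros f B Hf HB j k Hj Hk x. unfold FT.
  assert (E : Rabs x ^ j * Cmod (F0 (Nat.iter k nM f) x) = Cmod (F0 (Nat.iter j oD (Nat.iter k nM f)) x)).
  { rewrite F0_oD_iter, Cmod_mul, Cmod_RtoC, <- RPow_abs, Rabs_Ropp by (now apply nM_iter_S). auto. }
  rewrite E. replace (16 * (C1' * C2) * B) with (16 * (C1' * (C2 * B))) by ring.
  apply F0_bound; [apply (SL_S _ (SLin_iter j oD SLin_oD)); now apply nM_iter_S |].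
  apply K1; [lia | now apply nM_iter_S |]. apply K2; auto; lia.
Qed.

Lemma FT_S f : Schwartz1 f -> Schwartz1 (FT f).
Proof.
  intros Hf; apply Schwartz_intro.
  - intros k x; unfold FT; simpl. apply F0_deriv; now apply nM_iter_S.
  - intros N; destruct (FT_bd N) as [N' [C [_ H]]]; destruct (Schwartz_bd f N' Hf) as [B HB].
    exists (C * B); auto.
Qed.

Lemma SLin_FT : SLin FT.
Proof.
  split.
  - apply FT_S.
  - intros f g Hf Hg; apply fam_ext; intros k x; unfold FT.
    rewrite (SL_add _ (SLin_iter k nM SLin_nM)) by auto. unfold fadd1 at 2. apply F0_add; now apply nM_iter_S.
  - intros c f Hf; apply fam_ext; intros k x; unfold FT.
    rewrite (SL_scal _ (SLin_iter k nM SLin_nM)) by auto. unfold fscal1 at 2. apply F0_scal; now apply nM_iter_S.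
  - intros N; destruct (FT_bd N) as [N' [C [HC H]]]; exists N', C; auto.
Qed.

Lemma FT_M f : Schwartz1 f -> FT (fM1 f) = oD (FT f).
Proof.
  intros Hf; apply fam_ext; intros k x; rewrite oD_0; unfold FT.
  simpl Nat.iter. rewrite <- (F0_scal Ci).
  - f_equal. replace (nM (Nat.iter k nM f)) with (Nat.iter k nM (nM f)).
    + rewrite <- (SL_scal _ (SLin_iter k nM SLin_nM)).
      * f_equal. apply fam_ext; intros; unfold nM, fscal1.
        transitivity (Copp (Cmul (Cmul Ci Ci) (fM1 f k0 x0))); [rewrite Ci2; ring | ring].
      * apply SL_S; auto; apply SLin_nM.
    + clear. induction k as [|k IH]; simpl; auto. now rewrite IH.
  - apply (nM_iter_S (S k)); auto.
Qed.

Lemma FT_oD f : Schwartz1 f -> FT (oD f) = fopp1 (fM1 (FT f)).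
Proof.
  intros Hf; apply Schwartz_ext.
  - apply FT_S, SL_S; auto; apply SLin_oD.
  - apply Schwartz_opp, SL_S; [apply SLin_M | now apply FT_S].
  - intros x; unfold fopp1; rewrite fM1_0; unfold FT at 1; simpl. rewrite F0_oD by auto.
    unfold FT; simpl; rewrite RtoC_opp; ring.
Qed.

Lemma FT_pairing f g : Schwartz1 f -> Schwartz1 g ->
  CI (fun y => Cmul (FT f O y) (g O y)) = CI (fun x => Cmul (f O x) (FT g O x)).
Proof.
  intros Hf Hg.
  destruct (Schwartz_bd f 4 Hf) as [A HA]. destruct (Schwartz_bd g 4 Hg) as [B HB].
  assert (HA0 := bd_pos _ _ _ HA). assert (HB0 := bd_pos _ _ _ HB).
  set (e := fun x y => cis (- x * y)).
  assert (ex : forall x y, dCat (fun t => e t y) x (Cmul (Cmul Ci (RtoC (- y))) (e x y))).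
  { intros x y; unfold e. apply (dCat_ext (fun t => cis (- y * t))); [intros; f_equal; ring |].
    replace (- x * y) with (- y * x) by ring; apply dCat_cis. }
  assert (ey : forall x y, dCat (fun t => e x t) y (Cmul (Cmul Ci (RtoC (- x))) (e x y))) by (intros; apply dCat_cis).
  assert (Wf : forall i k x, (i <= 2)%nat -> (k <= 2)%nat -> (1 + x ^ 2) * (Rabs x ^ i * Cmod (f k x)) <= 2 * A)
    by (intros; apply bd_weight with 4%nat; auto; lia).
  assert (Wg : forall i k y, (i <= 2)%nat -> (k <= 2)%nat -> (1 + y ^ 2) * (Rabs y ^ i * Cmod (g k y)) <= 2 * B)
    by (intros; apply bd_weight with 4%nat; auto; lia).
  assert (Wt : forall i j k l c x y, (i <= 2)%nat -> (j <= 2)%nat -> (k <= 2)%nat -> (l <= 2)%nat -> 0 <= c ->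
     (1 + x ^ 2) * (1 + y ^ 2) * (c * (Rabs x ^ i * Cmod (f k x)) * (Rabs y ^ j * Cmod (g l y))) <= c * (2 * A * (2 * B))).
  { intros i j k l c x y Hi Hj Hk Hl Hc.
    replace ((1 + x ^ 2) * (1 + y ^ 2) * (c * (Rabs x ^ i * Cmod (f k x)) * (Rabs y ^ j * Cmod (g l y)))) with
      (c * (((1 + x ^ 2) * (Rabs x ^ i * Cmod (f k x))) * ((1 + y ^ 2) * (Rabs y ^ j * Cmod (g l y))))) by ring.
    apply Rmult_le_compat_l; auto. apply Rmult_le_compat; auto.
    - apply Rmult_le_pos; [nra | apply Rmult_le_pos; [apply pow_le, Rabs_pos | apply Cmod_pos]].
    - apply Rmult_le_pos; [nra | apply Rmult_le_pos; [apply pow_le, Rabs_pos | apply Cmod_pos]]. }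
  set (T := fun k l (p : Cx) x y => Cmul p (Cmul (Cmul (f k x) (g l y)) (e x y))).
  assert (Tm : forall k l p x y, Cmod (T k l p x y) = Cmod p * Cmod (f k x) * Cmod (g l y)).
  { intros; unfold T, e; rewrite !Cmod_mul, Cmod_cis; ring. }
  set (H := T O O C1).
  set (Hx := fun x y => Cadd (T 1%nat O C1 x y) (T O O (Cmul Ci (RtoC (- y))) x y)).
  set (Hxx := fun x y => Cadd (T 2%nat O C1 x y) (Cadd (T 1%nat O (Cmul (RtoC 2) (Cmul Ci (RtoC (- y)))) x y)
     (T O O (Cmul (Cmul Ci (RtoC (- y))) (Cmul Ci (RtoC (- y)))) x y))).
  set (Hy := fun x y => Cadd (T O 1%nat C1 x y) (T O O (Cmul Ci (RtoC (- x))) x y)).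
  assert (dTx : forall k l p x y, dCat (fun t => T k l p t y) x (Cadd (T (S k) l p x y) (T k l (Cmul p (Cmul Ci (RtoC (- y)))) x y))).
  { intros k l p x y; unfold T.
    eapply eq_ind; [apply dCat_cmul; apply dCat_mul; [apply dCat_mul; [apply (Schwartz_dCat f k x Hf) | apply dCat_const] | apply ex] |]. cbv beta; ring. }
  assert (dTy : forall k l p x y, dCat (fun t => T k l p x t) y (Cadd (T k (S l) p x y) (T k l (Cmul p (Cmul Ci (RtoC (- x)))) x y))).
  { intros k l p x y; unfold T.
    eapply eq_ind; [apply dCat_cmul; apply dCat_mul; [apply dCat_cmul; apply (Schwartz_dCat g l y Hg) | apply ey] |]. cbv beta; ring. }
  (* The factor 4 is the sum [1 + 2 + 1] of the coefficients in [Hxx]. *)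
  set (M := 4 * (2 * A * (2 * B))).
  assert (HAB : 0 <= 2 * A * (2 * B)) by nra.
  assert (P : forall x y, 0 <= (1 + x ^ 2) * (1 + y ^ 2)) by (intros; apply Rmult_le_pos; nra).
  destruct (fubini H Hx Hxx Hy M) as [E _].
  - intros x y; unfold H, Hx. eapply eq_ind; [apply dTx |]. unfold T; ring.
  - intros x y; unfold Hx, Hxx. eapply eq_ind; [apply dCat_add; [apply dTx |] |].
    + apply dTx.
    + unfold T. replace (RtoC 2) with (Cadd C1 C1) by (rewrite <- RtoC_1, <- RtoC_add; f_equal; ring). ring.
  - intros x y; unfold H, Hy. eapply eq_ind; [apply dTy |]. unfold T; ring.
  - intros x; unfold Hx. apply ccont_add.
    + eapply ccont_dCat; intros y; apply dTy.
    + apply ccont_dCat with (fun y => Cadd (Cmul (Cmul Ci (RtoC (- (1)))) (T O O C1 x y)) (Cmul (Cmul Ci (RtoC (- y)))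
         (Cadd (T O 1%nat C1 x y) (T O O (Cmul C1 (Cmul Ci (RtoC (- x)))) x y)))).
      intros y. apply (dCat_ext (fun t => Cmul (Cmul Ci (RtoC (- t))) (T O O C1 x t))); [intros; unfold T; ring |].
      apply (dCat_mul (fun t => Cmul Ci (RtoC (- t)))); [| apply dTy].
      apply dCat_cmul, (dCat_RtoC Ropp).
      assert (D : is_derive (fun t : R => - t) y (- (1))) by (auto_derive; [trivial | ring]). exact D.
  - intros x y; unfold H; rewrite Tm, Cmod_C1.
    generalize (Wt O O O O 1 x y ltac:(lia) ltac:(lia) ltac:(lia) ltac:(lia) ltac:(lra)); simpl; unfold M; simpl in *; nra.
  - intros x y; unfold Hx. eapply Rle_trans; [apply Rmult_le_compat_l; [apply P | apply Cmod_add] |].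
    rewrite !Tm, Cmod_C1, Cmod_mul, Cmod_Ci, Cmod_RtoC, Rabs_Ropp.
    generalize (Wt O O 1%nat O 1 x y ltac:(lia) ltac:(lia) ltac:(lia) ltac:(lia) ltac:(lra)).
    generalize (Wt O 1%nat O O 1 x y ltac:(lia) ltac:(lia) ltac:(lia) ltac:(lia) ltac:(lra)); simpl; unfold M; lra.
  - intros x y; unfold Hxx. eapply Rle_trans.
    { apply Rmult_le_compat_l; [apply P |]. eapply Rle_trans; [apply Cmod_add | apply Rplus_le_compat_l, Cmod_add]. }
    rewrite !Tm, !Cmod_mul, Cmod_C1, Cmod_Ci, !Cmod_RtoC, Rabs_Ropp, (Rabs_pos_eq 2) by lra.
    generalize (Wt O O 2%nat O 1 x y ltac:(lia) ltac:(lia) ltac:(lia) ltac:(lia) ltac:(lra)).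
    generalize (Wt O 1%nat 1%nat O 2 x y ltac:(lia) ltac:(lia) ltac:(lia) ltac:(lia) ltac:(lra)).
    generalize (Wt O 2%nat O O 1 x y ltac:(lia) ltac:(lia) ltac:(lia) ltac:(lia) ltac:(lra)); simpl; unfold M; lra.
  - intros x y; unfold Hy. eapply Rle_trans; [apply Rmult_le_compat_l; [apply P | apply Cmod_add] |].
    rewrite !Tm, Cmod_C1, Cmod_mul, Cmod_Ci, Cmod_RtoC, Rabs_Ropp.
    generalize (Wt O O O 1%nat 1 x y ltac:(lia) ltac:(lia) ltac:(lia) ltac:(lia) ltac:(lra)).
    generalize (Wt 1%nat O O O 1 x y ltac:(lia) ltac:(lia) ltac:(lia) ltac:(lia) ltac:(lra)); simpl; unfold M; lra.
  - transitivity (CI (fun y => CI (fun x => H x y))); [| rewrite E].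
    + f_equal; apply functional_extensionality; intros y. unfold FT; simpl; unfold F0.
      transitivity (Cmul (g O y) (CI (fun x => Cmul (f O x) (cis (- y * x))))); [ring |].
      rewrite <- (CI_cmul (g O y) _ _ (F0_dom 4 f A O (- y) Hf HA ltac:(lia) ltac:(lia))).
      f_equal; apply functional_extensionality; intros x; unfold H, T, e.
      replace (- x * y) with (- y * x) by ring. ring.
    + f_equal; apply functional_extensionality; intros x. unfold FT; simpl; unfold F0.
      rewrite <- (CI_cmul (f O x) _ _ (F0_dom 4 g B O (- x) Hg HB ltac:(lia) ltac:(lia))).
      f_equal; apply functional_extensionality; intros y; unfold H, T, e. ring.
Qed.

Lemma pow_exp_bound (d : nat) : exists K, 0 <= K /\ forall y, 0 <= y -> y ^ d <= K * exp y.
Proof.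
  destruct d as [|d]; [exists 1; split; [lra |]; intros y Hy; simpl; generalize (exp_ge y); lra |].
  set (n := INR (S d)). assert (Hn : 0 < n) by (apply (lt_INR 0); lia).
  exists (n ^ S d); split; [apply pow_le; lra |]; intros y Hy.
  assert (E : exp y = exp (y / n) ^ S d).
  { rewrite <- Rpower_pow by apply exp_pos; unfold Rpower; rewrite ln_exp; f_equal; unfold n; field. apply not_0_INR; lia. }
  rewrite E, <- Rpow_mult_distr; apply pow_incr; split; auto.
  generalize (exp_ge (y / n)); intros. apply Rle_trans with (n * (y / n)); [right; field; lra |].
  apply Rmult_le_compat_l; lra.
Qed.

Lemma gaussian_exists : exists g : Fam1, Schwartz1 g /\ (forall x, g O x = RtoC (exp (- (x * x) / 2))) /\
  forall x, g 1%nat x = Cmul (RtoC (- x)) (g O x).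
Proof.
  set (E := fun x => exp (- (x * x) / 2)).
  assert (DE : forall x, is_derive E x (- x * E x)) by (intros x; unfold E; auto_derive; [trivial | unfold Rdiv; field]).
  (* [nx] maps the coefficients of a polynomial [p] to those of [p' - x p], so the derivatives are,
     up to sign, Hermite polynomials times the Gaussian. *)
  destruct (choose_fun (fun l l' => forall x, dCat (fun t => Cmul (RtoC (E t)) (peval l t)) x (Cmul (RtoC (E x)) (peval l' x)))) as [nx Hnx].
  { intros l; destruct (peval_deriv l) as [f' [Hf' Hd]].
    assert (Hp : ispoly (fun x => Cadd (Cmul (Copp C1) (Cmul (RtoC x) (peval l x))) (f' x))).
    { apply ispoly_add; auto. apply ispoly_scal, ispoly_tmul. now exists l. }
    destruct Hp as [l' Hl']; exists l'; intros x. rewrite <- Hl'.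
    eapply eq_ind; [apply dCat_mul; [apply (dCat_RtoC E); apply DE | apply Hd] |]. cbv beta.
    rewrite RtoC_mul, RtoC_opp; ring. }
  set (g := (fun k x => Cmul (RtoC (E x)) (peval (Nat.iter k nx (C1 :: nil)) x)) : Fam1).
  assert (Hg0 : forall x, g O x = RtoC (E x)) by (intros x; unfold g; simpl; ring).
  assert (Hdg : forall k x, dCat (g k) x (g (S k) x)) by (intros k x; apply Hnx).
  exists g; split; [| split; auto].
  - apply Schwartz_intro; auto. intros N.
    assert (B1 : forall j k, exists B, forall x, Rabs x ^ j * Cmod (g k x) <= B).
    { intros j k. destruct (ispoly_bound (peval (Nat.iter k nx (C1 :: nil)))) as [M [d [HM H]]]; [eexists; auto |].
      destruct (pow_exp_bound (j + d)) as [K [HK0 HK]].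
      exists (K * M * exp 2); intros x; unfold g; rewrite Cmod_mul, Cmod_RtoC, (Rabs_pos_eq (E x)) by (left; apply exp_pos).
      specialize (H x). generalize (Rabs_pos x); intros Hx.
      specialize (HK (1 + Rabs x) ltac:(lra)). rewrite pow_add in HK.
      assert (Hj : Rabs x ^ j <= (1 + Rabs x) ^ j) by (apply pow_incr; lra).
      assert (HE : exp (1 + Rabs x) * E x <= exp 2).
      { unfold E; rewrite <- exp_plus; apply exp_le. replace (x * x) with (Rabs x * Rabs x) by (rewrite <- Rabs_mult; apply Rabs_pos_eq; nra).
        generalize (pow2_ge_0 (Rabs x - 1)); lra. }
      assert (PE : 0 < E x) by apply exp_pos.
      assert (Pj : 0 <= Rabs x ^ j) by (apply pow_le; auto).
      assert (Pd : 0 <= (1 + Rabs x) ^ d) by (apply pow_le; lra).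
      apply Rle_trans with ((1 + Rabs x) ^ j * (E x * (M * (1 + Rabs x) ^ d))).
      - apply Rmult_le_compat; auto; [apply Rmult_le_pos; [lra | apply Cmod_pos] |]. apply Rmult_le_compat_l; lra.
      - apply Rle_trans with (M * E x * (K * exp (1 + Rabs x))).
        + replace ((1 + Rabs x) ^ j * (E x * (M * (1 + Rabs x) ^ d))) with (M * E x * ((1 + Rabs x) ^ j * (1 + Rabs x) ^ d)) by ring.
          apply Rmult_le_compat_l; auto. nra.
        + replace (M * E x * (K * exp (1 + Rabs x))) with (K * M * (exp (1 + Rabs x) * E x)) by ring.
          apply Rmult_le_compat_l; auto. nra. }
    assert (G : forall J K : nat, exists B, forall j k, (j < J)%nat -> (k < K)%nat -> forall x, Rabs x ^ j * Cmod (g k x) <= B).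
    { induction J as [|J IHJ]; [intros K; exists 0; intros; lia |].
      induction K as [|K IHK]; [exists 0; intros; lia |].
      destruct IHK as [B1' H1]; destruct (IHJ (S K)) as [B2 H2]; destruct (B1 J K) as [B3 H3].
      exists (Rmax B1' (Rmax B2 B3)); intros j k Hj Hk x.
      destruct (Nat.eq_dec k K) as [->|].
      - destruct (Nat.eq_dec j J) as [->|].
        + eapply Rle_trans; [apply H3 |]; eapply Rle_trans; [| apply Rmax_r]; apply Rmax_r.
        + eapply Rle_trans; [apply H2; lia |]; eapply Rle_trans; [| apply Rmax_r]; apply Rmax_l.
      - eapply Rle_trans; [apply H1; lia | apply Rmax_l]. }
    destruct (G (S N) (S N)) as [B HB]; exists B; intros j k Hj Hk x; apply HB; lia.
  - intros x. apply dCat_unique with (g O) x; auto. rewrite Hg0, <- RtoC_mul.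
    apply (dCat_ext (fun t => RtoC (E t))); auto. apply dCat_RtoC, DE.
Qed.

(** * Translations, dilations and Fourier inversion *)

Definition transl (a : R) (f : Fam1) : Fam1 := fun k x => f k (x + a).

Lemma transl_S a f : Schwartz1 f -> Schwartz1 (transl a f).
Proof.
  intros Hf; apply Schwartz_intro.
  - intros k x; unfold transl.
    replace (f (S k) (x + a)) with (Cscal 1 (f (S k) (x + a))) by (rewrite Cscal_mul, RtoC_1; ring).
    apply (dCat_comp (f k) (fun x => x + a)); [now apply Schwartz_dCat |]. auto_derive; [trivial | ring].
  - intros N. destruct (Schwartz_bd f N Hf) as [B HB]. assert (HB0 := bd_pos _ _ _ HB).
    exists ((1 + Rabs a) ^ N * 2 ^ N * (2 * B)); intros j k Hj Hk x; unfold transl.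
    assert (Q : Rabs x ^ j <= (1 + Rabs a) ^ N * 2 ^ N * (1 + Rabs (x + a) ^ N)).
    { set (y := Rabs (x + a)). generalize (Rabs_pos a) (Rabs_pos (x + a)); fold y; intros Ha Hy.
      assert (Hx : Rabs x <= (1 + Rabs a) * (1 + y)).
      { replace x with ((x + a) - a) at 1 by ring. unfold Rminus; eapply Rle_trans; [apply Rabs_triang |].
        rewrite Rabs_Ropp; fold y; nra. }
      assert (H1 : 1 <= (1 + Rabs a) * (1 + y)) by nra.
      apply Rle_trans with (((1 + Rabs a) * (1 + y)) ^ N).
      - apply Rle_trans with (((1 + Rabs a) * (1 + y)) ^ j); [apply pow_incr; split; [apply Rabs_pos | auto] | now apply Rle_pow].
      - rewrite Rpow_mult_distr, Rmult_assoc; apply Rmult_le_compat_l; [apply pow_le; lra |].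
        assert (H2N : 0 <= 2 ^ N) by (apply pow_le; lra). assert (HyN : 0 <= y ^ N) by (apply pow_le; lra).
        destruct (Rle_dec y 1).
        + apply Rle_trans with (2 ^ N); [apply pow_incr; lra | nra].
        + apply Rle_trans with ((2 * y) ^ N); [apply pow_incr; lra |]. rewrite Rpow_mult_distr; nra. }
    assert (A1 := HB O k ltac:(lia) Hk (x + a)). assert (A2 := HB N k ltac:(lia) Hk (x + a)). simpl in A1.
    assert (QC : 0 <= (1 + Rabs a) ^ N * 2 ^ N) by (apply Rmult_le_pos; apply pow_le; generalize (Rabs_pos a); lra).
    generalize (Cmod_pos (f k (x + a))); intros.
    apply Rle_trans with ((1 + Rabs a) ^ N * 2 ^ N * (1 + Rabs (x + a) ^ N) * Cmod (f k (x + a))).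
    + now apply Rmult_le_compat_r.
    + rewrite Rmult_assoc. apply Rmult_le_compat_l; auto. lra.
Qed.

Definition dilate (c : R) (f : Fam1) : Fam1 := fun k x => Cscal (c ^ k) (f k (c * x)).

Lemma dilate_bd c N f B : c <> 0 -> bd N f B -> bd N (dilate c f) ((1 + / Rabs c) ^ N * (1 + Rabs c) ^ N * B).
Proof.
  intros Hc HB j k Hj Hk x; unfold dilate; rewrite Cmod_scal, <- RPow_abs.
  assert (Hac : 0 < Rabs c) by now apply Rabs_pos_lt.
  assert (Hic : 0 < / Rabs c) by now apply Rinv_0_lt_compat.
  assert (E : Rabs x = / Rabs c * Rabs (c * x)) by (rewrite Rabs_mult; field; lra).
  rewrite E, Rpow_mult_distr.
  assert (A := HB j k Hj Hk (c * x)). assert (HB0 := bd_pos _ _ _ HB).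
  assert ((/ Rabs c) ^ j <= (1 + / Rabs c) ^ N).
  { apply Rle_trans with ((1 + / Rabs c) ^ j); [apply pow_incr; lra | apply Rle_pow; [lra | auto]]. }
  assert (Rabs c ^ k <= (1 + Rabs c) ^ N).
  { apply Rle_trans with ((1 + Rabs c) ^ k); [apply pow_incr; lra | apply Rle_pow; [lra | auto]]. }
  replace ((/ Rabs c) ^ j * Rabs (c * x) ^ j * (Rabs c ^ k * Cmod (f k (c * x)))) with
    ((/ Rabs c) ^ j * Rabs c ^ k * (Rabs (c * x) ^ j * Cmod (f k (c * x)))) by ring.
  apply Rmult_le_compat; auto.
  - apply Rmult_le_pos; apply pow_le; lra.
  - apply Rmult_le_pos; [apply pow_le, Rabs_pos | apply Cmod_pos].
  - apply Rmult_le_compat; auto; apply pow_le; lra.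
Qed.

Lemma SLin_dilate c : c <> 0 -> SLin (dilate c).
Proof.
  intros Hc; split.
  - intros f Hf; apply Schwartz_intro.
    + intros k x; unfold dilate.
      apply (dCat_ext (fun t => Cmul (RtoC (c ^ k)) (f k (c * t)))); [intros; now rewrite Cscal_mul |].
      replace (Cscal (c ^ S k) (f (S k) (c * x))) with (Cmul (RtoC (c ^ k)) (Cscal c (f (S k) (c * x)))) by (simpl; cring).
      apply dCat_cmul, dCat_scale; now apply Schwartz_dCat.
    + intros N; destruct (Schwartz_bd f N Hf) as [B HB]; eexists; apply dilate_bd; eauto.
  - intros; apply fam_ext; intros; unfold dilate, fadd1; cring.
  - intros; apply fam_ext; intros; unfold dilate, fscal1; cring.
  - intros N; exists N, ((1 + / Rabs c) ^ N * (1 + Rabs c) ^ N); split.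
    + assert (0 < / Rabs c) by (apply Rinv_0_lt_compat; now apply Rabs_pos_lt).
      apply Rmult_le_pos; apply pow_le; generalize (Rabs_pos c); lra.
    + intros f B _; now apply dilate_bd.
Qed.

Lemma reflect_dilate : reflect = dilate (-1).
Proof.
  apply functional_extensionality; intros f; apply fam_ext; intros k x; unfold reflect, dilate; do 2 f_equal; ring.
Qed.

Lemma SLin_reflect : SLin reflect.
Proof. rewrite reflect_dilate; apply SLin_dilate; lra. Qed.

Lemma le_eps_zero z K : 0 <= K -> (forall e, 0 < e <= 1 -> Cmod z <= K * e) -> z = C0.
Proof.
  intros HK H; apply Cmod_eq0, Rle_antisym; [| apply Cmod_pos]. apply le_epsilon; intros e He; rewrite Rplus_0_l.
  set (d := Rmin 1 (e / (K + 1))).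
  assert (Hd : 0 < d) by (apply Rmin_pos; [lra | apply Rdiv_lt_0_compat; lra]).
  assert (d <= 1 /\ d <= e / (K + 1)) as [d1 d2] by (split; [apply Rmin_l | apply Rmin_r]).
  eapply Rle_trans; [apply (H d); lra |]. apply Rle_div_r in d2; lra.
Qed.


Lemma ccont_mul f g : ccont f -> ccont g -> ccont (fun x => Cmul (f x) (g x)).
Proof.
  intros Hf Hg x; destruct (Hf x) as [A B]; destruct (Hg x) as [A' B']; split; simpl.
  - apply (continuous_minus (fun t => fst (f t) * fst (g t)) (fun t => snd (f t) * snd (g t))).
    + now apply (continuous_mult (K := R_AbsRing) (fun t => fst (f t)) (fun t => fst (g t))).
    + now apply (continuous_mult (K := R_AbsRing) (fun t => snd (f t)) (fun t => snd (g t))).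
  - apply (continuous_plus (fun t => fst (f t) * snd (g t)) (fun t => snd (f t) * fst (g t))).
    + now apply (continuous_mult (K := R_AbsRing) (fun t => fst (f t)) (fun t => snd (g t))).
    + now apply (continuous_mult (K := R_AbsRing) (fun t => snd (f t)) (fun t => fst (g t))).
Qed.

Lemma Cdom_mulb f g M K : Cdom f M -> ccont g -> (forall x, Cmod (g x) <= K) -> Cdom (fun x => Cmul (f x) (g x)) (M * K).
Proof.
  intros [Cf Hf] Hg HK; split; [now apply ccont_mul |]; intros x; rewrite Cmod_mul, <- Rmult_assoc.
  apply Rmult_le_compat; auto using Cmod_pos. apply Rmult_le_pos; [nra | apply Cmod_pos].
Qed.

Lemma ccont_scale f c : ccont f -> ccont (fun x => f (c * x)).
Proof.
  intros Hf x; split; [apply (continuous_comp (fun x => c * x) (fun y => fst (f y))) |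
    apply (continuous_comp (fun x => c * x) (fun y => snd (f y)))]; try apply Hf;
    apply @ex_derive_continuous; auto_derive; trivial.
Qed.

Lemma Schwartz_sup f B N k x : bd N f B -> (k <= N)%nat -> Cmod (f k x) <= B.
Proof. intros H Hk; generalize (H O k ltac:(lia) Hk x); simpl; lra. Qed.

Lemma Schwartz_lip f B N k x y : Schwartz1 f -> bd N f B -> (S k <= N)%nat -> Cmod (Csub (f k x) (f k y)) <= 2 * B * Rabs (x - y).
Proof.
  intros Hf H Hk; apply (mean_C (f k) (f (S k))).
  - intros; now apply Schwartz_dCat.
  - intros t _; now apply Schwartz_sup with N.
Qed.

(* Dilate in [pair1 (FT f) (dilate e g) = pair1 f (FT (dilate e g))] and let [e] tend to [0]. *)
Lemma inversion_at_0 g f : Schwartz1 g -> g O 0 = C1 -> Schwartz1 f -> CI (FT f O) = Cmul (CI (FT g O)) (f O 0).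
Proof.
  intros Hg Hg0 Hf.
  assert (Hff := FT_S f Hf). assert (Hgg := FT_S g Hg).
  destruct (Schwartz_bd (FT f) 4 Hff) as [A HA]. destruct (Schwartz_bd (FT g) 4 Hgg) as [A' HA'].
  destruct (Schwartz_bd g 2 Hg) as [B HB]. destruct (Schwartz_bd f 2 Hf) as [B' HB'].
  assert (HA0 := bd_pos _ _ _ HA). assert (HA0' := bd_pos _ _ _ HA'). assert (HB0 := bd_pos _ _ _ HB). assert (HB0' := bd_pos _ _ _ HB').
  assert (D1 : Cdom (FT f O) (2 * A)) by (apply bd_Cdom with 4%nat; auto; lia).
  assert (D2 : Cdom (FT g O) (2 * A')) by (apply bd_Cdom with 4%nat; auto; lia).
  assert (D3 : forall e, Cdom (fun y => Cmul (FT f O y) (g O (e * y))) (2 * A * B)).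
  { intros e; apply Cdom_mulb; auto; [apply ccont_scale; now apply Schwartz_ccont |]. intros x; apply Schwartz_sup with 2%nat; auto; lia. }
  assert (D4 : forall e, Cdom (fun y => Cmul (FT g O y) (f O (e * y))) (2 * A' * B')).
  { intros e; apply Cdom_mulb; auto; [apply ccont_scale; now apply Schwartz_ccont |]. intros x; apply Schwartz_sup with 2%nat; auto; lia. }
  assert (Key : forall e, 0 < e -> CI (fun y => Cmul (FT f O y) (g O (e * y))) = CI (fun y => Cmul (FT g O y) (f O (e * y)))).
  { intros e He.
    transitivity (CI (fun y => Cmul (FT f O y) (dilate e g O y))).
    { f_equal; apply functional_extensionality; intros y; unfold dilate; simpl. rewrite Cscal_mul, RtoC_1; ring. }
    assert (Sd : Schwartz1 (dilate e g)) by (apply (SL_S _ (SLin_dilate e ltac:(lra))); auto).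
    rewrite FT_pairing by auto.
    assert (Efg : forall x, FT (dilate e g) O (e * x) = Cscal (/ e) (FT g O x)).
    { intros x; unfold FT; simpl; unfold F0. apply CI_val.
      assert (D := F0_dom 2 g B O (- x) Hg HB ltac:(lia) ltac:(lia)).
      generalize (CI_affine _ _ e 0 (proj1 D) (CI_spec _ _ D) ltac:(lra)). rewrite (Rabs_pos_eq e) by lra.
      replace (fun t => Cmul (g O (e * t + 0)) (cis (- x * (e * t + 0)))) with (fun t => Cmul (dilate e g O t) (cis (- (e * x) * t))); auto.
      apply functional_extensionality; intros t; unfold dilate; simpl. rewrite Rplus_0_r, Cscal_mul, RtoC_1.
      replace (- (e * x) * t) with (- x * (e * t)) by ring. ring. }
    set (u := fun x => Cmul (f O x) (FT (dilate e g) O x)).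
    destruct (Schwartz_bd (FT (dilate e g)) 2 (FT_S _ Sd)) as [B2 HB2].
    assert (Du : Cdom u (2 * B' * B2)).
    { apply Cdom_mulb; [apply bd_Cdom with 2%nat; auto; lia | apply Schwartz_ccont; now apply FT_S |].
      intros x; apply Schwartz_sup with 2%nat; auto; lia. }
    assert (K := CI_val _ _ (CI_affine _ _ e 0 (proj1 Du) (CI_spec _ _ Du) ltac:(lra))). rewrite (Rabs_pos_eq e) in K by lra.
    replace (fun x => u (e * x + 0)) with (fun y => Cmul (RtoC (/ e)) (Cmul (FT g O y) (f O (e * y)))) in K.
    - rewrite (CI_cmul _ _ _ (D4 e)), Cscal_mul in K.
      apply (f_equal (Cmul (RtoC e))) in K.
      replace (Cmul (RtoC e) (Cmul (RtoC (/ e)) (CI u))) with (Cmul (RtoC (e * / e)) (CI u)) in K by cring.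
      replace (Cmul (RtoC e) (Cmul (RtoC (/ e)) (CI (fun y => Cmul (FT g O y) (f O (e * y)))))) with
        (Cmul (RtoC (e * / e)) (CI (fun y => Cmul (FT g O y) (f O (e * y))))) in K by cring.
      rewrite Rinv_r, RtoC_1 in K by lra.
      transitivity (Cmul C1 (CI u)); [ring |]. rewrite <- K; ring.
    - apply functional_extensionality; intros y; unfold u; rewrite Rplus_0_r, Efg; cring. }
  set (d := Csub (CI (FT f O)) (Cmul (CI (FT g O)) (f O 0))).
  assert (Hd : d = C0).
  { apply le_eps_zero with (8 * (2 * A * (2 * B)) + 8 * (2 * A' * (2 * B'))); [apply Rplus_le_le_0_compat; repeat apply Rmult_le_pos; lra |].
    intros e [He He1].
    assert (Df0 : Cdom (fun y => Cmul (f O 0) (FT g O y)) (Cmod (f O 0) * (2 * A'))) by now apply Cdom_cmul.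
    replace d with (Cadd (Csub (CI (FT f O)) (CI (fun y => Cmul (FT f O y) (g O (e * y)))))
      (Csub (CI (fun y => Cmul (FT g O y) (f O (e * y)))) (CI (fun y => Cmul (f O 0) (FT g O y))))).
    2:{ rewrite Key, (CI_cmul _ _ _ D2) by auto; unfold d; ring. }
    rewrite <- (CI_sub _ _ _ _ D1 (D3 e)), <- (CI_sub _ _ _ _ (D4 e) Df0).
    eapply Rle_trans; [apply Cmod_add |]. rewrite Rmult_plus_distr_r.
    assert (Lip : forall (h : Fam1) Bh N y, Schwartz1 h -> bd N h Bh -> (1 <= N)%nat -> Cmod (Csub (h O (e * y)) (h O 0)) <= 2 * Bh * e * Rabs y).
    { intros h Bh N y Sh Hh HN; eapply Rle_trans; [apply (Schwartz_lip h Bh N O); auto |].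
      rewrite Rminus_0_r, Rabs_mult, (Rabs_pos_eq e) by lra. right; ring. }
    apply Rplus_le_compat.
    - replace (8 * (2 * A * (2 * B)) * e) with (8 * (2 * A * (2 * B) * e)) by ring. apply CI_bound; split.
      + apply (Cdom_sub _ _ _ _ D1 (D3 e)).
      + intros y. replace (Csub (FT f O y) (Cmul (FT f O y) (g O (e * y)))) with (Copp (Cmul (FT f O y) (Csub (g O (e * y)) (g O 0))))
          by (rewrite Hg0; ring).
        rewrite Cmod_opp, Cmod_mul.
        assert (W := bd_weight 4 (FT f) A 1 O y HA ltac:(lia) ltac:(lia)); rewrite pow_1 in W.
        assert (L := Lip g B 2%nat y Hg HB ltac:(lia)).
        apply Rle_trans with ((1 + y ^ 2) * (Cmod (FT f O y) * (2 * B * e * Rabs y))).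
        * apply Rmult_le_compat_l; [nra |]. apply Rmult_le_compat_l; [apply Cmod_pos | auto].
        * replace ((1 + y ^ 2) * (Cmod (FT f O y) * (2 * B * e * Rabs y))) with (2 * B * e * ((1 + y ^ 2) * (Rabs y * Cmod (FT f O y)))) by ring.
          replace (2 * A * (2 * B) * e) with (2 * B * e * (2 * A)) by ring. apply Rmult_le_compat_l; auto. repeat apply Rmult_le_pos; lra.
    - replace (8 * (2 * A' * (2 * B')) * e) with (8 * (2 * A' * (2 * B') * e)) by ring. apply CI_bound; split.
      + apply (Cdom_sub _ _ _ _ (D4 e) Df0).
      + intros y. replace (Csub (Cmul (FT g O y) (f O (e * y))) (Cmul (f O 0) (FT g O y))) with (Cmul (FT g O y) (Csub (f O (e * y)) (f O 0)))
          by ring.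
        rewrite Cmod_mul.
        assert (W := bd_weight 4 (FT g) A' 1 O y HA' ltac:(lia) ltac:(lia)); rewrite pow_1 in W.
        assert (L := Lip f B' 2%nat y Hf HB' ltac:(lia)).
        apply Rle_trans with ((1 + y ^ 2) * (Cmod (FT g O y) * (2 * B' * e * Rabs y))).
        * apply Rmult_le_compat_l; [nra |]. apply Rmult_le_compat_l; [apply Cmod_pos | auto].
        * replace ((1 + y ^ 2) * (Cmod (FT g O y) * (2 * B' * e * Rabs y))) with (2 * B' * e * ((1 + y ^ 2) * (Rabs y * Cmod (FT g O y)))) by ring.
          replace (2 * A' * (2 * B') * e) with (2 * B' * e * (2 * A')) by ring. apply Rmult_le_compat_l; auto. repeat apply Rmult_le_pos; lra. }
  replace (CI (FT f O)) with (Cadd d (Cmul (CI (FT g O)) (f O 0))) by (unfold d; ring). rewrite Hd; ring.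
Qed.

(** Translation reduces the formula at [x] to [inversion_at_0]. The constant is the integral of the
    transform [G] of the Gaussian. Since [G] solves the same first order equation as the Gaussian,
    it is a multiple of it, and the constant is the square of the integral of the Gaussian; that it
    is nonzero is shown without computing it. *)
Lemma FT_inversion : exists c, c <> C0 /\ forall f, Schwartz1 f -> FT (FT f) = fscal1 c (reflect f).
Proof.
  destruct gaussian_exists as [g [Hg [Eg0 Eg1]]].
  assert (Hg1 : g O 0 = C1) by (rewrite Eg0; replace (- (0 * 0) / 2) with 0 by field; now rewrite exp_0).
  set (c := CI (FT g O)).
  assert (Hall : forall f, Schwartz1 f -> FT (FT f) = fscal1 c (reflect f)).
  { intros f Hf; apply Schwartz_ext; [now apply FT_S, FT_S | apply Schwartz_scal; now apply reflect_Schwartz |].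
    (* With [a = - x] the transform of the translate is the integrand of the double transform at
       [x]. *)
    intros x. set (a := - x).
    assert (E : FT (transl a f) O = fun xi => Cmul (FT f O xi) (cis (- x * xi))).
    { apply functional_extensionality; intros xi. unfold FT; simpl; unfold F0. apply CI_val.
      destruct (Schwartz_bd f 2 Hf) as [B HB].
      assert (D := F0_dom 2 f B O (- xi) Hf HB ltac:(lia) ltac:(lia)).
      assert (K := CI_affine _ _ 1 a (proj1 D) (CI_spec _ _ D) ltac:(lra)).
      rewrite Rabs_R1, Rinv_1, Cscal_mul, RtoC_1 in K.
      assert (Hs : Schwartz1 (transl a f)) by now apply transl_S.
      assert (Eh : (fun x0 => Cmul (f O (1 * x0 + a)) (cis (- xi * (1 * x0 + a)))) =
              (fun x0 => Cmul (cis (- xi * a)) (Cmul (transl a f O x0) (cis (- xi * x0))))).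
      { apply functional_extensionality; intros t; unfold transl; replace (1 * t + a) with (t + a) by ring.
        replace (- xi * (t + a)) with (- xi * a + - xi * t) by ring. rewrite cis_add; ring. }
      rewrite Eh in K. apply (CImproper_cmul (cis (- x * xi))) in K; [| apply ccont_cmul, Schwartz_cis_ccont; auto].
      eapply eq_ind; [eapply eq_ind_r with (P := fun h => CImproper h _); [exact K |] |].
      - apply functional_extensionality; intros t.
        replace (Cmul (cis (- x * xi)) (Cmul (cis (- xi * a)) (Cmul (transl a f O t) (cis (- xi * t))))) with
          (Cmul (Cmul (cis (- x * xi)) (cis (- xi * a))) (Cmul (transl a f O t) (cis (- xi * t)))) by ring.
        rewrite <- cis_add. replace (- x * xi + - xi * a) with 0 by (unfold a; ring). rewrite cis_0; ring.
      - ring. }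
    unfold FT at 1; simpl; unfold F0 at 1. rewrite <- E.
    rewrite (inversion_at_0 g (transl a f)) by (auto using transl_S). fold c.
    unfold fscal1, reflect, transl, a; simpl. rewrite Rplus_0_l, Cscal_mul, RtoC_1; ring. }
  exists c; split; auto.
  set (G := FT g). assert (HG : Schwartz1 G) by now apply FT_S.
  assert (EoD : oD g = fscal1 (Copp Ci) (fM1 g)).
  { apply Schwartz_ext; [apply SL_S; auto; apply SLin_oD | apply Schwartz_scal, SL_S; auto; apply SLin_M |].
    intros x; rewrite oD_0; unfold fscal1; rewrite fM1_0, Eg1, RtoC_opp; ring. }
  assert (EG1 : forall x, G 1%nat x = Cmul (RtoC (- x)) (G O x)).
  { intros x; assert (K := FT_oD g Hg). rewrite EoD, (SL_scal FT SLin_FT), FT_M in K by (auto; apply SL_S; auto; apply SLin_M).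
    apply (f_equal (fun h => h O x)) in K; unfold fscal1, fopp1 in K; rewrite oD_0, fM1_0 in K; fold G in K.
    replace (G 1%nat x) with (Copp (Cmul (Cmul Ci Ci) (G 1%nat x))) by (rewrite Ci2; ring).
    transitivity (Cmul (Copp Ci) (Cmul Ci (G 1%nat x))); [ring |]. rewrite K, RtoC_opp; ring. }
  assert (EG : forall x, G O x = Cmul (G O 0) (g O x)).
  (* [h] has derivative 0, so [G] is [G 0] times the Gaussian. *)
  { intros x. set (h := fun t => Cmul (RtoC (exp (t * t / 2))) (G O t)).
    assert (Dh : forall t, dCat h t C0).
    { intros t; assert (De : is_derive (fun t => exp (t * t / 2)) t (t * exp (t * t / 2))) by (auto_derive; [trivial | unfold Rdiv; field]).
      eapply eq_ind; [apply dCat_mul; [apply (dCat_RtoC _ _ _ De) | apply (Schwartz_dCat G O t HG)] |]. cbv beta.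
      rewrite EG1, RtoC_mul, RtoC_opp; ring. }
    assert (Eh : h x = h 0).
    { assert (K : Cmod (Csub (h x) (h 0)) <= 2 * 0 * Rabs (x - 0)).
      { apply (mean_C h (fun _ => C0)); auto. intros; rewrite Cmod_C0; lra. }
      replace (h x) with (Cadd (Csub (h x) (h 0)) (h 0)) by ring.
      rewrite (Cmod_eq0 (Csub (h x) (h 0))); [ring |]. apply Rle_antisym; [lra | apply Cmod_pos]. }
    unfold h in Eh. replace (0 * 0 / 2) with 0 in Eh by field. rewrite exp_0, RtoC_1 in Eh.
    rewrite Eg0. replace (G O 0) with (Cmul C1 (G O 0)) by ring. rewrite <- Eh.
    replace (Cmul (Cmul (RtoC (exp (x * x / 2))) (G O x)) (RtoC (exp (- (x * x) / 2)))) with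
      (Cmul (Cmul (RtoC (exp (x * x / 2))) (RtoC (exp (- (x * x) / 2)))) (G O x)) by ring.
    rewrite <- RtoC_mul, <- exp_plus. replace (x * x / 2 + - (x * x) / 2) with 0 by field. rewrite exp_0, RtoC_1; ring. }
  destruct (Schwartz_bd g 2 Hg) as [B HB]. assert (Dg := bd_Cdom 2 g B O Hg HB ltac:(lia) ltac:(lia)).
  assert (E0 : G O 0 = CI (g O)).
  { unfold G, FT; simpl; unfold F0. f_equal; apply functional_extensionality; intros t.
    replace (- 0 * t) with 0 by ring. rewrite cis_0; ring. }
  assert (Ec : c = Cmul (CI (g O)) (CI (g O))).
  { unfold c; fold G. rewrite <- E0 at 1. rewrite <- (CI_cmul _ _ _ Dg). f_equal; apply functional_extensionality; auto. }
  (* On [[-1, 1]] the Gaussian is at least [e^(-1)], so its integral over any larger interval is at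
     least [2 e^(-1)]; if the total integral were 0, it would be at most [e^(-1)] on large
     intervals. *)
  assert (Hpos : CI (g O) <> C0).
  { intros Z. destruct (anti_exists (g O) (proj1 Dg)) as [H [HH _]].
    destruct (CImproper_anti_inv (g O) H _ (proj1 Dg) HH (CI_spec _ _ Dg) (exp (-1))) as [N HN]; [apply exp_pos |].
    set (X := Rmax 1 N). assert (1 <= X /\ N <= X) as [X1 X2] by (split; [apply Rmax_l | apply Rmax_r]).
    specialize (HN (- X) X ltac:(lra) ltac:(lra)). rewrite Z in HN.
    replace (Csub (Csub (H X) (H (- X))) C0) with (Csub (H X) (H (- X))) in HN by ring.
    set (r := fun t => fst (H t)).
    assert (Dr : forall t, is_derive r t (exp (- (t * t) / 2))).
    { intros t; generalize (proj1 (proj1 (dCat_is H t _) (HH t))); rewrite Eg0; auto. }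
    assert (Inc : forall a b v, a <= b -> (forall t, a <= t <= b -> v <= exp (- (t * t) / 2)) -> v * (b - a) <= r b - r a).
    { intros a b v Hab Hv. destruct (Req_dec a b) as [->|Hne]; [lra |].
      destruct (MVT_gen r a b (fun t => exp (- (t * t) / 2))) as [t [Ht Et]].
      - intros; apply Dr.
      - intros; apply derivable_continuous_pt; eexists; apply is_derive_Reals, Dr.
      - rewrite Rmin_left, Rmax_right in Ht by lra. rewrite Et. apply Rmult_le_compat_r; [lra | auto]. }
    assert (I1 := Inc (- X) (-1) 0 ltac:(lra) ltac:(intros; left; apply exp_pos)).
    assert (I3 := Inc 1 X 0 ltac:(lra) ltac:(intros; left; apply exp_pos)).
    assert (I2 := Inc (-1) 1 (exp (-1)) ltac:(lra) ltac:(intros; apply exp_le; nra)).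
    assert (Hr : r X - r (- X) <= exp (-1)).
    { eapply Rle_trans; [| apply HN]. eapply Rle_trans; [| apply fst_le_Cmod]. simpl; unfold r.
      eapply Rle_trans; [apply Rle_abs |]; right; f_equal; ring. }
    generalize (exp_pos (-1)); lra. }
  rewrite Ec; intros Z. apply (f_equal Cmod) in Z; rewrite Cmod_mul, Cmod_C0 in Z.
  assert (0 < Cmod (CI (g O))) by now apply Cmod_gt0. nra.
Qed.

(** * Conjugation by chirps *)

(* [chirp c f] is [e^(i c x^2 / 2) f]; its derivatives come from iterating [d/dx + i c x] on [f]. *)
Definition chirp_op (c : R) (f : Fam1) : Fam1 :=
  fadd1 (fscal1 (Copp Ci) (oD f)) (fscal1 (Cmul Ci (RtoC c)) (fM1 f)).

Definition chirp (c : R) (f : Fam1) : Fam1 :=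
  fun k x => Cmul (cis (c * (x * x / 2))) (Nat.iter k (chirp_op c) f O x).

Lemma SLin_chirp_op c : SLin (chirp_op c).
Proof.
  apply SLin_add; [apply (SLin_comp (fscal1 (Copp Ci)) oD) | apply (SLin_comp (fscal1 _) fM1)];
    auto using SLin_scal, SLin_oD, SLin_M.
Qed.

Lemma dCat_chirp c x : dCat (fun x => cis (c * (x * x / 2))) x (Cmul (Cmul Ci (RtoC (c * x))) (cis (c * (x * x / 2)))).
Proof.
  apply dCat_is; unfold cis, Ci, RtoC, Cmul; simpl; split; auto_derive; trivial; unfold Rdiv; field.
Qed.

Lemma chirp_op_0 c f x : chirp_op c f O x = Cadd (f 1%nat x) (Cmul (Cmul Ci (RtoC (c * x))) (f O x)).
Proof.
  unfold chirp_op, fadd1, fscal1; rewrite oD_0, fM1_0, RtoC_mul.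
  transitivity (Cadd (Copp (Cmul (Cmul Ci Ci) (f 1%nat x))) (Cmul (Cmul Ci (RtoC c)) (Cmul (RtoC x) (f O x)))); [ring |].
  rewrite Ci2; ring.
Qed.

Lemma SLin_chirp c : SLin (chirp c).
Proof.
  assert (HG := fun k => SLin_iter k _ (SLin_chirp_op c)).
  assert (HB : forall N, exists (N' : nat) C, 0 <= C /\ forall f B, Schwartz1 f -> bd N' f B -> bd N (chirp c f) (C * B)).
  { intros N; destruct (SL_unif (fun k => Nat.iter k (chirp_op c)) (S N) N HG) as [N' [C [HC H]]].
    exists N', C; split; auto; intros f B Hf HfB j k Hj Hk x; unfold chirp.
    rewrite Cmod_mul, Cmod_cis, Rmult_1_l. apply (H k ltac:(lia) f B Hf HfB); lia. }
  split; auto.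
  - intros f Hf; apply Schwartz_intro.
    + intros k x; unfold chirp; simpl Nat.iter.
      assert (Hk : Schwartz1 (Nat.iter k (chirp_op c) f)) by now apply (SL_S _ (HG k)).
      eapply eq_ind; [apply dCat_mul; [apply dCat_chirp | now apply Schwartz_dCat] |]. cbv beta.
      rewrite chirp_op_0; ring.
    + intros N; destruct (HB N) as [N' [C [_ H]]]; destruct (Schwartz_bd f N' Hf) as [B HfB]; exists (C * B); auto.
  - intros f g Hf Hg; apply fam_ext; intros k x; unfold chirp; rewrite (SL_add _ (HG k)) by auto; unfold fadd1; ring.
  - intros d f Hf; apply fam_ext; intros k x; unfold chirp; rewrite (SL_scal _ (HG k)) by auto; unfold fscal1; ring.
Qed.

Lemma chirp_M c f : Schwartz1 f -> chirp c (fM1 f) = fM1 (chirp c f).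
Proof.
  intros Hf; apply Schwartz_ext; [apply SL_S, SL_S; auto using SLin_chirp, SLin_M | apply SL_S, SL_S; auto using SLin_chirp, SLin_M |].
  intros x; rewrite fM1_0; unfold chirp; simpl; rewrite fM1_0; ring.
Qed.

Lemma chirp_oD c f : Schwartz1 f -> chirp c (oD f) = fadd1 (oD (chirp c f)) (fscal1 (RtoC c) (fM1 (chirp c f))).
Proof.
  intros Hf; assert (Hc : Schwartz1 (chirp c f)) by (apply SL_S; auto using SLin_chirp).
  apply Schwartz_ext.
  - apply SL_S, SL_S; auto using SLin_chirp, SLin_oD.
  - apply Schwartz_add; [| apply Schwartz_scal]; apply SL_S; auto using SLin_oD, SLin_M.
  - intros x; unfold fadd1, fscal1; rewrite oD_0, fM1_0; unfold chirp; simpl. rewrite oD_0, chirp_op_0.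
    set (e := cis _); rewrite RtoC_mul. transitivity (Cadd (Cmul e (Cmul Ci (f 1%nat x)))
      (Cmul (Cadd C1 (Cmul Ci Ci)) (Cmul (Cmul (RtoC c) (RtoC x)) (Cmul e (f O x))))); [rewrite Ci2; ring | ring].
Qed.

Lemma chirp_inv c f : Schwartz1 f -> chirp (- c) (chirp c f) = f.
Proof.
  intros Hf; apply Schwartz_ext; auto; [apply SL_S, SL_S; auto using SLin_chirp |].
  intros x; unfold chirp; simpl. transitivity (Cmul (Cmul (cis (- c * (x * x / 2))) (cis (c * (x * x / 2)))) (f O x)); [ring |].
  rewrite <- cis_add. replace (- c * (x * x / 2) + c * (x * x / 2)) with 0 by ring. rewrite cis_0; ring.
Qed.

(** Conjugation by a chirp and a Fourier transform turns [M] and [oD] into operators of this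
    form. *)
Definition weyl (p q : R) (f : Fam1) : Fam1 := fadd1 (fscal1 (RtoC p) (fM1 f)) (fscal1 (RtoC q) (oD f)).

Lemma SLin_weyl p q : SLin (weyl p q).
Proof.
  apply SLin_add; [apply (SLin_comp (fscal1 _) fM1) | apply (SLin_comp (fscal1 _) oD)]; auto using SLin_scal, SLin_oD, SLin_M.
Qed.

Lemma const_lead_weyl p q m l Q : SLin Q -> const_lead m l Q -> const_lead (S m) (Cmul Ci (Cmul (RtoC q) l)) (fun f => weyl p q (Q f)).
Proof.
  intros HQ HD; destruct (const_lead_derivs m l Q O HQ HD) as [u [Hu Eu]]; destruct (const_lead_derivs m l Q 1 HQ HD) as [v [Hv Ev]].
  rewrite Nat.add_0_r in Eu. rewrite Nat.add_1_r in Ev.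
  set (cf := fun k x => Cadd (if Nat.eq_dec k m then Cmul (RtoC p) (Cmul (RtoC x) l) else C0)
     (Cadd (if lt_dec k m then Cmul (RtoC p) (Cmul (RtoC x) (u k x)) else C0) (Cmul (Cmul Ci (RtoC q)) (v k x)))).
  exists (fun k x => if Nat.eq_dec k (S m) then Cmul Ci (Cmul (RtoC q) l) else cf k x); split; [| split].
  - intros k _; destruct (Nat.eq_dec k (S m)); [apply ispoly_const |]. unfold cf; apply ispoly_add; [| apply ispoly_add].
    + destruct (Nat.eq_dec k m); [apply ispoly_scal, ispoly_tmul, ispoly_const | apply ispoly_const].
    + destruct (lt_dec k m); [now apply ispoly_scal, ispoly_tmul | apply ispoly_const].
    + now apply ispoly_scal.
  - intros x; destruct (Nat.eq_dec (S m) (S m)); [auto | lia].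
  - intros f Hf x; unfold weyl, fadd1, fscal1; rewrite fM1_0, oD_0, Eu, Ev by auto.
    unfold Lp; simpl Csum. destruct (Nat.eq_dec (S m) (S m)); [| lia]. destruct (Nat.eq_dec m (S m)); [lia |].
    rewrite (Csum_ext m (fun k => Cmul (if Nat.eq_dec k (S m) then _ else _) _)
      (fun k => Cadd (Cmul (RtoC p) (Cmul (RtoC x) (Cmul (u k x) (f k x)))) (Cmul (Cmul Ci (RtoC q)) (Cmul (v k x) (f k x))))).
    2:{ intros k Hk; destruct (Nat.eq_dec k (S m)); [lia |]. unfold cf.
        destruct (Nat.eq_dec k m); [lia |]. destruct (lt_dec k m); [ring | lia]. }
    rewrite Csum_add, <- !Csum_mul. unfold cf. destruct (Nat.eq_dec m m); [| lia]. destruct (lt_dec m m); [lia |]. ring.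
Qed.

Lemma const_lead_id : const_lead 0 C1 (fun f => f).
Proof.
  exists (fun _ _ => C1); split; [intros; apply ispoly_const | split; auto].
  intros f _ x; unfold Lp; simpl; ring.
Qed.

Lemma const_lead_widen r m l Q : (r <= m)%nat -> const_lead r l Q -> const_lead m (if Nat.eq_dec r m then l else C0) Q.
Proof.
  intros Hr [p [A [B D]]]. exists (fun k x => if le_dec k r then p k x else C0); split; [| split].
  - intros k _; destruct (le_dec k r); [now apply A | apply ispoly_const].
  - intros x; destruct (Nat.eq_dec r m) as [->|]; [destruct (le_dec m m); auto; lia |]. destruct (le_dec m r); [lia | auto].
  - intros f Hf x; rewrite D by auto; unfold Lp. rewrite (Csum_widen (S r) (S m)); [| lia |].
    + apply Csum_ext; intros k Hk; destruct (le_dec k r); [auto | lia].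
    + intros k Hk; destruct (le_dec k r); [lia | ring].
Qed.

Lemma const_lead_scal m l c Q : const_lead m l Q -> const_lead m (Cmul c l) (fun f => fscal1 c (Q f)).
Proof.
  intros [p [A [B D]]]; exists (fun k x => Cmul c (p k x)); split; [| split].
  - intros; now apply ispoly_scal, A.
  - intros; now rewrite B.
  - intros f Hf x; unfold fscal1, Lp; rewrite D by auto; unfold Lp; rewrite Csum_mul; apply Csum_ext; intros; ring.
Qed.

Lemma const_lead_sum m n l (Q : nat -> Fam1 -> Fam1) : (forall i, (i < n)%nat -> const_lead m (l i) (Q i)) ->
  const_lead m (Csum n l) (fun f => fsum n (fun i => Q i f)).
Proof.
  induction n as [|n IH]; intros H.
  - exists (fun _ _ => C0); split; [intros; apply ispoly_const | split; auto].
    intros f _ x; symmetry; apply Csum_0; intros; ring.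
  - destruct (IH ltac:(intros; apply H; lia)) as [p [A [B D]]]; destruct (H n ltac:(lia)) as [p' [A' [B' D']]].
    exists (fun k x => Cadd (p k x) (p' k x)); split; [| split].
    + intros k Hk; apply ispoly_add; auto.
    + intros x; simpl; now rewrite B, B'.
    + intros f Hf x; specialize (D f Hf x); unfold fsum in *; simpl; rewrite D, D' by auto; unfold Lp.
      rewrite <- Csum_add; apply Csum_ext; intros; ring.
Qed.

(** * Sums of monomials in the Weyl algebra *)

Definition tri_sum (m : nat) (b : nat -> nat -> Cx) (Y : nat -> nat -> Fam1 -> Fam1) (f : Fam1) : Fam1 :=
  fsum (S m) (fun k => fsum (S m - k) (fun j => fscal1 (b k j) (Y k j f))).

Lemma SLin_tri_sum m b Y : (forall k j, SLin (Y k j)) -> SLin (tri_sum m b Y).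
Proof.
  intros H; apply SLin_sum; intros k _; apply SLin_sum; intros j _; apply (SLin_comp (fscal1 _)); auto using SLin_scal.
Qed.

Lemma const_lead_tri_sum m b Y l : (forall k j, const_lead (k + j) (l k j) (Y k j)) ->
  const_lead m (Csum (S m) (fun k => Cmul (b k (m - k)%nat) (l k (m - k)%nat))) (tri_sum m b Y).
Proof.
  intros H. apply (const_lead_sum m (S m)); intros k Hk.
  replace (Cmul (b k (m - k)%nat) (l k (m - k)%nat)) with
    (Csum (S m - k) (fun j => Cmul (b k j) (if Nat.eq_dec (k + j) m then l k j else C0))).
  - apply (const_lead_sum m (S m - k)); intros j Hj; apply const_lead_scal, const_lead_widen; [lia | auto].
  - rewrite (Csum_single _ (m - k)); [| lia |].
    + destruct (Nat.eq_dec (k + (m - k)) m); [auto | lia].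
    + intros j Hj Hne. destruct (Nat.eq_dec (k + j) m); [lia | ring].
Qed.

Lemma SL_tri_sum T m b Y f : SLin T -> (forall k j, SLin (Y k j)) -> Schwartz1 f ->
  T (tri_sum m b Y f) = fsum (S m) (fun k => fsum (S m - k) (fun j => fscal1 (b k j) (T (Y k j f)))).
Proof.
  intros HT HY Hf.
  assert (G : forall n (F : nat -> Fam1), (forall i, Schwartz1 (F i)) -> Schwartz1 (fsum n F) /\ T (fsum n F) = fsum n (fun i => T (F i))).
  { induction n as [|n IH]; intros F HF; [split; [apply Schwartz_f0 | apply SL_0; auto] |].
    destruct (IH F HF) as [A B]. change (fsum (S n) F) with (fadd1 (fsum n F) (F n)); split; [now apply Schwartz_add |].
    rewrite SL_add, B; auto. }
  unfold tri_sum. assert (S1 : forall k j, Schwartz1 (fscal1 (b k j) (Y k j f))) by (intros; now apply Schwartz_scal, SL_S).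
  assert (S2 : forall k, Schwartz1 (fsum (S m - k) (fun j => fscal1 (b k j) (Y k j f)))) by (intros; apply G; auto).
  rewrite (proj2 (G (S m) _ S2)). f_equal; apply functional_extensionality; intros k.
  rewrite (proj2 (G (S m - k)%nat _ (S1 k))). f_equal; apply functional_extensionality; intros j.
  apply SL_scal; auto. now apply SL_S.
Qed.

(** Near 0 the first nonzero coefficient dominates. This selects a chirp rate for which the leading
    coefficient does not vanish. *)
Lemma nonroot m (b : nat -> Cx) : (exists k, (k <= m)%nat /\ b k <> C0) ->
  forall d, 0 < d -> exists c, 0 < c < d /\ Csum (S m) (fun k => Cmul (b k) (RtoC (c ^ k))) <> C0.
Proof.
  revert b; induction m as [|m IH]; intros b [k [Hk Hb]] d Hd.
  - exists (d / 2); split; [lra |]. replace k with O in Hb by lia. simpl. rewrite RtoC_1. intros E; apply Hb; rewrite <- E; ring.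
  - assert (E : forall c, Csum (S (S m)) (fun k => Cmul (b k) (RtoC (c ^ k))) =
       Cadd (b O) (Cmul (RtoC c) (Csum (S m) (fun k => Cmul (b (S k)) (RtoC (c ^ k)))))).
    { intros c; rewrite Csum_first, Csum_mul; simpl pow at 1; rewrite RtoC_1; f_equal; [ring |].
      apply Csum_ext; intros; simpl; rewrite RtoC_mul; ring. }
    destruct (classic (b O = C0)) as [Z|Z].
    + destruct (IH (fun k => b (S k))) with (d := d) as [c [Hc Hn]]; auto.
      { destruct k; [contradiction | exists k; split; [lia | auto]]. }
      exists c; split; auto. rewrite E, Z. intros Q. apply Hn.
      transitivity (Cmul (Cinv (RtoC c)) (Cadd C0 (Cmul (RtoC c) (Csum (S m) (fun k => Cmul (b (S k)) (RtoC (c ^ k))))))); [| rewrite Q; ring].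
      field. intros Q'; apply (f_equal fst) in Q'; simpl in Q'; lra.
    + assert (Bn : exists M, 0 <= M /\ forall k, (k < S m)%nat -> Cmod (b (S k)) <= M).
      { clear; generalize (S m); intros n; induction n as [|n [M [HM H]]]; [exists 0; split; [lra | intros; lia] |].
        exists (M + Cmod (b (S n))); generalize (Cmod_pos (b (S n))); intros P; split; [lra |]; intros k Hk.
        destruct (Nat.eq_dec k n) as [->|]; [lra |]. generalize (H k ltac:(lia)); lra. }
      destruct Bn as [M [HM Bn]]. assert (P := Cmod_gt0 _ Z).
      set (K := INR (S m) * M). assert (HK : 0 <= K) by (apply Rmult_le_pos; [apply pos_INR | auto]).
      set (c := Rmin (Rmin 1 d) (Cmod (b O) / (K + 1)) / 2).
      assert (0 < Cmod (b O) / (K + 1)) by (apply Rdiv_lt_0_compat; lra).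
      assert (0 < c) by (unfold c; assert (0 < Rmin (Rmin 1 d) (Cmod (b O) / (K + 1))) by (repeat apply Rmin_pos; lra); lra).
      assert (2 * c <= 1 /\ 2 * c <= d /\ 2 * c <= Cmod (b O) / (K + 1)) as [c1 [c2 c3]].
      { unfold c; replace (2 * (Rmin (Rmin 1 d) (Cmod (b O) / (K + 1)) / 2)) with (Rmin (Rmin 1 d) (Cmod (b O) / (K + 1))) by field.
        repeat split; [eapply Rle_trans; [apply Rmin_l |]; apply Rmin_l | eapply Rle_trans; [apply Rmin_l |]; apply Rmin_r | apply Rmin_r]. }
      exists c; split; [lra |]. rewrite E. intros Q.
      set (s := Csum (S m) _) in Q.
      assert (Hs : Cmod s <= K).
      { apply Cmod_Csum_le; auto; intros k0 Hk0; rewrite Cmod_mul, Cmod_RtoC, Rabs_pos_eq by (apply pow_le; lra).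
        specialize (Bn k0 Hk0). assert (c ^ k0 <= 1) by (rewrite <- (pow1 k0); apply pow_incr; lra).
        assert (0 <= c ^ k0) by (apply pow_le; lra). generalize (Cmod_pos (b (S k0))); nra. }
      assert (E0 : Cmod (b O) = c * Cmod s).
      { replace (b O) with (Cadd (Cadd (b O) (Cmul (RtoC c) s)) (Copp (Cmul (RtoC c) s))) by ring.
        rewrite Q. replace (Cadd C0 (Copp (Cmul (RtoC c) s))) with (Copp (Cmul (RtoC c) s)) by ring.
        rewrite Cmod_opp, Cmod_mul, Cmod_RtoC, Rabs_pos_eq by lra; auto. }
      apply Rle_div_r in c3; [| lra]. nra.
Qed.

(** Multiplied by the inversion constant, both sides are the threefold transform of [f]. *)
Lemma FT_reflect f : Schwartz1 f -> FT (reflect f) = reflect (FT f).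
Proof.
  destruct FT_inversion as [c [Hc H]]; intros Hf.
  assert (E := H (FT f) (FT_S f Hf)). rewrite (H f Hf), (SL_scal _ SLin_FT) in E by auto using reflect_Schwartz.
  apply fam_ext; intros k x. apply (f_equal (fun h => h k x)) in E; unfold fscal1 in E.
  transitivity (Cmul (Cinv c) (Cmul c (FT (reflect f) k x))); [field; auto |]. rewrite E; field; auto.
Qed.

Lemma reflect_invol f : reflect (reflect f) = f.
Proof.
  apply fam_ext; intros k x; unfold reflect. rewrite Ropp_involutive, !Cscal_mul.
  transitivity (Cmul (RtoC ((-1) ^ k * (-1) ^ k)) (f k x)); [cring |].
  rewrite <- Rpow_mult_distr. replace (-1 * -1) with 1 by ring. rewrite pow1, RtoC_1; ring.
Qed.

Lemma FT_inverse : exists V, SLin V /\ (forall f, Schwartz1 f -> V (FT f) = f) /\ (forall f, Schwartz1 f -> FT (V f) = f) /\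
  exists c, c <> C0 /\ forall f, V f = fscal1 c (reflect (FT f)).
Proof.
  destruct FT_inversion as [c [Hc H]]. exists (fun f => fscal1 (Cinv c) (reflect (FT f))).
  assert (K : forall f, Schwartz1 f -> fscal1 (Cinv c) (reflect (FT (FT f))) = f).
  { intros f Hf; rewrite H, (SL_scal _ SLin_reflect), reflect_invol by auto using reflect_Schwartz.
    apply fam_ext; intros; unfold fscal1; field; auto. }
  split; [| split; [auto | split]].
  - apply (SLin_comp (fscal1 (Cinv c))); [apply SLin_scal |]. apply (SLin_comp reflect FT); auto using SLin_reflect, SLin_FT.
  - intros f Hf; rewrite (SL_scal _ SLin_FT), FT_reflect by auto using reflect_Schwartz, FT_S. now apply K.
  - exists (Cinv c); split; auto. intros Z. assert (E := Cinv_l c Hc). rewrite Z in E. apply (f_equal fst) in E; simpl in E; lra.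
Qed.

Lemma Tempered_comp u T : SLin T -> Tempered1 u -> Tempered1 (fun f => u (T f)).
Proof.
  intros HT [A [B [N [K H]]]]; split; [| split].
  - intros; rewrite (SL_add _ HT) by auto; apply A; now apply SL_S.
  - intros; rewrite (SL_scal _ HT) by auto; apply B; now apply SL_S.
  - destruct (SL_bd _ HT N) as [N' [C [HC HB]]]. exists N', (K * C); intros f Bf Hf Hb.
    rewrite Rmult_assoc. apply H; [now apply SL_S |]. now apply HB.
Qed.

Lemma coercive_conj Q Q' (mu nu : Fam1 -> Fam1) : SLin mu -> SLin nu -> SLin Q -> (forall f, Schwartz1 f -> nu (mu f) = f) ->
  (forall f, Schwartz1 f -> mu (Q f) = Q' (mu f)) -> coercive Q' -> coercive Q.
Proof.
  intros Hm Hn HQ Hnm HE [r [xi [Hxi H]]]. exists r, (fun i f => xi i (mu f)); split.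
  { intros; apply Tempered_comp; auto. }
  intros N. destruct (SL_bd _ Hn N) as [N1 [K1 [HK1 B1]]]. destruct (H N1) as [N2 [K2 [HK2 B2]]].
  destruct (SL_bd _ Hm N2) as [N3 [K3 [HK3 B3]]].
  exists N3, (K1 * (K2 * (K3 + 1))); split; [repeat apply Rmult_le_pos; lra |].
  intros f B Hf HB Hx. assert (HB0 := bd_pos _ _ _ HB). rewrite <- (Hnm f Hf).
  replace (K1 * (K2 * (K3 + 1)) * B) with (K1 * (K2 * ((K3 + 1) * B))) by ring.
  apply B1; [now apply SL_S |]. apply B2; [now apply SL_S | |].
  - rewrite <- HE by auto. apply bd_mono with N2 (K3 * B); auto; [nra |]. apply B3; auto; now apply SL_S.
  - intros i Hi; eapply Rle_trans; [now apply Hx |]. nra.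
Qed.

Lemma weyl_iter_const_lead p q m l Q n : SLin Q -> const_lead m l Q ->
  SLin (fun f => Nat.iter n (weyl p q) (Q f)) /\
  const_lead (n + m) (Cmul (Cmul (Cpow Ci n) (RtoC (q ^ n))) l) (fun f => Nat.iter n (weyl p q) (Q f)).
Proof.
  intros HQ HD; split; [apply (SLin_comp (Nat.iter n (weyl p q)) Q); auto using SLin_iter, SLin_weyl |].
  induction n as [|n IH].
  - simpl. replace (Cmul (Cmul C1 (RtoC 1)) l) with l by (rewrite RtoC_1; ring). auto.
  - simpl Nat.iter. replace (Cmul (Cmul (Cpow Ci (S n)) (RtoC (q ^ S n))) l) with
      (Cmul Ci (Cmul (RtoC q) (Cmul (Cmul (Cpow Ci n) (RtoC (q ^ n))) l))) by (simpl; rewrite RtoC_mul; ring).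
    apply (const_lead_weyl p q (n + m) _ (fun f => Nat.iter n (weyl p q) (Q f))); auto.
    apply (SLin_comp (Nat.iter n (weyl p q)) Q); auto using SLin_iter, SLin_weyl.
Qed.

Lemma Cpow_add z n m : Cpow z (n + m) = Cmul (Cpow z n) (Cpow z m).
Proof. induction n as [|n IH]; simpl; [ring | rewrite IH; ring]. Qed.

Definition PM (k j : nat) (f : Fam1) : Fam1 := Nat.iter k oD (Nat.iter j fM1 f).
Definition MP (k j : nat) (f : Fam1) : Fam1 := Nat.iter j fM1 (Nat.iter k oD f).

Lemma SLin_PM k j : SLin (PM k j).
Proof. apply (SLin_comp (Nat.iter k oD) (Nat.iter j fM1)); apply SLin_iter; auto using SLin_oD, SLin_M. Qed.

Lemma SLin_MP k j : SLin (MP k j).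
Proof. apply (SLin_comp (Nat.iter j fM1) (Nat.iter k oD)); apply SLin_iter; auto using SLin_oD, SLin_M. Qed.

Lemma SL_intertwine (T U V : Fam1 -> Fam1) k : SLin U -> (forall f, Schwartz1 f -> T (U f) = V (T f)) ->
  forall f, Schwartz1 f -> T (Nat.iter k U f) = Nat.iter k V (T f).
Proof.
  intros HU H f Hf; induction k as [|k IH]; auto. simpl. rewrite H, IH; auto. now apply (SL_S _ (SLin_iter k U HU)).
Qed.

(* The Fourier transform of a chirp turns [oD] into a first order operator for almost every rate [c],
   so that after conjugation the leading coefficient becomes constant. *)
Lemma coercive_tri_sum m b Y : (Y = PM \/ Y = MP) -> (exists k j, (k + j = m)%nat /\ b k j <> C0) -> coercive (tri_sum m b Y).
Proof.
  intros HY [k0 [j0 [Hkj Hb]]].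
  destruct (nonroot m (fun k => b k (m - k)%nat)) with (d := 1) as [c [_ Hc]]; [| lra |].
  { exists k0; split; [lia |]. now replace (m - k0)%nat with j0 by lia. }
  set (mu := fun f => FT (chirp c f)).
  assert (Smu : SLin mu) by (apply (SLin_comp FT (chirp c)); auto using SLin_FT, SLin_chirp).
  destruct FT_inverse as [V [SV [V1 _]]].
  assert (Snu : SLin (fun f => chirp (- c) (V f))) by (apply (SLin_comp (chirp (- c)) V); auto using SLin_chirp).
  (* [mu] carries [M] to [oD] and [oD] to [c oD - M]. Both images differentiate, so a monomial of
     degree [k + j] becomes an operator of that order with constant leading coefficient
     [i^(k + j) c^k]. *)
  assert (muM : forall f, Schwartz1 f -> mu (fM1 f) = weyl 0 1 (mu f)).
  { intros f Hf; unfold mu; rewrite chirp_M, FT_M by (auto; apply SL_S; auto using SLin_chirp).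
    unfold weyl; fext. }
  assert (muP : forall f, Schwartz1 f -> mu (oD f) = weyl (-1) c (mu f)).
  { intros f Hf; unfold mu. assert (Hcf : Schwartz1 (chirp c f)) by (apply SL_S; auto using SLin_chirp).
    rewrite chirp_oD, (SL_add _ SLin_FT), (SL_scal _ SLin_FT), FT_M, FT_oD by
      (auto; try apply Schwartz_scal; apply SL_S; auto using SLin_oD, SLin_M).
    unfold weyl; fext. replace (RtoC (-1)) with (Copp C1) by (rewrite <- RtoC_1, <- RtoC_opp; auto). ring. }
  (* One definition for both orders of the factors, as the source and its transpose differ in that
     order. *)
  set (Y' := fun k j (f : Fam1) => if excluded_middle_informative (Y = PM) then Nat.iter k (weyl (-1) c) (Nat.iter j (weyl 0 1) f)
     else Nat.iter j (weyl 0 1) (Nat.iter k (weyl (-1) c) f)).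
  assert (SY : forall k j, SLin (Y k j)) by (destruct HY as [->| ->]; auto using SLin_PM, SLin_MP).
  assert (H' : forall k j, SLin (Y' k j) /\ const_lead (k + j) (Cmul (Cpow Ci (k + j)) (RtoC (c ^ k))) (Y' k j)).
  { intros k j; unfold Y'; destruct (excluded_middle_informative (Y = PM)).
    - destruct (weyl_iter_const_lead 0 1 0 C1 _ j SLin_id const_lead_id) as [A B]. destruct (weyl_iter_const_lead (-1) c _ _ _ k A B) as [A' B'].
      split; auto. replace (Cmul (Cpow Ci (k + j)) (RtoC (c ^ k))) with
        (Cmul (Cmul (Cpow Ci k) (RtoC (c ^ k))) (Cmul (Cmul (Cpow Ci j) (RtoC (1 ^ j))) C1)).
      + now rewrite Nat.add_0_r in B'.
      + rewrite Cpow_add, pow1, RtoC_1; ring.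
    - destruct (weyl_iter_const_lead (-1) c 0 C1 _ k SLin_id const_lead_id) as [A B]. destruct (weyl_iter_const_lead 0 1 _ _ _ j A B) as [A' B'].
      split; auto. replace (Cmul (Cpow Ci (k + j)) (RtoC (c ^ k))) with
        (Cmul (Cmul (Cpow Ci j) (RtoC (1 ^ j))) (Cmul (Cmul (Cpow Ci k) (RtoC (c ^ k))) C1)).
      + rewrite Nat.add_0_r, Nat.add_comm in B'; exact B'.
      + rewrite Cpow_add, pow1, RtoC_1; ring. }
  apply coercive_conj with (tri_sum m b Y') mu (fun f => chirp (- c) (V f)); auto.
  - now apply SLin_tri_sum.
  - intros f Hf; unfold mu; rewrite V1, chirp_inv; auto. apply SL_S; auto using SLin_chirp.
  - intros f Hf; rewrite SL_tri_sum by auto. unfold tri_sum; f_equal; apply functional_extensionality; intros k.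
    f_equal; apply functional_extensionality; intros j. f_equal. unfold Y'.
    destruct (excluded_middle_informative _) as [->|Hne].
    + unfold PM. rewrite (SL_intertwine mu oD (weyl (-1) c) k SLin_oD muP), (SL_intertwine mu fM1 (weyl 0 1) j SLin_M muM); auto.
      apply (SL_S _ (SLin_iter j _ SLin_M)); auto.
    + destruct HY as [->| ->]; [contradiction |]. unfold MP.
      rewrite (SL_intertwine mu fM1 (weyl 0 1) j SLin_M muM), (SL_intertwine mu oD (weyl (-1) c) k SLin_oD muP); auto.
      apply (SL_S _ (SLin_iter k _ SLin_oD)); auto.
  (* The total leading coefficient is [i^m] times the polynomial in [c] that [nonroot] keeps away
     from 0. *)
  - apply DO_coercive with m (Csum (S m) (fun k => Cmul (b k (m - k)%nat) (Cmul (Cpow Ci (k + (m - k))) (RtoC (c ^ k))))).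
    + apply SLin_tri_sum; intros; apply H'.
    + intros E; apply Hc. transitivity (Cmul (Cinv (Cpow Ci m)) C0); [| ring]. rewrite <- E, Csum_mul. apply Csum_ext.
      intros k Hk; replace (k + (m - k))%nat with m by lia. field.
      intros Z; apply (f_equal Cmod) in Z. rewrite Cpow_mod, Cmod_Ci, pow1, Cmod_C0 in Z; lra.
    + apply (const_lead_tri_sum m b Y' (fun k j => Cmul (Cpow Ci (k + j)) (RtoC (c ^ k)))); intros; apply H'.
Qed.

(** * Schwartz functions on the plane *)

Lemma S2_dx g a b x y : Schwartz2 g -> dCat (fun t => g a b t y) x (g (S a) b x y).
Proof. intros [H _]; split; apply H. Qed.

Lemma S2_dy g a b x y : Schwartz2 g -> dCat (fun t => g a b x t) y (g a (S b) x y).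
Proof. intros [H _]; split; apply H. Qed.

Definition wt (N : nat) (x : R) : R := (1 + Rabs x) ^ N.

Lemma wt_1 N x : 1 <= wt N x.
Proof. apply pow_R1_Rle; generalize (Rabs_pos x); lra. Qed.

Lemma wt_le N K x : (N <= K)%nat -> wt N x <= wt K x.
Proof. intros; apply Rle_pow; auto; generalize (Rabs_pos x); lra. Qed.

Lemma pow_wt j N x : (j <= N)%nat -> Rabs x ^ j <= wt N x.
Proof.
  intros; apply Rle_trans with (wt j x); [| now apply wt_le]. apply pow_incr; generalize (Rabs_pos x); lra.
Qed.

Lemma wt_pow N x : wt N x <= 2 ^ N * (1 + Rabs x ^ N).
Proof.
  unfold wt; set (y := Rabs x). assert (Hy : 0 <= y) by apply Rabs_pos.
  assert (H2N : 0 <= 2 ^ N) by (apply pow_le; lra). assert (HyN : 0 <= y ^ N) by (now apply pow_le).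
  destruct (Rle_dec y 1).
  - apply Rle_trans with (2 ^ N); [apply pow_incr; lra | nra].
  - apply Rle_trans with ((2 * y) ^ N); [apply pow_incr; lra |]. rewrite Rpow_mult_distr; nra.
Qed.

(** The weights [wt] are at least 1 and submultiplicative under sums of arguments, which monomials
    are not; slicing and shears rely on this. *)
Definition bd2 (N : nat) (F : Fam2) (M : R) : Prop :=
  forall a b, (a <= N)%nat -> (b <= N)%nat -> forall x y, wt N x * wt N y * Cmod (F a b x y) <= M.

Lemma bd2_pos N F M : bd2 N F M -> 0 <= M.
Proof.
  intros H; eapply Rle_trans; [| apply (H O O ltac:(lia) ltac:(lia) 0 0)].
  repeat apply Rmult_le_pos; try apply Cmod_pos; generalize (wt_1 N 0); lra.
Qed.

Lemma S2_intro F : (forall a b x y, dCat (fun t => F a b t y) x (F (S a) b x y)) ->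
  (forall a b x y, dCat (fun t => F a b x t) y (F a (S b) x y)) -> (forall N, exists M, bd2 N F M) -> Schwartz2 F.
Proof.
  intros Hx Hy HB; split.
  - intros a b x y; destruct (Hx a b x y), (Hy a b x y); auto.
  - intros i j a b; destruct (HB (i + j + a + b)%nat) as [M HM]; exists M; intros x y.
    eapply Rle_trans; [| apply (HM a b ltac:(lia) ltac:(lia) x y)].
    apply Rmult_le_compat_r; [apply Cmod_pos |].
    apply Rmult_le_compat; try apply pow_le, Rabs_pos; apply pow_wt; lia.
Qed.

Lemma unif_bound {A : Type} (q : nat -> A -> R) n : (forall k, exists M, forall z, q k z <= M) ->
  exists M, 0 <= M /\ forall k z, (k <= n)%nat -> q k z <= M.
Proof.
  intros H; induction n as [|n [M [HM IH]]].
  - destruct (H O) as [M HM]; exists (Rmax 0 M); split; [apply Rmax_l |]. intros k z Hk; replace k with O by lia.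
    eapply Rle_trans; [apply HM | apply Rmax_r].
  - destruct (H (S n)) as [M' HM']; exists (Rmax M M'); split; [eapply Rle_trans; [apply HM | apply Rmax_l] |].
    intros k z Hk; destruct (Nat.eq_dec k (S n)) as [->|].
    + eapply Rle_trans; [apply HM' | apply Rmax_r].
    + eapply Rle_trans; [apply IH; lia | apply Rmax_l].
Qed.

Lemma S2_bd2 F N : Schwartz2 F -> exists M, bd2 N F M.
Proof.
  intros [_ H].
  assert (G : forall a b, exists M, forall z : R * R, wt N (fst z) * wt N (snd z) * Cmod (F a b (fst z) (snd z)) <= M).
  { intros a b; destruct (H O O a b) as [M1 H1], (H N O a b) as [M2 H2], (H O N a b) as [M3 H3], (H N N a b) as [M4 H4].
    exists (2 ^ N * 2 ^ N * (M1 + M2 + M3 + M4)); intros [x y]; simpl.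
    specialize (H1 x y); specialize (H2 x y); specialize (H3 x y); specialize (H4 x y); simpl in H1, H2, H3, H4.
    assert (P2 : 0 <= 2 ^ N * 2 ^ N) by (apply Rmult_le_pos; apply pow_le; lra).
    apply Rle_trans with ((2 ^ N * (1 + Rabs x ^ N)) * (2 ^ N * (1 + Rabs y ^ N)) * Cmod (F a b x y)).
    - apply Rmult_le_compat_r; [apply Cmod_pos |]. apply Rmult_le_compat; try apply wt_pow; generalize (wt_1 N x) (wt_1 N y); lra.
    - replace (2 ^ N * (1 + Rabs x ^ N) * (2 ^ N * (1 + Rabs y ^ N)) * Cmod (F a b x y)) with
        (2 ^ N * 2 ^ N * ((1 + Rabs x ^ N) * (1 + Rabs y ^ N) * Cmod (F a b x y))) by ring.
      apply Rmult_le_compat_l; auto. lra. }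
  (* The index [b] is packed into a subset type, so that [unif_bound] over [a] covers all [b <= N]
     as well. *)
  destruct (unif_bound (fun a (z : {b : nat | (b <= N)%nat} * (R * R)) => wt N (fst (snd z)) * wt N (snd (snd z)) *
     Cmod (F a (proj1_sig (fst z)) (fst (snd z)) (snd (snd z)))) N) as [M [_ HM]].
  - intros a. destruct (unif_bound _ N (G a)) as [M [_ HM]]; exists M; intros [[b Hb] z]; simpl. now apply (HM b z).
  - exists M; intros a b Ha Hb x y. apply (HM a (exist _ b Hb, (x, y)) Ha).
Qed.

Definition row (y : R) (b : nat) (F : Fam2) : Fam1 := fun a x => F a b x y.
Definition lift_x (Q : Fam1 -> Fam1) (F : Fam2) : Fam2 := fun a b x y => Q (row y b F) a x.
Definition sw (F : Fam2) : Fam2 := fun a b x y => F b a y x.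
Definition lift_y (Q : Fam1 -> Fam1) (F : Fam2) : Fam2 := sw (lift_x Q (sw F)).

Lemma row_S y b F : Schwartz2 F -> Schwartz1 (row y b F).
Proof.
  intros HF; split.
  - intros k x; apply (S2_dx F k b x y HF).
  - intros j k; destruct HF as [_ H]; destruct (H j O k b) as [M HM]; exists M; intros x.
    specialize (HM x y); simpl in HM; unfold row; lra.
Qed.

Lemma sw_S F : Schwartz2 F -> Schwartz2 (sw F).
Proof.
  intros HF; apply S2_intro.
  - intros; now apply S2_dy.
  - intros; now apply S2_dx.
  - intros N; destruct (S2_bd2 F N HF) as [M H]; exists M; intros a b Ha Hb x y; unfold sw.
    rewrite (Rmult_comm (wt N x)); auto.
Qed.

Lemma fam2_ext (F G : Fam2) : (forall a b x y, F a b x y = G a b x y) -> F = G.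
Proof.
  intros H; do 4 (apply functional_extensionality; intros); auto.
Qed.

Lemma S2_ext F G : Schwartz2 F -> Schwartz2 G -> (forall x y, F O O x y = G O O x y) -> F = G.
Proof.
  intros HF HG H.
  assert (E : forall a x y, F a O x y = G a O x y).
  { intros a x y. assert (E : row y O F = row y O G) by (apply Schwartz_ext; auto using row_S; intros; apply H).
    apply (f_equal (fun h => h a x) E). }
  apply fam2_ext; intros a b x y.
  assert (E' : row x a (sw F) = row x a (sw G)) by (apply Schwartz_ext; auto using row_S, sw_S; intros; apply E).
  apply (f_equal (fun h => h b y) E').
Qed.

(** The inverse of an operator is available on its range only, so linearity and continuity are
    stated relative to a domain closed under linear combinations. *)
Record SLinOn (D : Fam1 -> Prop) (Q : Fam1 -> Fam1) : Prop := {
  so_cadd : forall f g, D f -> D g -> D (fadd1 f g);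
  so_cscal : forall c f, D f -> D (fscal1 c f);
  so_S : forall f, D f -> Schwartz1 (Q f);
  so_add : forall f g, D f -> D g -> Q (fadd1 f g) = fadd1 (Q f) (Q g);
  so_scal : forall c f, D f -> Q (fscal1 c f) = fscal1 c (Q f);
  so_bd : forall N, exists (N' : nat) (C : R), 0 <= C /\ forall f B, D f -> bd N' f B -> bd N (Q f) (C * B) }.

Lemma SLin_on Q : SLin Q -> SLinOn Schwartz1 Q.
Proof. intros [A B C D]; split; auto using Schwartz_add, Schwartz_scal. Qed.

Lemma row_bd K N N' F M y b : bd2 K F M -> (N' <= K)%nat -> (N <= K)%nat -> (b <= K)%nat ->
  bd N' (fscal1 (RtoC (wt N y)) (row y b F)) M.
Proof.
  intros H H1 H2 H3 j k Hj Hk x; unfold fscal1, row. assert (W := wt_1 N y).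
  rewrite Cmod_mul, Cmod_RtoC, (Rabs_pos_eq (wt N y)), <- Rmult_assoc by lra.
  eapply Rle_trans; [| apply (H k b ltac:(lia) H3 x y)]. apply Rmult_le_compat_r; [apply Cmod_pos |].
  apply Rmult_le_compat; [apply pow_le, Rabs_pos | lra | apply pow_wt; lia | now apply wt_le].
Qed.

Lemma bd_wt N f B k x : bd N f B -> (k <= N)%nat -> wt N x * Cmod (f k x) <= 2 ^ N * (2 * B).
Proof.
  intros H Hk. assert (H0 := H O k ltac:(lia) Hk x). assert (HN := H N k ltac:(lia) Hk x). simpl in H0.
  apply Rle_trans with (2 ^ N * (1 + Rabs x ^ N) * Cmod (f k x)).
  - apply Rmult_le_compat_r; [apply Cmod_pos | apply wt_pow].
  - rewrite Rmult_assoc; apply Rmult_le_compat_l; [apply pow_le; lra | lra].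
Qed.

(** The continuity of [Q], applied to the Taylor remainder [D1] of the slices, shows that [Q]
    commutes with differentiation in [y]. Decay in [y] follows by homogeneity, applying [Q] to
    [wt N y] times the slice. *)
Lemma lift_S D Q F : SLinOn D Q -> Schwartz2 F -> (forall y b, D (row y b F)) -> Schwartz2 (lift_x Q F).
Proof.
  intros HQ HF HD; apply S2_intro.
  - intros a b x y; unfold lift_x. apply (Schwartz_dCat (Q (row y b F))). now apply (so_S D Q).
  - intros a b x y; unfold lift_x.
    destruct (so_bd D Q HQ a) as [N' [C [HC HB]]]. destruct (S2_bd2 F (N' + b + 2) HF) as [M HM].
    assert (HM0 := bd2_pos _ _ _ HM).
    apply dCat_quad with (C * (2 * M)); intros y' _.
    set (D1 := fadd1 (row y' b F) (fadd1 (fscal1 (Copp C1) (row y b F)) (fscal1 (RtoC (- (y' - y))) (row y (S b) F)))).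
    assert (E : Q D1 = fadd1 (Q (row y' b F)) (fadd1 (fscal1 (Copp C1) (Q (row y b F))) (fscal1 (RtoC (- (y' - y))) (Q (row y (S b) F))))).
    { unfold D1; rewrite !(so_add D Q), !(so_scal D Q); auto; repeat first [apply (so_cadd D Q) | apply (so_cscal D Q)]; auto. }
    assert (BD : bd N' D1 (2 * M * (y' - y) ^ 2)).
    { intros j k Hj Hk x0. unfold D1, fadd1, fscal1, row.
      set (w := wt N' x0). assert (Hw : 1 <= w) by apply wt_1.
      assert (T : Cmod (Csub (Csub (F k b x0 y') (F k b x0 y)) (Cscal (y' - y) (F k (S b) x0 y))) <= 2 * (M / w) * (y' - y) ^ 2).
      { apply (taylor_C (fun t => F k b x0 t) (fun t => F k (S b) x0 t) (fun t => F k (S (S b)) x0 t)); try (intros; now apply S2_dy).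
        intros t _. apply Rle_div_r; [lra |]. eapply Rle_trans; [| apply (HM k (S (S b)) ltac:(lia) ltac:(lia) x0 t)].
        rewrite Rmult_comm. apply Rmult_le_compat_r; [apply Cmod_pos |].
        assert (W := wt_le N' (N' + b + 2) x0 ltac:(lia)). generalize (wt_1 (N' + b + 2) t); fold w in W; nra. }
      replace (Cadd (F k b x0 y') (Cadd (Cmul (Copp C1) (F k b x0 y)) (Cmul (RtoC (- (y' - y))) (F k (S b) x0 y)))) with
        (Csub (Csub (F k b x0 y') (F k b x0 y)) (Cscal (y' - y) (F k (S b) x0 y))) by (rewrite Cscal_mul, RtoC_opp; ring).
      apply Rle_trans with (w * (2 * (M / w) * (y' - y) ^ 2)); [| right; field; lra].
      apply Rmult_le_compat; auto using Cmod_pos; [apply pow_le, Rabs_pos | now apply pow_wt]. }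
    assert (HD1 : D D1) by (unfold D1; repeat first [apply (so_cadd D Q) | apply (so_cscal D Q)]; auto).
    assert (K := HB D1 _ HD1 BD O a ltac:(lia) ltac:(lia) x). rewrite E in K; unfold fadd1, fscal1 in K; simpl in K.
    rewrite Rmult_1_l in K.
    replace (Csub (Csub (Q (row y' b F) a x) (Q (row y b F) a x)) (Cscal (y' - y) (Q (row y (S b) F) a x))) with
      (Cadd (Q (row y' b F) a x) (Cadd (Cmul (Copp C1) (Q (row y b F) a x)) (Cmul (RtoC (- (y' - y))) (Q (row y (S b) F) a x))))
      by (rewrite Cscal_mul, RtoC_opp; ring).
    simpl in *; lra.
  - intros N. destruct (so_bd D Q HQ N) as [N' [C [HC HB]]]. destruct (S2_bd2 F (N + N') HF) as [M HM].
    exists (2 ^ N * (2 * (C * M))); intros a b Ha Hb x y; unfold lift_x.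
    assert (K := HB _ _ (so_cscal D Q HQ (RtoC (wt N y)) _ (HD y b)) (row_bd (N + N') N N' F M y b HM ltac:(lia) ltac:(lia) ltac:(lia))).
    rewrite (so_scal D Q HQ) in K by auto. assert (K' := bd_wt N _ _ a x K Ha). unfold fscal1 in K'.
    rewrite Cmod_mul, Cmod_RtoC, Rabs_pos_eq in K' by (generalize (wt_1 N y); lra). lra.
Qed.

Lemma SLin_lift Q F : SLin Q -> Schwartz2 F -> Schwartz2 (lift_x Q F).
Proof. intros HQ HF; apply lift_S with Schwartz1; auto using SLin_on, row_S. Qed.

Lemma fadd2_S F G : Schwartz2 F -> Schwartz2 G -> Schwartz2 (fadd2 F G).
Proof.
  intros HF HG; apply S2_intro.
  - intros; apply (dCat_add (fun t => F a b t y) (fun t => G a b t y)); now apply S2_dx.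
  - intros; apply (dCat_add (fun t => F a b x t) (fun t => G a b x t)); now apply S2_dy.
  - intros N; destruct (S2_bd2 F N HF) as [M H], (S2_bd2 G N HG) as [M' H']; exists (M + M').
    intros a b Ha Hb x y; specialize (H a b Ha Hb x y); specialize (H' a b Ha Hb x y); unfold fadd2.
    generalize (Cmod_add (F a b x y) (G a b x y)) (wt_1 N x) (wt_1 N y); intros K W1 W2.
    apply Rle_trans with (wt N x * wt N y * (Cmod (F a b x y) + Cmod (G a b x y))); [| lra].
    apply Rmult_le_compat_l; auto; nra.
Qed.

Lemma fscal2_S c F : Schwartz2 F -> Schwartz2 (fscal2 c F).
Proof. apply (SLin_lift (fscal1 c)), SLin_scal. Qed.

Definition oDx (F : Fam2) : Fam2 := fopp2 (fDx F).
Definition oDy (F : Fam2) : Fam2 := fopp2 (fDy F).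

Lemma fMx_S F : Schwartz2 F -> Schwartz2 (fMx F).
Proof. apply (SLin_lift fM1), SLin_M. Qed.

Lemma oDx_S F : Schwartz2 F -> Schwartz2 (oDx F).
Proof. apply (SLin_lift oD), SLin_oD. Qed.

Lemma fMy_S F : Schwartz2 F -> Schwartz2 (fMy F).
Proof. intros HF; apply (sw_S (fMx (sw F))), fMx_S, sw_S, HF. Qed.

Lemma oDy_S F : Schwartz2 F -> Schwartz2 (oDy F).
Proof. intros HF; apply (sw_S (oDx (sw F))), oDx_S, sw_S, HF. Qed.

(* [shx t F (x, y) = F (x + t y, y)]; [shY t] is [d/dy] followed through the substitution. *)
Definition shY (t : R) (F : Fam2) : Fam2 :=
  fadd2 (fscal2 (Copp Ci) (oDy F)) (fscal2 (Cmul (Copp Ci) (RtoC t)) (oDx F)).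
Definition shx (t : R) (F : Fam2) : Fam2 := fun a b x y => Nat.iter b (shY t) F a O (x + t * y) y.

Lemma shY_val t F a b x y : shY t F a b x y = Cadd (F a (S b) x y) (Cmul (RtoC t) (F (S a) b x y)).
Proof.
  unfold shY, fadd2, fscal2, oDx, oDy, fopp2, fDx, fDy.
  transitivity (Copp (Cmul (Cmul Ci Ci) (Cadd (F a (S b) x y) (Cmul (RtoC t) (F (S a) b x y))))); [ring | rewrite Ci2; ring].
Qed.

Lemma shY_S t F : Schwartz2 F -> Schwartz2 (shY t F).
Proof. intros HF; apply fadd2_S; apply fscal2_S; auto using oDx_S, oDy_S. Qed.

Lemma shx_S t F : Schwartz2 F -> Schwartz2 (shx t F).
Proof.
  intros HF.
  assert (HI : forall b, Schwartz2 (Nat.iter b (shY t) F)) by (induction b; simpl; auto using shY_S).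
  apply S2_intro.
  - intros a b x y; unfold shx. set (G := Nat.iter b (shY t) F).
    replace (G (S a) O (x + t * y) y) with (Cscal 1 (G (S a) O (x + t * y) y)) by (rewrite Cscal_mul, RtoC_1; ring).
    apply (dCat_comp (fun z => G a O z y) (fun x => x + t * y)); [apply S2_dx, HI |]. auto_derive; [trivial | ring].
  - intros a b x y; unfold shx. simpl Nat.iter; rewrite shY_val. set (G := Nat.iter b (shY t) F).
    assert (HG : Schwartz2 G) by apply HI. destruct (S2_bd2 G (a + 2) HG) as [M HM]. assert (HM0 := bd2_pos _ _ _ HM).
    assert (HS : forall k b u v, (k <= a + 2)%nat -> (b <= a + 2)%nat -> Cmod (G k b u v) <= M).
    { intros k b0 u v Hk Hb; eapply Rle_trans; [| apply (HM k b0 Hk Hb u v)].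
      generalize (wt_1 (a + 2) u) (wt_1 (a + 2) v) (Cmod_pos (G k b0 u v)); intros.
      rewrite <- (Rmult_1_l (Cmod _)) at 1. apply Rmult_le_compat_r; auto; nra. }
    (* Both arguments of [G] move with [y]. The increment is split into a step in the second
       argument, a step in the first, and the change of the derivative [G a 1] between the two base
       points. *)
    apply dCat_quad with (2 * M + 2 * M * Rabs t + 2 * M * t ^ 2); intros y' _.
    set (x' := x + t * y'). set (x0 := x + t * y). set (h := y' - y).
    assert (Ex : x' - x0 = t * h) by (unfold x', x0, h; ring).
    assert (T1 : Cmod (Csub (Csub (G a O x' y') (G a O x' y)) (Cscal h (G a 1%nat x' y))) <= 2 * M * h ^ 2).
    { apply (taylor_C (fun v => G a O x' v) (fun v => G a 1%nat x' v) (fun v => G a 2%nat x' v)); try (intros; now apply S2_dy).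
      intros; apply HS; lia. }
    assert (T2 : Cmod (Csub (Csub (G a O x' y) (G a O x0 y)) (Cscal (x' - x0) (G (S a) O x0 y))) <= 2 * M * (x' - x0) ^ 2).
    { apply (taylor_C (fun v => G a O v y) (fun v => G (S a) O v y) (fun v => G (S (S a)) O v y)); try (intros; now apply S2_dx).
      intros; apply HS; lia. }
    assert (T3 : Cmod (Csub (G a 1%nat x' y) (G a 1%nat x0 y)) <= 2 * M * Rabs (x' - x0)).
    { apply (mean_C (fun v => G a 1%nat v y) (fun v => G (S a) 1%nat v y)); try (intros; now apply S2_dx). intros; apply HS; lia. }
    rewrite Ex in T2, T3.
    replace (Csub (Csub (G a O x' y') (G a O x0 y)) (Cscal h (Cadd (G a 1%nat x0 y) (Cmul (RtoC t) (G (S a) O x0 y))))) with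
      (Cadd (Csub (Csub (G a O x' y') (G a O x' y)) (Cscal h (G a 1%nat x' y)))
        (Cadd (Csub (Csub (G a O x' y) (G a O x0 y)) (Cscal (t * h) (G (S a) O x0 y)))
         (Cscal h (Csub (G a 1%nat x' y) (G a 1%nat x0 y))))) by cring.
    eapply Rle_trans; [apply Cmod_add |]. assert (T4 := Cmod_add (Csub (Csub (G a O x' y) (G a O x0 y)) (Cscal (t * h) (G (S a) O x0 y)))
         (Cscal h (Csub (G a 1%nat x' y) (G a 1%nat x0 y)))).
    rewrite Cmod_scal in T4.
    assert (T5 : Rabs h * Cmod (Csub (G a 1%nat x' y) (G a 1%nat x0 y)) <= 2 * M * Rabs t * h ^ 2).
    { apply Rle_trans with (Rabs h * (2 * M * Rabs (t * h))); [apply Rmult_le_compat_l; auto using Rabs_pos |].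
      rewrite Rabs_mult. replace (Rabs h * (2 * M * (Rabs t * Rabs h))) with (2 * M * Rabs t * (Rabs h ^ 2)) by ring.
      rewrite RPow_abs, (Rabs_pos_eq (h ^ 2)) by apply pow2_ge_0. lra. }
    replace ((t * h) ^ 2) with (t ^ 2 * h ^ 2) in T2 by ring. lra.
  - intros N.
    assert (G : forall b, exists M, forall z : {a : nat | (a <= N)%nat} * (R * R),
      wt N (fst (snd z)) * wt N (snd (snd z)) * Cmod (shx t F (proj1_sig (fst z)) b (fst (snd z)) (snd (snd z))) <= M).
    { intros b; destruct (S2_bd2 _ (N + N) (HI b)) as [M HM]. exists (wt N t * M); intros [[a Ha] [x y]]; unfold shx; simpl.
      set (u := x + t * y).
      (* Here [x = u - t y]: the weight in [x] is bounded by weights in [u] and [y], and decay of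
         order [N + N] in [y] pays for the shear. *)
      assert (W : wt N x <= wt N t * wt N u * wt N y).
      { unfold wt; rewrite <- !Rpow_mult_distr. apply pow_incr; split; [generalize (Rabs_pos x); lra |].
        assert (Rabs x <= Rabs u + Rabs t * Rabs y).
        { replace x with (u + - (t * y)) by (unfold u; ring). rewrite <- Rabs_mult, <- (Rabs_Ropp (t * y)). apply Rabs_triang. }
        generalize (Rabs_pos t) (Rabs_pos u) (Rabs_pos y); intros.
        assert (0 <= Rabs t * Rabs u) by nra. assert (0 <= Rabs u * Rabs y) by nra. assert (0 <= Rabs t * Rabs u * Rabs y) by nra. lra. }
      specialize (HM a O ltac:(lia) ltac:(lia) u y). set (g := Nat.iter b (shY t) F a O u y) in *.
      assert (W2 : wt N y * wt N y = wt (N + N) y) by (unfold wt; rewrite pow_add; auto).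
      assert (W3 := wt_le N (N + N) u ltac:(lia)).
      generalize (wt_1 N x) (wt_1 N y) (wt_1 N u) (wt_1 N t) (wt_1 (N + N) y); intros.
      apply Rle_trans with (wt N t * wt N u * wt N y * wt N y * Cmod g).
      - apply Rmult_le_compat_r; [apply Cmod_pos |]. apply Rmult_le_compat_r; [lra | auto].
      - replace (wt N t * wt N u * wt N y * wt N y * Cmod g) with (wt N t * (wt N u * (wt N y * wt N y) * Cmod g)) by ring.
        apply Rmult_le_compat_l; [lra |]. rewrite W2. eapply Rle_trans; [| apply HM].
        apply Rmult_le_compat_r; [apply Cmod_pos |]. apply Rmult_le_compat_r; lra. }
    destruct (unif_bound _ N G) as [M [_ HM]]; exists M; intros a b Ha Hb x y. apply (HM b (exist _ a Ha, (x, y)) Hb).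
Qed.

Definition tens (p q : Fam1) : Fam2 := fun a b x y => Cmul (p a x) (q b y).

Lemma tens_S p q : Schwartz1 p -> Schwartz1 q -> Schwartz2 (tens p q).
Proof.
  intros Hp Hq; apply S2_intro.
  - intros a b x y; unfold tens. apply (dCat_ext (fun t => Cmul (q b y) (p a t))); [intros; ring |].
    replace (Cmul (p (S a) x) (q b y)) with (Cmul (q b y) (p (S a) x)) by ring. apply dCat_cmul; now apply Schwartz_dCat.
  - intros a b x y; unfold tens. apply (dCat_cmul (p a x) (q b)); now apply Schwartz_dCat.
  - intros N; destruct (Schwartz_bd p N Hp) as [B HB], (Schwartz_bd q N Hq) as [B' HB'].
    exists ((2 ^ N * (2 * B)) * (2 ^ N * (2 * B'))); intros a b Ha Hb x y; unfold tens; rewrite Cmod_mul.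
    replace (wt N x * wt N y * (Cmod (p a x) * Cmod (q b y))) with ((wt N x * Cmod (p a x)) * (wt N y * Cmod (q b y))) by ring.
    apply Rmult_le_compat; try now apply bd_wt.
    + apply Rmult_le_pos; [generalize (wt_1 N x); lra | apply Cmod_pos].
    + apply Rmult_le_pos; [generalize (wt_1 N y); lra | apply Cmod_pos].
Qed.

(** * Transposition and intertwining *)

Definition pair1 (f g : Fam1) : Cx := CI (fun x => Cmul (f O x) (g O x)).
Definition pair2 (f g : Fam2) : Cx := CI (fun y => pair1 (row y O f) (row y O g)).

Lemma prod_bd f g M M' a b c d x y : bd2 2 f M -> bd2 2 g M' -> (a <= 2)%nat -> (b <= 2)%nat -> (c <= 2)%nat -> (d <= 2)%nat ->
  (1 + x ^ 2) * (1 + y ^ 2) * Cmod (Cmul (f a b x y) (g c d x y)) <= M * M'.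
Proof.
  intros H H' Ha Hb Hc Hd. specialize (H a b Ha Hb x y); specialize (H' c d Hc Hd x y).
  assert (W : forall z, 0 <= 1 + z ^ 2 <= wt 2 z).
  { intros z; unfold wt. rewrite <- (Rabs_pos_eq (z ^ 2)), <- RPow_abs by apply pow2_ge_0. generalize (Rabs_pos z); intros; split; nra. }
  assert (G : Cmod (g c d x y) <= M').
  { eapply Rle_trans; [| exact H']. generalize (wt_1 2 x) (wt_1 2 y) (Cmod_pos (g c d x y)); intros.
    rewrite <- (Rmult_1_l (Cmod _)) at 1. apply Rmult_le_compat_r; auto; nra. }
  rewrite Cmod_mul, <- Rmult_assoc. destruct (W x), (W y). assert (P := Cmod_pos (f a b x y)).
  apply Rmult_le_compat; auto using Cmod_pos.
  - apply Rmult_le_pos; auto; nra.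
  - eapply Rle_trans; [| exact H]. apply Rmult_le_compat_r; auto. apply Rmult_le_compat; auto.
Qed.

Lemma S2_ccont_x f a b y : Schwartz2 f -> ccont (fun x => f a b x y).
Proof. intros H; apply (ccont_dCat _ (fun x => f (S a) b x y)); intros; now apply S2_dx. Qed.

Lemma S2_ccont_y f a b x : Schwartz2 f -> ccont (fun y => f a b x y).
Proof. intros H; apply (ccont_dCat _ (fun y => f a (S b) x y)); intros; now apply S2_dy. Qed.

Lemma pair2_fubini f g : Schwartz2 f -> Schwartz2 g ->
  pair2 f g = pair2 (sw f) (sw g) /\ CImproper2 (fun x y => Cmul (f O O x y) (g O O x y)) (pair2 f g).
Proof.
  intros Hf Hg. destruct (S2_bd2 f 2 Hf) as [M HM], (S2_bd2 g 2 Hg) as [M' HM'].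
  assert (P : forall a b c d x y, (a <= 2)%nat -> (b <= 2)%nat -> (c <= 2)%nat -> (d <= 2)%nat ->
    (1 + x ^ 2) * (1 + y ^ 2) * Cmod (Cmul (f a b x y) (g c d x y)) <= M * M') by (intros; now apply prod_bd).
  assert (HMM : 0 <= M * M') by (apply Rmult_le_pos; [exact (bd2_pos _ _ _ HM) | exact (bd2_pos _ _ _ HM')]).
  assert (A : forall x y z w, (1 + x ^ 2) * (1 + y ^ 2) * Cmod (Cadd z w) <= (1 + x ^ 2) * (1 + y ^ 2) * Cmod z + (1 + x ^ 2) * (1 + y ^ 2) * Cmod w).
  { intros; rewrite <- Rmult_plus_distr_l; apply Rmult_le_compat_l; [apply Rmult_le_pos; nra | apply Cmod_add]. }
  set (p := fun a b c d x y => Cmul (f a b x y) (g c d x y)).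
  assert (Px : forall a b c d x y, dCat (fun t => p a b c d t y) x (Cadd (p (S a) b c d x y) (p a b (S c) d x y))).
  { intros; apply (dCat_mul (fun t => f a b t y) (fun t => g c d t y)); now apply S2_dx. }
  assert (Py : forall a b c d x y, dCat (fun t => p a b c d x t) y (Cadd (p a (S b) c d x y) (p a b c (S d) x y))).
  { intros; apply (dCat_mul (fun t => f a b x t) (fun t => g c d x t)); now apply S2_dy. }
  assert (P' : forall a b c d x y, (a <= 2)%nat -> (b <= 2)%nat -> (c <= 2)%nat -> (d <= 2)%nat ->
    (1 + x ^ 2) * (1 + y ^ 2) * Cmod (p a b c d x y) <= M * M') by (intros; now apply P).
  destruct (fubini (p 0 0 0 0)%nat (fun x y => Cadd (p 1 0 0 0 x y) (p 0 0 1 0 x y))%nat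
     (fun x y => Cadd (Cadd (p 2 0 0 0 x y) (p 1 0 1 0 x y)) (Cadd (p 1 0 1 0 x y) (p 0 0 2 0 x y)))%nat
     (fun x y => Cadd (p 0 1 0 0 x y) (p 0 0 0 1 x y))%nat (4 * (M * M'))) as [E1 [E2 E3]]; auto.
  - intros; apply (dCat_add (fun t => p 1 0 0 0 t y)%nat (fun t => p 0 0 1 0 t y)%nat); apply Px.
  - intros x; apply ccont_add; apply ccont_mul; now apply S2_ccont_y.
  - intros x y; generalize (P' 0 0 0 0 x y)%nat; intros K; specialize (K ltac:(lia) ltac:(lia) ltac:(lia) ltac:(lia)); lra.
  - intros x y; eapply Rle_trans; [apply A |].
    assert (K1 := (P' 1 0 0 0 x y ltac:(lia) ltac:(lia) ltac:(lia) ltac:(lia))%nat).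
    assert (K2 := (P' 0 0 1 0 x y ltac:(lia) ltac:(lia) ltac:(lia) ltac:(lia))%nat). lra.
  - intros x y; eapply Rle_trans; [apply A |].
    assert (A1 := (A x y (p 2 0 0 0 x y) (p 1 0 1 0 x y))%nat). assert (A2 := (A x y (p 1 0 1 0 x y) (p 0 0 2 0 x y))%nat).
    assert (K1 := (P' 2 0 0 0 x y ltac:(lia) ltac:(lia) ltac:(lia) ltac:(lia))%nat).
    assert (K2 := (P' 1 0 1 0 x y ltac:(lia) ltac:(lia) ltac:(lia) ltac:(lia))%nat).
    assert (K3 := (P' 0 0 2 0 x y ltac:(lia) ltac:(lia) ltac:(lia) ltac:(lia))%nat). lra.
  - intros x y; eapply Rle_trans; [apply A |].
    assert (K1 := (P' 0 1 0 0 x y ltac:(lia) ltac:(lia) ltac:(lia) ltac:(lia))%nat).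
    assert (K2 := (P' 0 0 0 1 x y ltac:(lia) ltac:(lia) ltac:(lia) ltac:(lia))%nat). lra.
  - split; [exact E1 |]. exists (fun y => CI (fun x => p 0 0 0 0 x y)%nat); split.
    + intros y; apply CI_spec with (M * M'); split; [apply ccont_mul; now apply S2_ccont_x |].
      intros x; eapply Rle_trans; [| apply (P' 0 0 0 0 x y ltac:(lia) ltac:(lia) ltac:(lia) ltac:(lia))%nat].
      apply Rmult_le_compat_r; [apply Cmod_pos |]. nra.
    + rewrite <- E1 in E2. exact E2.
Qed.

Lemma pair2_val f g l : CImproper2 (fun x y => Cmul (f O O x y) (g O O x y)) l -> pair2 f g = l.
Proof.
  intros [G [HG Hl]]. apply CI_val. replace (fun y => pair1 (row y O f) (row y O g)) with G; auto.
  apply functional_extensionality; intros y; symmetry; apply CI_val, HG.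
Qed.

(** The transpose [T'] for [pair2] is kept as data: it is how [T] acts on functionals given by
    Schwartz functions. *)
Record Op2 (T T' : Fam2 -> Fam2) : Prop := {
  o_S : forall f, Schwartz2 f -> Schwartz2 (T f);
  o_S' : forall f, Schwartz2 f -> Schwartz2 (T' f);
  o_add : forall f g, Schwartz2 f -> Schwartz2 g -> T (fadd2 f g) = fadd2 (T f) (T g);
  o_scal : forall c f, Schwartz2 f -> T (fscal2 c f) = fscal2 c (T f);
  o_pair : forall f g, Schwartz2 f -> Schwartz2 g -> pair2 f (T g) = pair2 (T' f) g }.

Definition Iso2 (T : Fam2 -> Fam2) : Prop := exists T' Ti Ti', Op2 T T' /\ Op2 Ti Ti' /\ forall f, Schwartz2 f -> T (Ti f) = f.

Lemma Op2_comp T T' U U' : Op2 T T' -> Op2 U U' -> Op2 (fun f => T (U f)) (fun f => U' (T' f)).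
Proof.
  intros [A1 A2 A3 A4 A5] [B1 B2 B3 B4 B5]; split; auto.
  - intros; now rewrite B3, A3 by auto.
  - intros; now rewrite B4, A4 by auto.
  - intros; now rewrite A5, B5 by auto.
Qed.

Lemma Iso2_comp T U : Iso2 T -> Iso2 U -> Iso2 (fun f => T (U f)).
Proof.
  intros [T' [Ti [Ti' [H1 [H2 H3]]]]] [U' [Ui [Ui' [K1 [K2 K3]]]]].
  exists (fun f => U' (T' f)), (fun f => Ui (Ti f)), (fun f => Ti' (Ui' f)).
  split; [now apply Op2_comp | split; [now apply Op2_comp |]].
  intros f Hf; rewrite K3, H3; auto. now apply (o_S _ _ H2).
Qed.

Lemma Op2_sw T T' : Op2 T T' -> Op2 (fun f => sw (T (sw f))) (fun f => sw (T' (sw f))).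
Proof.
  intros [A1 A2 A3 A4 A5]; split; auto using sw_S.
  - intros f g Hf Hg; change (sw (fadd2 f g)) with (fadd2 (sw f) (sw g)); rewrite A3 by auto using sw_S; auto.
  - intros c f Hf; change (sw (fscal2 c f)) with (fscal2 c (sw f)); rewrite A4 by auto using sw_S; auto.
  - intros f g Hf Hg. rewrite (proj1 (pair2_fubini f (sw (T (sw g))) Hf (sw_S _ (A1 _ (sw_S _ Hg))))).
    rewrite (proj1 (pair2_fubini (sw (T' (sw f))) g (sw_S _ (A2 _ (sw_S _ Hf))) Hg)).
    change (pair2 (sw f) (T (sw g)) = pair2 (T' (sw f)) (sw g)). apply A5; auto using sw_S.
Qed.

Lemma Iso2_sw T : Iso2 T -> Iso2 (fun f => sw (T (sw f))).
Proof.
  intros [T' [Ti [Ti' [H1 [H2 H3]]]]]; exists (fun f => sw (T' (sw f))), (fun f => sw (Ti (sw f))), (fun f => sw (Ti' (sw f))).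
  split; [now apply Op2_sw | split; [now apply Op2_sw |]]. intros f Hf.
  change (sw (T (Ti (sw f))) = f). rewrite H3; auto using sw_S.
Qed.

Lemma Op2_lift Q Q' : SLin Q -> SLin Q' -> (forall f g, Schwartz1 f -> Schwartz1 g -> pair1 f (Q g) = pair1 (Q' f) g) ->
  Op2 (lift_x Q) (lift_x Q').
Proof.
  intros HQ HQ' H; split; auto using SLin_lift.
  - intros f g Hf Hg; apply fam2_ext; intros a b x y; unfold lift_x, fadd2.
    change (row y b _) with (fadd1 (row y b f) (row y b g)) at 1. rewrite (SL_add _ HQ); auto using row_S.
  - intros c f Hf; apply fam2_ext; intros a b x y; unfold lift_x, fscal2.
    change (row y b _) with (fscal1 c (row y b f)) at 1. rewrite (SL_scal _ HQ); auto using row_S.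
  - intros f g Hf Hg; unfold pair2; f_equal; apply functional_extensionality; intros y.
    apply (H (row y O f) (row y O g)); auto using row_S.
Qed.

Lemma Op2_shx t : Op2 (shx t) (shx (- t)).
Proof.
  split; auto using shx_S.
  - intros f g Hf Hg; apply S2_ext; auto using shx_S, fadd2_S.
  - intros c f Hf; apply S2_ext; auto using shx_S, fscal2_S.
  - intros f g Hf Hg; unfold pair2; f_equal; apply functional_extensionality; intros y.
    unfold pair1, row, shx; simpl. set (u := fun x => Cmul (f O O (x + - t * y) y) (g O O x y)).
    assert (Hf' : Schwartz2 (shx (- t) f)) by now apply shx_S.
    destruct (pair2_fubini _ _ Hf' Hg) as [_ [G [HG _]]]. specialize (HG y). fold u in HG.
    assert (Cu : ccont u) by (apply (ccont_mul (fun x => shx (- t) f O O x y) (fun x => g O O x y)); now apply S2_ccont_x).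
    assert (K := CI_affine u (G y) 1 (t * y) Cu HG ltac:(lra)).
    rewrite Rabs_R1, Rinv_1, Cscal_mul, RtoC_1 in K.
    rewrite (CI_val u (G y)) by exact HG. apply CI_val. replace (G y) with (Cmul C1 (G y)) by ring.
    replace (fun x => Cmul (f O O x y) (g O O (x + t * y) y)) with (fun x => u (1 * x + t * y)); auto.
    apply functional_extensionality; intros x; unfold u. replace (1 * x + t * y + - t * y) with x by ring.
    now replace (1 * x + t * y) with (x + t * y) by ring.
Qed.

Lemma Iso2_shx t : Iso2 (shx t).
Proof.
  exists (shx (- t)), (shx (- t)), (shx (- - t)); split; [apply Op2_shx | split; [apply Op2_shx |]].
  intros f Hf; apply S2_ext; auto using shx_S. intros x y; unfold shx; simpl. f_equal; ring.
Qed.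

Lemma Cdom_prod f g : Schwartz1 f -> Schwartz1 g -> exists M, Cdom (fun x => Cmul (f O x) (g O x)) M.
Proof.
  intros Hf Hg; destruct (Schwartz_bd f 2 Hf) as [B HB], (Schwartz_bd g 2 Hg) as [B' HB'].
  exists (2 * B * B'); apply Cdom_mulb; [apply bd_Cdom with 2%nat; auto; lia | now apply Schwartz_ccont |].
  intros x; apply Schwartz_sup with 2%nat; auto; lia.
Qed.

Lemma pair1_add_l f g h : Schwartz1 f -> Schwartz1 g -> Schwartz1 h -> pair1 (fadd1 f g) h = Cadd (pair1 f h) (pair1 g h).
Proof.
  intros Hf Hg Hh; destruct (Cdom_prod f h Hf Hh) as [M HM], (Cdom_prod g h Hg Hh) as [M' HM'].
  unfold pair1; rewrite <- (CI_add _ _ _ _ HM HM'); f_equal; apply functional_extensionality; intros; unfold fadd1; ring.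
Qed.

Lemma pair1_scal_l c f h : Schwartz1 f -> Schwartz1 h -> pair1 (fscal1 c f) h = Cmul c (pair1 f h).
Proof.
  intros Hf Hh; destruct (Cdom_prod f h Hf Hh) as [M HM].
  unfold pair1; rewrite <- (CI_cmul c _ _ HM); f_equal; apply functional_extensionality; intros; unfold fscal1; ring.
Qed.

Lemma pair1_sym f g : pair1 f g = pair1 g f.
Proof. unfold pair1; f_equal; apply functional_extensionality; intros; ring. Qed.

Lemma pair1_dilate c f g : c <> 0 -> Schwartz1 f -> Schwartz1 g ->
  pair1 f (dilate c g) = pair1 (fscal1 (RtoC (/ Rabs c)) (dilate (/ c) f)) g.
Proof.
  intros Hc Hf Hg. assert (Hd : Schwartz1 (dilate (/ c) f)) by (apply SL_S; auto; now apply SLin_dilate, Rinv_neq_0_compat).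
  rewrite pair1_scal_l by auto. destruct (Cdom_prod _ _ Hd Hg) as [M HM].
  assert (K := CI_val _ _ (CI_affine _ _ c 0 (proj1 HM) (CI_spec _ _ HM) Hc)). rewrite Cscal_mul in K.
  unfold pair1 at 2; rewrite <- K. unfold pair1; f_equal; apply functional_extensionality; intros x.
  unfold dilate; simpl; rewrite !Cscal_mul, RtoC_1. replace (/ c * (c * x + 0)) with x by (field; auto).
  rewrite Rplus_0_r; ring.
Qed.

Lemma Iso2_dilate c : c <> 0 -> Iso2 (lift_x (dilate c)).
Proof.
  intros Hc. assert (Hi := Rinv_neq_0_compat c Hc).
  assert (K : forall c, c <> 0 -> Op2 (lift_x (dilate c)) (lift_x (fun f => fscal1 (RtoC (/ Rabs c)) (dilate (/ c) f)))).
  { intros d Hd; apply Op2_lift; [now apply SLin_dilate | | intros; now apply pair1_dilate].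
    apply (SLin_comp (fscal1 _) (dilate (/ d))); [apply SLin_scal | apply SLin_dilate, Rinv_neq_0_compat; auto]. }
  exists (lift_x (fun f => fscal1 (RtoC (/ Rabs c)) (dilate (/ c) f))), (lift_x (dilate (/ c))), (lift_x (fun f => fscal1 (RtoC (/ Rabs (/ c))) (dilate (/ / c) f))).
  split; [auto | split; [auto |]]. intros f Hf; apply S2_ext; auto using SLin_lift, SLin_dilate.
  intros x y; unfold lift_x, row, dilate; simpl; rewrite !Cscal_mul, RtoC_1. replace (/ c * (c * x)) with x by (field; auto). ring.
Qed.

Lemma pair1_reflect f g : Schwartz1 f -> Schwartz1 g -> pair1 f (reflect g) = pair1 (reflect f) g.
Proof.
  intros Hf Hg; rewrite reflect_dilate, pair1_dilate by (auto; lra). f_equal.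
  apply fam_ext; intros k x; unfold fscal1. replace (Rabs (-1)) with 1 by (rewrite Rabs_left; lra). replace (/ -1) with (-1) by field.
  rewrite Rinv_1, RtoC_1; ring.
Qed.

(** The inverse transform is symmetric for the bilinear pairing, by [FT_pairing] and because
    reflection is symmetric and commutes with [FT]. *)
Lemma Iso2_V V c : SLin V -> (forall f, Schwartz1 f -> V (FT f) = f) -> (forall f, V f = fscal1 c (reflect (FT f))) -> Iso2 (lift_x V).
Proof.
  intros HV H1 H2.
  assert (OV : Op2 (lift_x V) (lift_x V)).
  { apply Op2_lift; auto. intros f g Hf Hg. rewrite !H2, (pair1_sym f), !pair1_scal_l by auto using reflect_Schwartz, FT_S.
    f_equal. rewrite (pair1_sym _ f), pair1_reflect by auto using FT_S. rewrite (pair1_sym _ (FT g)).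
    unfold pair1 at 1; rewrite FT_pairing by auto using reflect_Schwartz. change (pair1 g (FT (reflect f)) = pair1 (reflect (FT f)) g).
    rewrite FT_reflect by auto. apply pair1_sym. }
  assert (OF : Op2 (lift_x FT) (lift_x FT)).
  { apply Op2_lift; auto using SLin_FT. intros f g Hf Hg; unfold pair1; rewrite FT_pairing; auto. }
  exists (lift_x V), (lift_x FT), (lift_x FT); split; [auto | split; [auto |]].
  intros f Hf; apply fam2_ext; intros a b x y; unfold lift_x.
  change (V (FT (row y b f)) a x = f a b x y). rewrite H1; auto using row_S.
Qed.

(** The negative transpose of [al D_y - be M_x]; [opXi] is that of [ga D_x - de M_y]. See [dL1_val]
    and [dL2_val]. *)
Definition opX (al be : R) (F : Fam2) : Fam2 := fadd2 (fscal2 (RtoC (- al)) (oDy F)) (fscal2 (RtoC be) (fMx F)).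
Definition opXi (ga de : R) (F : Fam2) : Fam2 := fadd2 (fscal2 (RtoC (- ga)) (oDx F)) (fscal2 (RtoC de) (fMy F)).
(** The substitution [(x, y) -> (be x + al y, - be (de x + ga y))], factored into shears and a
    dilation, each of which preserves S(R^2) and has an explicit transpose. *)
Definition subst_xy (al be de : R) (F : Fam2) : Fam2 := shx (al / be) (lift_x (dilate be) (sw (shx (- de) (sw F)))).

Lemma subst_xy_S al be de F : be <> 0 -> Schwartz2 F -> Schwartz2 (subst_xy al be de F).
Proof. intros; apply shx_S, SLin_lift; [now apply SLin_dilate |]. apply sw_S, shx_S, sw_S; auto. Qed.

Lemma Iso2_subst_xy al be de : be <> 0 -> Iso2 (subst_xy al be de).
Proof.
  intros Hb. apply (Iso2_comp (shx (al / be)) (fun F => lift_x (dilate be) (sw (shx (- de) (sw F))))); [apply Iso2_shx |].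
  apply (Iso2_comp (lift_x (dilate be)) (fun F => sw (shx (- de) (sw F)))); [now apply Iso2_dilate |].
  apply Iso2_sw, Iso2_shx.
Qed.

Lemma subst_xy_00 al be ga de F x y : al * de - be * ga = 1 -> be <> 0 ->
  subst_xy al be de F O O x y = F O O (be * x + al * y) (- be * (de * x + ga * y)).
Proof.
  intros Hdet Hbe; unfold subst_xy, shx, lift_x, dilate, row, sw, shx; simpl. rewrite Cscal_mul, RtoC_1.
  replace (be * (x + al / be * y)) with (be * x + al * y) by (field; auto).
  replace (y + - de * (be * x + al * y)) with (- be * (de * x + ga * y)); [ring |].
  replace y with ((al * de - be * ga) * y) at 2 by (rewrite Hdet; ring). ring.
Qed.

Lemma subst_xy_10 al be ga de F x y : al * de - be * ga = 1 -> be <> 0 ->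
  let u := be * x + al * y in let v := - be * (de * x + ga * y) in
  subst_xy al be de F 1%nat O x y = Cmul (RtoC be) (Csub (F 1%nat O u v) (Cmul (RtoC de) (F O 1%nat u v))).
Proof.
  intros Hdet Hbe u v; unfold subst_xy, shx, lift_x, dilate, row, sw; simpl Nat.iter. rewrite shY_val.
  replace (be * (x + al / be * y)) with u by (unfold u; field; auto).
  replace (y + - de * u) with v; [simpl pow; rewrite Rmult_1_r, RtoC_opp, Cscal_mul; ring |].
  unfold u, v. replace y with ((al * de - be * ga) * y) at 2 by (rewrite Hdet; ring). ring.
Qed.

Lemma subst_xy_01 al be ga de F x y : al * de - be * ga = 1 -> be <> 0 ->
  let u := be * x + al * y in let v := - be * (de * x + ga * y) in
  subst_xy al be de F O 1%nat x y = Cadd (F O 1%nat u v) (Cmul (RtoC al) (Csub (F 1%nat O u v) (Cmul (RtoC de) (F O 1%nat u v)))).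
Proof.
  intros Hdet Hbe u v; unfold subst_xy, shx, lift_x, dilate, row, sw; simpl Nat.iter. rewrite shY_val; simpl Nat.iter; rewrite shY_val.
  replace (be * (x + al / be * y)) with u by (unfold u; field; auto).
  replace (y + - de * u) with v.
  - simpl pow. rewrite Rmult_1_r, RtoC_opp, !Cscal_mul, RtoC_1. replace (RtoC al) with (Cmul (RtoC (al / be)) (RtoC be)); [ring |].
    rewrite <- RtoC_mul; f_equal; field; auto.
  - unfold u, v. replace y with ((al * de - be * ga) * y) at 2 by (rewrite Hdet; ring). ring.
Qed.

Lemma fMx_00 F x y : fMx F O O x y = Cmul (RtoC x) (F O O x y).
Proof. unfold fMx; simpl; cring. Qed.

Lemma fMy_00 F x y : fMy F O O x y = Cmul (RtoC y) (F O O x y).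
Proof. unfold fMy; simpl; cring. Qed.

Lemma oDx_val F a b x y : oDx F a b x y = Cmul Ci (F (S a) b x y).
Proof. unfold oDx, fopp2, fDx; ring. Qed.

Lemma oDy_val F a b x y : oDy F a b x y = Cmul Ci (F a (S b) x y).
Proof. unfold oDy, fopp2, fDy; ring. Qed.

Lemma subst_xy_Mx al be ga de F : al * de - be * ga = 1 -> be <> 0 -> Schwartz2 F ->
  subst_xy al be de (fMx F) = fadd2 (fscal2 (RtoC be) (fMx (subst_xy al be de F))) (fscal2 (RtoC al) (fMy (subst_xy al be de F))).
Proof.
  intros Hdet Hbe HF; apply S2_ext.
  - apply subst_xy_S; auto using fMx_S.
  - apply fadd2_S; apply fscal2_S; [apply fMx_S | apply fMy_S]; now apply subst_xy_S.
  - intros x y; unfold fadd2, fscal2. rewrite fMx_00, fMy_00, !(subst_xy_00 al be ga de), fMx_00 by auto. cring.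
Qed.

Lemma subst_xy_Dx al be ga de F : al * de - be * ga = 1 -> be <> 0 -> Schwartz2 F ->
  subst_xy al be de (oDx F) = fadd2 (fscal2 (RtoC (- ga)) (oDx (subst_xy al be de F))) (fscal2 (RtoC de) (oDy (subst_xy al be de F))).
Proof.
  intros Hdet Hbe HF; apply S2_ext.
  - apply subst_xy_S; auto using oDx_S.
  - apply fadd2_S; apply fscal2_S; [apply oDx_S | apply oDy_S]; now apply subst_xy_S.
  - intros x y; unfold fadd2, fscal2. rewrite oDx_val, oDy_val, (subst_xy_00 al be ga de), (subst_xy_10 al be ga de),
      (subst_xy_01 al be ga de), oDx_val by auto.
    set (p := F 1%nat O _ _); set (q := F O 1%nat _ _).
    transitivity (Cmul (RtoC (al * de - be * ga)) (Cmul Ci p)); [rewrite Hdet, RtoC_1; ring |].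
    transitivity (Cadd (Cmul (RtoC (al * de - be * ga)) (Cmul Ci p)) (Cmul (RtoC (de * (1 - (al * de - be * ga)))) (Cmul Ci q))); [rewrite Hdet |].
    + replace (de * (1 - 1)) with 0 by ring. rewrite RtoC_0; ring.
    + cring.
Qed.

Definition twist (V : Fam1 -> Fam1) (al be de : R) (F : Fam2) : Fam2 := lift_y V (subst_xy al be de F).

Lemma lift_y_add V F G : SLin V -> Schwartz2 F -> Schwartz2 G -> lift_y V (fadd2 F G) = fadd2 (lift_y V F) (lift_y V G).
Proof.
  intros HV HF HG; apply fam2_ext; intros a b x y; unfold lift_y, sw at 1, lift_x.
  change (row x a (sw (fadd2 F G))) with (fadd1 (row x a (sw F)) (row x a (sw G))). rewrite (SL_add _ HV); auto using row_S, sw_S.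
Qed.

Lemma lift_y_scal V c F : SLin V -> Schwartz2 F -> lift_y V (fscal2 c F) = fscal2 c (lift_y V F).
Proof.
  intros HV HF; apply fam2_ext; intros a b x y; unfold lift_y, sw at 1, lift_x.
  change (row x a (sw (fscal2 c F))) with (fscal1 c (row x a (sw F))). rewrite (SL_scal _ HV); auto using row_S, sw_S.
Qed.

Lemma lift_y_S V F : SLin V -> Schwartz2 F -> Schwartz2 (lift_y V F).
Proof. intros HV HF; apply sw_S, SLin_lift; auto using sw_S. Qed.

Lemma lift_y_Mx V F : SLin V -> Schwartz2 F -> lift_y V (fMx F) = fMx (lift_y V F).
Proof.
  intros HV HF; apply S2_ext; [apply lift_y_S; auto using fMx_S | apply fMx_S; now apply lift_y_S |].
  intros x y; rewrite fMx_00; unfold lift_y, sw at 1 3, lift_x.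
  replace (row x O (sw (fMx F))) with (fscal1 (RtoC x) (row x O (sw F))).
  - rewrite (SL_scal _ HV); auto using row_S, sw_S.
  - apply fam_ext; intros k t; unfold fscal1, row, sw, fMx; simpl. rewrite !Cscal_mul, RtoC_0; ring.
Qed.

Lemma lift_y_Dx V F : SLin V -> Schwartz2 F -> lift_y V (oDx F) = oDx (lift_y V F).
Proof.
  intros HV HF; apply S2_ext; [apply lift_y_S; auto using oDx_S | apply oDx_S; now apply lift_y_S |].
  intros x y; rewrite oDx_val; unfold lift_y, sw at 1 3, lift_x.
  replace (row x O (sw (oDx F))) with (fscal1 Ci (row x 1 (sw F))).
  - rewrite (SL_scal _ HV); auto using row_S, sw_S.
  - apply fam_ext; intros k t; unfold fscal1, row, sw; now rewrite oDx_val.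
Qed.

Lemma lift_y_My V F : (forall f, Schwartz1 f -> V (fM1 f) = fopp1 (oD (V f))) -> Schwartz2 F ->
  lift_y V (fMy F) = fscal2 (Copp C1) (oDy (lift_y V F)).
Proof.
  intros HM HF; apply fam2_ext; intros a b x y; unfold lift_y, sw at 1, lift_x.
  change (row x a (sw (fMy F))) with (fM1 (row x a (sw F))). rewrite HM by auto using row_S, sw_S.
  unfold fopp1, fscal2; rewrite oDy_val; unfold oD, fopp1, fD1, sw; ring.
Qed.

Lemma lift_y_Dy V F : (forall f, Schwartz1 f -> V (oD f) = fM1 (V f)) -> Schwartz2 F ->
  lift_y V (oDy F) = fMy (lift_y V F).
Proof.
  intros HM HF; apply fam2_ext; intros a b x y; unfold lift_y, sw at 1, lift_x.
  change (row x a (sw (oDy F))) with (oD (row x a (sw F))). rewrite HM by auto using row_S, sw_S. auto.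
Qed.

Lemma reflect_M f : reflect (fM1 f) = fopp1 (fM1 (reflect f)).
Proof.
  apply fam_ext; intros k x; unfold reflect, fopp1, fM1. rewrite !Cscal_mul, RtoC_opp.
  destruct k; [simpl; rewrite RtoC_0; ring |]. simpl pred. simpl pow; rewrite !RtoC_mul.
  replace (RtoC (-1)) with (Copp C1) by (rewrite <- RtoC_1, <- RtoC_opp; auto). ring.
Qed.

Lemma reflect_oD f : reflect (oD f) = fopp1 (oD (reflect f)).
Proof.
  apply fam_ext; intros k x; unfold fopp1; rewrite oD_0; unfold reflect; rewrite oD_0, !Cscal_mul. simpl pow; rewrite !RtoC_mul.
  replace (RtoC (-1)) with (Copp C1) by (rewrite <- RtoC_1, <- RtoC_opp; auto). ring.
Qed.

(* Up to a constant, [T F (x, y)] is the integral of [F (be x + al h, - be (de x + ga h)) e^(i h y)] over [h]. *)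
Lemma twist_exists al be ga de : al * de - be * ga = 1 -> be <> 0 -> exists T, Iso2 T /\
  (forall F, Schwartz2 F -> T (fMx F) = opX al be (T F)) /\ (forall F, Schwartz2 F -> T (oDx F) = opXi ga de (T F)).
Proof.
  intros Hdet Hbe. destruct FT_inverse as [V [HV [H1 [_ [c [_ Hc]]]]]].
  assert (HM : forall f, Schwartz1 f -> V (fM1 f) = fopp1 (oD (V f))).
  { intros f Hf; rewrite !Hc, FT_M, reflect_oD, (SL_scal _ SLin_oD) by auto using reflect_Schwartz, FT_S. fext. }
  assert (HP : forall f, Schwartz1 f -> V (oD f) = fM1 (V f)).
  { intros f Hf; rewrite !Hc, FT_oD, (SL_opp reflect), reflect_M, (SL_scal _ SLin_M)
      by (auto using reflect_Schwartz, FT_S, SLin_reflect; apply SL_S; auto using SLin_M, FT_S). fext. }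
  exists (twist V al be de). split; [| split].
  - apply (Iso2_comp (lift_y V) (subst_xy al be de)); [| now apply Iso2_subst_xy].
    apply (Iso2_sw (lift_x V)). now apply (Iso2_V V c).
  - intros F HF; unfold twist. assert (HS := subst_xy_S al be de F Hbe HF).
    rewrite (subst_xy_Mx al be ga de), lift_y_add, !lift_y_scal, lift_y_Mx, lift_y_My by
      (auto; try apply fscal2_S; auto using fMx_S, fMy_S).
    apply fam2_ext; intros; unfold opX, fadd2, fscal2; rewrite RtoC_opp; ring.
  - intros F HF; unfold twist. assert (HS := subst_xy_S al be de F Hbe HF).
    rewrite (subst_xy_Dx al be ga de), lift_y_add, !lift_y_scal, lift_y_Dx, lift_y_Dy by
      (auto; try apply fscal2_S; auto using oDx_S, oDy_S).
    reflexivity.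
Qed.

(** * Solving the source equations and the conclusion *)

(** Test with the complex conjugate: the primitive of [|f|^2] is monotone and has total increment 0,
    so it is constant. *)
Lemma pairing_zero f : Schwartz1 f -> (forall g, Schwartz1 g -> pair1 f g = C0) -> f = f0.
Proof.
  intros Hf H. set (h := (fun k x => Ccj (f k x)) : Fam1).
  assert (Hh : Schwartz1 h).
  { apply Schwartz_intro; [intros; now apply dCat_conj, Schwartz_dCat |]. intros N; destruct (Schwartz_bd f N Hf) as [B HB].
    exists B; intros j k Hj Hk x; unfold h; rewrite Cmod_conj; auto. }
  destruct (Cdom_prod f h Hf Hh) as [M HM]. destruct (anti_exists _ (proj1 HM)) as [G [HG _]].
  assert (K := CImproper_anti_inv _ G _ (proj1 HM) HG (CI_spec _ _ HM)).
  change (CI _) with (pair1 f h) in K. rewrite (H h Hh) in K.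
  set (r := fun t => fst (G t)).
  assert (Dr : forall t, is_derive r t (Cmod (f O t) * Cmod (f O t))).
  { intros t; generalize (proj1 (proj1 (dCat_is G t _) (HG t))); unfold h; rewrite Cmul_conj; auto. }
  assert (Inc : forall a b, a <= b -> r a <= r b).
  { intros a b Hab. destruct (MVT_gen r a b (fun t => Cmod (f O t) * Cmod (f O t))) as [t [_ Et]].
    - intros; apply Dr.
    - intros; apply derivable_continuous_pt; eexists; apply is_derive_Reals, Dr.
    - assert (P := Rle_0_sqr (Cmod (f O t))); unfold Rsqr in P. nra. }
  assert (Cst : forall a b, a <= b -> r b = r a).
  { intros a b Hab; apply Rle_antisym; [| auto]. apply le_epsilon; intros e He. destruct (K e He) as [N HN].
    set (b' := Rmax b N). set (a' := Rmin a (- N)).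
    assert (b <= b' /\ N <= b') as [B1 B2] by (split; [apply Rmax_l | apply Rmax_r]).
    assert (a' <= a /\ a' <= - N) as [A1 A2] by (split; [apply Rmin_l | apply Rmin_r]).
    specialize (HN a' b' A2 B2). assert (I1 := Inc _ _ B1). assert (I2 := Inc _ _ A1).
    assert (Q : r b' - r a' <= e).
    { eapply Rle_trans; [| apply HN]. eapply Rle_trans; [| apply fst_le_Cmod]. simpl; unfold r.
      eapply Rle_trans; [apply Rle_abs |]; right; f_equal; ring. }
    lra. }
  apply Schwartz_ext; auto using Schwartz_f0. intros x; unfold f0. apply Cmod_eq0.
  assert (D0 : is_derive r x 0).
  { apply (is_derive_ext (fun _ => r x)); [| apply (is_derive_const (r x) x)].
    intros t; destruct (Rle_dec x t); [symmetry; now apply Cst | apply Cst; lra]. }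
  assert (E := is_derive_unique _ _ _ (Dr x)). rewrite (is_derive_unique _ _ _ D0) in E. nra.
Qed.

(** [cp_est] with [B = 0] makes the preimage in [L] unique; uniqueness gives linearity, and [cp_est]
    in general gives continuity. *)
Lemma complement_inverse Q L : SLin Q -> complement Q L -> exists R,
  SLinOn (fun f => exists u, L u /\ Q u = f) R /\ (forall f, (exists u, L u /\ Q u = f) -> Q (R f) = f).
Proof.
  intros HQ HL. set (R := fun f => epsilon (inhabits f0) (fun u => L u /\ Q u = f)).
  assert (HR : forall f, (exists u, L u /\ Q u = f) -> L (R f) /\ Q (R f) = f) by (intros f Hf; exact (epsilon_spec _ _ Hf)).
  assert (U : forall u u', L u -> L u' -> Q u = Q u' -> u = u').
  { intros u u' Hu Hu' E. set (d := fsub1 u u').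
    assert (Su := cp_S _ _ HL _ Hu). assert (Su' := cp_S _ _ HL _ Hu').
    assert (Ld : L d). { unfold d, fsub1; rewrite fopp1_scal. apply (cp_add _ _ HL); auto. now apply (cp_scal _ _ HL). }
    assert (Ed : Q d = f0). { unfold d; rewrite (SL_sub Q); auto. rewrite E; fext. }
    apply fam_ext; intros k x. destruct (cp_est _ _ HL k) as [N' [C [HC H]]].
    assert (B := H d 0 Ld ltac:(rewrite Ed; apply bd_f0) O k ltac:(lia) ltac:(lia) x). simpl in B.
    assert (Z : Cmod (d k x) = 0) by (generalize (Cmod_pos (d k x)); lra). apply Cmod_eq0 in Z.
    unfold d, fsub1, fadd1, fopp1 in Z. transitivity (Cadd (Cadd (u k x) (Copp (u' k x))) (u' k x)); [ring | rewrite Z; ring]. }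
  exists R; split; [split |].
  - intros f g [u [Lu Eu]] [u' [Lu' Eu']]; exists (fadd1 u u'); split; [now apply (cp_add _ _ HL) |].
    rewrite (SL_add _ HQ), Eu, Eu'; auto; now apply (cp_S _ _ HL).
  - intros c f [u [Lu Eu]]; exists (fscal1 c u); split; [now apply (cp_scal _ _ HL) |].
    rewrite (SL_scal _ HQ), Eu; auto; now apply (cp_S _ _ HL).
  - intros f Hf; now apply (cp_S _ _ HL), HR.
  - intros f g Hf Hg; destruct (HR f Hf) as [Lf Ef], (HR g Hg) as [Lg Eg].
    assert (Lfg : L (fadd1 (R f) (R g))) by now apply (cp_add _ _ HL).
    assert (Efg : Q (fadd1 (R f) (R g)) = fadd1 f g) by (rewrite (SL_add _ HQ), Ef, Eg; auto; now apply (cp_S _ _ HL)).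
    destruct (HR (fadd1 f g)) as [A B]; [eauto |]. apply U; auto. congruence.
  - intros c f Hf; destruct (HR f Hf) as [Lf Ef].
    assert (Lc : L (fscal1 c (R f))) by now apply (cp_scal _ _ HL).
    assert (Ec : Q (fscal1 c (R f)) = fscal1 c f) by (rewrite (SL_scal _ HQ), Ef; auto; now apply (cp_S _ _ HL)).
    destruct (HR (fscal1 c f)) as [A B]; [eauto |]. apply U; auto. congruence.
  - intros N; destruct (cp_est _ _ HL N) as [N' [C [HC H]]]; exists N', C; split; auto.
    intros f B Hf HB. destruct (HR f Hf) as [Lf Ef]. apply H; auto. now rewrite Ef.
  - intros f Hf; now apply HR.
Qed.

Lemma iter_dual {A B : Type} (T : A -> A) j (U : A -> B) f :
  Nat.iter j (fun (u : A -> B) (g : A) => u (T g)) U f = U (Nat.iter j T f).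
Proof. revert f; induction j as [|j IH]; intros f; auto. simpl. rewrite IH, iter_comm; auto. Qed.

Definition lin1 (U : Dist1) : Prop :=
  (forall f g, Schwartz1 f -> Schwartz1 g -> U (fadd1 f g) = Cadd (U f) (U g)) /\
  (forall c f, Schwartz1 f -> U (fscal1 c f) = Cmul c (U f)).

Lemma lin1_fsum U n F : lin1 U -> (forall i, Schwartz1 (F i)) ->
  Schwartz1 (fsum n F) /\ U (fsum n F) = Csum n (fun i => U (F i)).
Proof.
  intros [Ha Hs] HF; induction n as [|n [A B]].
  - split; [apply Schwartz_f0 |]. change (fsum 0 F) with f0. replace f0 with (fscal1 C0 f0) by fext.
    rewrite Hs by apply Schwartz_f0; simpl; ring.
  - change (fsum (S n) F) with (fadd1 (fsum n F) (F n)); split; [now apply Schwartz_add |]. rewrite Ha, B; auto.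
Qed.

Lemma lin1_tri_sum U m b Y f : lin1 U -> (forall k j, SLin (Y k j)) -> Schwartz1 f ->
  U (tri_sum m b Y f) = Csum (S m) (fun k => Csum (S m - k) (fun j => Cmul (b k j) (U (Y k j f)))).
Proof.
  intros HU HY Hf. assert (S1 : forall k j, Schwartz1 (fscal1 (b k j) (Y k j f))) by (intros; now apply Schwartz_scal, SL_S).
  unfold tri_sum. rewrite (proj2 (lin1_fsum U (S m) _ HU (fun k => proj1 (lin1_fsum U (S m - k) _ HU (S1 k))))).
  apply Csum_ext; intros k _. rewrite (proj2 (lin1_fsum U (S m - k) _ HU (S1 k))). apply Csum_ext; intros j _.
  apply HU. now apply SL_S.
Qed.

(** Transposition reverses [M^j D^k], and [oD] absorbs the sign of the transpose of [D], so the
    coefficients stay [a k j]. In [Asrc] the sign [(-1)^k] turns [oD^k] back into [D^k]. *)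
Definition Atr (m : nat) (a : nat -> nat -> Cx) : Fam1 -> Fam1 := tri_sum m a PM.
Definition Asrc (m : nat) (a : nat -> nat -> Cx) : Fam1 -> Fam1 :=
  tri_sum m (fun k j => Cmul (RtoC ((-1) ^ k)) (a k j)) MP.

Lemma SLin_Atr m a : SLin (Atr m a).
Proof. apply SLin_tri_sum, SLin_PM. Qed.

Lemma SLin_Asrc m a : SLin (Asrc m a).
Proof. apply SLin_tri_sum, SLin_MP. Qed.

Lemma source_op_val m a u f : lin1 u -> Schwartz1 f -> source_op m a u f = u (Atr m a f).
Proof.
  intros Hu Hf; unfold Atr; rewrite lin1_tri_sum by auto using SLin_PM. unfold source_op, PM.
  apply Csum_ext; intros k _; apply Csum_ext; intros j _. f_equal.
  transitivity (Nat.iter k dD1 u (Nat.iter j fM1 f)); [apply (iter_dual fM1 j) | apply (iter_dual oD k u)].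
Qed.

Lemma source_transpose_op_val m a u f : lin1 u -> Schwartz1 f -> source_transpose_op m a u f = u (Asrc m a f).
Proof.
  intros Hu Hf; unfold Asrc; rewrite lin1_tri_sum by auto using SLin_MP. unfold source_transpose_op, MP.
  apply Csum_ext; intros k _; apply Csum_ext; intros j _. f_equal.
  transitivity (Nat.iter j dM1 u (Nat.iter k oD f)); [apply (iter_dual oD k) | apply (iter_dual fM1 j u)].
Qed.

Lemma pair1_M f g : pair1 (fM1 f) g = pair1 f (fM1 g).
Proof. unfold pair1; f_equal; apply functional_extensionality; intros x; rewrite !fM1_0; ring. Qed.

Lemma pair1_oD f g : Schwartz1 f -> Schwartz1 g -> pair1 (oD f) g = Copp (pair1 f (oD g)).
Proof.
  intros Hf Hg. assert (Hf' : Schwartz1 (oD f)) by (apply SL_S; auto using SLin_oD).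
  assert (Hg' : Schwartz1 (oD g)) by (apply SL_S; auto using SLin_oD).
  destruct (Cdom_prod _ _ Hf' Hg) as [M1 H1], (Cdom_prod _ _ Hf Hg') as [M2 H2].
  assert (E : Cadd (pair1 (oD f) g) (pair1 f (oD g)) = C0).
  { unfold pair1; rewrite <- (CI_add _ _ _ _ H1 H2). destruct (Schwartz_bd f 1 Hf) as [B HB], (Schwartz_bd g 0 Hg) as [B' HB'].
    apply (CI_deriv (fun x => Cmul Ci (Cmul (f O x) (g O x))) _ (B * B')).
    - apply ccont_add; [apply H1 | apply H2].
    - intros x; rewrite !oD_0. replace (Cadd (Cmul (Cmul Ci (f 1%nat x)) (g O x)) (Cmul (f O x) (Cmul Ci (g 1%nat x)))) with
        (Cmul Ci (Cadd (Cmul (f 1%nat x) (g O x)) (Cmul (f O x) (g 1%nat x)))) by ring.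
      apply dCat_cmul, dCat_mul; now apply Schwartz_dCat.
    - intros x; rewrite !Cmod_mul, Cmod_Ci, Rmult_1_l, <- Rmult_assoc.
      assert (K := HB 1%nat O ltac:(lia) ltac:(lia) x). rewrite pow_1 in K.
      apply Rmult_le_compat; auto using Cmod_pos; [apply Rmult_le_pos; auto using Rabs_pos, Cmod_pos |].
      apply Schwartz_sup with O; auto. }
  transitivity (Csub (Cadd (pair1 (oD f) g) (pair1 f (oD g))) (pair1 f (oD g))); [ring | rewrite E; ring].
Qed.

Lemma pair1_Atr m a f g : Schwartz1 f -> Schwartz1 g -> pair1 (Atr m a f) g = pair1 f (Asrc m a g).
Proof.
  assert (HM : forall j f g, pair1 (Nat.iter j fM1 f) g = pair1 f (Nat.iter j fM1 g)).
  { induction j as [|j IH]; intros; auto. simpl; rewrite pair1_M, IH, iter_comm; auto. }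
  assert (HP : forall k f g, Schwartz1 f -> Schwartz1 g ->
    pair1 (Nat.iter k oD f) g = Cmul (RtoC ((-1) ^ k)) (pair1 f (Nat.iter k oD g))).
  { induction k as [|k IH]; intros f' g' Hf' Hg'; [simpl; rewrite RtoC_1; ring |].
    simpl Nat.iter at 1. rewrite pair1_oD, IH by (auto; try apply (SL_S _ SLin_oD); auto; apply (SL_S _ (SLin_iter k _ SLin_oD)); auto).
    rewrite iter_comm. simpl; rewrite RtoC_mul. replace (RtoC (-1)) with (Copp C1) by (rewrite <- RtoC_1, <- RtoC_opp; auto). ring. }
  assert (L : forall h, Schwartz1 h -> lin1 (fun f => pair1 f h)).
  { intros h Hh; split; intros; [now apply pair1_add_l | now apply pair1_scal_l]. }
  intros Hf Hg. unfold Atr; rewrite (lin1_tri_sum (fun f => pair1 f g)) by auto using SLin_PM.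
  rewrite (pair1_sym f). unfold Asrc; rewrite (lin1_tri_sum (fun g => pair1 g f)) by auto using SLin_MP.
  apply Csum_ext; intros k _; apply Csum_ext; intros j _. unfold PM, MP.
  rewrite HP by (auto; apply (SL_S _ (SLin_iter j _ SLin_M)); auto). rewrite HM, (pair1_sym f). ring.
Qed.

(** * The twisted operator on test functions *)

Definition lin2 (U : Dist2) : Prop :=
  (forall f g, Schwartz2 f -> Schwartz2 g -> U (fadd2 f g) = Cadd (U f) (U g)) /\
  (forall c f, Schwartz2 f -> U (fscal2 c f) = Cmul c (U f)).

Definition fsum2 (n : nat) (F : nat -> Fam2) : Fam2 := fun a b x y => Csum n (fun i => F i a b x y).

Lemma lin2_fsum2 U n F G : lin2 U -> Schwartz2 G -> (forall i, Schwartz2 (F i)) ->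
  Schwartz2 (fsum2 n F) /\ U (fsum2 n F) = Csum n (fun i => U (F i)).
Proof.
  intros [Ha Hs] HG HF; induction n as [|n [A B]].
  - replace (fsum2 0 F) with (fscal2 C0 G) by (apply fam2_ext; intros; unfold fscal2, fsum2; simpl; ring).
    split; [now apply fscal2_S |]. rewrite Hs by auto; simpl; ring.
  - change (fsum2 (S n) F) with (fadd2 (fsum2 n F) (F n)); split; [now apply fadd2_S |]. rewrite Ha, B; auto.
Qed.

Lemma iter_S2 T k F : (forall F, Schwartz2 F -> Schwartz2 (T F)) -> Schwartz2 F -> Schwartz2 (Nat.iter k T F).
Proof. intros H HF; induction k; simpl; auto. Qed.

Lemma row_iter_Dx k y b F : row y b (Nat.iter k oDx F) = Nat.iter k oD (row y b F).
Proof. induction k as [|k IH]; auto. simpl; rewrite <- IH; auto. Qed.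

Lemma row_iter_Mx k y b F : row y b (Nat.iter k fMx F) = Nat.iter k fM1 (row y b F).
Proof. induction k as [|k IH]; auto. simpl; rewrite <- IH; auto. Qed.

Lemma lin2_lift_Atr U m a F : lin2 U -> Schwartz2 F ->
  U (lift_x (Atr m a) F) = Csum (S m) (fun k => Csum (S m - k) (fun j => Cmul (a k j) (U (Nat.iter k oDx (Nat.iter j fMx F))))).
Proof.
  intros HU HF. set (Y := fun k j => fscal2 (a k j) (Nat.iter k oDx (Nat.iter j fMx F))).
  assert (S0 : forall k j, Schwartz2 (Nat.iter k oDx (Nat.iter j fMx F))) by (intros; apply iter_S2, iter_S2; auto using oDx_S, fMx_S).
  assert (S1 : forall k j, Schwartz2 (Y k j)) by (intros; now apply fscal2_S).
  replace (lift_x (Atr m a) F) with (fsum2 (S m) (fun k => fsum2 (S m - k) (Y k))).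
  - rewrite (proj2 (lin2_fsum2 U (S m) _ F HU HF (fun k => proj1 (lin2_fsum2 U (S m - k) _ F HU HF (S1 k))))).
    apply Csum_ext; intros k _. rewrite (proj2 (lin2_fsum2 U (S m - k) _ F HU HF (S1 k))). apply Csum_ext; intros j _.
    now apply HU.
  - apply fam2_ext; intros p q x y; unfold fsum2, lift_x, Atr, tri_sum, fsum. apply Csum_ext; intros k _; apply Csum_ext; intros j _.
    unfold Y, fscal2, fscal1, PM. f_equal. rewrite <- row_iter_Mx, <- row_iter_Dx; auto.
Qed.

Lemma opX_S al be F : Schwartz2 F -> Schwartz2 (opX al be F).
Proof. intros; apply fadd2_S; apply fscal2_S; auto using oDy_S, fMx_S. Qed.

Lemma opXi_S ga de F : Schwartz2 F -> Schwartz2 (opXi ga de F).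
Proof. intros; apply fadd2_S; apply fscal2_S; auto using oDx_S, fMy_S. Qed.

Lemma iter_neg_dual (d : Dist2 -> Dist2) (X : Fam2 -> Fam2) j U f :
  (forall F, Schwartz2 F -> Schwartz2 (X F)) -> (forall U F, lin2 U -> Schwartz2 F -> d U F = Copp (U (X F))) ->
  (forall U, lin2 U -> lin2 (d U)) -> lin2 U -> Schwartz2 f ->
  lin2 (Nat.iter j d U) /\ Nat.iter j d U f = Cmul (RtoC ((-1) ^ j)) (U (Nat.iter j X f)).
Proof.
  intros HX Hd Hl HU Hf; split; [induction j; simpl; auto |].
  revert U HU; induction j as [|j IH]; intros U HU; [simpl; rewrite RtoC_1; ring |].
  simpl Nat.iter at 1. rewrite <- iter_comm, IH, Hd by (auto; now apply iter_S2). simpl; rewrite RtoC_mul.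
  replace (RtoC (-1)) with (Copp C1) by (rewrite <- RtoC_1, <- RtoC_opp; auto). ring.
Qed.

Lemma dL1_val al be U F : lin2 U -> Schwartz2 F -> dL1 al be U F = Copp (U (opX al be F)).
Proof.
  intros [Ha Hs] HF; unfold opX; rewrite Ha, !Hs by (try apply fscal2_S; auto using oDy_S, fMx_S).
  unfold dL1, dDy, dMx; fold (oDy F); rewrite !Cscal_mul, RtoC_opp; ring.
Qed.

Lemma dL2_val ga de U F : lin2 U -> Schwartz2 F -> dL2 ga de U F = Copp (U (opXi ga de F)).
Proof.
  intros [Ha Hs] HF; unfold opXi; rewrite Ha, !Hs by (try apply fscal2_S; auto using oDx_S, fMy_S).
  unfold dL2, dDx, dMy; fold (oDx F); rewrite !Cscal_mul, RtoC_opp; ring.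
Qed.

Lemma lin2_comp T U : lin2 U -> (forall F, Schwartz2 F -> Schwartz2 (T F)) ->
  (forall f g, Schwartz2 f -> Schwartz2 g -> T (fadd2 f g) = fadd2 (T f) (T g)) ->
  (forall c f, Schwartz2 f -> T (fscal2 c f) = fscal2 c (T f)) -> lin2 (fun F => U (T F)).
Proof. intros [Ha Hs] HS HA HC; split; intros; [rewrite HA, Ha | rewrite HC, Hs]; auto. Qed.

Lemma lin2_neg_dual (d : Dist2 -> Dist2) (X : Fam2 -> Fam2) :
  (forall F, Schwartz2 F -> Schwartz2 (X F)) -> (forall f g, X (fadd2 f g) = fadd2 (X f) (X g)) ->
  (forall c f, X (fscal2 c f) = fscal2 c (X f)) -> (forall U F, lin2 U -> Schwartz2 F -> d U F = Copp (U (X F))) ->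
  forall U, lin2 U -> lin2 (d U).
Proof.
  intros HX HA HC Hd U HU; pose proof HU as [Ha Hs]; split.
  - intros; rewrite !Hd, HA, Ha by auto using fadd2_S; ring.
  - intros; rewrite !Hd, HC, Hs by auto using fscal2_S; ring.
Qed.

(** Each factor contributes a sign through [dL1_val] or [dL2_val], and together they cancel the
    [(-1)^(j + k)] of the definition. Transposition reverses the factors into the order of [PM]. *)
Lemma twisted_op_val m a al be ga de v F : lin2 v -> Schwartz2 F ->
  twisted_op m a al be ga de v F =
  Csum (S m) (fun k => Csum (S m - k) (fun j => Cmul (a k j) (v (Nat.iter k (opXi ga de) (Nat.iter j (opX al be) F))))).
Proof.
  intros Hv HF.
  assert (L1 : forall U, lin2 U -> lin2 (dL1 al be U)).
  { apply (lin2_neg_dual _ (opX al be)); [intros; now apply opX_S | | | intros; now apply dL1_val]; intros; apply fam2_ext; intros;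
      unfold opX, fadd2, fscal2, oDy, fopp2, fDy, fMx; rewrite !Cscal_mul; ring. }
  assert (L2 : forall U, lin2 U -> lin2 (dL2 ga de U)).
  { apply (lin2_neg_dual _ (opXi ga de)); [intros; now apply opXi_S | | | intros; now apply dL2_val]; intros; apply fam2_ext; intros;
      unfold opXi, fadd2, fscal2, oDx, fopp2, fDx, fMy; rewrite !Cscal_mul; ring. }
  unfold twisted_op; apply Csum_ext; intros k _; apply Csum_ext; intros j _.
  assert (N2 : forall G, Schwartz2 G -> lin2 (Nat.iter k (dL2 ga de) v) /\
     Nat.iter k (dL2 ga de) v G = Cmul (RtoC ((-1) ^ k)) (v (Nat.iter k (opXi ga de) G))).
  { intros G HG; apply iter_neg_dual; auto; [intros; now apply opXi_S | intros; now apply dL2_val]. }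
  rewrite (proj2 (iter_neg_dual (dL1 al be) (opX al be) j (Nat.iter k (dL2 ga de) v) F ltac:(intros; now apply opX_S)
     ltac:(intros; now apply dL1_val) L1 (proj1 (N2 F HF)) HF)).
  rewrite (proj2 (N2 _ (iter_S2 (opX al be) j F ltac:(intros; now apply opX_S) HF))).
  set (z := v _). transitivity (Cmul (RtoC ((-1) ^ (j + k) * ((-1) ^ j * (-1) ^ k))) (Cmul (a k j) z)); [rewrite !RtoC_mul; ring |].
  rewrite <- pow_add, <- Rpow_mult_distr. replace (-1 * -1) with 1 by ring. rewrite pow1, RtoC_1; ring.
Qed.

Lemma intertwine2 (T U W : Fam2 -> Fam2) k : (forall F, Schwartz2 F -> Schwartz2 (U F)) ->
  (forall F, Schwartz2 F -> T (U F) = W (T F)) -> forall F, Schwartz2 F -> T (Nat.iter k U F) = Nat.iter k W (T F).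
Proof. intros HU H F HF; induction k as [|k IH]; auto. simpl. rewrite H, IH; auto. now apply iter_S2. Qed.

(** Lifted to slices, this rank one operator sends [F] to the product of [g (x)] and the pairing of
    the slice of [F] at [y] with [psi]; this is how the latter is seen to be a Schwartz function of
    [y]. *)
Lemma SLin_pair psi g : Schwartz1 psi -> Schwartz1 g -> SLin (fun f => fscal1 (pair1 f psi) g).
Proof.
  intros Hp Hg; split.
  - intros; now apply Schwartz_scal.
  - intros f h Hf Hh; rewrite pair1_add_l by auto. fext.
  - intros c f Hf; rewrite pair1_scal_l by auto. fext.
  - intros N; destruct (Schwartz_bd psi 2 Hp) as [B HB], (Schwartz_bd g N Hg) as [B' HB'].
    assert (P := bd_pos _ _ _ HB). assert (P' := bd_pos _ _ _ HB').
    exists 2%nat, (8 * (2 * B) * B'); split; [repeat apply Rmult_le_pos; lra |]. intros f A Hf HA.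
    apply bd_mono with N (Cmod (pair1 f psi) * B'); [lia | | now apply bd_scal].
    replace (8 * (2 * B) * B' * A) with (8 * (2 * A * B) * B') by ring. apply Rmult_le_compat_r; auto.
    apply CI_bound, Cdom_mulb; [apply bd_Cdom with 2%nat; auto; lia | now apply Schwartz_ccont |].
    intros x; apply Schwartz_sup with 2%nat; auto; lia.
Qed.

Lemma InS1_pair U : InS1 U -> exists psi, Schwartz1 psi /\ forall f, Schwartz1 f -> U f = pair1 psi f.
Proof. intros [psi [Hp H]]; exists psi; split; auto. intros f Hf; symmetry; now apply CI_val, H. Qed.

Theorem theorem3p3 (m : nat) (a : nat -> nat -> Cx) (al be ga de : R)
  (Hdet : al * de - be * ga = 1)
  (Hbd : be * de <> 0)
  (Hord : exists k j : nat, (k + j = m)%nat /\ a k j <> C0)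
  (Hker : forall u : Dist1, Tempered1 u -> Dist1_zero (source_op m a u) -> Dist1_zero u)
  (Hkert : forall u : Dist1, Tempered1 u ->
             Dist1_zero (source_transpose_op m a u) -> InS1 u) :
  globally_regular2 (twisted_op m a al be ga de).
Proof.
  intros v [Va [Vs _]] [w [Hw Hvw]]. assert (Hv : lin2 v) by (split; auto).
  assert (Hbe : be <> 0) by (intros E; apply Hbd; rewrite E; ring).
  destruct (twist_exists al be ga de Hdet Hbe) as [T [[T' [Ti [Ti' [HT [HTi HTT]]]]] [TX TXi]]].
  assert (ST := o_S _ _ HT).
  assert (LT : lin2 (fun F => v (T F))) by exact (lin2_comp T v Hv ST (o_add _ _ HT) (o_scal _ _ HT)).
  (* The weak form of the equation for [v] after conjugation by [T]: the operator now acts in [x]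
     alone. *)
  assert (Key : forall H, Schwartz2 H -> v (T (lift_x (Atr m a) H)) = pair2 (T' w) H).
  { intros H HH. rewrite <- (o_pair _ _ HT) by auto. rewrite (pair2_val _ _ _ (Hvw (T H) (ST H HH))), twisted_op_val by auto.
    rewrite (lin2_lift_Atr (fun F => v (T F)) m a H LT HH).
    apply Csum_ext; intros k _; apply Csum_ext; intros j _.
    rewrite (intertwine2 T oDx (opXi ga de)), (intertwine2 T fMx (opX al be)); auto using oDx_S, fMx_S.
    apply iter_S2; auto using fMx_S. }
  destruct (coercive_complement _ (SLin_Atr m a)) as [L HL]; [apply coercive_tri_sum; auto |].
  destruct (coercive_complement _ (SLin_Asrc m a)) as [L' HL'].
  { apply coercive_tri_sum; auto. destruct Hord as [k [j [E Hkj]]]; exists k, j; split; auto. intros Z; apply Hkj, Cmod_eq0.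
    apply (f_equal Cmod) in Z; rewrite Cmod_mul, Cmod_RtoC, pow_m1_abs, Cmod_C0 in Z; lra. }
  (* A functional vanishing on the range of [Atr] is in the kernel of the source, hence 0. *)
  assert (Surj : forall f, Schwartz1 f -> exists u, L u /\ Atr m a u = f).
  { intros f Hf; apply closed_range; auto using SLin_Atr. intros U HU HU0. apply (Hker U HU); auto.
    intros g Hg; rewrite source_op_val; auto. destruct HU as [A [B _]]; split; auto. }
  (* A functional vanishing on the range of [Asrc] is in the kernel of the transpose, hence given by
     some [psi] in S(R); then [Atr m a psi] pairs to 0 with every test function and vanishes. *)
  assert (Rng : forall f, Schwartz1 f -> (forall psi, Schwartz1 psi -> Atr m a psi = f0 -> pair1 f psi = C0) ->
    exists u, L' u /\ Asrc m a u = f).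
  { intros f Hf Hpsi; apply closed_range; auto using SLin_Asrc. intros U HU HU0.
    destruct (InS1_pair U) as [psi [Hp EU]].
    { apply Hkert; auto. intros g Hg; rewrite source_transpose_op_val; auto. destruct HU as [A [B _]]; split; auto. }
    rewrite EU, pair1_sym by auto. apply Hpsi; auto. apply pairing_zero; [apply SL_S; auto using SLin_Atr |].
    intros g Hg; rewrite pair1_Atr, <- EU by (auto; apply SL_S; auto using SLin_Asrc). auto. }
  destruct (complement_inverse _ _ (SLin_Atr m a) HL) as [R [HR ER]].
  destruct (complement_inverse _ _ (SLin_Asrc m a) HL') as [R' [HR' ER']].
  set (w' := T' w) in *. assert (Hw' : Schwartz2 w') by (apply (o_S' _ _ HT); auto).
  (* The pairing of the slice of [w'] at [y] with a [psi] in the kernel of [Atr] is a Schwartz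
     function of [y]. Integrated against [phi] it gives [pair2 w' (tens psi phi)], which is 0 by
     [Key], so it vanishes together with its derivatives, the cases [b > 0]. *)
  assert (Orth : forall y b, exists u, L' u /\ Asrc m a u = row y b w').
  { intros y b; apply Rng; [now apply row_S |]. intros psi Hp Hpsi.
    (* Only the value 1 at 0 matters: restricting the lifted function to [x = 0] recovers the
       pairing. *)
    destruct gaussian_exists as [g [Hg [Eg _]]].
    assert (Eg0 : g O 0 = C1) by (rewrite Eg; replace (- (0 * 0) / 2) with 0 by field; now rewrite exp_0).
    assert (HW : Schwartz2 (lift_x (fun f => fscal1 (pair1 f psi) g) w')) by (apply SLin_lift; auto using SLin_pair).
    assert (Hh := row_S 0 O _ (sw_S _ HW)).
    assert (Eh : forall c z, row 0 O (sw (lift_x (fun f => fscal1 (pair1 f psi) g) w')) c z = pair1 (row z c w') psi).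
    { intros; unfold row at 1, sw, lift_x, fscal1. rewrite Eg0; ring. }
    rewrite <- Eh, (pairing_zero _ Hh); auto.
    intros phi Hphi. assert (HH := tens_S psi phi Hp Hphi).
    transitivity (pair2 w' (tens psi phi)).
    - unfold pair2, pair1 at 1; f_equal; apply functional_extensionality; intros z. rewrite Eh.
      replace (row z O (tens psi phi)) with (fscal1 (phi O z) psi) by (apply fam_ext; intros; unfold fscal1, row, tens; ring).
      rewrite (pair1_sym _ (fscal1 _ _)), pair1_scal_l by auto using row_S. rewrite (pair1_sym psi); ring.
    - rewrite <- Key by auto. replace (lift_x (Atr m a) (tens psi phi)) with (fscal2 C0 (tens psi phi)).
      + rewrite (o_scal _ _ HT), Vs by auto; ring.
      + apply fam2_ext; intros p q x z; unfold lift_x.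
        replace (row z q (tens psi phi)) with (fscal1 (phi q z) psi) by (apply fam_ext; intros; unfold fscal1, row, tens; ring).
        rewrite (SL_scal _ (SLin_Atr m a)), Hpsi by auto. unfold fscal1, fscal2, f0; ring. }
  (* By [Orth] all slices of [w'] and of its [y]-derivatives lie in the domain of [R'], as [lift_S]
     requires. *)
  assert (Hg' : Schwartz2 (lift_x R' w')) by (apply (lift_S _ _ _ HR'); auto).
  exists (Ti' (lift_x R' w')). assert (Hgg := o_S' _ _ HTi _ Hg'). split; auto. intros f Hf.
  assert (HF := o_S _ _ HTi f Hf). set (F := Ti f) in *.
  assert (HH : Schwartz2 (lift_x R F)) by (apply (lift_S _ _ _ HR); auto; intros; now apply Surj, row_S).
  (* Both sides are rewritten as pairings with [lift_x R F]: [v f] through [Key], the other one by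
     moving [Asrc] across [pair1] on each slice. *)
  replace (v f) with (pair2 (Ti' (lift_x R' w')) f); [now apply pair2_fubini |].
  rewrite <- (o_pair _ _ HTi) by auto. fold F. rewrite <- (HTT f Hf). fold F.
  replace F with (lift_x (Atr m a) (lift_x R F)).
  2:{ apply fam2_ext; intros p q x y; unfold lift_x. change (Atr m a (R (row y q F)) p x = F p q x y).
      rewrite ER; auto. now apply Surj, row_S. }
  rewrite Key by auto. symmetry.
  replace w' with (lift_x (Asrc m a) (lift_x R' w')) at 1.
  2:{ apply fam2_ext; intros p q x y; unfold lift_x. change (Asrc m a (R' (row y q w')) p x = w' p q x y).
      rewrite ER'; auto. }
  unfold pair2; f_equal; apply functional_extensionality; intros y.
  change (pair1 (Asrc m a (row y O (lift_x R' w'))) (row y O (lift_x R F)) =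
    pair1 (row y O (lift_x R' w')) (Atr m a (row y O (lift_x R F)))).
  rewrite (pair1_sym (row y O (lift_x R' w'))), pair1_Atr by auto using row_S. apply pair1_sym.
Qed.
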